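(* Let $\gamma\ge 1$ and $\beta\in\mathbb{R}$ be such that $q:=\frac{\beta}{\gamma+1}<\frac12$. Let $\rho>0$ and $F(v)=\rho\,\mathrm{sgn}(v)|v|^{\gamma}$ for $v\in\mathbb{R}$. Let $t_0>0$, $v_0>0$, $x_0\in\mathbb{R}$, let $(B_t)_{t\ge 0}$ be a standard one-dimensional Brownian motion, and let $(V_t,X_t)_{t\ge t_0}$ be the solution to $$\mathrm{d}V_t=\mathrm{d}B_t-t^{-\beta}F(V_t)\,\mathrm{d}t,\quad V_{t_0}=v_0,\qquad \mathrm{d}X_t=V_t\,\mathrm{d}t,\quad X_{t_0}=x_0 .$$ Let $\Pi_F$ be the invariant probability measure of the ergodic process solving the homogeneous SDE $$\mathrm{d}H_s=\mathrm{d}W_s-F(H_s)\,\mathrm{d}s,$$ where $W$ is a standard Brownian motion. Let $(\mathscr{V}_t)_{t>0}$ be the process whose finite-dimensional distribution at distinct times $t_1,\dots,t_d>0$ is the pushforward of the product measure $\Pi_F^{\otimes d}$ by the linear map $T(u_1,\dots,u_d)=(t_1^{q}u_1,\dots,t_d^{q}u_d)$. Then, as $\varepsilon\to0$, $$\left(\varepsilon^{q}V_{t/\varepsilon}\right)_{t\ge\varepsilon t_0}\ \stackrel{\text{f.d.d.}}{\Longrightarrow}\ (\mathscr{V}_t)_{t>0}.$$ Moreover, in the linear case $\gamma=1$, if $\beta>-\frac12$, let $(\mathscr{X}_t)_{t\ge0}$ be the centered Gaussian process with covariance function $$K(s,t)=\frac{(s\wedge t)^{1+2\beta}}{\rho^2(1+2\beta)}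 .$$ Then, as $\varepsilon\to0$, $$\left(\varepsilon^{\beta+\frac12}X_{t/\varepsilon}\right)_{t\ge\varepsilon t_0}\ \stackrel{\text{f.d.d.}}{\Longrightarrow}\ (\mathscr{X}_t)_{t\ge0}.$$
   Context: Under the stated assumptions the stochastic differential equation for $(V,X)$ has a pathwise unique strong solution, which is almost surely defined for all $t\ge t_0$ (no explosion). The convention $\mathrm{sgn}(0)=0$ is used. The notation $(Z^{(\varepsilon)}_t)\stackrel{\text{f.d.d.}}{\Longrightarrow}(Z_t)$ means: for every finite subset $S\subset(0,+\infty)$, the vector $(Z^{(\varepsilon)}_t)_{t\in S}$ (which is defined as soon as $\varepsilon t_0\le\min S$) converges in distribution to $(Z_t)_{t\in S}$ in $\mathbb{R}^S$ as $\varepsilon\to0$. *)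

(* Defs.v *)
From HB Require Import structures.
From mathcomp Require Import all_boot all_order all_algebra.
From mathcomp Require Import all_classical all_reals all_analysis.

Set Implicit Arguments.
Unset Strict Implicit.
Unset Printing Implicit Defensive.

Import Order.TTheory GRing.Theory Num.Def Num.Theory.
Import numFieldNormedType.Exports.

Local Open Scope classical_set_scope.
Local Open Scope ring_scope.

Section processes.
Context d (T : measurableType d) (R : realType) (P : probability T R).

(* Taking [A j = setT] recovers the product rule for every subfamily. *)
Definition mutually_independent n (X : 'I_n -> T -> R) :=
  forall A : 'I_n -> set R, (forall i, measurable (A i)) ->
    P (\bigcap_(i in [set: 'I_n]) (X i @^-1` A i)) =
    (\prod_(i < n) P (X i @^-1` A i))%E.

(* The sigma-algebra of the process over the time interval [0, +oo[. *)
Definition sigma_process (W : R -> T -> R) : set (set T) :=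
  <<s \bigcup_(t in `[0, +oo[) preimage_set_system setT (W t) measurable >>.

Definition independent_of_process (X : T -> R) (W : R -> T -> R) :=
  forall (A : set R) (E : set T), measurable A -> sigma_process W E ->
    P (X @^-1` A `&` E) = (P (X @^-1` A) * P E)%E.

(* The second parameter of [normal_prob] is the standard deviation. *)
Definition brownian_motion (B : R -> {RV P >-> R}) :=
  [/\ {ae P, forall w, B 0 w = 0},
      {ae P, forall w, {within `[0, +oo[, continuous (fun t => B t w)}},
      forall s t, 0 <= s -> s < t -> forall A : set R, measurable A ->
        P [set w | A (B t w - B s w)] = normal_prob 0 (sqrtr (t - s)) A &
      forall n (t : nat -> R), 0 <= t 0%N ->
        {homo t : i j / (i <= j)%N >-> i <= j} ->
        mutually_independent
          (fun (i : 'I_n) w => B (t i.+1) w - B (t i) w)].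

(* Solution on [t0, +oo[ of dV_t = dB_t - b(t, V_t) dt.  As the noise is
   additive, the equation is an almost sure identity between continuous paths
   and involves no stochastic integral. *)
Definition sde_solution (B V : R -> {RV P >-> R}) (b : R -> R -> R) (t0 : R) :=
  {ae P, forall w,
    {within `[t0, +oo[, continuous (fun t => V t w)} /\
    forall t, t0 <= t ->
      V t w = V t0 w + (B t w - B t0 w)
              - \int[lebesgue_measure]_(s in `[t0, t]) b s (V s w)}.

(* [normal_prob m 0] is not the Dirac mass at [m] in the library, hence the
   case distinction. *)
Definition gaussian_rv (X : T -> R) :=
  exists m s : R, 0 <= s /\
    forall A : set R, measurable A ->
      P (X @^-1` A) = if s == 0 then \d_m A else normal_prob m s A.

Definition centered_gaussian_process (Y : R -> {RV P >-> R})
    (K : R -> R -> R) :=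
  [/\ forall n (t a : 'I_n -> R), (forall i, 0 <= t i) ->
        gaussian_rv (fun w => \sum_(i < n) a i * Y (t i) w),
      forall t, 0 <= t -> ('E_P[Y t] = 0)%E &
      forall s t, 0 <= s -> 0 <= t -> covariance P (Y s) (Y t) = (K s t)%:E].

End processes.

Section laws.
Context (R : realType).

Definition drift (rho gamma : R) (v : R) : R :=
  rho * (sgr v * (`|v| `^ gamma)).

(* Quantifying over all probability spaces expresses invariance under the
   semigroup: the law of [H s] depends only on that of [H 0]. *)
Definition invariant_law (F : R -> R) (Pi : probability R R) :=
  forall (d : measure_display) (T : measurableType d) (P : probability T R)
    (W H : R -> {RV P >-> R}),
    brownian_motion W ->
    independent_of_process P (H 0) (fun t => W t) ->
    sde_solution W H (fun _ => F) 0 ->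
    (forall A : set R, measurable A -> P (H 0 @^-1` A) = Pi A) ->
    forall s, 0 <= s ->
      forall A : set R, measurable A -> P (H s @^-1` A) = Pi A.

Fixpoint product_law (Pi : probability R R) n : set (n.-tuple R) -> \bar R :=
  match n return set (n.-tuple R) -> \bar R with
  | 0 => \d_[tuple]
  | m.+1 => pushforward (Pi \x product_law Pi (n := m))%E
              (fun p : R * m.-tuple R => [tuple of p.1 :: p.2])
  end.

(* The law at [t_1, ..., t_n] is the image of the n-fold product of [Pi] by
   (u_1, ..., u_n) |-> (t_1^q u_1, ..., t_n^q u_n). *)
Definition scaled_product_process d (T : measurableType d)
    (P : probability T R) (Y : R -> {RV P >-> R}) (Pi : probability R R)
    (q : R) :=
  forall n (t : 'I_n -> R), injective t -> (forall i, 0 < t i) ->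
    forall A : set (n.-tuple R), measurable A ->
      pushforward P (fun w => [tuple Y (t i) w | i < n]) A =
      pushforward (product_law Pi (n := n))
        (fun u => [tuple t i `^ q * tnth u i | i < n]) A.

Definition cvg_in_law d (T : measurableType d) (P : probability T R)
    d' (T' : measurableType d') (P' : probability T' R) n
    (Z : R -> T -> 'rV[R]_n) (Y : T' -> 'rV[R]_n) :=
  forall f : 'rV[R]_n -> R, continuous f ->
    (exists M, forall x, `|f x| <= M) ->
    ('E_P[f \o Z eps])%E @[eps --> 0^'+] --> ('E_P'[f \o Y])%E.

(* A finite subset of ]0, +oo[ is the range of an injective [t : 'I_n -> R].
   [Z eps t] only matters for small [eps], so that processes defined for
   [eps * t0 <= t] may be extended arbitrarily. *)
Definition fdd_cvg d (T : measurableType d) (P : probability T R)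
    d' (T' : measurableType d') (P' : probability T' R)
    (Z : R -> R -> T -> R) (Y : R -> T' -> R) :=
  forall n (t : 'I_n -> R), injective t -> (forall i, 0 < t i) ->
    cvg_in_law P P' (fun eps w => \row_(i < n) Z eps (t i) w)
                    (fun w => \row_(i < n) Y (t i) w).

End laws.

(* Main.v *)
Require Import Defs.
From HB Require Import structures.
From mathcomp Require Import all_boot all_order all_algebra.
From mathcomp Require Import all_classical all_reals all_analysis.
From mathcomp Require Import measurable_realfun ring lra.

(** The velocity equation is scale invariant. Over the window of length
    [L * T ^ (2 q)] that ends at [T], with time measured in units of
    [T ^ (2 q)] and velocity in units of [T ^ q], it becomes the homogeneous
    equation with a coefficient close to 1, because [q < 1/2] makes the window
    short compared with [T] ([solves_rescaled]). Three facts give the first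
    limit.

    - The drift is monotone and contracts linearly beyond any given distance
      ([drift_contract]), so that solutions driven by the same path forget
      their starting points exponentially fast. This yields the a priori bound
      [E |V_t| <= C t ^ q] ([a_priori_bound]) and shows that [V_T / T ^ q] is
      close, for large [L], to the solution at time [L] of the homogeneous
      equation started from 0 and driven by the rescaled noise of the window
      ([window_approximation]).
    - The law of that solution does not depend on the window: it is the limit of
      universal iterated normal integrals, those of the implicit Euler scheme
      ([cvg_euler_blocks]). On a product space the solution started from 0 can
      be compared with one started from an independent variable of law [Pi],
      which has law [Pi] forever; hence the common law is close to [Pi]
      ([invariant_law_limit]).
    - The windows that end at [t_1 / eps < ... < t_n / eps] are disjoint for
      small [eps], and the noise has independent increments. Hence the limit is
      a product ([window_product_limit]).

    In the linear case the product rule for [s ^ beta (B_s - V_s)] gives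
    [rho (X_t - x0) = M_t + R_t], where [M_t] is the integral of [s ^ beta]
    against the noise and [R_t] involves the velocity but no drift
    ([position_decomposition]). By the a priori bound [R_t] is of smaller order
    than [t ^ (beta + 1/2)] ([position_remainder]; here [beta < 1], that is
    [q < 1/2], is used again). The integral [M_t], defined by parts, is a
    pathwise limit of sums of independent normal increments, so that linear
    combinations of its values are normal with a variance that is computed
    exactly and converges after scaling to that of the limit process
    ([stieltjes_combination]).

    Both limits are turned into convergence in law by a Bernstein approximation
    of bounded continuous functions in bounded periodic coordinates, which
    leaves products of one-variable trigonometric test functions on a box
    ([cvg_in_law_criterion]); for the position these reduce further to cosines
    of linear forms ([trig_weights_cvg]). Almost sure hypotheses are replaced by
    sure ones by moving the exceptional sample points ([regular_paths]), and
    path integrals are handled through Riemann sums, so that joint measurability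
    in time and sample point never arises. *)

Set Implicit Arguments.
Unset Strict Implicit.
Unset Printing Implicit Defensive.

Import Order.TTheory GRing.Theory Num.Def Num.Theory.
Import numFieldNormedType.Exports.

Local Open Scope classical_set_scope.
Local Open Scope ring_scope.

(** * Integrals of continuous functions *)

Section calculus.
Context {R : realType}.
Implicit Types (f g F : R -> R) (a b c x y e s k u : R).
Local Notation mu := (@lebesgue_measure R).
Local Notation I f a b := (\int[mu]_(x in `[a, b]) (f x)).

Lemma integrable_continuous f a b : continuous f ->
  mu.-integrable `[a, b] (EFin \o f).
Proof.
move=> cf; apply: continuous_compact_integrable; first exact: segment_compact.
exact: continuous_subspaceT.
Qed.

Lemma int_pt f a : I f a a = 0.
Proof. by rewrite set_itv1 Rintegral_set1. Qed.

Lemma int_cat f a b c : continuous f -> a <= b -> b <= c ->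
  I f a c = I f a b + I f b c.
Proof.
move=> cf ab bc; apply/eqP; rewrite addrC -subr_eq; apply/eqP.
rewrite Rintegral_itvB ?bnd_simp//; last exact: integrable_continuous.
rewrite Rintegral_itv_obnd_cbnd//.
apply: integrableS (integrable_continuous b c cf) => //.
exact: subset_itv_oc_cc.
Qed.

Lemma intD f g a b : continuous f -> continuous g ->
  I (fun x => f x + g x) a b = I f a b + I g a b.
Proof. by move=> cf cg; rewrite RintegralD//; exact: integrable_continuous. Qed.

Lemma intB f g a b : continuous f -> continuous g ->
  I (fun x => f x - g x) a b = I f a b - I g a b.
Proof. by move=> cf cg; rewrite RintegralB//; exact: integrable_continuous. Qed.

Lemma intZ f c a b : continuous f -> I (fun x => c * f x) a b = c * I f a b.
Proof. by move=> cf; rewrite RintegralZl//; exact: integrable_continuous. Qed.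

Lemma int_cst c a b : a <= b -> I (fun=> c) a b = c * (b - a).
Proof.
move=> ab; rewrite Rintegral_cst//= lebesgue_measure_itv/= lte_fin.
move: ab; rewrite le_eqVlt => /predU1P[->|->]; last by rewrite -EFinB.
by rewrite ltxx subrr.
Qed.

Lemma eq_int f g a b : (forall x, a <= x <= b -> f x = g x) ->
  I f a b = I g a b.
Proof. by move=> fg; apply: eq_Rintegral => x; rewrite inE/= in_itv/= => /fg. Qed.

Lemma le_int f g a b : continuous f -> continuous g ->
  (forall x, a <= x <= b -> f x <= g x) -> I f a b <= I g a b.
Proof.
move=> cf cg fg; apply: le_Rintegral; [by []|exact: integrable_continuous|exact: integrable_continuous|].
by move=> x /=; rewrite in_itv/=; exact: fg.
Qed.

Lemma int_ge0 f a b : (forall x, a <= x <= b -> 0 <= f x) -> 0 <= I f a b.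
Proof. by move=> f0; apply: Rintegral_ge0 => x /=; rewrite in_itv/=; exact: f0. Qed.

Lemma le_abs_int f a b : continuous f ->
  `|I f a b| <= I (fun x => `|f x|) a b.
Proof. by move=> cf; apply: le_normr_Rintegral => //; exact: integrable_continuous. Qed.

Lemma continuous_norm f : continuous f -> continuous (fun x => `|f x|).
Proof.
by move=> cf x; apply: (@continuous_comp _ _ _ f normr); [exact: cf|exact: norm_continuous].
Qed.

Lemma le_abs_int_cst f a b c : a <= b -> continuous f ->
  (forall x, a <= x <= b -> `|f x| <= c) -> `|I f a b| <= c * (b - a).
Proof.
move=> ab cf fc; apply: le_trans (le_abs_int _ _ cf) _.
rewrite -int_cst//; apply: le_int => //; first exact: continuous_norm.
by move=> x; exact: cvg_cst.
Qed.

Lemma is_derive_int f a x : continuous f -> a < x ->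
  is_derive x 1 (fun t => I f a t) (f x).
Proof.
move=> cf ax.
have x1 : x < x + 1 by rewrite ltrDl.
have [d e] := continuous_FTC1_closed x1 (integrable_continuous _ _ cf) ax (cf x).
by apply: DeriveDef; [exact: d|rewrite -derive1E].
Qed.

Lemma FTC2 F f a b : a <= b -> continuous f ->
  (forall x, a <= x <= b -> is_derive x 1 F (f x)) -> I f a b = F b - F a.
Proof.
rewrite le_eqVlt => /predU1P[<- _ _|ab cf dF]; first by rewrite int_pt subrr.
have D x : a <= x <= b -> derivable F x 1 by move=> /dF[].
have C x : a <= x <= b -> {for x, continuous F}.
  by move=> xab; apply: differentiable_continuous; apply/derivable1_diffP/D.
rewrite /Rintegral (@continuous_FTC2 R f F a b ab)//.
- exact: continuous_subspaceT.
- split.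
  + by move=> x; rewrite in_itv/= => /andP[ax xb]; apply: D; rewrite !ltW.
  + by apply: cvg_at_right_filter; apply: C; rewrite lexx ltW.
  + by apply: cvg_at_left_filter; apply: C; rewrite lexx ltW.
- move=> x; rewrite in_itv/= => /andP[ax xb]; rewrite derive1E.
  by apply: derive_val; apply: dF; rewrite !ltW.
Qed.

(** The primitive is integrated from a point left of [a], which makes it
    differentiable at [a] itself. *)
Lemma primitive f a : continuous f -> exists F,
  (forall t, a <= t -> F t = I f a t) /\
  (forall t, a <= t -> is_derive t 1 F (f t)).
Proof.
move=> cf; exists (fun t => I f (a - 1) t - I f (a - 1) a); split=> t ta.
  have a1 : a - 1 <= a by rewrite gerBl.
  by rewrite (int_cat cf a1 ta) addrAC subrr add0r.
have h : is_derive t 1 (fun t => I f (a - 1) t) (f t).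
  by apply: is_derive_int => //; rewrite (lt_le_trans _ ta)// gtrBl.
by apply: is_derive_eq; rewrite subr0.
Qed.

Lemma int_affine g s k a b : continuous g -> a <= b -> 0 <= k ->
  I g (s + k * a) (s + k * b) = k * I (fun x => g (s + k * x)) a b.
Proof.
move=> cg ab k0; have [G [Gi dG]] := primitive (s + k * a) cg.
have cl : continuous (fun x => g (s + k * x)).
  move=> x; apply: (@continuous_comp _ _ _ (fun x => s + k * x) g); last exact: cg.
  by apply: cvgD; [exact: cvg_cst|apply: cvgMr; exact: cvg_id].
have kab x : a <= x -> s + k * a <= s + k * x by move=> ax; rewrite lerD2l ler_wpM2l.
rewrite -intZ//.
have -> : I (fun x => k * g (s + k * x)) a b = G (s + k * b) - G (s + k * a).
  apply: (@FTC2 (fun x => G (s + k * x))) => //.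
    by move=> x; apply: cvgMr; exact: cl.
  move=> x /andP[x0 _].
  have h : is_derive (s + k * x) 1 G (g (s + k * x)) by apply: dG; exact: kab.
  have hl : is_derive x 1 (fun x => s + k * x) k.
    apply: is_derive_eq.
    by rewrite /GRing.scale/=; ring.
  have := @is_derive1_comp R G (fun x => s + k * x) x (g (s + k * x)) k h hl.
  by rewrite mulrC.
by rewrite -Gi ?kab// [G (s + k * a)]Gi// int_pt subr0.
Qed.

Lemma bounded_continuous f a b : continuous f ->
  exists2 M, 0 <= M & forall x, a <= x <= b -> `|f x| <= M.
Proof.
move=> cf; have [ab|ba] := leP a b; last first.
  by exists 0 => // x /andP[ax xb]; move: (le_trans ax xb); rewrite leNgt ba.
have [c _ fc] := @EVT_max R (fun x => `|f x|) a b ab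
  (continuous_subspaceT (continuous_norm cf)).
by exists `|f c| => // x xab; apply: fc; rewrite in_itv.
Qed.

Lemma heine f a b e : continuous f -> 0 < e -> exists2 d, 0 < d &
  forall x y, a <= x <= b -> a <= y <= b -> `|x - y| <= d -> `|f x - f y| <= e.
Proof.
move=> cf e0.
have := (compact_near_coveringP `[a, b]%classic).1 (@segment_compact R a b)
  R (0^'+) (fun d x => forall y, `|x - y| <= d -> `|f x - f y| <= e) _.
case.
  move=> x _; have /cvgrPdist_lt/(_ (e / 2)) := cf x.
  rewrite divr_gt0// => /(_ isT)[r /= r0 hr].
  exists (ball x (r / 2), [set d | 0 < d < r / 2]).
    split; first by apply: nbhsx_ballx; rewrite divr_gt0.
    have := @nbhs_right_lt R 0 (r / 2); rewrite divr_gt0// => /(_ isT) H.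
    by near=> d; apply/andP; split; near: d; [exact: nbhs_right_gt|exact: H].
  move=> [z d]/= [xz /andP[d0 dr]] y zy.
  have h1 := hr z; have h2 := hr y.
  rewrite /ball/= in xz.
  have {}h1 : `|f x - f z| < e / 2 by apply: h1; rewrite /ball_/=; lra.
  have {}h2 : `|f x - f y| < e / 2.
    apply: h2; rewrite /ball_/= -(subrKA z) (le_lt_trans (ler_normD _ _))//; lra.
  have -> : f z - f y = (f x - f y) - (f x - f z) by ring.
  by rewrite (le_trans (ler_normB _ _))//; lra.
move=> d /= d0 hd.
exists (d / 2); first by rewrite divr_gt0.
move=> x y xab _ xy; apply: (hd (d / 2)) => //=.
- by rewrite sub0r normrN gtr0_norm ?divr_gt0// ltr_pdivrMr// ltr_pMr// ltr1n.
- by rewrite divr_gt0.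
Unshelve. all: by end_near. Qed.

Lemma continuous_max_within f a : {within `[a, +oo[, continuous f} ->
  continuous (fun t => f (maxr a t)).
Proof.
move=> /subspace_continuousP cf t.
have cm : continuous (fun t : R => maxr a t).
  move=> x; apply: continuous_max; [exact: cvg_cst|exact: cvg_id].
apply/cvgrPdist_lt => e e0.
have ma : `[a, +oo[%classic (maxr a t) by rewrite /= in_itv/= andbT le_max lexx.
have /cvgrPdist_lt/(_ _ e0) := cf _ ma.
rewrite near_withinE => /= -[r /= r0 hr].
have /cvgrPdist_lt/(_ _ r0) := cm t.
apply: filterS => x xr; apply: hr => //=.
by rewrite in_itv/= andbT le_max lexx.
Qed.

End calculus.

(** * Differential inequalities and Riemann sums *)

Section dissipative_inequalities.
Context {R : realType}.
Implicit Types (f g F D phi : R -> R) (a b c d e s T u x y eta kappa : R).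
Local Notation mu := (@lebesgue_measure R).
Local Notation I f a b := (\int[mu]_(x in `[a, b]) (f x)).

Lemma derive_le0_decr F f a b : a <= b ->
  (forall x, a <= x <= b -> is_derive x 1 F (f x)) ->
  (forall x, a <= x <= b -> f x <= 0) -> F b <= F a.
Proof.
move=> ab dF f0.
have cF : {within `[a, b], continuous F}.
  apply: derivable_within_continuous => x; rewrite in_itv/= => /dF[].
  by [].
have dF' x : x \in `]a, b[ -> is_derive x 1 F (f x).
  by rewrite in_itv/= => /andP[ax xb]; apply: dF; rewrite !ltW.
have [c] := MVT_segment ab dF' cF.
rewrite in_itv/= => /f0 fc0 Fab.
by rewrite -subr_le0 Fab mulr_le0_ge0// subr_ge0.
Qed.

(** A smooth majorant of the absolute value, whose growth can be
    differentiated through the zeros of [D]. *)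
Lemma is_derive_smooth_abs D phi x kappa : 0 < kappa -> is_derive x 1 D (phi x) ->
  is_derive x 1 (fun t => Num.sqrt (D t ^+ 2 + kappa ^+ 2))
    (D x * phi x / Num.sqrt (D x ^+ 2 + kappa ^+ 2)).
Proof.
move=> k0 dD.
have pos : 0 < D x ^+ 2 + kappa ^+ 2 by rewrite ltr_wpDl ?sqr_ge0 ?exprn_gt0.
have h1 : is_derive x 1 (fun t => D t ^+ 2 + kappa ^+ 2) (2 * D x * phi x).
  by apply: is_derive_eq; rewrite /GRing.scale/=; ring.
have h2 := is_derive1_sqrt pos.
have h := @is_derive1_comp R Num.sqrt (fun t => D t ^+ 2 + kappa ^+ 2) x _ _ h2 h1.
apply: (is_derive_eq h); have : Num.sqrt (D x ^+ 2 + kappa ^+ 2) != 0.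
  by rewrite gt_eqF// sqrtr_gt0.
by move=> n0; field.
Qed.

Lemma smooth_abs_ge x kappa : `|x| <= Num.sqrt (x ^+ 2 + kappa ^+ 2).
Proof. by rewrite -sqrtr_sqr ler_sqrt ?addr_ge0 ?sqr_ge0// lerDl sqr_ge0. Qed.

Lemma smooth_abs_le x kappa : 0 <= kappa ->
  Num.sqrt (x ^+ 2 + kappa ^+ 2) <= `|x| + kappa.
Proof.
move=> k0; rewrite -(@ger0_norm _ (`|x| + kappa)) ?addr_ge0// -sqrtr_sqr.
rewrite ler_sqrt ?sqr_ge0// sqrrD real_normK ?num_real// -addrA lerD2l lerDr.
by rewrite mulrn_wge0// mulr_ge0.
Qed.

Section fixed_path.
Variables (D phi e : R -> R) (s T : R).
Hypotheses (cphi : continuous phi) (ce : continuous e) (sT : s <= T).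
Hypothesis eqD : forall t, s <= t <= T -> D t = D s + I phi s t.
Hypothesis e0 : forall t, s <= t <= T -> 0 <= e t.

(** Gronwall's inequality for the absolute value. The term [c * eta] in the
    hypothesis allows for a contraction that only acts at distances above
    [eta]. *)
Lemma dissipative_decay c eta : 0 <= c -> 0 <= eta ->
  (forall u, s <= u <= T ->
    D u * phi u <= - c * D u ^+ 2 + (c * eta + e u) * `|D u|) ->
  `|D T| <= eta + expR (- (c * (T - s))) * `|D s| + I e s T.
Proof.
move=> c0 eta0 hD.
have [Phi [PhiI dPhi]] := primitive s cphi.
have [E [EI dE]] := primitive s ce.
pose D1 t := D s + Phi t.
have D1E t : s <= t <= T -> D1 t = D t.
  by move=> stT; rewrite /D1 [RHS]eqD// PhiI//; case/andP: stT.
have dD1 t : s <= t <= T -> is_derive t 1 D1 (phi t).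
  move=> /andP[st _]; have := dPhi _ st => h.
  by apply: (is_derive_eq (is_deriveD (is_derive_cst (D s) t 1) h)); rewrite add0r.
apply/ler_addgt0Pr => k k0.
pose N t := Num.sqrt (D1 t ^+ 2 + k ^+ 2).
have N0 t : 0 < N t by rewrite sqrtr_gt0 ltr_wpDl ?sqr_ge0 ?exprn_gt0.
have N2 t : N t ^+ 2 = D1 t ^+ 2 + k ^+ 2.
  by rewrite sqr_sqrtr// addr_ge0 ?sqr_ge0.
pose X t := expR (c * (t - s)).
(* Gronwall's argument: [G] is nonincreasing. *)
pose G t := X t * (N t - (k + eta)) - X T * E t.
pose g t := X t * (c * (N t - k - eta) + D1 t * phi t / N t) - X T * e t.
have GG : G T <= G s.
  apply: (@derive_le0_decr G g _ _ sT) => t stT.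
    have h1 := is_derive_smooth_abs k0 (dD1 t stT).
    have h2 : is_derive t 1 E (e t) by case/andP: stT => st _; exact: dE.
    have h3 : is_derive t 1 (fun t => c * (t - s)) c.
      by apply: is_derive_eq; rewrite /GRing.scale/=; ring.
    have h4 : is_derive t 1 X (c * X t).
      have h := @is_derive1_comp R expR (fun t => c * (t - s)) t _ _
        (is_derive_expR _) h3.
      by apply: (is_derive_eq h); rewrite mulrC.
    apply: is_derive_eq; rewrite /g /GRing.scale/= -/(N t); ring.
  have Xle : X t <= X T.
    by rewrite ler_expR ler_wpM2l// lerD2r; case/andP: stT.
  rewrite subr_le0 (le_trans _ (ler_wpM2r (e0 stT) Xle))//.
  rewrite ler_wpM2l ?expR_ge0//.
  have hDt := hD t stT; rewrite -(D1E t stT) in hDt.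
  have aN : `|D1 t| <= N t by exact: smooth_abs_ge.
  have kN : k <= N t.
    by rewrite -[leLHS](gtr0_norm k0) /N addrC smooth_abs_ge.
  have e0t := e0 stT.
  rewrite -lerBrDl ler_pdivrMr// (le_trans hDt)//.
  have h1 : (c * eta + e t) * `|D1 t| <= (c * eta + e t) * N t.
    by rewrite ler_wpM2l// addr_ge0// mulr_ge0.
  have h2 : c * k * k <= c * k * N t by rewrite ler_wpM2l// mulr_ge0// ltW.
  have -> : - c * D1 t ^+ 2 = - c * N t ^+ 2 + c * k * k by rewrite N2; ring.
  rewrite -subr_ge0; lra.
have Es : E s = 0 by rewrite EI// int_pt.
have ET : E T = I e s T by rewrite EI.
have Xs : X s = 1 by rewrite /X subrr mulr0 expR0.
move: GG; rewrite /G Xs Es ET mulr0 subr0 mul1r => GG.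
have sTs : s <= s <= T by rewrite lexx.
have sTT : s <= T <= T by rewrite lexx andbT.
have NT : `|D T| <= N T by rewrite -(D1E _ sTT) smooth_abs_ge.
have Ns : N s <= `|D s| + k by rewrite -(D1E _ sTs) smooth_abs_le// ltW.
have XT : expR (- (c * (T - s))) = (X T)^-1 by rewrite expRN.
have XT0 : 0 < X T by exact: expR_gt0.
have {}GG : X T * (N T - (k + eta) - I e s T) <= `|D s|.
  by rewrite mulrBr (le_trans GG)//; lra.
rewrite -ler_pdivlMl// in GG.
rewrite XT; lra.
Qed.

(** The total dissipation is paid for by the initial distance and the
    perturbation; below distance 1 nothing is known but the bound [p0]. *)
Lemma dissipative_integral (p : R -> R) (p0 : R) : continuous p -> 0 <= p0 ->
  (forall u, s <= u <= T -> 0 <= p u) ->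
  (forall u, s <= u <= T -> `|D u| < 1 -> p u <= p0) ->
  (forall u, s <= u <= T -> D u * phi u <= - p u * `|D u| + e u * `|D u|) ->
  I p s T <= 2 * (`|D s| + 1 + I e s T) + p0 * (T - s).
Proof.
move=> cp p00 pp pD hD.
have [Phi [PhiI dPhi]] := primitive s cphi.
have [E [EI dE]] := primitive s ce.
have [Q [QI dQ]] := primitive s cp.
pose D1 t := D s + Phi t.
have D1E t : s <= t <= T -> D1 t = D t.
  by move=> stT; rewrite /D1 [RHS]eqD// PhiI//; case/andP: stT.
have dD1 t : s <= t <= T -> is_derive t 1 D1 (phi t).
  move=> /andP[st _]; have := dPhi _ st => h.
  by apply: (is_derive_eq (is_deriveD (is_derive_cst (D s) t 1) h)); rewrite add0r.
pose N t := Num.sqrt (D1 t ^+ 2 + 1 ^+ 2).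
have N0 t : 0 < N t by rewrite sqrtr_gt0 ltr_wpDl ?sqr_ge0 ?exprn_gt0.
(* The factor 2 suffices: if [1 <= |D|], then [1/2 <= |D| / N]. *)
pose G t := Q t + 2 * (N t - E t) - p0 * t.
pose g t := p t + 2 * (D1 t * phi t / N t - e t) - p0.
have GG : G T <= G s.
  apply: (@derive_le0_decr G g _ _ sT) => t stT.
    have h1 := is_derive_smooth_abs ltr01 (dD1 t stT).
    have h2 : is_derive t 1 E (e t) by case/andP: stT => st _; exact: dE.
    have h3 : is_derive t 1 Q (p t) by case/andP: stT => st _; exact: dQ.
    apply: is_derive_eq; rewrite /g /GRing.scale/= -/(N t); ring.
  have hDt := hD t stT; rewrite -(D1E t stT) in hDt.
  have aN : `|D1 t| <= N t by exact: smooth_abs_ge.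
  have e0t := e0 stT; have p0t := pp t stT; have pDt := pD t stT.
  rewrite -(D1E t stT) in pDt.
  have h1 : D1 t * phi t / N t <= - p t * (`|D1 t| / N t) + e t.
    rewrite ler_pdivrMr//.
    have -> : (- p t * (`|D1 t| / N t) + e t) * N t = - p t * `|D1 t| + e t * N t.
      by field; rewrite gt_eqF.
    apply: (le_trans hDt).
    by rewrite lerD2l ler_wpM2l.
  have r0 : 0 <= `|D1 t| / N t by rewrite divr_ge0// ltW.
  have h2 : p t <= 2 * (p t * (`|D1 t| / N t)) + p0.
    have [/pDt|D1t] := ltP `|D1 t| 1.
      by move=> /le_trans; apply; rewrite lerDr mulr_ge0// mulr_ge0.
    have NN : N t <= 2 * `|D1 t|.
      have := @smooth_abs_le (D1 t) 1 ler01; rewrite -/(N t); lra.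
    have : 1 <= 2 * (`|D1 t| / N t) by rewrite mulrA ler_pdivlMr// mul1r.
    move=> /(ler_wpM2l p0t); lra.
  rewrite /g; lra.
have Es : E s = 0 by rewrite EI// int_pt.
have ET : E T = I e s T by rewrite EI.
have Qs : Q s = 0 by rewrite QI// int_pt.
have QT : Q T = I p s T by rewrite QI.
move: GG; rewrite /G Es Qs ET QT => GG.
have sTs : s <= s <= T by rewrite lexx.
have Ns : N s <= `|D s| + 1 by rewrite -(D1E _ sTs) smooth_abs_le.
have := ltW (N0 T); lra.
Qed.

End fixed_path.

Lemma cvg_nat_eps (u : nat -> R) (l : R) :
  (forall e, 0 < e -> exists N, forall n, (N <= n)%N -> `|l - u n| <= e) ->
  u @ \oo --> l.
Proof.
move=> h; apply/cvgrPdist_le => e' e'0; have [N hN] := h _ e'0.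
by near=> n; apply: hN; near: n; exact: nbhs_infty_ge.
Unshelve. all: by end_near. Qed.

Lemma int_grid f a (h : R) n : continuous f -> 0 <= h ->
  I f a (a + n%:R * h) = \sum_(k < n) I f (a + k%:R * h) (a + k.+1%:R * h).
Proof.
move=> cf h0; elim: n => [|n IH]; first by rewrite big_ord0 mul0r addr0 int_pt.
rewrite big_ord_recr/= -IH -int_cat//; first by rewrite lerDl mulr_ge0.
by rewrite lerD2l ler_wpM2r// ler_nat.
Qed.

Lemma riemann_sum_dist f a b d e' : continuous f -> a <= b ->
  (forall x y, a <= x <= b -> a <= y <= b -> `|x - y| <= d -> `|f x - f y| <= e') ->
  forall n, (b - a) / n.+1%:R <= d ->
  `|I f a b - \sum_(k < n.+1)
      f (a + k%:R * ((b - a) / n.+1%:R)) * ((b - a) / n.+1%:R)| <= e' * (b - a).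
Proof.
move=> cf ab hf n; set h := (b - a) / _ => hd.
have h0 : 0 <= h by rewrite divr_ge0// subr_ge0.
have hb : a + n.+1%:R * h = b by rewrite /h; field.
rewrite -[X in I f a X]hb int_grid// -sumrB (le_trans (ler_norm_sum _ _ _))//.
have -> : e' * (b - a) = \sum_(k < n.+1) e' * h.
  by rewrite sumr_const card_ord -mulr_natr /h; field.
apply: ler_sum => k _.
have k1 : a + k%:R * h <= a + k.+1%:R * h by rewrite lerD2l ler_wpM2r// ler_nat.
have kh : a + k.+1%:R * h - (a + k%:R * h) = h by rewrite -natr1; ring.
have -> : f (a + k%:R * h) * h = I (fun=> f (a + k%:R * h)) (a + k%:R * h) (a + k.+1%:R * h).
  by rewrite int_cst// kh.
have cc : continuous (fun _ : R => f (a + k%:R * h)) by move=> x; exact: cvg_cst.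
rewrite -intB// -[in leRHS]kh; apply: le_abs_int_cst => //.
  by move=> x; apply: cvgB; [exact: cf|exact: cc].
move=> x /andP[x1 x2].
have ka : a <= a + k%:R * h by rewrite lerDl mulr_ge0.
have kb : a + k.+1%:R * h <= b.
  by rewrite -[leRHS]hb lerD2l ler_wpM2r// ler_nat.
apply: hf; first by rewrite (le_trans ka)// (le_trans x2).
- by rewrite ka (le_trans k1).
- rewrite ger0_norm ?subr_ge0// (le_trans _ hd)//; lra.
Qed.

Lemma mesh_small (l d : R) : 0 < d -> exists N, forall n, (N <= n)%N -> l / n.+1%:R <= d.
Proof.
move=> d0; exists (Num.bound `|l / d|) => n Nn.
rewrite ler_pdivrMr// mulrC -ler_pdivrMr//.
rewrite (le_trans (ler_norm _))// (le_trans (ltW (archi_boundP (normr_ge0 _))))//.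
by rewrite ler_nat (leq_trans Nn).
Qed.

Lemma cvg_riemann_sum f a b : continuous f -> a <= b ->
  (fun n => \sum_(k < n.+1)
      f (a + k%:R * ((b - a) / n.+1%:R)) * ((b - a) / n.+1%:R)) @ \oo --> I f a b.
Proof.
move=> cf ab; apply: cvg_nat_eps => e' e'0.
have ba : 0 < b - a + 1 by rewrite ltr_wpDl// subr_ge0.
have [d d0 hd] := @heine R f a b (e' / (b - a + 1)) cf (divr_gt0 e'0 ba).
have [N hN] := mesh_small (b - a) d0.
exists N => n /hN nd; apply: le_trans (riemann_sum_dist cf ab hd nd) _.
by rewrite -mulrA ger_pMr// mulrC ler_pdivrMr// mul1r; lra.
Qed.

End dissipative_inequalities.

(** * The drift *)

Section drift.
Context {R : realType}.
Variables (rho gamma : R).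
Hypotheses (rho0 : 0 < rho) (gamma1 : 1 <= gamma).
Implicit Types (x y z D k eta K : R).
Local Notation F := (drift rho gamma).

Let gamma0 : 0 < gamma. Proof. exact: lt_le_trans gamma1. Qed.

Lemma drift_ge0E x : 0 <= x -> F x = rho * x `^ gamma.
Proof.
rewrite /drift le_eqVlt => /predU1P[<-|x0].
  by rewrite sgr0 mul0r powR0 ?gt_eqF.
by rewrite gtr0_sg// mul1r gtr0_norm.
Qed.

Lemma driftN x : F (- x) = - F x.
Proof. by rewrite /drift sgrN normrN mulNr mulrN. Qed.

Lemma drift0 : F 0 = 0. Proof. by rewrite /drift sgr0 mul0r mulr0. Qed.

Lemma norm_drift x : `|F x| = F `|x|.
Proof.
rewrite [RHS]drift_ge0E// /drift normrM (gtr0_norm rho0) normrM.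
rewrite (ger0_norm (powR_ge0 _ _)).
have [->|x0] := eqVneq x 0; last by rewrite normr_sg x0 mul1r.
by rewrite sgr0 normr0 mul0r powR0 ?gt_eqF.
Qed.

Lemma drift_ge0 x : 0 <= x -> 0 <= F x.
Proof. by move=> x0; rewrite drift_ge0E// mulr_ge0 ?powR_ge0 ?ltW. Qed.

Lemma drift_le x y : x <= y -> F x <= F y.
Proof.
have pos u v : 0 <= u -> u <= v -> F u <= F v.
  move=> u0 uv; have v0 := le_trans u0 uv.
  rewrite !drift_ge0E// ler_wpM2l ?(ltW rho0)//.
  by apply: ge0_ler_powR; rewrite ?nnegrE// ltW.
move=> xy; have [x0|x0] := leP 0 x; first exact: pos.
have [y0|y0] := leP 0 y.
  apply: (@le_trans _ _ 0); last exact: drift_ge0.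
  by rewrite -oppr_ge0 -driftN drift_ge0// oppr_ge0 ltW.
by rewrite -lerN2 -!driftN pos ?lerN2// oppr_ge0 ltW.
Qed.

Lemma driftM k x : 0 < k -> F (k * x) = k `^ gamma * F x.
Proof.
move=> k0; have pos u : 0 <= u -> F (k * u) = k `^ gamma * F u.
  move=> u0; rewrite !drift_ge0E// ?mulr_ge0 ?(ltW k0)// powRM// ?(ltW k0)//.
  by rewrite mulrCA.
have [/pos//|x0] := leP 0 x.
have := pos (- x); rewrite oppr_ge0 (ltW x0) mulrN !driftN mulrN => /(_ isT).
by move/oppr_inj.
Qed.

Lemma powR_subSr x : 0 <= x -> x `^ gamma = x `^ (gamma - 1) * x.
Proof. by move=> x0; rewrite mulrC mulr_powRB1. Qed.

Lemma powR_sub1_le x y : 0 <= x -> x <= y -> x `^ (gamma - 1) <= y `^ (gamma - 1).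
Proof.
move=> x0 xy; apply: ge0_ler_powR; rewrite ?nnegrE// ?subr_ge0//.
exact: le_trans xy.
Qed.

(** Superadditivity on the half-line, extended to all pairs at the price of a
    factor 2 in the argument. *)
Lemma drift_half x y : y <= x -> F ((x - y) / 2) <= F x - F y.
Proof.
have pos u v : 0 <= v -> v <= u -> F ((u - v) / 2) <= F u - F v.
  move=> v0 vu; have u0 := le_trans v0 vu.
  have uv0 : 0 <= u - v by rewrite subr_ge0.
  apply: (@le_trans _ _ (F (u - v))); first by apply: drift_le; lra.
  rewrite !drift_ge0E// -mulrBr ler_wpM2l ?(ltW rho0)// !powR_subSr//.
  have h1 := powR_sub1_le v0 vu.
  have h2 : (u - v) `^ (gamma - 1) <= u `^ (gamma - 1) by apply: powR_sub1_le; lra.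
  have h3 := ler_wpM2r v0 h1; have h4 := ler_wpM2r uv0 h2.
  by lra.
move=> yx; have [y0|y0] := leP 0 y; first exact: pos.
have [x0|x0] := leP 0 x; last first.
  have := @pos (- y) (- x); rewrite oppr_ge0 lerN2 (ltW x0) => /(_ isT yx).
  by rewrite !driftN !opprK [- y + x]addrC [- F y + _]addrC.
have Fx := drift_ge0 x0; have Fy : 0 <= - F y by rewrite -driftN drift_ge0// oppr_ge0 ltW.
have [xy|xy] := leP x (- y).
  have : F ((x - y) / 2) <= F (- y) by apply: drift_le; lra.
  by rewrite driftN; lra.
have : F ((x - y) / 2) <= F x by apply: drift_le; lra.
by lra.
Qed.

(** Strict monotony in quantitative form, uniform in the base point [y]. *)
Lemma drift_monotone y D :
  `|D| * F (`|D| / 2) <= D * (F (y + D) - F y).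
Proof.
have [D0|D0] := leP 0 D.
  rewrite ger0_norm// ler_wpM2l//.
  have := @drift_half (y + D) y; rewrite lerDl => /(_ D0).
  by rewrite addrAC subrr add0r.
rewrite ltr0_norm// mulNr -mulrN ler_wnM2l// ?(ltW D0)//.
have := @drift_half y (y + D); rewrite gerDl => /(_ (ltW D0)).
by rewrite opprD addrA subrr add0r; lra.
Qed.

Lemma drift_linear_lb eta z : 0 <= eta -> eta <= z ->
  rho * eta `^ (gamma - 1) * z <= F z.
Proof.
move=> eta0 etaz; have z0 := le_trans eta0 etaz.
rewrite drift_ge0E// powR_subSr// mulrA ler_wpM2r// ler_wpM2l ?(ltW rho0)//.
exact: powR_sub1_le.
Qed.

Definition decay_rate eta := rho / 2 * (eta / 2) `^ (gamma - 1).

Lemma decay_rate_gt0 eta : 0 < eta -> 0 < decay_rate eta.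
Proof. by move=> e0; rewrite !mulr_gt0 ?invr_gt0// powR_gt0// divr_gt0. Qed.

(** Beyond distance [eta] the drift contracts at a linear rate; the correction
    term takes care of smaller distances. *)
Lemma drift_contract eta y D : 0 < eta ->
  decay_rate eta * D ^+ 2 - decay_rate eta * eta * `|D| <= D * (F (y + D) - F y).
Proof.
move=> eta0; apply: le_trans (drift_monotone y D).
have c0 := decay_rate_gt0 eta0.
have -> : D ^+ 2 = `|D| * `|D| by rewrite -expr2 real_normK// num_real.
have [De|De] := leP eta `|D|.
  have : rho * (eta / 2) `^ (gamma - 1) * (`|D| / 2) <= F (`|D| / 2).
    by apply: drift_linear_lb; lra.
  have -> : rho * (eta / 2) `^ (gamma - 1) * (`|D| / 2) = decay_rate eta * `|D|.
    by rewrite /decay_rate; field.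
  move=> /(ler_wpM2l (normr_ge0 D)) h.
  have : 0 <= decay_rate eta * eta * `|D| by apply: mulr_ge0 => //; apply: mulr_ge0; apply: ltW.
  by lra.
apply: (@le_trans _ _ 0); last by rewrite mulr_ge0// drift_ge0// divr_ge0.
rewrite -mulrA -mulrBr pmulr_rle0// -mulrBl mulr_le0_ge0//.
by rewrite subr_le0 ltW.
Qed.

Lemma drift_add_le x y : `|F (x + y)| <= 4 `^ gamma * F (`|x| / 2) + 2 `^ gamma * `|F y|.
Proof.
have two0 : 0 < 2 :> R by [].
have four0 : 0 < 4 :> R by [].
rewrite !norm_drift -(driftM _ two0) -(driftM _ four0).
have -> : 4 * (`|x| / 2) = 2 * `|x| by field.
have xy := ler_normD x y.
have Fx : 0 <= F (2 * `|x|) by rewrite drift_ge0// mulr_ge0.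
have Fy : 0 <= F (2 * `|y|) by rewrite drift_ge0// mulr_ge0.
have [h|h] := leP `|x| `|y|.
  have : F `|x + y| <= F (2 * `|y|) by apply: drift_le; lra.
  by lra.
have : F `|x + y| <= F (2 * `|x|) by apply: drift_le; lra.
by lra.
Qed.

Lemma drift_lipschitz K : exists2 C, 0 <= C &
  forall x y, `|x| <= K -> `|y| <= K -> `|F x - F y| <= C * `|x - y|.
Proof.
have c0 : 0 <= rho * gamma * K `^ (gamma - 1).
  by rewrite !mulr_ge0 ?powR_ge0// ltW.
exists (2 * (rho * gamma * K `^ (gamma - 1))); first by rewrite mulr_ge0.
set C := rho * gamma * _ in c0 *.
have pos u v : 0 <= v -> v <= u -> u <= K -> F u - F v <= C * (u - v).
  rewrite le_eqVlt => /predU1P[<- u0 uK|v0 vu uK].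
    rewrite drift0 !subr0 drift_ge0E// powR_subSr// mulrA ler_wpM2r//.
    rewrite /C -mulrA ler_wpM2l ?(ltW rho0)//.
    apply: (le_trans (powR_sub1_le u0 uK)).
    by rewrite ler_peMl// powR_ge0.
  have u0 := lt_le_trans v0 vu.
  have dp x : v <= x -> is_derive x 1 (fun t => powR t gamma) (gamma * x `^ (gamma - 1)).
    by move=> vx; apply: is_derive1_powR; exact: lt_le_trans vx.
  have cF : {within `[v, u], continuous (fun t : R => powR t gamma)}.
    apply: derivable_within_continuous => x; rewrite in_itv/= => /andP[vx _].
    by have [] := dp x vx.
  have dF' x : x \in `]v, u[ -> is_derive x 1 (fun t => powR t gamma) (gamma * x `^ (gamma - 1)).
    by rewrite in_itv/= => /andP[ax xb]; apply: dp; rewrite !ltW.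
  have [c] := MVT_segment vu dF' cF.
  rewrite in_itv/= => /andP[vc cu] E.
  rewrite !drift_ge0E ?(ltW u0) ?(ltW v0)// -mulrBr E /C !mulrA.
  rewrite ler_wpM2r ?subr_ge0//  ler_wpM2l ?mulr_ge0 ?(ltW rho0) ?(ltW gamma0)//.
  by apply: powR_sub1_le; rewrite ?(le_trans cu)// (le_trans (ltW v0)).
have main u v : v <= u -> `|u| <= K -> `|v| <= K -> F u - F v <= 2 * C * (u - v).
  move=> vu; rewrite !ler_norml => /andP[u1 u2] /andP[v1 v2].
  have C2 : C * (u - v) <= 2 * C * (u - v).
    by rewrite ler_wpM2r ?subr_ge0//; lra.
  have [v0|v0] := leP 0 v; first by rewrite (le_trans _ C2)// pos.
  have [u0|u0] := leP 0 u.
    have := pos _ _ (lexx 0) u0 u2.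
    have := @pos (- v) 0 (lexx 0); rewrite driftN drift0 => H.
    have {H} : - F v - 0 <= C * (- v - 0) by apply: H; lra.
    have h1 : C * u <= C * (u - v) by rewrite ler_wpM2l//; lra.
    have h2 : C * - v <= C * (u - v) by rewrite ler_wpM2l//; lra.
    by rewrite !subr0 -mulrA; lra.
  apply: (le_trans _ C2).
  have := @pos (- v) (- u); rewrite !driftN => H.
  have {H} : - F v - - F u <= C * (- v - - u) by apply: H; lra.
  by lra.
move=> x y xK yK; have [xy|xy] := leP x y.
  rewrite distrC (distrC x) !ger0_norm ?subr_ge0 ?drift_le//.
  exact: main.
rewrite !ger0_norm ?subr_ge0 ?drift_le ?(ltW xy)//.
by apply: main => //; exact: ltW.
Qed.

Lemma continuous_drift : continuous F.
Proof.
move=> x; have [C C0 hC] := drift_lipschitz (`|x| + 1).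
apply/cvgrPdist_le => e e0; near=> y.
have xy1 : `|x - y| <= 1 by near: y; apply: cvgr_dist_le => //; exact: cvg_id.
have xye : `|x - y| <= e / (C + 1).
  by near: y; apply: cvgr_dist_le; [exact: cvg_id|rewrite divr_gt0// ltr_wpDl].
have yx : `|y| <= `|x| + 1.
  by rewrite -[y](subKr x) (le_trans (ler_normB _ _))// lerD2l.
apply: (le_trans (hC _ _ _ yx)); first by rewrite lerDl.
apply: (@le_trans _ _ ((C + 1) * `|x - y|)).
  by rewrite ler_wpM2r//; lra.
by rewrite mulrC -ler_pdivlMr// ltr_wpDl.
Unshelve. all: by end_near. Qed.

End drift.

(** * Equations driven by a continuous path *)

Section continuity_helpers.
Context {R : realType}.
Implicit Types (f g : R -> R) (a b c C K x y : R).
Local Notation mu := (@lebesgue_measure R).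
Local Notation I f a b := (\int[mu]_(x in `[a, b]) (f x)).

Lemma contD f g : continuous f -> continuous g -> continuous (fun x => f x + g x).
Proof. by move=> cf cg x; apply: cvgD; [exact: cf|exact: cg]. Qed.
Lemma contB f g : continuous f -> continuous g -> continuous (fun x => f x - g x).
Proof. by move=> cf cg x; apply: cvgB; [exact: cf|exact: cg]. Qed.
Lemma contM f g : continuous f -> continuous g -> continuous (fun x => f x * g x).
Proof. by move=> cf cg x; apply: cvgM; [exact: cf|exact: cg]. Qed.
Lemma contN f : continuous f -> continuous (fun x => - f x).
Proof. by move=> cf x; apply: cvgN; exact: cf. Qed.
Lemma cont_cst c : continuous (fun _ : R => c).
Proof. by move=> x; exact: cvg_cst. Qed.
Lemma cont_id : continuous (fun x : R => x).
Proof. by move=> x; exact: cvg_id. Qed.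
Lemma cont_comp f g : continuous f -> continuous g -> continuous (fun x => g (f x)).
Proof. by move=> cf cg x; apply: (@continuous_comp _ _ _ f g); [exact: cf|exact: cg]. Qed.
Lemma cont_max f g : continuous f -> continuous g -> continuous (fun x => maxr (f x) (g x)).
Proof. by move=> cf cg x; apply: continuous_max; [exact: cf|exact: cg]. Qed.
Lemma cont_min f g : continuous f -> continuous g -> continuous (fun x => minr (f x) (g x)).
Proof. by move=> cf cg x; apply: continuous_min; [exact: cf|exact: cg]. Qed.

Lemma intN f a b : continuous f -> I (fun x => - f x) a b = - I f a b.
Proof.
move=> cf; rewrite -mulN1r -intZ//; apply: eq_int => x _; rewrite mulN1r//.
Qed.

Lemma int_gt f a b : b < a -> I f a b = 0.
Proof. by move=> ba; rewrite set_itv_ge ?Rintegral_set0// bnd_simp -ltNge. Qed.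

Lemma continuous_int f a : continuous f -> continuous (fun t => I f a t).
Proof.
move=> cf; have [P [PI dP]] := primitive a cf.
have -> : (fun t => I f a t) = (fun t => P (maxr a t)).
  apply/funext => t; have [ta|ta] := leP a t; first by rewrite PI.
  by rewrite PI// int_pt int_gt.
move=> t; have am : a <= maxr a t by rewrite le_max lexx.
apply: (@continuous_comp _ _ _ (fun t => maxr a t) P).
  by apply: cont_max; [exact: cont_cst|exact: cont_id].
apply: differentiable_continuous; apply/derivable1_diffP.
by have [] := dP _ am.
Qed.

(** Clamping to [[-K, K]] makes a locally Lipschitz function globally so. *)
Definition clamp (K x : R) := maxr (- K) (minr x K).

Lemma clamp_id K x : `|x| <= K -> clamp K x = x.
Proof.
rewrite ler_norml /clamp => /andP[xK Kx].
by rewrite min_l// max_r.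
Qed.

Lemma clamp_norm K x : 0 <= K -> `|clamp K x| <= K.
Proof.
move=> K0; rewrite /clamp ler_norml le_max lexx/= ge_max ge_min lexx orbT andbT.
lra.
Qed.

Lemma clamp_norm_le K x : 0 <= K -> `|clamp K x| <= `|x|.
Proof.
rewrite /clamp /maxr /minr => K0; case: (ltP x K) => xK; case: ltP => h;
  rewrite !ler_norml; have := ler_norm x; have := ler_norm (- x); rewrite normrN; lra.
Qed.

Lemma clamp_le K x y : x <= y -> clamp K x <= clamp K y.
Proof.
move=> xy; rewrite /clamp /maxr /minr.
by case: (ltP x K) => xK; case: (ltP y K) => yK; case: ltP => h1; case: ltP => h2; lra.
Qed.

Lemma clamp_lip K x y : 0 <= K -> `|clamp K x - clamp K y| <= `|x - y|.
Proof.
wlog xy : x y / y <= x => [hw K0|K0].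
  have [yx|xy] := leP y x; first exact: hw.
  by rewrite distrC (distrC x); apply: hw => //; exact: ltW.
rewrite !ger0_norm ?subr_ge0 ?clamp_le// /clamp /maxr /minr.
by case: (ltP x K) => xK; case: (ltP y K) => yK; case: ltP => h1; case: ltP => h2; lra.
Qed.

Lemma continuous_clamp K : continuous (clamp K).
Proof.
apply: cont_max; first exact: cont_cst.
by apply: cont_min; [exact: cont_id|exact: cont_cst].
Qed.

Lemma geometric_cauchy (u : nat -> R) C : 0 <= C ->
  (forall n, `|u n.+1 - u n| <= C / 2 ^+ n) ->
  exists l, forall n, `|l - u n| <= 2 * C / 2 ^+ n.
Proof.
move=> C0 hu.
have step n m : `|u (n + m)%N - u n| <= 2 * C / 2 ^+ n - 2 * C / 2 ^+ (n + m).
  elim: m => [|m IH]; first by rewrite addn0 !subrr normr0.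
  rewrite addnS -(subrKA (u (n + m)%N)) (le_trans (ler_normD _ _))//.
  rewrite (le_trans (lerD (hu _) IH))// exprS invfM.
  by set z := (2 ^+ (n + m))^-1; set z' := (2 ^+ n)^-1; lra.
have stepm n m : (n <= m)%N -> `|u m - u n| <= 2 * C / 2 ^+ n.
  move=> nm; have := step n (m - n)%N; rewrite subnKC// => /le_trans; apply.
  by rewrite gerBl divr_ge0 ?mulr_ge0// exprn_ge0.
have pw (e : R) : 0 < e -> exists n, 2 * C / 2 ^+ n <= e.
  move=> e0; have Ce : 0 <= 2 * C / e by rewrite divr_ge0 ?mulr_ge0 ?(ltW e0).
  exists (Num.bound (2 * C / e)).
  rewrite ler_pdivrMr ?exprn_gt0// [e * _]mulrC -ler_pdivrMr//.
    apply: (le_trans (ltW (archi_boundP Ce))).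
  by rewrite -natrX ler_nat ltnW// ltn_expl.
have cu : cvgn u.
  apply: cauchy_cvg; apply/cauchyP => e e0.
  have [n hn] := pw (e / 2) (divr_gt0 e0 (ltr0Sn _ _)).
  exists (u n); exists n => // m /= nm.
  rewrite /ball/= distrC (le_lt_trans (stepm _ _ nm))// (le_lt_trans hn)//.
  by rewrite ltr_pdivrMr// ltr_pMr// ltr1n.
exists (lim (u @ \oo)) => n.
have h : (fun m => `|u m - u n|) @ \oo --> `|lim (u @ \oo) - u n|.
  by apply: cvg_norm; apply: cvgB => //; exact: cvg_cst.
rewrite -(cvg_lim _ h)//; apply: limr_le; first by apply/cvg_ex; eexists; exact: h.
by exists n => // m /= nm; exact: stepm.
Qed.

End continuity_helpers.

Section path_comparison.
Context {R : realType}.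
Variables (rho gamma : R).
Hypotheses (rho0 : 0 < rho) (gamma1 : 1 <= gamma).
Implicit Types (s T L eta t u : R) (a w h H : R -> R).
Local Notation mu := (@lebesgue_measure R).
Local Notation I f a b := (\int[mu]_(x in `[a, b]) (f x)).
Local Notation F := (drift rho gamma).
Local Notation c_ := (decay_rate rho gamma).

Let cF : continuous F. Proof. exact: continuous_drift. Qed.

(** Two solutions of a perturbed equation contract down to distance [eta], at a
    rate that the decay of the drift at that distance determines. *)
Lemma perturbed_contraction (D y a r e : R -> R) s T (a0 eta : R) :
  continuous y -> continuous D -> continuous a -> continuous r -> continuous e ->
  s <= T -> 0 <= a0 -> 0 < eta ->
  (forall u, s <= u <= T -> a0 <= a u) ->
  (forall u, s <= u <= T -> `|r u| <= e u) ->
  (forall t, s <= t <= T ->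
    D t = D s + I (fun u => - (a u * (F (y u + D u) - F (y u))) + r u) s t) ->
  `|D T| <= eta + expR (- (a0 * c_ eta * (T - s))) * `|D s| + I e s T.
Proof.
move=> cy cD ca cr ce sT a00 eta0 ha hr hD.
have c0 := decay_rate_gt0 gamma rho0 eta0.
apply: (dissipative_decay _ ce sT hD).
- apply: contD => //; apply: contN; apply: contM => //; apply: contB.
    by apply: cont_comp => //; exact: contD.
  exact: cont_comp.
- by move=> u /hr; exact: le_trans.
- by rewrite mulr_ge0// ltW.
- exact: ltW.
- move=> u suT; have h1 := drift_contract rho0 gamma1 (y u) (D u) eta0.
  have h2 := ha _ suT; have h3 := hr _ suT.
  have h4 : 0 <= D u * (F (y u + D u) - F (y u)).
    apply: le_trans (drift_monotone rho0 gamma1 (y u) (D u)).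
    by rewrite mulr_ge0// drift_ge0// divr_ge0.
  have h5 := ler_wpM2r h4 h2.
  have h6 : D u * r u <= e u * `|D u|.
    by rewrite (le_trans (ler_norm _))// normrM mulrC ler_wpM2r.
  have h7 := ler_wpM2l a00 h1.
  by lra.
Qed.

Definition solves a w H s T :=
  forall t, s <= t <= T -> H t = H s + (w t - w s) - I (fun u => a u * F (H u)) s t.

Lemma solvesS a w H s T s' T' : continuous a -> continuous H ->
  s <= s' -> T' <= T ->
  solves a w H s T -> solves a w H s' T'.
Proof.
move=> ca cH ss' TT' hH t /andP[st tT].
rewrite (hH t) ?(le_trans ss') ?(le_trans tT)//.
rewrite (hH s') ?ss' ?(le_trans st) ?(le_trans tT)//.
rewrite (int_cat _ ss' st); last by apply: contM => //; exact: cont_comp.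
by ring.
Qed.

(** The solution minus its noise satisfies a dissipative equation perturbed by
    the drift along the noise, which starts from [H s]. *)
Lemma window_bound a w H s T (a0 a1 eta : R) : continuous a -> continuous w -> continuous H ->
  s <= T -> 0 <= a0 -> 0 < eta -> (forall u, s <= u <= T -> a0 <= a u <= a1) ->
  solves a w H s T ->
  `|H T| <= `|w T - w s| + eta + expR (- (a0 * c_ eta * (T - s))) * `|H s|
     + a1 * I (fun u => `|F (w u - w s)|) s T.
Proof.
move=> ca cw cH sT a00 eta0 ha hH.
pose y u := w u - w s; pose D u := H u - y u.
have cy : continuous y by apply: contB => //; exact: cont_cst.
have cD : continuous D by exact: contB.
have cFy : continuous (fun u => `|F (y u)|).
  by apply: continuous_norm; exact: cont_comp.
have := @perturbed_contraction D y a (fun u => - (a u * F (y u)))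
  (fun u => a1 * `|F (y u)|) s T a0 eta cy cD ca.
have h1 : continuous (fun u => - (a u * F (y u))).
  by apply: contN; apply: contM => //; exact: cont_comp.
have h2 : continuous (fun u => a1 * `|F (y u)|).
  by apply: contM => //; exact: cont_cst.
move=> /(_ h1 h2 sT a00 eta0).
have h3 u : s <= u <= T -> a0 <= a u by case/ha/andP.
have h4 u : s <= u <= T -> `|- (a u * F (y u))| <= a1 * `|F (y u)|.
  move=> /ha/andP[a0u ua1]; rewrite normrN normrM ler_wpM2r// ger0_norm//.
  exact: le_trans a0u.
move=> /(_ h3 h4); rewrite intZ//.
have Ds : D s = H s by rewrite /D /y subrr subr0.
rewrite Ds.
move=> hD.
have -> : H T = y T + D T by rewrite /D; ring.
rewrite (le_trans (ler_normD _ _))// -!addrA lerD2l !addrA; apply: hD => t stT.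
have cH' : continuous (fun u => a u * F (H u)) by apply: contM => //; exact: cont_comp.
have -> : I (fun u => - (a u * (F (y u + D u) - F (y u))) + - (a u * F (y u))) s t
    = - I (fun u => a u * F (H u)) s t.
  by rewrite -intN//; apply: eq_int => u _; rewrite [y u + _]addrC subrK; ring.
by rewrite /D hH// /y; ring.
Qed.

(** Freezing the coefficient costs at most its distance to 1 times the total
    drift of the frozen solution, and the initial gap is forgotten
    exponentially fast. *)
Lemma solves_dist a w H h L (a0 om eta : R) : continuous a -> continuous H -> continuous h ->
  0 <= L -> 0 <= a0 -> 0 < eta ->
  (forall u, 0 <= u <= L -> a0 <= a u) ->
  (forall u, 0 <= u <= L -> `|1 - a u| <= om) ->
  solves a w H 0 L -> solves (fun=> 1) w h 0 L ->
  `|H L - h L| <= eta + expR (- (a0 * c_ eta * L)) * `|H 0 - h 0|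
     + om * I (fun u => `|F (h u)|) 0 L.
Proof.
move=> ca cH ch L0 a00 eta0 ha hom hH hh.
pose D u := H u - h u.
have cD : continuous D by exact: contB.
have cFh : continuous (fun u => F (h u)) by exact: cont_comp.
have cFH : continuous (fun u => F (H u)) by exact: cont_comp.
have cFn : continuous (fun u => `|F (h u)|) by exact: continuous_norm.
have c1a : continuous (fun u => (1 - a u)) by apply: contB => //; exact: cont_cst.
have cr : continuous (fun u => (1 - a u) * F (h u)) by exact: contM.
have ce : continuous (fun u => om * `|F (h u)|) by apply: contM => //; exact: cont_cst.
have hr u : 0 <= u <= L -> `|(1 - a u) * F (h u)| <= om * `|F (h u)|.
  by move=> /hom h1; rewrite normrM ler_wpM2r.
have := @perturbed_contraction D h a _ _ 0 L a0 eta ch cD ca cr ce L0 a00 eta0 ha hr.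
rewrite intZ// subr0; apply => t tL.
have -> : I (fun u => - (a u * (F (h u + D u) - F (h u))) + (1 - a u) * F (h u)) 0 t
    = I (fun u => 1 * F (h u)) 0 t - I (fun u => a u * F (H u)) 0 t.
  rewrite -intB; first by apply: eq_int => u _; rewrite /D [h u + _]addrC subrK; ring.
  - by apply: contM => //; exact: cont_cst.
  - exact: contM.
have E2 (x y k A B : R) : x + k - A - (y + k - B) = x - y + (B - A) by ring.
by rewrite /D (hH t tL) (hh t tL) E2.
Qed.

(** The drift cannot exceed what it dissipates, so that its integral is
    controlled by the noise and the starting value. *)
Lemma solves_drift_integral w h L : continuous w -> continuous h -> 0 <= L ->
  solves (fun=> 1) w h 0 L ->
  I (fun u => `|F (h u)|) 0 L <=
    4 `^ gamma * (2 * (`|h 0| + 1 + I (fun u => `|F (w u - w 0)|) 0 L) + F (1 / 2) * L)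
    + 2 `^ gamma * I (fun u => `|F (w u - w 0)|) 0 L.
Proof.
move=> cw ch L0 hh.
pose y u := w u - w 0; pose D u := h u - y u.
have cy : continuous y by apply: contB => //; exact: cont_cst.
have cD : continuous D by exact: contB.
have cFh : continuous (fun u => F (h u)) by exact: cont_comp.
have cFy : continuous (fun u => F (y u)) by exact: cont_comp.
have cFn : continuous (fun u => `|F (h u)|) by exact: continuous_norm.
have cFyn : continuous (fun u => `|F (y u)|) by exact: continuous_norm.
have cp : continuous (fun u => F (`|D u| / 2)).
  apply: (cont_comp (f := fun u => `|D u| / 2)) => //.
  by apply: contM; [exact: continuous_norm|exact: cont_cst].
have hD t : 0 <= t <= L -> D t = D 0 + I (fun u => - F (h u)) 0 t.
  move=> tL; rewrite intN// /D /y (hh t)//.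
  have -> : I (fun u => 1 * F (h u)) 0 t = I (fun u => F (h u)) 0 t.
    by apply: eq_int => u _; rewrite mul1r.
  by ring.
have p0 : 0 <= F (1 / 2) by rewrite drift_ge0.
have := @dissipative_integral R D _ _ 0 L (contN cFh) cFyn L0 hD (fun _ _ => normr_ge0 _)
   _ _ cp p0.
have h1 u : 0 <= u <= L -> 0 <= F (`|D u| / 2) by rewrite drift_ge0// divr_ge0.
have h2 u : 0 <= u <= L -> `|D u| < 1 -> F (`|D u| / 2) <= F (1 / 2).
  by move=> _ Du; apply: drift_le => //; lra.
have h3 u : 0 <= u <= L ->
   D u * - F (h u) <= - F (`|D u| / 2) * `|D u| + `|F (y u)| * `|D u|.
  move=> _; have := drift_monotone rho0 gamma1 (y u) (D u).
  rewrite {2}/D [y u + _]addrC subrK => h3.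
  have h4 : - (D u * F (y u)) <= `|F (y u)| * `|D u|.
    by rewrite (le_trans (ler_norm _))// normrN normrM mulrC.
  by lra.
move=> /(_ h1 h2 h3); rewrite subr0.
have -> : D 0 = h 0 by rewrite /D /y subrr subr0.
move=> hp.
have four : 0 <= 4 `^ gamma :> R by exact: powR_ge0.
apply: (@le_trans _ _ (I (fun u => 4 `^ gamma * F (`|D u| / 2) + 2 `^ gamma * `|F (y u)|) 0 L)).
  apply: le_int => //.
    by apply: contD; apply: contM => //; exact: cont_cst.
  move=> u _; have := drift_add_le rho0 gamma1 (D u) (y u).
  by rewrite {1}/D subrK.
rewrite intD; [|by apply: contM => //; exact: cont_cst..].
rewrite (intZ _ _ _ cp) (intZ _ _ _ cFyn).
by apply: lerD; [exact: ler_wpM2l|].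
Qed.

Lemma solves_unique w h h' L : continuous h -> continuous h' -> 0 <= L ->
  solves (fun=> 1) w h 0 L -> solves (fun=> 1) w h' 0 L -> h 0 = h' 0 -> h L = h' L.
Proof.
move=> ch ch' L0 hh hh' h00; apply/eqP; rewrite -subr_eq0 -normr_le0.
apply/ler_addgt0Pr => e e0; rewrite add0r.
have := @solves_dist (fun=> 1) w h h' L 1 0 e (@cont_cst _ 1) ch ch' L0 ler01 e0
  (fun _ _ => lexx _) _ hh hh'.
move=> H; apply: le_trans (H _) _; first by move=> u _; rewrite subrr normr0.
by rewrite h00 subrr normr0 mulr0 mul0r !addr0.
Qed.

Section picard.
Variables (v : R -> R) (h0 L M lam : R) (G : R -> R).
Hypotheses (cv : continuous v) (L0 : 0 <= L) (cG : continuous G).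
Hypotheses (M0 : 0 <= M) (GM : forall x, `|G x| <= M).
Hypotheses (lam0 : 0 <= lam) (Glip : forall x y, `|G x - G y| <= lam * `|x - y|).

Let T (z : R -> R) (t : R) := h0 - I (fun u => G (z u + v u)) 0 t.

Let cT z : continuous z -> continuous (T z).
Proof.
move=> cz; apply: contB; first exact: cont_cst.
by apply: continuous_int; apply: cont_comp => //; exact: contD.
Qed.

Let zz n := iter n T (fun=> h0).

Let czz n : continuous (zz n).
Proof. by elim: n => [|n IH]; [exact: cont_cst|exact: cT]. Qed.

Let E (t : R) := expR (2 * lam * t).

Let dE (x : R) : is_derive x 1 (fun t => E t / 2) (lam * E x).
Proof.
have h3 : is_derive x 1 (fun t => 2 * lam * t) (2 * lam).
  by apply: is_derive_eq; rewrite /GRing.scale/=; ring.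
have h := @is_derive1_comp R expR (fun t => 2 * lam * t) x _ _ (is_derive_expR _) h3.
have h4 := is_deriveM h (is_derive_cst (2^-1 : R) x 1).
by apply: (is_derive_eq h4); rewrite /E /GRing.scale/=; field.
Qed.

Let cE : continuous E.
Proof.
apply: (cont_comp (f := fun t => 2 * lam * t)); last exact: continuous_expR.
by apply: contM; [exact: cont_cst|exact: cont_id].
Qed.

Let iE t : 0 <= t -> I (fun u => lam * E u) 0 t <= E t / 2.
Proof.
move=> t0; have -> : I (fun u => lam * E u) 0 t = E t / 2 - E 0 / 2.
  apply: (FTC2 (F := fun t => E t / 2)) => //.
  by apply: contM => //; exact: cont_cst.
by rewrite gerBl divr_ge0 ?expR_ge0.
Qed.

Let cGz z : continuous z -> continuous (fun u => G (z u + v u)).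
Proof. by move=> cz; apply: cont_comp => //; exact: contD. Qed.

(** The exponential weight turns the Picard map into a contraction of ratio
    1/2 on the whole interval. *)
Let zzS n t : 0 <= t <= L -> `|zz n.+1 t - zz n t| <= M * L * E t / 2 ^+ n.
Proof.
elim: n t => [|n IH] t /andP[t0 tL].
  rewrite /zz /= /T addrAC subrr add0r normrN expr0 divr1.
  have h1 : `|I (fun u => G (h0 + v u)) 0 t| <= M * (t - 0).
    by apply: le_abs_int_cst => //; apply: cGz; exact: cont_cst.
  rewrite subr0 in h1; apply: (le_trans h1); rewrite -mulrA ler_wpM2l//.
  rewrite (le_trans tL)// ler_peMr// -[leLHS]expR0 ler_expR.
  by rewrite !mulr_ge0.
have -> : zz n.+2 t - zz n.+1 t =
    - I (fun u => G (zz n.+1 u + v u) - G (zz n u + v u)) 0 t.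
  by rewrite intB; [rewrite /zz/= /T; ring|exact/cGz|exact/cGz].
rewrite normrN; apply: le_trans (le_abs_int _ _ _) _.
  by apply: contB; exact: cGz.
apply: (@le_trans _ _ (I (fun u => (M * L / 2 ^+ n) * (lam * E u)) 0 t)).
  apply: le_int.
  - by apply: continuous_norm; apply: contB; exact: cGz.
  - by apply: contM; [exact: cont_cst|apply: contM => //; exact: cont_cst].
  move=> u /andP[u0 ut]; apply: (le_trans (Glip _ _)).
  have := IH u; rewrite u0 (le_trans ut tL) => /(_ isT) h1.
  have -> : zz n.+1 u + v u - (zz n u + v u) = zz n.+1 u - zz n u by ring.
  by rewrite (le_trans (ler_wpM2l lam0 h1))//; lra.
rewrite intZ; last by apply: contM => //; exact: cont_cst.
have c0 : 0 <= M * L / 2 ^+ n by rewrite divr_ge0 ?mulr_ge0 ?exprn_ge0.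
rewrite (le_trans (ler_wpM2l c0 (iE t0)))// exprS invfM.
by rewrite le_eqVlt; apply/orP; left; apply/eqP; ring.
Qed.

Let EL t : t <= L -> E t <= E L.
Proof. by move=> tL; rewrite ler_expR ler_wpM2l// mulr_ge0. Qed.

Let zz_lim t : exists l, 0 <= t <= L -> forall n, `|l - zz n t| <= 2 * (M * L * E L) / 2 ^+ n.
Proof.
have [tL|] := boolP (0 <= t <= L); last by exists 0.
have [] := @geometric_cauchy R (fun n => zz n t) (M * L * E L).
- by rewrite !mulr_ge0// expR_ge0.
- move=> n; apply: (le_trans (zzS n tL)).
  rewrite ler_wpM2r ?invr_ge0 ?exprn_ge0// ler_wpM2l ?mulr_ge0// EL//.
  by case/andP: tL.
- by move=> l hl; exists l.
Qed.

Let zl t := projT1 (cid (zz_lim t)).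
Let zlP t : 0 <= t <= L -> forall n, `|zl t - zz n t| <= 2 * (M * L * E L) / 2 ^+ n.
Proof. by rewrite /zl; case: cid. Qed.

Let C := 2 * (M * L * E L).
Let C0 : 0 <= C. Proof. by rewrite !mulr_ge0// expR_ge0. Qed.

Let small (x A : R) : 0 <= A -> (forall n, x <= A / 2 ^+ n) -> x <= 0.
Proof.
move=> A0 hx; apply/ler_addgt0Pr => e e0; rewrite add0r.
have Ae : 0 <= A / e by rewrite divr_ge0// ltW.
apply: (le_trans (hx (Num.bound (A / e)))).
rewrite ler_pdivrMr ?exprn_gt0// [e * _]mulrC -ler_pdivrMr//.
apply: (le_trans (ltW (archi_boundP Ae))).
by rewrite -natrX ler_nat ltnW// ltn_expl.
Qed.

Let zz_lip n s t : 0 <= s -> s <= t -> `|zz n t - zz n s| <= M * (t - s).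
Proof.
move=> s0 st; case: n => [|n]; first by rewrite /zz/= subrr normr0 mulr_ge0// subr_ge0.
have -> : zz n.+1 t - zz n.+1 s = - I (fun u => G (zz n u + v u)) s t.
  rewrite [zz n.+1 t]/(T (zz n) t) [zz n.+1 s]/(T (zz n) s) /T.
  have E2 (x y k : R) : x - (y + k) - (x - y) = - k by ring.
  have cc : continuous (fun u => G (zz n u + v u)) by apply: cGz.
  by rewrite (int_cat cc s0 st) E2.
by rewrite normrN; apply: le_abs_int_cst => //; exact: cGz.
Qed.

Let zl_lip s t : 0 <= s <= L -> 0 <= t <= L -> `|zl t - zl s| <= M * `|t - s|.
Proof.
wlog st : s t / s <= t => [hw sL tL|sL tL].
  have [|ts] := leP s t; first by move=> st; exact: hw.
  by rewrite distrC (distrC t); apply: hw => //; exact: ltW.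
rewrite (ger0_norm (_ : 0 <= t - s)) ?subr_ge0//.
rewrite -subr_le0; apply: (@small _ (2 * C)); first by rewrite mulr_ge0.
move=> n; have h1 := zlP sL n; have h2 := zlP tL n.
have h3 : `|zz n t - zz n s| <= M * (t - s) by apply: zz_lip => //; case/andP: sL.
have -> : zl t - zl s = (zl t - zz n t) + (zz n t - zz n s) - (zl s - zz n s) by ring.
rewrite lerBlDr (le_trans (ler_normB _ _))// (le_trans (lerD (ler_normD _ _) (lexx _)))//.
by rewrite -/C in h1 h2; lra.
Qed.

Let cl t := maxr 0 (minr t L).
Let clP t : 0 <= cl t <= L.
Proof. by rewrite /cl le_max lexx/= ge_max L0 ge_min lexx orbT. Qed.
Let cl_id t : 0 <= t <= L -> cl t = t.
Proof. by case/andP => t0 tL; rewrite /cl min_l// max_r. Qed.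
Let ccl : continuous cl.
Proof.
apply: cont_max; first exact: cont_cst.
by apply: cont_min; [exact: cont_id|exact: cont_cst].
Qed.

Lemma picard_solution : exists z, continuous z /\
  forall t, 0 <= t <= L -> z t = h0 - I (fun u => G (z u + v u)) 0 t.
Proof.
pose z t := zl (cl t).
have cz : continuous z.
  move=> t; apply/cvgrPdist_le => e e0; near=> s.
  apply: (le_trans (zl_lip (clP s) (clP t))).
  have : `|cl t - cl s| <= e / (M + 1).
    near: s; apply: cvgr_dist_le; [exact: ccl|rewrite divr_gt0// ltr_wpDl//].
  rewrite ler_pdivlMr ?ltr_wpDl// => h.
  by rewrite (le_trans _ h)// mulrC ler_wpM2l// lerDl.
exists z; split=> // t tL; apply/eqP; rewrite -subr_eq0 -normr_le0.
case/andP: (tL) => t0 tL'.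
apply: (@small _ (C + lam * C * L)); first by rewrite addr_ge0// mulr_ge0// mulr_ge0.
move=> n.
have -> : z t - (h0 - I (fun u => G (z u + v u)) 0 t) =
   (zl t - zz n.+1 t) + I (fun u => G (z u + v u) - G (zz n u + v u)) 0 t.
  rewrite intB; [|exact: cGz|exact: cGz].
  by rewrite [zz n.+1 t]/(T (zz n) t) /T /z cl_id//; ring.
rewrite (le_trans (ler_normD _ _))// mulrDl lerD//.
  apply: (le_trans (zlP tL _)); rewrite -/C ler_wpM2l// lef_pV2 ?posrE ?exprn_gt0//.
  by rewrite exprS ler_peMl ?exprn_ge0// ler1n.
apply: (@le_trans _ _ ((lam * (C / 2 ^+ n)) * (t - 0))).
  apply: le_abs_int_cst => //; first by apply: contB; exact: cGz.
  move=> u /andP[u0 ut]; apply: (le_trans (Glip _ _)); rewrite ler_wpM2l//.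
  have uL : 0 <= u <= L by rewrite u0 (le_trans ut).
  have -> : z u + v u - (zz n u + v u) = zl u - zz n u by rewrite /z cl_id//; ring.
  exact: zlP.
have c0 : 0 <= lam * C / 2 ^+ n by rewrite divr_ge0 ?exprn_ge0// mulr_ge0.
have := ler_wpM2l c0 tL'; rewrite subr0; lra.
Unshelve. all: by end_near. Qed.

End picard.

(** The truncated equation has a solution by Picard iteration, and monotony of
    the drift keeps it below the truncation level. *)
Lemma exists_solution_itv w (h0 L : R) : continuous w -> 0 <= L ->
  exists h, [/\ continuous h, h 0 = h0 & solves (fun=> 1) w h 0 L].
Proof.
move=> cw L0; pose y u := w u - w 0.
have cy : continuous y by apply: contB => //; exact: cont_cst.
have cFy : continuous (fun u => `|F (y u)|) by apply: continuous_norm; exact: cont_comp.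
have [My My0 hMy] := bounded_continuous 0 L cy.
(* A bound of the solution that is independent of the truncation level. *)
pose K := `|h0| + I (fun u => `|F (y u)|) 0 L + My.
have IFy t : 0 <= t -> 0 <= I (fun u => `|F (y u)|) 0 t by move=> t0; apply: int_ge0.
have K0 : 0 <= K by rewrite !addr_ge0// IFy.
have [lam lam0 Flip] := drift_lipschitz rho0 gamma1 K.
pose G x := F (clamp K x).
have cG : continuous G by apply: cont_comp => //; exact: continuous_clamp.
have GM x : `|G x| <= F K.
  by rewrite norm_drift//; apply: drift_le => //; exact: clamp_norm.
have Glip x x' : `|G x - G x'| <= lam * `|x - x'|.
  apply: (le_trans (Flip _ _ _ _)); [exact: clamp_norm|exact: clamp_norm|].
  by rewrite ler_wpM2l// clamp_lip.
have [z [cz hz]] := picard_solution h0 cy L0 cG (drift_ge0 rho0 gamma1 K0) GM lam0 Glip.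
pose h u := z u + y u.
have ch : continuous h by exact: contD.
have cGh : continuous (fun u => G (z u + y u)) by exact: cont_comp.
have z0 : z 0 = h0 by rewrite hz ?lexx// int_pt subr0.
have zb t : 0 <= t <= L -> `|z t| <= `|h0| + I (fun u => `|F (y u)|) 0 L.
  move=> /andP[t0 tL].
  have hD s : 0 <= s <= t -> z s = z 0 + I (fun u => - G (z u + y u)) 0 s.
    by move=> /andP[s0 st]; rewrite intN// z0 hz// s0 (le_trans st).
  have := @dissipative_decay R z _ _ 0 t (contN cGh) cFy t0 hD (fun _ _ => normr_ge0 _)
    0 0 (lexx _) (lexx _) _.
  have hz0 u : 0 <= u <= t -> z u * - G (z u + y u) <=
      - 0 * z u ^+ 2 + (0 * 0 + `|F (y u)|) * `|z u|.
    move=> _; rewrite oppr0 !mul0r !add0r.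
    have Gy : `|G (y u)| <= `|F (y u)|.
      by rewrite !norm_drift//; apply: drift_le => //; rewrite clamp_norm_le.
    have zG : 0 <= z u * (G (z u + y u) - G (y u)).
      have [zu|zu] := leP 0 (z u).
        by rewrite mulr_ge0// subr_ge0; apply: drift_le => //; apply: clamp_le; rewrite lerDr.
      rewrite mulr_le0 ?(ltW zu)// subr_le0; apply: drift_le => //; apply: clamp_le.
      by rewrite gerDr ltW.
    have : - (z u * G (y u)) <= `|F (y u)| * `|z u|.
      by rewrite (le_trans (ler_norm _))// normrN normrM mulrC ler_wpM2r.
    by lra.
  move=> /(_ hz0); rewrite add0r mul0r oppr0 expR0 mul1r z0 => /le_trans; apply.
  by rewrite lerD2l (int_cat cFy t0 tL) lerDl int_ge0.
have hb u : 0 <= u <= L -> `|h u| <= K.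
  by move=> uL; rewrite (le_trans (ler_normD _ _))// lerD// ?zb// hMy.
exists h; split=> //; first by rewrite /h z0 /y subrr addr0.
move=> t tL; rewrite /h hz// {1}/y {2}/y subrr addr0 z0.
have -> : I (fun u => 1 * F (z u + y u)) 0 t = I (fun u => G (z u + y u)) 0 t.
  apply: eq_int => u /andP[u0 ut]; rewrite mul1r /G clamp_id//.
  by apply: hb; rewrite u0 (le_trans ut)//; case/andP: tL.
by rewrite /y; ring.
Qed.

Lemma exists_solution w (h0 : R) : continuous w ->
  exists h, [/\ continuous h, h 0 = h0 & forall L, solves (fun=> 1) w h 0 L].
Proof.
move=> cw.
have ex n := exists_solution_itv h0 cw (ler0n R n).
pose hn n := projT1 (cid (ex n)).
have hnP n : [/\ continuous (hn n), hn n 0 = h0 & solves (fun=> 1) w (hn n) 0 n%:R].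
  by rewrite /hn; case: cid.
pose h t := hn (truncn (maxr 0 t)).+1 (maxr 0 t).
have hE m t : 0 <= t <= m%:R -> h t = hn m t.
  move=> /andP[t0 tm]; rewrite /h max_r//.
  have [c1 e1 s1] := hnP m; have [c2 e2 s2] := hnP (truncn t).+1.
  apply: (@solves_unique w _ _ t) => //; last by rewrite e1.
  - apply: (solvesS _ c2 (lexx 0) _ s2); first exact: cont_cst.
    by rewrite ltW// truncnS_gt.
  - by apply: (solvesS _ c1 (lexx 0) tm s1); exact: cont_cst.
have h00 : h 0 = h0 by rewrite (hE 0%N) ?lexx//; case: (hnP 0%N).
have hmax t : h t = h (maxr 0 t).
  by rewrite /h; congr (hn (truncn _).+1 _); rewrite (@max_r _ _ 0 (maxr 0 t))// le_max lexx.
have ch : continuous h.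
  move=> t; pose m := (truncn (maxr 0 t + 1)).+1.
  have cm : continuous (fun t => hn m (maxr 0 t)).
    apply: (cont_comp (f := fun t => maxr 0 t)); last by case: (hnP m).
    by apply: cont_max; [exact: cont_cst|exact: cont_id].
  have key s : s <= t + 1 -> h s = hn m (maxr 0 s).
    move=> st; rewrite hmax; apply: hE; rewrite le_max lexx/=.
    rewrite (@le_trans _ _ (maxr 0 t + 1))//; last by rewrite ltW// truncnS_gt.
    by rewrite ge_max addr_ge0 ?le_max ?lexx//= (le_trans st)// lerD2r le_max lexx orbT.
  rewrite /continuous_at key ?lerDl//.
  apply: cvg_trans (cm t); apply: near_eq_cvg; near=> s.
  rewrite key//; have : `|t - s| <= 1 by near: s; apply: cvgr_dist_le => //; exact: cvg_id.
  by rewrite ler_norml; lra.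
exists h; split=> // L t /andP[t0 tL].
pose m := (truncn t).+1.
have tm : t <= m%:R by rewrite ltW// truncnS_gt.
have [c e s] := hnP m.
have tm' : 0 <= t <= m%:R by rewrite t0.
rewrite (hE m t tm') (s t tm') h00 e; apply: (congr1 (fun x => _ - x)).
by apply: eq_int => u /andP[u0 ut]; rewrite (hE m)// u0 (le_trans ut).
Unshelve. all: by end_near. Qed.

End path_comparison.

(** * The implicit Euler scheme *)

Section implicit_euler.
Context {R : realType}.
Variables (rho gamma : R).
Hypotheses (rho0 : 0 < rho) (gamma1 : 1 <= gamma).
Implicit Types (x y L d : R) (w h : R -> R).
Local Notation mu := (@lebesgue_measure R).
Local Notation I f a b := (\int[mu]_(x in `[a, b]) (f x)).
Local Notation F := (drift rho gamma).

Lemma resolvent_ex d x : exists y, 0 <= d -> y + d * F y = x.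
Proof.
have [d0|] := leP 0 d; last by exists 0.
pose g y := y + d * F y.
have cg : continuous g.
  apply: contD; first exact: cont_id.
  by apply: contM; [exact: cont_cst|exact: continuous_drift].
have le1 : g (- `|x|) <= x.
  rewrite /g driftN.
  have := mulr_ge0 d0 (drift_ge0 rho0 gamma1 (normr_ge0 x)).
  have := ler_norm (- x); rewrite normrN; lra.
have le2 : x <= g `|x|.
  rewrite /g; have := mulr_ge0 d0 (drift_ge0 rho0 gamma1 (normr_ge0 x)).
  by have := ler_norm x; lra.
have xx : - `|x| <= `|x| by rewrite ge0_cp.
have [||y _ <-] := @IVT R g _ _ x xx.
- exact: continuous_subspaceT.
- by rewrite ge_min le1/= le_max le2 orbT.
- by exists y.
Qed.

(** One implicit step; unlike an explicit one it is nonexpansive, although the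
    drift is not globally Lipschitz. *)
Definition resolvent d x := projT1 (cid (resolvent_ex d x)).

Lemma resolventP d x : 0 <= d -> resolvent d x + d * F (resolvent d x) = x.
Proof. by rewrite /resolvent; case: cid. Qed.

(** The nonexpansiveness that makes the errors of the scheme add up only. *)
Lemma resolvent_dist d y y' : 0 <= d ->
  `|y - y'| <= `|(y + d * F y) - (y' + d * F y')|.
Proof.
move=> d0; wlog yy : y y' / y' <= y => [hw|].
  have [|yy] := leP y' y; first exact: hw.
  by rewrite distrC (distrC (y + _)); apply: hw; exact: ltW.
have FF := drift_le rho0 gamma1 yy.
have dFF := ler_wpM2l d0 FF.
by rewrite !ger0_norm; lra.
Qed.

Lemma resolvent_lip d x x' : 0 <= d -> `|resolvent d x - resolvent d x'| <= `|x - x'|.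
Proof. by move=> d0; have := @resolvent_dist d (resolvent d x) (resolvent d x') d0; rewrite !resolventP. Qed.

Lemma continuous_resolvent d : 0 <= d -> continuous (resolvent d).
Proof.
move=> d0 x; apply/cvgrPdist_le => e e0; near=> y.
by apply: (le_trans (resolvent_lip _ _ d0)); near: y; apply: cvgr_dist_le => //; exact: cvg_id.
Unshelve. all: by end_near. Qed.

Definition euler d (h0 : R) (u : seq R) := foldl (fun e x => resolvent d (e + Num.sqrt d * x)) h0 u.

Definition scaled_increments w d n :=
  mkseq (fun k => (w (k.+1%:R * d) - w (k%:R * d)) / Num.sqrt d) n.

(** The error made in one step is an oscillation of the drift along the
    solution; by nonexpansiveness the errors of all steps just add up. *)
Lemma euler_error w h d n (e : R) : continuous h -> 0 < d ->
  solves rho gamma (fun=> 1) w h 0 (n%:R * d) ->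
  (forall k v, (k < n)%N -> k%:R * d <= v <= k.+1%:R * d ->
    `|F (h (k.+1%:R * d)) - F (h v)| <= e) ->
  `|h (n%:R * d) - euler d (h 0) (scaled_increments w d n)| <= n%:R * d * e.
Proof.
move=> ch d0 hh he.
have cFh : continuous (fun u => F (h u)).
  by apply: cont_comp => //; exact: continuous_drift.
elim: n hh he => [|n IH] hh he; first by rewrite !mul0r subrr normr0.
have nn1 : n%:R * d <= n.+1%:R * d by rewrite ler_wpM2r ?(ltW d0)// ler_nat.
have {}IH := IH (solvesS rho0 gamma1 (@cont_cst R 1) ch (lexx 0) nn1 hh)
  (fun k v kn => he k v (ltnW kn)).
rewrite {1}/scaled_increments mkseqS /euler foldl_rcons.
rewrite -/(scaled_increments w d n) -/(euler _ _ _).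
set E := euler _ _ _ in IH *.
have sd : Num.sqrt d != 0 by rewrite gt_eqF// sqrtr_gt0.
rewrite [Num.sqrt d * _]mulrC divfK//.
set dw := w _ - w _; set x := E + dw.
have nd0 : 0 <= n%:R * d by rewrite mulr_ge0// ltW.
have hs : h (n.+1%:R * d) = h (n%:R * d) + dw - I (fun u => F (h u)) (n%:R * d) (n.+1%:R * d).
  have := solvesS rho0 gamma1 (@cont_cst R 1) ch nd0 (lexx _) hh.
  move=> /(_ (n.+1%:R * d)); rewrite nn1 lexx => /(_ isT) ->.
  by apply: (congr1 (fun z => _ - z)); apply: eq_int => v _; rewrite mul1r.
have hr := @resolvent_dist d (h (n.+1%:R * d)) (resolvent d x) (ltW d0).
apply: (le_trans hr); rewrite resolventP ?(ltW d0)//.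
have -> : h (n.+1%:R * d) + d * F (h (n.+1%:R * d)) - x =
   (h (n%:R * d) - E) + (F (h (n.+1%:R * d)) * d - I (fun u => F (h u)) (n%:R * d) (n.+1%:R * d)).
  rewrite {1}hs /x.
  have E2 (a b c k i : R) : a + b - i + c - (k + b) = (a - k) + (c - i) by ring.
  by rewrite E2 [F _ * d]mulrC.
rewrite (le_trans (ler_normD _ _))//.
have -> : n.+1%:R * d * e = n%:R * d * e + e * d by rewrite -natr1; ring.
rewrite lerD//.
have dE : n.+1%:R * d - n%:R * d = d by rewrite -natr1; ring.
set A := F (h (n.+1%:R * d)).
have -> : A * d = I (fun=> A) (n%:R * d) (n.+1%:R * d) by rewrite int_cst// dE.
rewrite -[e * d](congr1 (fun z => e * z) dE) -intB//; last exact: cont_cst.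
apply: le_abs_int_cst => //.
  by apply: contB => //; exact: cont_cst.
by move=> v hv; exact: he.
Qed.

Lemma cvg_euler w h L : continuous h -> 0 < L -> solves rho gamma (fun=> 1) w h 0 L ->
  (fun n => euler (L / n.+1%:R) (h 0) (scaled_increments w (L / n.+1%:R) n.+1)) @ \oo
    --> h L.
Proof.
move=> ch L0 hh.
have cFh : continuous (fun u => F (h u)).
  by apply: cont_comp => //; exact: continuous_drift.
apply: cvg_nat_eps => e e0.
have [d d0 hd] := heine 0 L cFh (divr_gt0 e0 L0).
have [N hN] := mesh_small L d0.
exists N => n /hN nd; set dn := L / _ in nd *.
have dn0 : 0 < dn by rewrite divr_gt0.
have Ln : n.+1%:R * dn = L by rewrite /dn; field.
have := @euler_error w h dn n.+1 (e / L) ch dn0.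
rewrite Ln => /(_ hh); rewrite mulrCA divff ?gt_eqF// mulr1; apply.
move=> k v kn /andP[v1 v2].
have kL : k.+1%:R * dn <= L by rewrite -[leRHS]Ln ler_wpM2r ?(ltW dn0)// ler_nat.
have k0 : 0 <= k%:R * dn by rewrite mulr_ge0// ltW.
apply: hd.
- by rewrite kL mulr_ge0// ltW.
- by rewrite (le_trans k0 v1) (le_trans v2).
- rewrite ger0_norm ?subr_ge0// (le_trans _ nd)//.
  by move: v1; rewrite -natr1; lra.
Qed.

End implicit_euler.

(** * Trigonometric Bernstein approximation *)

Section bernstein.
Context {R : realType}.
Implicit Types (x d e M : R).

Definition bernstein m k (s : R) : R := 'C(m, k)%:R * s ^+ k * (1 - s) ^+ (m - k).

Lemma bernstein_ge0 m k (s : R) : 0 <= s <= 1 -> 0 <= bernstein m k s.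
Proof.
by move=> /andP[s0 s1]; rewrite !mulr_ge0// exprn_ge0// subr_ge0.
Qed.

(** Pascal's rule, in the form of one more coin toss: this yields the moments
    of the binomial law by induction. *)
Lemma bernstein_rec m (s : R) (h : nat -> R) :
  \sum_(k < m.+2) bernstein m.+1 k s * h k =
  (1 - s) * (\sum_(k < m.+1) bernstein m k s * h k) +
  s * (\sum_(k < m.+1) bernstein m k s * h k.+1).
Proof.
have b0 : bernstein m.+1 0 s = (1 - s) * bernstein m 0 s.
  by rewrite /bernstein !bin0 !expr0 !subn0 exprS; ring.
have bS k : (k < m.+1)%N -> bernstein m.+1 k.+1 s =
    (1 - s) * bernstein m k.+1 s + s * bernstein m k s.
  rewrite ltnS => km; rewrite /bernstein binS subSS natrD.
  move: km; rewrite leq_eqVlt => /predU1P[->|km].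
    by rewrite bin_small// subnn !expr0 exprS; ring.
  by rewrite -(subnSK km) !exprS; ring.
rewrite big_ord_recl/= b0.
have -> : \sum_(i < m.+1) bernstein m.+1 (bump 0 i) s * h (bump 0 i) =
   \sum_(i < m.+1) ((1 - s) * (bernstein m i.+1 s * h i.+1) + s * (bernstein m i s * h i.+1)).
  by apply: eq_bigr => i _; rewrite /bump/= add1n bS//; ring.
rewrite big_split/= -!mulr_sumr addrA; congr (_ + _).
rewrite -mulrA -mulrDr; congr (_ * _).
rewrite big_ord_recr/= {3}/bernstein bin_small// mul0r !mul0r addr0.
by rewrite big_ord_recl.
Qed.

Lemma bernstein_sum m (s : R) : \sum_(k < m.+1) bernstein m k s = 1.
Proof.
elim: m => [|m IH]; first by rewrite big_ord1 /bernstein bin0 !expr0; ring.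
have := bernstein_rec m s (fun=> 1).
under eq_bigr do rewrite mulr1.
by move=> ->; under eq_bigr do rewrite mulr1; rewrite IH; ring.
Qed.

Lemma bernstein_variance m (s : R) :
  \sum_(k < m.+1) bernstein m k s * (k%:R - m%:R * s) ^+ 2 = m%:R * (s * (1 - s)).
Proof.
elim: m => [|m IH]; first by rewrite big_ord1 /=; ring.
rewrite (bernstein_rec m s (fun k => (k%:R - m.+1%:R * s) ^+ 2)) !mulr_sumr -big_split/=.
have -> : m.+1%:R * (s * (1 - s)) = m%:R * (s * (1 - s)) + 1 * (s * (1 - s)).
  by rewrite -natr1; ring.
rewrite -IH -[X in _ = _ + X * _](bernstein_sum m s) mulr_suml -big_split/=.
by apply: eq_bigr => k _; rewrite -!natr1; ring.
Qed.

Section several_variables.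
Variables (n : nat) (m : nat).

Definition bernstein_prod (k : {ffun 'I_n -> 'I_m.+1}) (s : 'I_n -> R) :=
  \prod_(i < n) bernstein m (k i) (s i).

Lemma bernstein_prod_ge0 k s : (forall i, 0 <= s i <= 1) -> 0 <= bernstein_prod k s.
Proof. by move=> hs; apply: prodr_ge0 => i _; exact: bernstein_ge0. Qed.

Lemma bernstein_prod_sum s : \sum_k bernstein_prod k s = 1.
Proof.
rewrite -(bigA_distr_bigA (fun i j => bernstein m (nat_of_ord j) (s i))).
by apply: big1 => i _; rewrite bernstein_sum.
Qed.

Lemma bernstein_prod_marginal (s : 'I_n -> R) (i : 'I_n) (g : nat -> R) :
  \sum_k bernstein_prod k s * g (k i) = \sum_(j < m.+1) bernstein m j (s i) * g j.
Proof.
pose F i' (j : 'I_m.+1) := bernstein m j (s i') * (if i' == i then g j else 1).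
have -> : \sum_k bernstein_prod k s * g (k i) =
   \sum_(k : {ffun 'I_n -> 'I_m.+1}) \prod_i' F i' (k i').
  apply: eq_bigr => k _; rewrite /F big_split/=; congr (_ * _).
  by rewrite -big_mkcond/= big_pred1_eq.
rewrite -bigA_distr_bigA (bigD1 i)//= [X in _ * X]big1 ?mulr1.
  by apply: eq_bigr => j _; rewrite /F eqxx.
move=> i' /negbTE i'i; rewrite /F i'i.
by under eq_bigr do rewrite mulr1; exact: bernstein_sum.
Qed.

(** Chebyshev's inequality for the weights controls the nodes far from [s]. *)
Lemma bernstein_approx (g : ('I_n -> R) -> R) (s : 'I_n -> R) (d e C : R) :
  (0 < m)%N -> 0 < d -> 0 <= e -> (forall i, 0 <= s i <= 1) ->
  (forall y, `|g y| <= C) ->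
  (forall y, (forall i, 0 <= y i <= 1) -> (forall i, `|y i - s i| <= d) -> `|g y - g s| <= e) ->
  `|\sum_k bernstein_prod k s * g (fun i => (k i)%:R / m%:R) - g s|
    <= e + 2 * C * (n%:R / (m%:R * d ^+ 2)).
Proof.
move=> m0 d0 e0 hs gC hg.
have mR : 0 < m%:R :> R by rewrite ltr0n.
have C0 : 0 <= C by rewrite (le_trans (normr_ge0 (g s))).
pose nd (k : {ffun 'I_n -> 'I_m.+1}) (i : 'I_n) : R := (k i)%:R / m%:R.
have nd01 k i : 0 <= nd k i <= 1.
  by rewrite /nd divr_ge0//= ler_pdivrMr// mul1r ler_nat -ltnS ltn_ord.
have -> : \sum_k bernstein_prod k s * g (fun i => (k i)%:R / m%:R) - g s =
   \sum_k bernstein_prod k s * (g (nd k) - g s).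
  under [RHS]eq_bigr do rewrite mulrBr.
  by rewrite sumrB -mulr_suml bernstein_prod_sum mul1r.
apply: (le_trans (ler_norm_sum _ _ _)).
apply: (@le_trans _ _ (\sum_k bernstein_prod k s *
   (e + 2 * C * \sum_i ((nd k i - s i) ^+ 2 / d ^+ 2)))).
  apply: ler_sum => k _; rewrite normrM ger0_norm ?bernstein_prod_ge0//.
  rewrite ler_wpM2l ?bernstein_prod_ge0//.
  have sum0 : 0 <= \sum_i ((nd k i - s i) ^+ 2 / d ^+ 2).
    by apply: sumr_ge0 => i _; rewrite divr_ge0 ?sqr_ge0.
  have [/forallP hk|] := boolP [forall i, `|nd k i - s i| <= d].
    by rewrite (le_trans (hg _ _ hk))// lerDl mulr_ge0// mulr_ge0.
  rewrite negb_forall => /existsP[i]; rewrite -ltNge => hi.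
  apply: (@le_trans _ _ (2 * C)).
    rewrite (le_trans (ler_normB _ _))// mulr2n mulrDl mul1r lerD//.
  rewrite (@le_trans _ _ (2 * C * \sum_i ((nd k i - s i) ^+ 2 / d ^+ 2)))//; last by rewrite lerDr.
  rewrite ler_peMr ?mulr_ge0// (bigD1 i)//= ler_wpDr//.
    by apply: sumr_ge0 => j _; rewrite divr_ge0 ?sqr_ge0.
  rewrite ler_pdivlMr ?exprn_gt0// mul1r -[leRHS]real_normK ?num_real//.
  by rewrite ler_sqr ?nnegrE ?(ltW d0) ?(ltW hi).
have -> : \sum_k bernstein_prod k s * (e + 2 * C * \sum_i ((nd k i - s i) ^+ 2 / d ^+ 2)) =
   e + 2 * C * \sum_i \sum_k bernstein_prod k s * ((nd k i - s i) ^+ 2 / d ^+ 2).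
  under eq_bigr do rewrite mulrDr.
  rewrite big_split/= -mulr_suml bernstein_prod_sum mul1r; congr (_ + _).
  rewrite exchange_big/= mulr_sumr; apply: eq_bigr => k _.
  by rewrite mulrCA !mulr_sumr.
rewrite lerD2l ler_wpM2l ?mulr_ge0//.
have -> : n%:R / (m%:R * d ^+ 2) = \sum_(i < n) (m%:R * d ^+ 2)^-1.
  by rewrite sumr_const card_ord mulr_natl.
apply: ler_sum => i _.
rewrite (@bernstein_prod_marginal s i (fun j => (j%:R / m%:R - s i) ^+ 2 / d ^+ 2)).
have -> : \sum_(j < m.+1) bernstein m j (s i) * ((j%:R / m%:R - s i) ^+ 2 / d ^+ 2) =
   (\sum_(j < m.+1) bernstein m j (s i) * (j%:R - m%:R * s i) ^+ 2) / (m%:R ^+ 2 * d ^+ 2).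
  rewrite mulr_suml; apply: eq_bigr => j _; field.
  by rewrite !gt_eqF.
rewrite bernstein_variance.
have -> : m%:R * (s i * (1 - s i)) / (m%:R ^+ 2 * d ^+ 2) = s i * (1 - s i) * (m%:R * d ^+ 2)^-1.
  by field; rewrite !gt_eqF.
have md : 0 <= (m%:R * d ^+ 2)^-1 by rewrite invr_ge0 mulr_ge0// sqr_ge0.
rewrite ler_piMl//.
have /andP[s0 s1] := hs i.
by rewrite mulr_ile1// ?subr_ge0// gerBl.
Qed.

End several_variables.
End bernstein.

Section trigonometric_approximation.
Context {R : realType}.
Implicit Types (x y d e M : R).

Lemma sin_le x y : - (1 / 2) <= x -> x <= y -> y <= 1 / 2 -> sin x <= sin y :> R.
Proof.
move=> x1 xy y1; rewrite -lerN2.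
have h1 t : x <= t <= y -> is_derive t 1 (fun t => - sin t) (- cos t).
  by move=> _; exact: is_deriveN.
apply: (@derive_le0_decr R (fun t => - sin t) (fun t => - cos t) x y xy h1) => t /andP[xt ty].
rewrite oppr_le0 cos_ge0_pihalf//; have := @pihalf_ge1 R; lra.
Qed.

(** For [x] in [[-M, M]] the angle [x / (2 * M)] stays in [[-1/2, 1/2]], where
    the sine is injective. *)
Definition sigma_max : R := sin (1 / 2).

Lemma sigma_max_lt1 : 0 < sigma_max < 1.
Proof.
have p := @pihalf_ge1 R.
have s0 : 0 < sigma_max by apply: sin_gt0_pihalf; apply/andP; split; lra.
rewrite s0/=.
have c0 : 0 < cos (1 / 2 : R) by apply: cos_gt0_pihalf; apply/andP; split; lra.
have := cos2Dsin2 (1 / 2 : R); rewrite -/sigma_max => h.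
have c2 : 0 < cos (1 / 2 : R) ^+ 2 by rewrite exprn_gt0.
rewrite -(@ltr_pXn2r _ 2)// ?nnegrE ?ltW// expr1n; lra.
Qed.

(** The periodic map sending the line to [[0, 1]] in which the Bernstein
    weights become trigonometric polynomials; it is injective on [[-M, M]]. *)
Definition to_unit M x : R := (1 + sin (x / (2 * M))) / 2.
Definition of_unit M (s : R) : R := 2 * M * asin (clamp sigma_max (2 * s - 1)).

Lemma to_unit01 M x : 0 <= to_unit M x <= 1.
Proof.
have h1 := sin_geN1 (x / (2 * M)); have h2 := sin_le1 (x / (2 * M)).
by rewrite /to_unit; apply/andP; split; lra.
Qed.

Lemma to_unitK M x : 0 < M -> `|x| <= M -> of_unit M (to_unit M x) = x.
Proof.
move=> M0; rewrite ler_norml => /andP[x1 x2].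
have M2 : 0 < 2 * M by rewrite mulr_gt0.
have y1 : - (1 / 2) <= x / (2 * M) by rewrite ler_pdivlMr//; lra.
have y2 : x / (2 * M) <= 1 / 2 by rewrite ler_pdivrMr//; lra.
rewrite /of_unit /to_unit.
have -> : 2 * ((1 + sin (x / (2 * M))) / 2) - 1 = sin (x / (2 * M)) by field.
rewrite clamp_id; last first.
  rewrite ler_norml /sigma_max -sinN !sin_le//; lra.
rewrite sinK; first by rewrite mulrC divfK// gt_eqF.
have := @pihalf_ge1 R => p; rewrite in_itv/=; apply/andP; split; lra.
Qed.

Lemma continuous_of_unit M : continuous (of_unit M).
Proof.
have /andP[s0 s1] := sigma_max_lt1.
apply: contM; first exact: cont_cst.
have cc : continuous (fun s : R => clamp sigma_max (2 * s - 1)).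
  apply: (cont_comp (f := fun s => 2 * s - 1)); last exact: continuous_clamp.
  by apply: contB; [apply: contM; [exact: cont_cst|exact: cont_id]|exact: cont_cst].
move=> s; apply: (@continuous_comp _ _ _ (fun s : R => clamp sigma_max (2 * s - 1)) (@asin R)).
  exact: cc.
apply: continuous_asin.
have := @clamp_norm R sigma_max (2 * s - 1) (ltW s0).
by rewrite ler_norml => /andP[h1 h2]; apply/andP; split; lra.
Qed.

Lemma heine_row n (f : 'rV[R]_n -> R) (K e : R) : continuous f -> 0 < e ->
  exists2 d, 0 < d & forall x y : 'rV[R]_n,
    (forall i, `|x ord0 i| <= K) -> (forall i, `|x ord0 i - y ord0 i| <= d) ->
    `|f x - f y| <= e.
Proof.
move=> cf e0.
pose B := [set v : 'rV[R]_n | forall i, `[(- K), K]%classic (v ord0 i)].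
have cB : compact B by apply: (@rV_compact _ _ (fun=> `[(- K), K]%classic)) => i; exact: segment_compact.
have := (compact_near_coveringP B).1 cB R (0^'+)
  (fun d (x : 'rV[R]_n) => forall y : 'rV[R]_n,
    (forall i, `|x ord0 i - y ord0 i| <= d) -> `|f x - f y| <= e) _.
case.
  move=> x _; have /cvgrPdist_lt/(_ (e / 2)) := cf x.
  rewrite divr_gt0// => /(_ isT)/nbhs_ballP[r /= r0 hr].
  exists (ball x (r / 2), [set d | 0 < d < r / 2]).
    split; first by apply: nbhsx_ballx; rewrite divr_gt0.
    have := @nbhs_right_lt R 0 (r / 2); rewrite divr_gt0// => /(_ isT) H.
    by near=> d; apply/andP; split; near: d; [exact: nbhs_right_gt|exact: H].
  move=> [z d]/= [[_ xz] /andP[d0 dr]] y zy.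
  have {}xz i : `|x ord0 i - z ord0 i| < r / 2 by exact: xz.
  have h1 : `|f x - f z| < e / 2.
    apply: hr; split => // i j; rewrite ord1 /ball/=.
    by rewrite (lt_trans (xz j))// ltr_pdivrMr// ltr_pMr// ltr1n.
  have h2 : `|f x - f y| < e / 2.
    apply: hr; split => // i j; rewrite ord1 /ball/= -(subrKA (z ord0 j)).
    rewrite (le_lt_trans (ler_normD _ _))//.
    by have := xz j; have := zy j; lra.
  have -> : f z - f y = (f x - f y) - (f x - f z) by ring.
  by rewrite (le_trans (ler_normB _ _))//; lra.
move=> d /= d0 hd.
exists (d / 2); first by rewrite divr_gt0.
move=> x y xK xy; apply: (hd (d / 2)) => //=.
- by rewrite sub0r normrN gtr0_norm ?divr_gt0// ltr_pdivrMr// ltr_pMr// ltr1n.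
- by rewrite divr_gt0.
- by move=> i; rewrite /= in_itv/= -ler_norml.
Unshelve. all: by end_near. Qed.

Definition trig_weight (m k : nat) M x : R := bernstein m k (to_unit M x).

Lemma trig_weight_ge0 m k M x : 0 <= trig_weight m k M x.
Proof. by apply: bernstein_ge0; exact: to_unit01. Qed.

(** In the coordinates [to_unit] these are Bernstein polynomials. The weights
    form a convex combination everywhere, so that the bound of [f] survives
    also outside the box. *)
Lemma trig_approx n (f : 'rV[R]_n -> R) (C M e : R) : continuous f ->
  (forall x : 'rV[R]_n, `|f x| <= C) -> 0 < M -> 0 < e ->
  exists m (c : {ffun 'I_n -> 'I_m.+1} -> R),
    (forall x : 'I_n -> R, `|\sum_k c k * \prod_i trig_weight m (k i) M (x i)| <= C) /\
    (forall x : 'I_n -> R, (forall i, `|x i| <= M) ->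
      `|\sum_k c k * \prod_i trig_weight m (k i) M (x i) - f (\row_i x i)| <= e).
Proof.
move=> cf fC M0 e0.
have [K K0 hK] := bounded_continuous 0 1 (@continuous_of_unit M).
have [d1 d10 hd1] := heine_row K cf (divr_gt0 e0 (ltr0Sn _ 1)).
have [d d0 hd] := heine 0 1 (@continuous_of_unit M) d10.
have C0 : 0 <= C by rewrite (le_trans (normr_ge0 (f 0))).
pose A := 2 * C * n%:R / d ^+ 2.
have [N hN] := mesh_small A (divr_gt0 e0 (ltr0Sn R 1)).
pose m := N.+1.
pose g (s : 'I_n -> R) := f (\row_i of_unit M (s i)).
exists m, (fun k : {ffun 'I_n -> 'I_m.+1} => g (fun i => (k i)%:R / m%:R)).
have W0 (x : 'I_n -> R) (k : {ffun 'I_n -> 'I_m.+1}) : 0 <= \prod_i trig_weight m (k i) M (x i).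
  by apply: prodr_ge0 => i _; exact: trig_weight_ge0.
have W1 (x : 'I_n -> R) :
    \sum_(k : {ffun 'I_n -> 'I_m.+1}) \prod_i trig_weight m (k i) M (x i) = 1.
  exact: (@bernstein_prod_sum R n m (fun i => to_unit M (x i))).
split=> [x|x xM].
  apply: (le_trans (ler_norm_sum _ _ _)).
  apply: (@le_trans _ _ (\sum_(k : {ffun 'I_n -> 'I_m.+1})
    C * \prod_i trig_weight m (k i) M (x i))).
    apply: ler_sum => k _; rewrite normrM (ger0_norm (W0 x k)).
    by apply: ler_wpM2r; [exact: W0|exact: fC].
  by rewrite -mulr_sumr W1 mulr1.
have fx : f (\row_i x i) = g (fun i => to_unit M (x i)).
  by congr f; apply/rowP => i; rewrite !mxE to_unitK.
have := @bernstein_approx R n m g (fun i => to_unit M (x i)) d (e / 2) C isT d0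
   (ltW (divr_gt0 e0 (ltr0Sn _ 1))) (fun i => to_unit01 M (x i)) (fun y : 'I_n -> R => fC _).
rewrite -fx.
have -> : \sum_(k : {ffun 'I_n -> 'I_m.+1}) bernstein_prod k (fun i => to_unit M (x i)) *
      g (fun i => (k i)%:R / m%:R) =
    \sum_(k : {ffun 'I_n -> 'I_m.+1}) g (fun i => (k i)%:R / m%:R) *
      \prod_i trig_weight m (k i) M (x i).
  by apply: eq_bigr => k _; rewrite mulrC.
move=> H; apply: (le_trans (H _)).
  move=> y y01 yx; rewrite distrC fx; apply: hd1 => i; rewrite !mxE.
    exact: hK (to_unit01 _ _).
  rewrite distrC; apply: hd; [exact: y01|exact: to_unit01|exact: yx].
have -> : 2 * C * (n%:R / (m%:R * d ^+ 2)) = A / N.+1%:R.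
  by rewrite /A /m invfM; ring.
by rewrite [leRHS](splitr e) lerD2l; exact: hN.
Qed.

End trigonometric_approximation.

(** * A criterion for convergence in law *)

Lemma cvg_sumR (R : realType) (U : Type) (F : set_system U) (I : finType) (f : I -> U -> R)
    (l : I -> R) : Filter F -> (forall i, f i x @[x --> F] --> l i) ->
  \sum_i f i x @[x --> F] --> \sum_i l i.
Proof.
move=> FF h; elim: (index_enum I) => [|i s IH].
  by rewrite big_nil; under eq_fun do rewrite big_nil; exact: cvg_cst.
by rewrite big_cons; under eq_fun do rewrite big_cons; exact: cvgD.
Qed.

Section bounded_expectation.
Context d (T : measurableType d) (R : realType) (P : probability T R).
Implicit Types (f g : T -> R) (C : R).
Local Notation E f := (\int[P]_w (f w)).

Lemma integrable_bounded f C : measurable_fun setT f -> (forall w, `|f w| <= C) ->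
  P.-integrable setT (EFin \o f).
Proof.
move=> mf fC; apply: measurable_bounded_integrable => //.
  by have := probability_setT P => /= ->; rewrite ltry.
exists C; split; [exact: num_real|move=> x Cx w _ /=].
exact: le_trans (fC w) (ltW Cx).
Qed.

Lemma Rint_EFin f C : measurable_fun setT f -> (forall w, `|f w| <= C) ->
  (\int[P]_w (f w)%:E)%E = (E f)%:E.
Proof.
move=> mf fC; rewrite /Rintegral fineK//; apply: integrable_fin_num => //.
exact: integrable_bounded fC.
Qed.

Lemma Rint_cst C : E (fun=> C) = C.
Proof. by rewrite Rintegral_cst//; have := probability_setT P => /= ->; rewrite mulr1. Qed.

Lemma Rint_le f g C : measurable_fun setT f -> measurable_fun setT g ->
  (forall w, `|f w| <= C) -> (forall w, `|g w| <= C) -> (forall w, f w <= g w) ->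
  E f <= E g.
Proof.
move=> mf mg fC gC fg; apply: le_Rintegral => //.
- exact: integrable_bounded fC.
- exact: integrable_bounded gC.
Qed.

Lemma Rint_distB f g C : measurable_fun setT f -> measurable_fun setT g ->
  (forall w, `|f w| <= C) -> (forall w, `|g w| <= C) ->
  `|E f - E g| <= E (fun w => `|f w - g w|).
Proof.
move=> mf mg fC gC; rewrite -RintegralB//; [|exact: integrable_bounded fC|exact: integrable_bounded gC].
apply: le_normr_Rintegral => //; apply: (@integrable_bounded _ (C + C)).
  exact: measurable_funB.
by move=> w; rewrite (le_trans (ler_normB _ _))// lerD.
Qed.

Lemma Rint_lin (I : finType) (c : I -> R) (g : I -> T -> R) :
  (forall i, P.-integrable setT (EFin \o g i)) ->
  E (fun w => \sum_i c i * g i w) = \sum_i c i * E (g i).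
Proof.
move=> intg.
have intcg i : P.-integrable setT (fun w => (c i * g i w)%:E).
  by under eq_fun do rewrite EFinM; exact: integrableZl (intg i).
rewrite /Rintegral; under eq_integral do rewrite -sumEFin.
rewrite integral_sum//.
transitivity (fine (\sum_i (c i * E (g i))%:E)%E); last by rewrite sumEFin.
congr fine; apply: eq_bigr => i _; under eq_integral do rewrite EFinM.
rewrite (integralZl measurableT (intg i)) -[X in (_ * X)%E]fineK//.
exact: integrable_fin_num (intg i).
Qed.

Lemma Rint_sum (I : finType) (c : I -> R) (g : I -> T -> R) C :
  (forall i, measurable_fun setT (g i)) -> (forall i w, `|g i w| <= C) ->
  E (fun w => \sum_i c i * g i w) = \sum_i c i * E (g i).
Proof. by move=> mg gC; apply: Rint_lin => i; exact: integrable_bounded (gC i). Qed.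

Lemma Rint_affine (I : finType) (e : R) (c : I -> R) (g : I -> T -> R) C :
  (forall i, measurable_fun setT (g i)) -> (forall i w, `|g i w| <= C) ->
  E (fun w => e + \sum_i c i * g i w) = e + \sum_i c i * E (g i).
Proof.
move=> mg gC; rewrite -(Rint_sum c mg gC) -[X in X + _](Rint_cst e).
apply: RintegralD => //.
  by apply: (@integrable_bounded _ `|e|) => //; exact: measurable_cst.
apply: (@integrable_bounded _ (\sum_i `|c i| * C)).
  by apply: measurable_sum => i; apply: measurable_funM.
move=> w; rewrite (le_trans (ler_norm_sum _ _ _))//; apply: ler_sum => i _.
by rewrite normrM ler_wpM2l.
Qed.

Lemma Rint_indic (A : set T) : measurable A -> E (\1_A) = fine (P A).
Proof. by move=> mA; rewrite /Rintegral integral_indic// setIT. Qed.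

End bounded_expectation.

Section criterion.
Context {R : realType}.
Implicit Types (M e : R).

Lemma trig_weight_le1 m (k : 'I_m.+1) M (x : R) : trig_weight m k M x <= 1.
Proof.
rewrite -(bernstein_sum m (to_unit M x)) (bigD1 k)//= lerDl.
by apply: sumr_ge0 => j _; exact: trig_weight_ge0.
Qed.

Lemma continuous_trig_weight m k M : continuous (trig_weight m k M).
Proof.
have cu : continuous (to_unit M).
  apply: contM; last exact: cont_cst.
  apply: contD; first exact: cont_cst.
  apply: (cont_comp (f := fun x => x / (2 * M))); last exact: continuous_sin.
  by apply: contM; [exact: cont_id|exact: cont_cst].
apply: (cont_comp (f := to_unit M)) => //.
have cX (q : nat) : continuous (fun x : R => x ^+ q) by exact: exprn_continuous.
apply: contM; first by apply: contM; [exact: cont_cst|exact: cX].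
apply: (cont_comp (f := fun s => 1 - s) (g := fun x => x ^+ (m - k))); last exact: cX.
by apply: contB; [exact: cont_cst|exact: cont_id].
Qed.

Lemma measurable_abs_gt d (T : measurableType d) (Y : T -> R) M :
  measurable_fun setT Y -> measurable [set w | M < `|Y w|].
Proof.
move=> mY; have mn : measurable_fun setT (fun w => `|Y w|).
  by apply: (measurableT_comp _ mY); exact: normr_measurable.
have -> : [set w | M < `|Y w|] = setT `&` (fun w => `|Y w|) @^-1` `]M, +oo[%classic.
  by rewrite setTI; apply/seteqP; split=> w /=; rewrite in_itv/= andbT.
exact: mn.
Qed.

Section prod_weights.
Context d (T : measurableType d) (n : nat) (Z : 'I_n -> T -> R).
Hypothesis mZ : forall i, measurable_fun setT (Z i).
Local Notation W m k M := (fun w => \prod_i trig_weight m (k i) M (Z i w)).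

Lemma measurable_prod_weight m (k : {ffun 'I_n -> 'I_m.+1}) M : measurable_fun setT (W m k M).
Proof.
apply: measurable_prod => i _; apply: (measurableT_comp _ (mZ i)).
by apply: continuous_measurable_fun; exact: continuous_trig_weight.
Qed.

Lemma prod_weight01 m (k : {ffun 'I_n -> 'I_m.+1}) M (x : 'I_n -> R) :
  0 <= \prod_i trig_weight m (k i) M (x i) <= 1.
Proof.
apply/andP; split; first by apply: prodr_ge0 => i _; exact: trig_weight_ge0.
apply: (@le_trans _ _ (\prod_(i < n) 1)); last by rewrite big1.
by apply: ler_prod => i _; rewrite trig_weight_ge0 trig_weight_le1.
Qed.

Lemma measurable_continuous_row (f : 'rV[R]_n -> R) C : continuous f ->
  (forall x : 'rV[R]_n, `|f x| <= C) -> measurable_fun setT (fun w => f (\row_i Z i w)).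
Proof.
move=> cf fC.
have inv0 N : 0 < N.+1%:R^-1 :> R by rewrite invr_gt0.
have ap N := trig_approx cf fC (ltr0Sn R N) (inv0 N).
pose mm N := projT1 (cid (ap N)).
pose cc N := projT1 (cid (projT2 (cid (ap N)))).
have ccP N := projT2 (cid (projT2 (cid (ap N)))).
apply: (@measurable_fun_cvg _ _ _ _
  (fun N w => \sum_k cc N k * \prod_i trig_weight (mm N) (k i) N.+1%:R (Z i w))).
  move=> N; apply: measurable_sum => k; apply: measurable_funM; first exact: measurable_cst.
  exact: measurable_prod_weight.
move=> w _; apply: cvg_nat_eps => e e0.
have [N1 hN1] := mesh_small 1 e0.
pose S := \sum_i `|Z i w|.
exists (maxn N1 (Num.bound S)) => N; rewrite geq_max => /andP[NN1 NS].
have h := (ccP N).2.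
rewrite distrC; apply: (le_trans (h (fun i => Z i w) _)).
  move=> i; have S0 : 0 <= S by apply: sumr_ge0.
  apply: (@le_trans _ _ S); first by rewrite /S (bigD1 i)//= lerDl sumr_ge0.
  apply: (le_trans (ltW (archi_boundP S0))).
  by rewrite ler_nat (leq_trans NS).
by have := hN1 _ NN1; rewrite div1r.
Qed.

Variable P : probability T R.

(** Mass escaping the box is all that the approximation can miss. *)
Lemma trig_approx_expectation (f g : 'rV[R]_n -> R) C M e e1 : 0 <= C ->
  measurable_fun setT (fun w => f (\row_i Z i w)) ->
  measurable_fun setT (fun w => g (\row_i Z i w)) ->
  (forall x : 'rV[R]_n, `|f x| <= C) -> (forall x : 'rV[R]_n, `|g x| <= C) ->
  0 <= e ->
  (forall x : 'rV[R]_n, (forall i, `|x ord0 i| <= M) -> `|f x - g x| <= e) ->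
  (forall i, (P [set w | (M < `|Z i w|)%R] <= e1%:E)%E) ->
  `|\int[P]_w f (\row_i Z i w) - \int[P]_w g (\row_i Z i w)| <= e + 2 * C * (n%:R * e1).
Proof.
move=> C0 mf mg fC gC e0 fg tight.
apply: (le_trans (Rint_distB P mf mg (fun w => fC _) (fun w => gC _))).
pose A i := [set w | (M < `|Z i w|)%R].
have mA i : measurable (A i) by exact: measurable_abs_gt.
have mh i : measurable_fun setT (\1_(A i) : T -> R) by exact: measurable_indic.
have h1 i w : `|\1_(A i) w| <= 1 :> R.
  by rewrite indicE; case: (_ \in _); rewrite ?normr1 ?normr0.
have ineq w : `|f (\row_i Z i w) - g (\row_i Z i w)| <= e + \sum_i 2 * C * \1_(A i) w.
  have s0 : 0 <= \sum_(i < n) 2 * C * \1_(A i) w.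
    by apply: sumr_ge0 => i _; rewrite mulr_ge0// mulr_ge0.
  have [/forallP hb|] := boolP [forall i, `|Z i w| <= M].
    by rewrite (le_trans (fg _ _))// ?lerDl// => i; rewrite mxE.
  rewrite negb_forall => /existsP[i]; rewrite -ltNge => hi.
  rewrite (le_trans (ler_normB _ _))// ler_wpDl// (bigD1 i)//= ler_wpDr//.
    by apply: sumr_ge0 => j _; rewrite mulr_ge0// mulr_ge0.
  rewrite indicE mem_set//= mulr1 mulr2n mulrDl mul1r.
  by apply: lerD; [exact: fC|exact: gC].
apply: (@le_trans _ _ (\int[P]_w (e + \sum_i 2 * C * \1_(A i) w))).
  apply: (@Rint_le _ _ _ _ _ _ (2 * C + (e + \sum_(i < n) 2 * C))) => //.
  - by apply: measurableT_comp; [exact: normr_measurable|exact: measurable_funB].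
  - apply: measurable_funD; first exact: measurable_cst.
    by apply: measurable_sum => i; apply: measurable_funM.
  - move=> w; rewrite normr_id (le_trans (ler_normB _ _))//.
    rewrite mulr2n mulrDl mul1r ler_wpDr ?addr_ge0 ?sumr_ge0//.
      by move=> i _; rewrite addr_ge0.
    by apply: lerD; [exact: fC|exact: gC].
  - move=> w; rewrite ler_wpDl ?mulr_ge0// (le_trans (ler_normD _ _))//.
    rewrite (ger0_norm e0) lerD2l (le_trans (ler_norm_sum _ _ _))//.
    by apply: ler_sum => i _; rewrite normrM ger0_norm ?mulr_ge0// ler_piMr ?mulr_ge0.
rewrite (Rint_affine P e (fun=> 2 * C) mh h1) lerD2l.
rewrite -mulr_sumr ler_wpM2l ?mulr_ge0//.
apply: (@le_trans _ _ (\sum_(i < n) e1)); last by rewrite sumr_const card_ord mulr_natl.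
apply: ler_sum => i _; rewrite Rint_indic//.
have := tight i; rewrite -lee_fin fineK// fin_num_measure//.
Qed.

End prod_weights.

Lemma tight_rv d (T : measurableType d) (P : probability T R) (Y : T -> R) e :
  measurable_fun setT Y -> 0 < e ->
  exists2 M, 0 < M & (P [set w | (M < `|Y w|)%R] <= e%:E)%E.
Proof.
move=> mY e0; pose A (N : nat) := [set w | (N%:R < `|Y w|)%R].
have mA N : measurable (A N) by exact: measurable_abs_gt.
have I0 : \bigcap_N A N = set0.
  rewrite -subset0 => w /(_ (Num.bound `|Y w|) Logic.I); rewrite /A/=.
  by rewrite ltNge ltW// archi_boundP.
have : P (A N) @[N --> \oo] --> P (\bigcap_N A N).
  apply: nonincreasing_cvg_mu => //.
  - by rewrite (le_lt_trans (probability_le1 _ _))// ltry.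
  - by rewrite I0.
  - move=> p q pq; apply/subsetPset => w; rewrite /A/=; apply: le_lt_trans.
    by rewrite ler_nat.
rewrite I0 measure0 => /fine_cvgP[_ /cvgrPdist_le/(_ _ e0)][N _ hN].
have := hN N.+1 (leqnSn N); rewrite /= sub0r normrN ger0_norm ?fine_ge0// => h.
exists N.+1%:R => //; rewrite -(@fineK _ (P _)) ?fin_num_measure ?lee_fin//.
exact: (mA N.+1).
Qed.

(** By tightness all the laws live, up to a small mass, on one box, on which the
    test function is approximated by a finite combination of weights. *)
Lemma cvg_in_law_criterion d (T : measurableType d) (P : probability T R)
    d' (T' : measurableType d') (P' : probability T' R) n
    (Z : R -> 'I_n -> T -> R) (Y : 'I_n -> T' -> R) :
  (forall eps i, measurable_fun setT (Z eps i)) ->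
  (forall i, measurable_fun setT (Y i)) ->
  (forall e, 0 < e -> exists2 M, 0 < M & forall i,
     \forall eps \near 0^'+, (P [set w | (M < `|Z eps i w|)%R] <= e%:E)%E) ->
  (forall m (k : {ffun 'I_n -> 'I_m.+1}) M, 0 < M ->
     \int[P]_w (\prod_i trig_weight m (k i) M (Z eps i w)) @[eps --> 0^'+] -->
     \int[P']_w (\prod_i trig_weight m (k i) M (Y i w))) ->
  cvg_in_law P P' (fun eps w => \row_i Z eps i w) (fun w => \row_i Y i w).
Proof.
move=> mZ mY tight conv f cf [C0 fC0].
pose C := `|C0|.
have C_ge0 : 0 <= C by exact: normr_ge0.
have fC x : `|f x| <= C by rewrite (le_trans (fC0 _))// ler_norm.
have mfZ eps := measurable_continuous_row (mZ eps) cf fC.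
have mfY := measurable_continuous_row mY cf fC.
have -> : ('E_P'[f \o (fun w => \row_i Y i w)] = (\int[P']_w f (\row_i Y i w))%:E)%E.
  by rewrite unlock; exact: (Rint_EFin P' mfY (fun w => fC _)).
have -> : (fun eps => ('E_P[f \o (fun w => \row_i Z eps i w)])%E) =
    (fun eps => (\int[P]_w f (\row_i Z eps i w))%:E).
  by apply/funext => eps; rewrite unlock; exact: (Rint_EFin P (mfZ eps) (fun w => fC _)).
apply: cvg_EFin; first by near=> eps.
apply/cvgrPdist_le => e e0.
pose e4 := e / 5; have e40 : 0 < e4 by rewrite divr_gt0.
pose e1 := e4 / (2 * C * n%:R + 1).
have den : 0 < 2 * C * n%:R + 1 by rewrite ltr_wpDl// mulr_ge0// mulr_ge0.
have e10 : 0 < e1 by rewrite divr_gt0.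
have [M1 M10 hM1] := tight _ e10.
have [M2 M20 hM2] : exists2 M, 0 < M & forall i, (P' [set w | (M < `|Y i w|)%R] <= e1%:E)%E.
  have h i := tight_rv P' (mY i) e10.
  pose MM i := projT1 (cid2 (h i)).
  have MM0 i : 0 < MM i by rewrite /MM; case: cid2.
  have MMP i : (P' [set w | (MM i < `|Y i w|)%R] <= e1%:E)%E by rewrite /MM; case: cid2.
  exists (1 + \sum_i MM i); first by rewrite ltr_pwDl// sumr_ge0// => i _; exact: ltW.
  move=> i; apply: le_trans (MMP i); apply: le_measure; rewrite ?inE.
  - exact: measurable_abs_gt.
  - exact: measurable_abs_gt.
  - move=> w /=; apply: le_lt_trans; rewrite (bigD1 i)//= addrCA lerDl.
    by rewrite addr_ge0// sumr_ge0// => j _; exact: ltW.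
pose M := maxr M1 M2.
have M0 : 0 < M by rewrite lt_max M10.
have [m [c [cC capp]]] := trig_approx cf fC M0 e40.
pose g (x : 'rV[R]_n) := \sum_k c k * \prod_i trig_weight m (k i) M (x ord0 i).
have gE (x : 'I_n -> R) : g (\row_i x i) = \sum_k c k * \prod_i trig_weight m (k i) M (x i).
  by apply: eq_bigr => k _; congr (_ * _); apply: eq_bigr => i _; rewrite mxE.
have gC x : `|g x| <= C by exact: (cC (fun i => x ord0 i)).
have fg (x : 'rV[R]_n) : (forall i, `|x ord0 i| <= M) -> `|f x - g x| <= e4.
  have rx : \row_i x ord0 i = x by apply/rowP => i; rewrite mxE.
  by move=> /capp; rewrite distrC rx.
have mg d2 (T2 : measurableType d2) (X : 'I_n -> T2 -> R) :
   (forall i, measurable_fun setT (X i)) -> measurable_fun setT (fun w => g (\row_i X i w)).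
  move=> mX; under eq_fun do rewrite gE.
  apply: measurable_sum => k; apply: measurable_funM; first exact: measurable_cst.
  exact: measurable_prod_weight.
have Eg d2 (T2 : measurableType d2) (P2 : probability T2 R) (X : 'I_n -> T2 -> R) :
   (forall i, measurable_fun setT (X i)) -> \int[P2]_w g (\row_i X i w) =
     \sum_k c k * \int[P2]_w (\prod_i trig_weight m (k i) M (X i w)).
  move=> mX; rewrite -(Rint_sum P2 c (C := 1)).
  - by congr Rintegral; apply/funext => w; rewrite gE.
  - by move=> k; exact: measurable_prod_weight.
  - move=> k w; have /andP[h1 h2] := prod_weight01 k M (fun i => X i w).
    by rewrite ger0_norm.
have cvg_g : \int[P]_w g (\row_i Z eps i w) @[eps --> 0^'+] --> \int[P']_w g (\row_i Y i w).
  rewrite (Eg _ _ _ _ mY); under eq_fun do rewrite (Eg _ _ _ _ (mZ _)).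
  by apply: cvg_sumR => k; apply: cvgMr; exact: conv.
have bound : e4 + 2 * C * (n%:R * e1) <= e4 + e4.
  rewrite lerD2l mulrA /e1 mulrCA ger_pMr// ler_pdivrMr// mul1r; lra.
have hY : `|\int[P']_w f (\row_i Y i w) - \int[P']_w g (\row_i Y i w)| <= e4 + e4.
  apply: le_trans bound.
  apply: (trig_approx_expectation (P := P') mY C_ge0 mfY (mg _ _ _ mY) fC gC (ltW e40) fg) => i.
  apply: le_trans (hM2 i); apply: le_measure; rewrite ?inE; [exact: measurable_abs_gt..|].
  by move=> w /=; apply: le_lt_trans; rewrite le_max lexx orbT.
near=> eps.
have hZ : `|\int[P]_w f (\row_i Z eps i w) - \int[P]_w g (\row_i Z eps i w)| <= e4 + e4.
  apply: le_trans bound.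
  apply: (trig_approx_expectation (P := P) (mZ eps) C_ge0 (mfZ eps) (mg _ _ _ (mZ eps)) fC gC (ltW e40) fg) => i.
  apply: (@le_trans _ _ (P [set w | (M1 < `|Z eps i w|)%R])).
    apply: le_measure; rewrite ?inE; [exact: measurable_abs_gt..|].
    by move=> w /=; apply: le_lt_trans; rewrite le_max lexx.
  move: i; near: eps; exact: filter_forall.
have hg : `|\int[P']_w g (\row_i Y i w) - \int[P]_w g (\row_i Z eps i w)| <= e4.
  by near: eps; exact: cvgr_dist_le.
have three (a b a' b' : R) : `|a - b| <= e4 + e4 -> `|a' - b'| <= e4 + e4 -> `|b - b'| <= e4 ->
    `|a - a'| <= 5 * e4.
  move=> h1 h2 h3; have -> : a - a' = (a - b) + (b - b') - (a' - b') by ring.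
  rewrite (le_trans (ler_normB _ _))//.
  by have := ler_normD (a - b) (b - b'); lra.
have := three _ _ _ _ hY hZ hg.
by rewrite /e4 mulrC divfK.
Unshelve. all: by end_near. Qed.

End criterion.

(** * Product laws and iterated integrals *)

Section product_law.
Context {R : realType}.
Implicit Types (Pi : probability R R).

Lemma measurable_cons_pair n :
  measurable_fun [set: R * n.-tuple R] (fun p => [tuple of p.1 :: p.2]).
Proof. exact: measurable_cons measurable_fst measurable_snd. Qed.

Lemma product_law_ex Pi n :
  exists m : probability (n.-tuple R) R, product_law Pi (n := n) = m.
Proof.
elim: n => [|n [m IH]].
  by exists (dirac [tuple]).
exists (distribution (Pi \x m)%E (mfun_Sub (mem_set (@measurable_cons_pair n)))).
by rewrite /= IH.
Qed.

(** The iterated product law, packaged as a probability measure. *)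
Definition iid_law Pi n := projT1 (cid (product_law_ex Pi n)).

Lemma iid_lawE Pi n : product_law Pi (n := n) = iid_law Pi n.
Proof. by rewrite /iid_law; case: cid. Qed.

Definition rectangle n (A : 'I_n -> set R) := [set u : n.-tuple R | forall i, A i (tnth u i)].

Lemma measurable_rectangle n (A : 'I_n -> set R) : (forall i, measurable (A i)) ->
  measurable (rectangle A).
Proof.
move=> mA; have -> : rectangle A = \big[setI/setT]_(i < n) ((@tnth n R ^~ i) @^-1` A i).
  apply/seteqP; split=> u.
    move=> h; elim/big_rec : _ => //= i B _ uB; split=> //; exact: h.
  move=> h i; move: h; rewrite (bigD1 i)//= => -[] //.
apply: bigsetI_measurable => i _; rewrite -[X in measurable X]setTI.
exact: (measurable_tnth i).
Qed.

Lemma iid_law_rectangle Pi n (A : 'I_n -> set R) : (forall i, measurable (A i)) ->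
  iid_law Pi n (rectangle A) = (\prod_(i < n) Pi (A i))%E.
Proof.
rewrite -iid_lawE; elim: n A => [|n IH] A mA.
  by rewrite big_ord0 /= diracE mem_set// => -[].
rewrite big_ord_recl/= /pushforward.
have -> : (fun p : R * n.-tuple R => [tuple of p.1 :: p.2]) @^-1` rectangle A =
    A ord0 `*` rectangle (fun i => A (lift ord0 i)).
  apply/seteqP; split=> -[x u] /=.
    move=> h; split; first by have := h ord0.
    by move=> i; have := h (lift ord0 i); rewrite tnthS.
  move=> [Ax Au] i; case: (unliftP ord0 i) => [j ->|->]//=.
  by rewrite tnthS.
rewrite iid_lawE product_measure1E//.
  by rewrite -IH ?iid_lawE.
exact: measurable_rectangle.
Qed.

Lemma measurable_tupleE n : @measurable _ (n.-tuple R) =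
  <<s [set B | exists A : 'I_n -> set R, (forall i, measurable (A i)) /\ B = rectangle A] >>.
Proof.
apply/seteqP; split.
  apply: smallest_sub; first exact: smallest_sigma_algebra.
  case: n => [|n]; first by rewrite big_ord0.
  rewrite -bigcup_mkord_ord => B [i ilt [C mC <-]].
  apply: sub_sigma_algebra; exists (fun j => if j == inord i then C else setT); split.
    by move=> j; case: ifP.
  rewrite setTI; apply/seteqP; split=> u /=.
    by move=> Cu j; case: eqP => // ->.
  by move=> /(_ (inord i)); rewrite eqxx.
apply: smallest_sub; first exact: sigma_algebra_measurable.
by move=> B [A [mA ->]]; exact: measurable_rectangle.
Qed.

Lemma measurable_tuple_of d (T : measurableType d) n (X : 'I_n -> T -> R) :
  (forall i, measurable_fun setT (X i)) ->
  measurable_fun setT (fun w => [tuple X i w | i < n]).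
Proof.
move=> mX; apply/measurable_fun_tnthP => i.
by apply: (eq_measurable_fun (X i)) => // w _; rewrite /= tnth_mktuple.
Qed.

(** Both laws agree on rectangles, which are stable under intersection and
    generate the measurable sets of tuples. *)
Lemma law_of_independent d (T : measurableType d) (P : probability T R) Pi n
    (X : 'I_n -> T -> R) : (forall i, measurable_fun setT (X i)) ->
  mutually_independent P X ->
  (forall i A, measurable A -> P (X i @^-1` A) = Pi A) ->
  forall B, measurable B -> P [set w | B [tuple X i w | i < n]] = iid_law Pi n B.
Proof.
move=> mX indep law B mB; have mt := measurable_tuple_of mX.
pose G := [set B | exists A : 'I_n -> set R, (forall i, measurable (A i)) /\ B = rectangle A].
have pm := @measure_unique _ R (n.-tuple R) G (fun=> setT) (measurable_tupleE n) _ _ _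
  (measure_function_pushforward__canonical__measure_function_Measure P mt) (iid_law Pi n).
apply: pm => //.
- move=> _ _ [A [mA ->]] [C [mC ->]]; exists (fun i => A i `&` C i); split.
    by move=> i; exact: measurableI.
  apply/seteqP; split=> u /=; first by move=> [h1 h2] i; split; [exact: h1|exact: h2].
  by move=> h; split=> i; have [] := h i.
- move=> k; exists (fun=> setT); split=> //.
  by apply/seteqP; split.
- by rewrite bigcup_const//; exists 0%N.
- move=> _ [A [mA ->]]; rewrite [RHS]iid_law_rectangle//.
  transitivity (P (\bigcap_(i in [set: 'I_n]) (X i @^-1` A i))).
    congr (P _); apply/seteqP; split=> w /=.
      by move=> h i _; have := h i; rewrite tnth_mktuple.
    by move=> h i; rewrite tnth_mktuple; exact: h.
  by rewrite indep//; apply: eq_bigr => i _; exact: law.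
- move=> k; change (P [set: T] < +oo)%E.
  by have := probability_setT P => /= ->; exact: ltry.
Qed.

End product_law.

Section iterated_integral.
Context {R : realType}.
Variable Pi : probability R R.
Implicit Types (g h : seq R -> R).

(** Sequences of all lengths form no measurable space here; tuples of each
    length do. *)
Definition measurable_seqfun g := forall n, measurable_fun [set: n.-tuple R] (fun u => g u).

Definition iid_int n g := (\int[iid_law Pi n]_u (g (tval u))%:E)%E.

Lemma measurable_seqfun_take k g : measurable_seqfun g -> measurable_seqfun (fun s => g (take k s)).
Proof.
move=> mg n; apply: (@measurableT_comp _ _ _ _ _ _ (fun u : (minn k n).-tuple R => g u) _
  (fun u : n.-tuple R => [tuple of take k u])); first exact: mg.
apply/measurable_fun_tnthP => i.
have iN : (i < n)%N by rewrite (leq_trans (ltn_ord i))// geq_minr.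
apply: (eq_measurable_fun (fun u : n.-tuple R => tnth u (Ordinal iN))); last exact: measurable_tnth.
move=> u _ /=; rewrite !(tnth_nth 0)/= nth_take//.
by rewrite (leq_trans (ltn_ord i))// geq_minl.
Qed.

Lemma measurable_seqfun_drop k g : measurable_seqfun g -> measurable_seqfun (fun s => g (drop k s)).
Proof.
move=> mg n; apply: (@measurableT_comp _ _ _ _ _ _ (fun u : (n - k).-tuple R => g u) _
  (fun u : n.-tuple R => [tuple of drop k u])); first exact: mg.
apply/measurable_fun_tnthP => i.
have iN : (k + i < n)%N by have := ltn_ord i; rewrite ltn_subRL.
apply: (eq_measurable_fun (fun u : n.-tuple R => tnth u (Ordinal iN))); last exact: measurable_tnth.
by move=> u _ /=; rewrite !(tnth_nth 0)/= nth_drop.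
Qed.

Lemma measurable_seqfunM g h : measurable_seqfun g -> measurable_seqfun h ->
  measurable_seqfun (fun s => g s * h s).
Proof. by move=> mg mh n; apply: measurable_funM; [exact: mg|exact: mh]. Qed.

Lemma measurable_seqfun_cons2 g n : measurable_seqfun g ->
  measurable_fun [set: R * n.-tuple R] (fun p => g (p.1 :: p.2)).
Proof.
move=> mg; apply: (@measurableT_comp _ _ _ _ _ _ (fun u : n.+1.-tuple R => g u) _
  (fun p : R * n.-tuple R => [tuple of p.1 :: p.2])); first exact: mg.
exact: measurable_cons_pair.
Qed.

Lemma measurable_seqfun_cons g x : measurable_seqfun g -> measurable_seqfun (fun s => g (x :: s)).
Proof.
move=> mg n; apply: (@measurableT_comp _ _ _ _ _ _ (fun p : R * n.-tuple R => g (p.1 :: p.2)) _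
  (fun u : n.-tuple R => (x, u))); first exact: measurable_seqfun_cons2.
exact: measurable_pair1.
Qed.

Lemma iid_int0 g : (forall s, 0 <= g s) -> measurable_seqfun g -> iid_int 0 g = (g [::])%:E.
Proof.
move=> g0 mg; rewrite /iid_int.
transitivity (\int[dirac ([tuple] : 0.-tuple R)]_u (g (tval u))%:E)%E.
  by apply: eq_measure_integral => A mA _; apply/esym; have := iid_lawE Pi 0; rewrite /= => <-.
rewrite integral_dirac//; last by apply/measurable_EFinP; exact: (mg 0%N).
by rewrite diracE mem_set// mul1e.
Qed.

Lemma iid_lawS n A : iid_law Pi n.+1 A =
  pushforward (Pi \x iid_law Pi n)%E (fun p : R * n.-tuple R => [tuple of p.1 :: p.2]) A.
Proof. by rewrite -(iid_lawE Pi n) -(iid_lawE Pi n.+1). Qed.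

Lemma iid_intS n g : (forall s, 0 <= g s) -> measurable_seqfun g ->
  iid_int n.+1 g = (\int[Pi]_x iid_int n (fun s => g (x :: s)))%E.
Proof.
move=> g0 mg; rewrite /iid_int.
transitivity (\int[pushforward (Pi \x iid_law Pi n)%E
     (fun p : R * n.-tuple R => [tuple of p.1 :: p.2])]_u (g (tval u))%:E)%E.
  apply: eq_measure_integral; first exact: measurable_cons_pair.
  by move=> mf A mA _; exact: iid_lawS.
rewrite ge0_integral_pushforward//=.
- rewrite fubini_tonelli1//.
    by apply/measurable_EFinP; exact: measurable_seqfun_cons2.
  by move=> p; rewrite lee_fin.
- exact: measurable_cons_pair.
- by apply/measurable_EFinP; exact: mg.
- by move=> u _; rewrite lee_fin.
Qed.

Lemma iid_int_ge0 n g : (forall s, 0 <= g s) -> (0 <= iid_int n g)%E.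
Proof. by move=> g0; apply: integral_ge0 => u _; rewrite lee_fin. Qed.

Lemma measurable_iid_int_cons n g : (forall s, 0 <= g s) -> measurable_seqfun g ->
  measurable_fun setT (fun x => iid_int n (fun s => g (x :: s))).
Proof.
move=> g0 mg; apply: (@measurable_fun_fubini_tonelli_F _ _ _ _ R (iid_law Pi n)
   (fun p : R * n.-tuple R => (g (p.1 :: p.2))%:E)).
- by apply/measurable_EFinP; exact: measurable_seqfun_cons2.
- by move=> p; rewrite lee_fin.
Qed.

Lemma iid_int_split k m g h : (forall s, 0 <= g s) -> (forall s, 0 <= h s) ->
  measurable_seqfun g -> measurable_seqfun h ->
  iid_int (k + m) (fun s => g (take k s) * h (drop k s)) = (iid_int k g * iid_int m h)%E.
Proof.
elim: k g => [|k IH] g g0 h0 mg mh.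
  rewrite iid_int0// add0n -ge0_integralZl//.
  - by apply: eq_integral => u _; rewrite take0 drop0 EFinM.
  - by apply/measurable_EFinP; exact: mh.
  - by move=> u _; rewrite lee_fin.
  - by rewrite lee_fin.
rewrite addSn iid_intS; last 2 first.
- by move=> s; rewrite mulr_ge0.
- apply: measurable_seqfunM; first exact: measurable_seqfun_take.
  exact: measurable_seqfun_drop.
rewrite [iid_int k.+1 g]iid_intS// -ge0_integralZr//.
- by apply: eq_integral => x _; rewrite -IH//; exact: measurable_seqfun_cons.
- exact: measurable_iid_int_cons.
- by move=> x _; apply: iid_int_ge0.
- exact: iid_int_ge0.
Qed.

Lemma iid_int1 n : iid_int n (fun=> 1) = 1%E.
Proof. by rewrite /iid_int integral_cst//; have := probability_setT (iid_law Pi n) => /= ->; rewrite mule1. Qed.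

Lemma eq_iid_int n g h : (forall s, size s = n -> g s = h s) -> iid_int n g = iid_int n h.
Proof. by move=> gh; apply: eq_integral => u _; rewrite gh// size_tuple. Qed.

Lemma iid_int_blocks N n (g : nat -> seq R -> R) :
  (forall j s, 0 <= g j s) -> (forall j, measurable_seqfun (g j)) ->
  iid_int (n * N) (fun s => \prod_(j < n) g j (take N (drop (j * N) s))) =
  (\prod_(j < n) iid_int N (g j))%E.
Proof.
move=> g0 mg; elim: n g g0 mg => [|n IH] g g0 mg.
  rewrite big_ord0 iid_int0//; first by rewrite big_ord0.
    by move=> s; rewrite big_ord0.
  move=> m; rewrite (_ : (fun u : m.-tuple R => _) = fun=> 1); first exact: measurable_cst.
  by apply/funext => u; rewrite big_ord0.
have mblock : measurable_seqfun (fun s => \prod_(j < n) g j.+1 (take N (drop (j * N) s))).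
  move=> p; apply: measurable_prod => j _.
  by have := measurable_seqfun_drop (j * N) (measurable_seqfun_take N (mg j.+1)); exact.
rewrite big_ord_recl/= -(IH (fun j => g j.+1))//.
rewrite -iid_int_split//.
- rewrite mulSn; apply: eq_iid_int => s _.
  rewrite big_ord_recl/= mul0n drop0; congr (_ * _).
  by apply: eq_bigr => j _; rewrite drop_drop /bump/= add1n mulSn addnC.
- by move=> s; apply: prodr_ge0.
Qed.

Lemma iid_int_prod n (g : nat -> R -> R) :
  (forall j x, 0 <= g j x) -> (forall j, measurable_fun setT (g j)) ->
  iid_int n (fun s => \prod_(j < n) g j (nth 0 s j)) =
  (\prod_(j < n) \int[Pi]_x (g j x)%:E)%E.
Proof.
move=> g0 mg.
have mhead j : measurable_seqfun (fun s => g j (nth 0 s 0)).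
  move=> [|m]; first by apply: (eq_measurable_fun (cst (g j 0))) => // u _; rewrite tuple0.
  apply: (measurableT_comp (mg j)).
  apply: (eq_measurable_fun (fun u : m.+1.-tuple R => tnth u ord0)).
    by move=> u _; rewrite (tnth_nth 0).
  exact: measurable_tnth.
have := iid_int_blocks 1 n (fun j s => g0 j (nth 0 s 0)) mhead.
rewrite muln1 => E; transitivity (\prod_(j < n) iid_int 1 (fun s : seq R => g j (nth 0%R s 0)))%E.
  rewrite -E; apply: eq_iid_int => s sn; apply: eq_bigr => j _.
  by rewrite muln1 nth_take// nth_drop addn0.
apply: eq_bigr => j _; rewrite iid_intS//; apply: eq_integral => x _.
rewrite iid_int0//; exact: (measurable_seqfun_cons x (mhead j)).
Qed.

Lemma iid_int_law d (T : measurableType d) (P : probability T R) n (X : nat -> T -> R) g :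
  (forall i : 'I_n, measurable_fun setT (X i)) -> mutually_independent P (fun i : 'I_n => X i) ->
  (forall (i : 'I_n) A, measurable A -> P (X i @^-1` A) = Pi A) ->
  (forall s, 0 <= g s) -> measurable_seqfun g ->
  (\int[P]_w (g (mkseq (fun i => X i w) n))%:E)%E = iid_int n g.
Proof.
move=> mX indep law g0 mg; rewrite /iid_int.
have mt := measurable_tuple_of mX.
transitivity (\int[pushforward P (fun w => [tuple X i w | i < n])]_u (g (tval u))%:E)%E; last first.
  apply: eq_measure_integral => A mA _.
  exact: (law_of_independent mX indep law).
rewrite ge0_integral_pushforward//=.
- apply: eq_integral => w _; congr ((g _)%:E).
  rewrite /= /mkseq -val_enum_ord -map_comp; exact: eq_map.
- by apply/measurable_EFinP; exact: mg.
- by move=> u _; rewrite lee_fin.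
Qed.

End iterated_integral.

(** * The normal law *)

Section normal_law.
Context {R : realType}.
Implicit Types (m s a b p x : R).
Local Notation mu := (@lebesgue_measure R).
Local Notation I f a b := (\int[mu]_(x in `[a, b]) (f x)).
Local Notation N := (@normal_prob R 0 1).

Lemma normal_prob_itv m s a b : s != 0 ->
  normal_prob m s `]a, b]%classic = (I (normal_pdf m s) a b)%:E.
Proof.
move=> s0; rewrite /normal_prob integral_itv_obnd_cbnd; last first.
  by apply/measurable_EFinP/measurable_funTS; exact: measurable_normal_pdf.
have h := integrable_continuous a b (@continuous_normal_pdf R m s s0).
by rewrite /Rintegral fineK//; exact: (integrable_fin_num _ h).
Qed.

Lemma normal_pdf_affine m s x : 0 < s -> s * normal_pdf m s (m + s * x) = normal_pdf 0 1 x.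
Proof.
move=> s0; rewrite !normal_pdfE ?gt_eqF//= /normal_peak /normal_fun.
have -> : - (m + s * x - m) ^+ 2 / (s ^+ 2 *+ 2) = - (x - 0) ^+ 2 / (1 ^+ 2 *+ 2).
  by field; rewrite gt_eqF.
rewrite mulrA; congr (_ * _).
rewrite expr1n mul1r -mulrnAr sqrtrM ?sqr_ge0// sqrtr_sqr gtr0_norm//.
by rewrite invfM mulrA mulfV ?gt_eqF// mul1r.
Qed.

(** Affine change of variables, checked on half-open intervals. *)
Lemma normal_prob_affine m s : 0 < s -> forall A, measurable A ->
  normal_prob m s A = N [set x | A (m + s * x)].
Proof.
move=> s0.
have mf : measurable_fun [set: measurableTypeR R]
    ((fun x => m + s * x) : measurableTypeR R -> measurableTypeR R).
  by apply: measurable_funD => //; exact: measurable_funM.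
move=> A mA.
have pm := @measure_unique _ R (measurableTypeR R) (@ocitv R) (fun n => `](- n%:R)%R, n%:R]%classic)
  _ _ _ _ (normal_prob m s) (measure_function_pushforward__canonical__measure_function_Measure N mf).
apply: pm => //.
- exact: ocitvI.
- by move=> i; exact: is_ocitv.
- rewrite -subTset => x _; exists (Num.bound `|x|) => //=; rewrite in_itv/=.
  have := archi_boundP (normr_ge0 x); rewrite ltr_norml => /andP[h1 h2].
  by rewrite h1 ltW.
- move=> _ [[a b] _ <-]/=.
  have [ab|ba] := leP a b; last first.
    rewrite (_ : `]a, b]%classic = set0); last by rewrite set_itv_ge// bnd_simp -leNgt ltW.
    by rewrite /pushforward preimage_set0 (measure0 (normal_prob m s)) (measure0 N).
  rewrite normal_prob_itv ?gt_eqF// /pushforward.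
  have -> : (fun x => m + s * x) @^-1` `]a, b]%classic = `](a - m) / s, (b - m) / s]%classic.
    apply/seteqP; split=> x /=; rewrite !in_itv/= ltr_pdivrMr// ler_pdivlMr// ltrBlDl lerBrDl mulrC//.
  rewrite (@normal_prob_itv 0 1 _ _ (oner_neq0 R)); congr (_%:E).
  have -> : I (normal_pdf 0 1) ((a - m) / s) ((b - m) / s) =
     s * I (fun x => normal_pdf m s (m + s * x)) ((a - m) / s) ((b - m) / s).
    rewrite -intZ; first by apply: eq_int => x _; rewrite normal_pdf_affine.
    apply: (cont_comp (f := fun x => m + s * x)); last by apply: continuous_normal_pdf; rewrite gt_eqF.
    by apply: contD; [exact: cont_cst|apply: contM; [exact: cont_cst|exact: cont_id]].
  rewrite -int_affine ?(ltW s0)//; last by rewrite ler_pM2r ?invr_gt0// lerD2r.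
    by rewrite ![s * _]mulrC !divfK ?gt_eqF// !subrKC.
  by apply: continuous_normal_pdf; rewrite gt_eqF.
- by move=> k; rewrite (le_lt_trans (probability_le1 _ _))// ltry.
Qed.

Lemma ge0_integral_normal m s (f : R -> \bar R) : s != 0 ->
  measurable_fun setT f -> (forall x, 0 <= f x)%E ->
  (\int[normal_prob m s]_x f x = \int[mu]_x (f x * (normal_pdf m s x)%:E))%E.
Proof.
move=> s0 mf f0.
have dom := normal_prob_dominates m s.
rewrite -(Radon_Nikodym_SigmaFinite.change_of_variables dom f0 measurableT mf).
apply: ae_eq_integral => //.
- apply: emeasurable_funM => //.
  exact: measurable_int (Radon_Nikodym_SigmaFinite.f_integrable dom).
- apply: emeasurable_funM => //; apply/measurable_EFinP; exact: measurable_normal_pdf.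
- apply: ae_eqe_mul2l => /=; apply: integral_ae_eq => //.
  + exact: Radon_Nikodym_SigmaFinite.f_integrable.
  + by apply/measurable_EFinP; exact: measurable_normal_pdf.
  + by move=> E _ mE; rewrite -Radon_Nikodym_SigmaFinite.f_integral.
Qed.

Lemma normal_moment_finite p : 0 <= p -> (\int[N]_x (`|x| `^ p)%:E < +oo)%E.
Proof.
move=> p0; have mp : measurable_fun setT (fun x : R => (`|x| `^ p)%:E).
  apply/measurable_EFinP; apply: (measurableT_comp (measurable_powR p)).
  exact: normr_measurable.
rewrite ge0_integral_normal ?oner_eq0//.
pose r := Num.sqrt (2 : R).
have r0 : 0 < r by rewrite sqrtr_gt0.
pose C := expR (p ^+ 2) * (normal_peak 1 / normal_peak r).
apply: (@le_lt_trans _ _ (\int[mu]_x (C%:E * (normal_pdf 0 r x)%:E))%E); last first.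
  rewrite ge0_integralZl//.
  - by rewrite integral_normal_pdf mule1 ltry.
  - by apply/measurable_EFinP; exact: measurable_normal_pdf.
  - by move=> x _; rewrite lee_fin normal_pdf_ge0.
  - by rewrite lee_fin mulr_ge0 ?expR_ge0// divr_ge0// normal_peak_ge0.
apply: ge0_le_integral => //.
- by move=> x _; rewrite mule_ge0// lee_fin ?powR_ge0 ?normal_pdf_ge0.
- by apply: emeasurable_funM => //; apply/measurable_EFinP; exact: measurable_normal_pdf.
- by apply: emeasurable_funM => //; apply/measurable_EFinP; exact: measurable_normal_pdf.
move=> x _; rewrite -!EFinM lee_fin !normal_pdfE ?oner_eq0 ?gt_eqF//= /C.
have -> : expR (p ^+ 2) * (normal_peak 1 / normal_peak r) * (normal_peak r * normal_fun 0 r x)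
   = normal_peak 1 * (expR (p ^+ 2) * normal_fun 0 r x).
  by field; rewrite gt_eqF// normal_peak_gt0 ?gt_eqF.
rewrite mulrCA ler_wpM2l ?normal_peak_ge0// /normal_fun !subr0.
have -> : r ^+ 2 = 2 by rewrite sqr_sqrtr.
apply: (@le_trans _ _ (expR (`|x| * p) * expR (- x ^+ 2 / (1 ^+ 2 *+ 2)))).
  rewrite ler_wpM2r ?expR_ge0// expRM; apply: ge0_ler_powR; rewrite ?nnegrE ?expR_ge0//.
  by rewrite (le_trans _ (expR_ge1Dx _))// lerDr.
rewrite -!expRD ler_expR expr1n.
have : 0 <= (`|x| / 2 - p) ^+ 2 by exact: sqr_ge0.
have : `|x| ^+ 2 = x ^+ 2 by rewrite real_normK// num_real.
have -> : (`|x| / 2 - p) ^+ 2 = `|x| ^+ 2 / 4 - `|x| * p + p ^+ 2 by field.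
by move=> ->; lra.
Qed.

Local Notation phi := (@normal_pdf R 0 1).

Let cphi : continuous phi.
Proof. by apply: continuous_normal_pdf; rewrite oner_eq0. Qed.

Let phiE x : phi x = normal_peak 1 * expR (- (x ^+ 2 / 2)).
Proof. by rewrite normal_pdfE ?oner_eq0//= /normal_fun subr0 expr1n mulNr. Qed.

Lemma normal_probN (A : set R) : measurable A -> N [set x : R | A (- x)] = N A.
Proof.
move=> mA; rewrite /normal_prob.
transitivity (\int[pushforward mu (-%R : _ -> measurableTypeR R)]_(x in A) (phi x)%:E)%E; last first.
  by apply: eq_measure_integral => B mB _; exact: lebesgue_measureN.
rewrite ge0_integral_pushforward//=.
- by apply: eq_integral => x _; rewrite !phiE sqrrN.
- by apply/measurable_EFinP/measurable_funTS; exact: measurable_normal_pdf.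
- by move=> x _; rewrite lee_fin normal_pdf_ge0.
Qed.

Lemma normal_integrable_id : N.-integrable setT (fun x : R => x%:E).
Proof.
apply/integrableP; split; first by apply/measurable_EFinP.
have := normal_moment_finite ler01.
by under eq_integral do rewrite powRr1//.
Qed.

Lemma normal_mean : (\int[N]_x x%:E = 0)%E.
Proof.
have ii := normal_integrable_id.
have e : (\int[N]_x x%:E = - \int[N]_x x%:E)%E.
  rewrite -integralN; last exact: integrable_add_def.
  transitivity (\int[pushforward N (-%R : _ -> measurableTypeR R)]_x x%:E)%E.
    by apply: eq_measure_integral => B mB _; have := normal_probN mB; rewrite /pushforward => h; first [exact: h|exact: esym h].
  rewrite integral_pushforward//=.
  by apply/integrableN: ii.
have fin := integrable_fin_num measurableT ii.
move: e; rewrite -(fineK fin) -EFinN => -[e].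
by congr (_%:E); lra.
Qed.

Lemma normal_second_moment : (\int[N]_x (x ^+ 2)%:E = 1)%E.
Proof.
have m2 : measurable_fun setT (fun x : R => (x ^+ 2)%:E).
  by apply/measurable_EFinP; exact: measurable_funX.
rewrite ge0_integral_normal ?oner_eq0//; last by move=> x; rewrite lee_fin sqr_ge0.
pose S n := `[(- n%:R : R), n%:R]%classic.
have ndS : nondecreasing_seq S.
  move=> m n mn; apply/subsetPset => x; rewrite /S/= !in_itv/= => /andP[x1 x2].
  have mn' : m%:R <= n%:R :> R by rewrite ler_nat.
  by apply/andP; split; lra.
have US : \bigcup_n S n = setT.
  rewrite -subTset => x _; exists (Num.bound `|x|) => //=; rewrite /S/= in_itv/=.
  by rewrite -ler_norml ltW// archi_boundP.
have key (f : R -> R) : continuous f -> (forall x, 0 <= f x) ->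
    ((I f (- n%:R) n%:R)%:E @[n --> \oo] --> \int[mu]_x (f x)%:E)%E.
  move=> cf f0; rewrite -US.
  have mS n : measurable (S n) by exact: measurable_itv.
  have mf n : measurable_fun (S n) (fun x => (f x)%:E).
    by apply/measurable_EFinP/measurable_funTS; exact: continuous_measurable_fun.
  have f0' n x : S n x -> (0 <= (f x)%:E)%E by move=> _; rewrite lee_fin.
  have := @ge0_nondecreasing_set_cvg_integral _ (measurableTypeR R) R S (fun x => (f x)%:E) mu
    ndS mS mf f0'.
  apply: cvg_trans; apply: near_eq_cvg; near=> n.
  by rewrite /Rintegral fineK//; exact: (integrable_fin_num _ (integrable_continuous _ _ cf)).
have k1 := key _ cphi (normal_pdf_ge0 _ _).
rewrite integral_normal_pdf in k1.
have cf : continuous (fun x => x ^+ 2 * phi x).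
  by apply: contM => //; exact: (@exprn_continuous R 2).
have f0 x : 0 <= x ^+ 2 * phi x by rewrite mulr_ge0 ?sqr_ge0 ?normal_pdf_ge0.
have k2 := key _ cf f0.
have dphi x : is_derive x 1 phi (- x * phi x).
  have -> : phi = (fun x => normal_peak 1 * expR (- (x ^+ 2 / 2))) by apply/funext => y; rewrite phiE.
  have h3 : is_derive x 1 (fun x => - (x ^+ 2 / 2)) (- x).
    by apply: is_derive_eq; rewrite /GRing.scale/=; field.
  have h := @is_derive1_comp R expR (fun x => - (x ^+ 2 / 2)) x _ _ (is_derive_expR _) h3.
  have h4 := is_deriveZ (normal_peak 1) h.
  by apply: (is_derive_eq h4); rewrite /GRing.scale/=; ring.
have e n : I (fun x => x ^+ 2 * phi x) (- n%:R) n%:R = I phi (- n%:R) n%:R - 2 * (n%:R * phi n%:R).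
  have nn : - n%:R <= n%:R :> R by rewrite ge0_cp.
  have h : I (fun x => phi x - x ^+ 2 * phi x) (- n%:R) n%:R = n%:R * phi n%:R - (- n%:R) * phi (- n%:R).
    apply: (@FTC2 R (fun x => x * phi x)) => //; first exact: contB.
    move=> x _; have := dphi x => hx.
    by apply: is_derive_eq; rewrite /GRing.scale/=; ring.
  have phiN : phi (- n%:R) = phi n%:R by rewrite !phiE sqrrN.
  move: h; rewrite intB// phiN => h.
  have -> : 2 * (n%:R * phi n%:R) = n%:R * phi n%:R - - n%:R * phi n%:R by ring.
  by rewrite -h; ring.
have tail : (fun n : nat => n%:R * phi n%:R) @ \oo --> 0.
  apply: cvg_nat_eps => d d0.
  have [M hM] := mesh_small (normal_peak 1 * 2 : R) d0.
  exists M.+1 => -[//|n] /hM; apply: le_trans.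
  have n0 : 0 < n.+1%:R :> R by rewrite ltr0n.
  rewrite sub0r normrN ger0_norm ?mulr_ge0 ?normal_pdf_ge0//.
  rewrite phiE (mulrCA n.+1%:R) -(mulrA (normal_peak 1) 2) ler_wpM2l ?normal_peak_ge0//.
  rewrite expRN ler_pdivrMr ?expR_gt0//.
  have := expR_ge1Dx (n.+1%:R ^+ 2 / 2 : R) => h1.
  apply: (@le_trans _ _ (2 / n.+1%:R * (n.+1%:R ^+ 2 / 2))).
    by rewrite le_eqVlt; apply/orP; left; apply/eqP; field.
  rewrite ler_wpM2l ?divr_ge0 ?(ltW n0)//; lra.
have k3 : ((I (fun x => x ^+ 2 * phi x) (- n%:R) n%:R)%:E @[n --> \oo] --> (1 - (2 * 0 : R)%:E)%E)%E.
  under eq_fun do rewrite e EFinB.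
  apply: cvgeB => //; apply: cvg_EFin; first by near=> n.
  by apply: cvgM; [exact: cvg_cst|exact: tail].
rewrite mulr0 sube0 in k3.
under eq_integral do rewrite -EFinM.
exact: (cvg_unique (@ereal_hausdorff R) k2 k3).
Unshelve. all: by end_near. Qed.

End normal_law.

(** * Expectations of path integrals *)

Section fatou_riemann.
Context d (T : measurableType d) (R : realType) (P : probability T R).
Implicit Types (Y : R -> T -> R) (a b t : R) (m : R -> R).
Local Notation mu := (@lebesgue_measure R).
Local Notation I f a b := (\int[mu]_(x in `[a, b]) (f x)).

Lemma subdivision_itv a b n k : a <= b -> (k <= n.+1)%N ->
  a <= a + k%:R * ((b - a) / n.+1%:R) <= b.
Proof.
move=> ab kn; have d0 : 0 <= b - a by rewrite subr_ge0.
rewrite lerDl mulr_ge0 ?divr_ge0//= mulrCA -lerBrDl -[leRHS]mulr1 ler_wpM2l//.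
by rewrite ler_pdivrMr ?mul1r ?ler_nat ?ltr0n.
Qed.

Definition riemann_sum (f : R -> R) a b n :=
  \sum_(k < n.+1) f (a + k%:R * ((b - a) / n.+1%:R)) * ((b - a) / n.+1%:R).

Lemma measurable_path_integral Y a b : a <= b ->
  (forall t, measurable_fun setT (Y t)) -> (forall w, continuous (Y ^~ w)) ->
  measurable_fun setT (fun w => I (Y ^~ w) a b).
Proof.
move=> ab mY cY; apply: (@measurable_fun_cvg _ _ _ setT (fun n w => riemann_sum (Y ^~ w) a b n)).
  move=> n; apply: measurable_sum => k; apply: measurable_funM; first exact: mY.
  exact: measurable_cst.
by move=> w _; exact: cvg_riemann_sum.
Qed.

(** Fatou's lemma along Riemann sums replaces Tonelli's theorem, which would
    require the joint measurability of the process. *)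
Lemma expectation_path_integral Y a b m : a <= b ->
  (forall t, measurable_fun setT (Y t)) -> (forall w, continuous (Y ^~ w)) ->
  (forall t w, 0 <= Y t w) -> continuous m ->
  (forall t, a <= t <= b -> (\int[P]_w (Y t w)%:E <= (m t)%:E)%E) ->
  (\int[P]_w (I (Y ^~ w) a b)%:E <= (I m a b)%:E)%E.
Proof.
move=> ab mY cY Y0 cm Ym.
pose S n w := riemann_sum (Y ^~ w) a b n.
have d0 n : 0 <= (b - a) / n.+1%:R by rewrite divr_ge0// subr_ge0.
have mS n : measurable_fun setT (fun w => (S n w)%:E).
  apply/measurable_EFinP; apply: measurable_sum => k.
  by apply: measurable_funM; [exact: mY|exact: measurable_cst].
have S0 n w : (0 <= (S n w)%:E)%E.
  by rewrite lee_fin; apply: sumr_ge0 => k _; rewrite mulr_ge0.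
have -> : (\int[P]_w (I (Y ^~ w) a b)%:E = \int[P]_w limn_einf (fun n => (S n w)%:E))%E.
  apply: eq_integral => w _; apply/esym.
  have /cvg_limn_einf_sup[-> _//] : (S n w)%:E @[n --> \oo] --> (I (Y ^~ w) a b)%:E.
  by apply/fine_cvgP; split; [exact: nearW|exact: cvg_riemann_sum].
apply: (le_trans (fatou P measurableT mS (fun n w _ => S0 n w))).
have cS : (riemann_sum m a b n)%:E @[n --> \oo] --> (I m a b)%:E.
  by apply/fine_cvgP; split; [exact: nearW|exact: cvg_riemann_sum].
rewrite limn_einf_lim -(cvg_lim _ cS)//; apply: lee_lim.
- exact: is_cvg_einfs.
- by apply/cvg_ex; exists (I m a b)%:E.
have einfs_le (u : nat -> \bar R) n : (einfs u n <= u n)%E.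
  by apply: ereal_inf_lbound; exists n => /=.
apply: nearW => n; apply: (le_trans (einfs_le _ _)).
rewrite /S /riemann_sum; under eq_integral do rewrite -sumEFin.
rewrite ge0_integral_sum//.
- rewrite -sumEFin; apply: lee_sum => k _.
  under eq_integral do rewrite EFinM.
  rewrite ge0_integralZr//; last 3 first.
  + by apply/measurable_EFinP; exact: mY.
  + by move=> w _; rewrite lee_fin.
  + by rewrite lee_fin.
  rewrite [leRHS]EFinM; apply: lee_wpmul2r; first by rewrite lee_fin.
  by apply: Ym; apply: subdivision_itv => //; rewrite ltnW.
- move=> k; apply/measurable_EFinP; apply: measurable_funM; first exact: mY.
  exact: measurable_cst.
- by move=> k w _; rewrite lee_fin mulr_ge0.
Qed.

End fatou_riemann.

(** * Brownian motion with continuous paths *)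

Section std_normal.
Context {R : realType}.

Let mid : @measurable_fun _ _ (measurableTypeR R) R setT id.
Proof. by move=> _ A mA; rewrite setTI. Qed.

(** The standard normal law on [R] itself: the canonical measurable structure
    of the real line has the same measurable sets as the one on which
    [normal_prob] lives, but another display. *)
Definition std_normal : probability R R :=
  distribution [the probability (measurableTypeR R) R of @normal_prob R 0 1]
    (@mfun_Sub _ _ (measurableTypeR R) R id (mem_set mid)).

Lemma ge0_integral_std_normal (f : R -> \bar R) : measurable_fun setT f ->
  (forall x, 0 <= f x)%E ->
  (\int[std_normal]_x f x = \int[normal_prob 0 1]_x f x)%E.
Proof.
move=> mf f0.
by rewrite (@ge0_integral_pushforward _ _ (measurableTypeR R) R R _ mid _ setT f measurableT mf).
Qed.

Lemma integral_std_normal_id : (\int[std_normal]_x x%:E = 0)%E.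
Proof.
rewrite -(@normal_mean R).
by apply: (integral_pushforward mid) => //; exact: normal_integrable_id.
Qed.

End std_normal.

Section almost_sure.
Context d (T : measurableType d) (R : realType) (P : probability T R).

(** The points of a null set are sent to a fixed point of its complement: the
    composition with this map turns almost sure path properties into sure ones
    without changing any law. *)
Lemma ae_retraction (Q : T -> Prop) : {ae P, forall w, Q w} ->
  exists phi : T -> T, [/\ measurable_fun setT phi, forall w, Q (phi w),
    forall A, measurable A -> P (phi @^-1` A) = P A & {ae P, forall w, phi w = w}].
Proof.
move=> [N [mN PN QN]].
have [w0 Nw0] : exists w, ~ N w.
  apply: contrapT => /forallNP NT; have := probability_setT P => /=.
  rewrite (_ : [set: T] = N) ?PN => [/eqP|]; first by rewrite eqe eq_sym oner_eq0.
  by apply/seteqP; split=> // w _; exact: contrapT (NT w).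
pose phi w := if w \in N then w0 else w.
have aephi : {ae P, forall w, phi w = w}.
  exists N; split=> // w /=; apply: contra_notP => Nw.
  by rewrite /phi; case: ifPn => // /set_mem.
have mphi : measurable_fun setT phi.
  apply: measurable_fun_ifT; [|exact: measurable_cst|exact: measurable_id].
  apply: (@measurable_fun_bool _ _ _ _ true).
  rewrite setTI (_ : _ @^-1` _ = N)//; apply/seteqP; split=> w /=; first by move/set_mem.
  exact: mem_set.
exists phi; split=> // [w|A mA].
  rewrite /phi; case: ifPn => [_|/negP wN]; apply: contrapT => /QN //.
  by move=> Nw; apply: wN; exact: mem_set.
have mA' : measurable (phi @^-1` A) by rewrite -[X in measurable X]setTI; exact: mphi.
apply/eqP; rewrite eq_le; apply/andP; split.
  apply: (@le_trans _ _ (P (A `|` N))).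
    apply: le_measure; rewrite ?inE//; first exact: measurableU.
    move=> w /=; rewrite /phi; case: ifPn => [/set_mem|]; first by right.
    by left.
  by rewrite (le_trans (measureU2 _ _ _))//= PN adde0.
apply: (@le_trans _ _ (P (phi @^-1` A `|` N))).
  apply: le_measure; rewrite ?inE//; first exact: measurableU.
  move=> w Aw; have [Nw|Nw] := pselect (N w); [by right|left].
  by rewrite /= /phi; case: ifPn => // /set_mem.
by rewrite (le_trans (measureU2 _ _ _))//= PN adde0.
Qed.

Lemma bounded_cvg_expectation (f : nat -> T -> R) (g : T -> R) C :
  (forall n, measurable_fun setT (f n)) -> (forall n w, `|f n w| <= C) ->
  (forall w, f n w @[n --> \oo] --> g w) ->
  \int[P]_w (f n w) @[n --> \oo] --> \int[P]_w (g w).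
Proof.
move=> mf fC fg.
have mg : measurable_fun setT g by apply: (measurable_fun_cvg mf) => w _; exact: fg.
have gC w : `|g w| <= C.
  have h : `|f n w| @[n --> \oo] --> `|g w| by apply: cvg_norm; exact: fg.
  rewrite -(cvg_lim (@Rhausdorff R) h).
  apply: limr_le; last by apply: nearW => n; exact: fC.
  by apply/cvg_ex; exists `|g w|.
apply: fine_cvg; rewrite fineK; last by rewrite (Rint_EFin P mg gC).
have h := @dominated_cvg _ _ _ P _ measurableT (fun n w => (f n w)%:E) (fun w => (g w)%:E)
  (fun=> C%:E); apply: h => //.
- by move=> n; apply/measurable_EFinP.
- by move=> w _; apply/fine_cvgP; split; [exact: nearW|exact: fg].
- by apply: (@integrable_bounded _ _ _ P (fun=> C) `|C|) => //; exact: measurable_cst.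
- by move=> n w _; rewrite abse_EFin lee_fin.
Qed.

End almost_sure.

Section continuous_brownian_motion.
Context d (T : measurableType d) (R : realType) (P : probability T R).
Implicit Types (W : R -> T -> R) (s t : R) (f : R -> R).
Local Notation N := (@std_normal R).

(** Brownian motion up to the value at time 0, with all paths continuous on
    the whole line. *)
Definition continuous_bm W := [/\
  forall t, measurable_fun setT (W t),
  forall w, continuous (W ^~ w),
  forall s t, 0 <= s -> s < t -> forall A : set R, measurable A ->
    P [set w | A (W t w - W s w)] = normal_prob 0 (sqrtr (t - s)) A &
  forall n (t : nat -> R), 0 <= t 0%N -> {homo t : i j / (i <= j)%N >-> i <= j} ->
    mutually_independent P (fun (i : 'I_n) w => W (t i.+1) w - W (t i) w)].

Lemma brownian_motion_retraction (B : R -> {RV P >-> R}) (phi : T -> T) :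
  brownian_motion B -> measurable_fun setT phi ->
  (forall A, measurable A -> P (phi @^-1` A) = P A) ->
  (forall w, {within `[0, +oo[, continuous (fun t => B t (phi w))}) ->
  continuous_bm (fun t w => B (maxr 0 t) (phi w)).
Proof.
move=> [_ _ incr indep] mphi Pphi cphi; split.
- by move=> t; apply: measurableT_comp => //; exact: measurable_funPT.
- move=> w t; exact: (continuous_max_within (cphi w)).
- move=> s t s0 st A mA.
  have t0 : 0 <= t by rewrite (le_trans s0)// ltW.
  rewrite -(incr s t s0 st A mA) !max_r//.
  have mD : measurable [set w | A (B t w - B s w)].
    rewrite -[X in measurable X]setTI.
    by apply: (measurable_funB (measurable_funPT (B t)) (measurable_funPT (B s))).
  by rewrite -(Pphi _ mD).
- move=> n t t0 tm A mA.
  have tge i : 0 <= t i by rewrite (le_trans t0)// tm.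
  have mB (i : 'I_n) : measurable ((fun w => B (t i.+1) w - B (t i) w) @^-1` A i).
    rewrite -[X in measurable X]setTI.
    by apply: (measurable_funB (measurable_funPT (B (t i.+1))) (measurable_funPT (B (t i)))).
  have -> : \bigcap_(i in [set: 'I_n])
      ((fun w => B (maxr 0 (t i.+1)) (phi w) - B (maxr 0 (t i)) (phi w)) @^-1` A i) =
      phi @^-1` (\bigcap_(i in [set: 'I_n]) ((fun w => B (t i.+1) w - B (t i) w) @^-1` A i)).
    by apply/seteqP; split=> w /= h i iT; have := h i iT; rewrite /= !max_r.
  rewrite Pphi; last by apply: fin_bigcap_measurable.
  rewrite indep//; apply: eq_bigr => i _; rewrite -(Pphi _ (mB i)).
  by congr (P _); apply/seteqP; split=> w /=; rewrite !max_r.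
Qed.

Variable W : R -> T -> R.
Hypothesis cW : continuous_bm W.

Let measurable_scaled (c : R) (A : set R) : measurable A -> measurable ((fun x => x / c) @^-1` A).
Proof.
move=> mA; rewrite -[X in measurable X]setTI.
have mf : measurable_fun setT (fun x : R => x / c).
  by apply: measurable_funM; [exact: measurable_id|exact: measurable_cst].
exact: mf.
Qed.

Lemma increments_iid (s : nat -> R) n (G : seq R -> R) : 0 <= s 0%N ->
  (forall i, (i < n)%N -> s i < s i.+1) ->
  (forall l, 0 <= G l) -> measurable_seqfun G ->
  (\int[P]_w (G (mkseq (fun i => (W (s i.+1) w - W (s i) w) / Num.sqrt (s i.+1 - s i)) n))%:E)%E
  = iid_int N n G.
Proof.
move=> s0 smono G0 mG; have [mW _ incr indep] := cW.
have sle i j : (i <= j)%N -> (j <= n)%N -> s i <= s j.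
  elim: j => [|j IH]; first by rewrite leqn0 => /eqP ->.
  rewrite leq_eqVlt => /predU1P[->//|]; rewrite ltnS => ij jn.
  by rewrite (le_trans (IH ij (ltnW jn)))// ltW// smono.
have sge i : (i <= n)%N -> 0 <= s i by move=> iN; rewrite (le_trans s0)// sle.
pose c i := Num.sqrt (s i.+1 - s i).
have c0 i : (i < n)%N -> 0 < c i by move=> iN; rewrite sqrtr_gt0 subr_gt0 smono.
apply: iid_int_law => //.
- move=> i; apply: measurable_funM; last exact: measurable_cst.
  exact: measurable_funB.
- move=> A mA; have := @indep n (fun k => s (minn k n)) _ _ (fun i => (fun x => x / c i) @^-1` A i) _.
  rewrite min0n => /(_ s0); have tm : {homo (fun k => s (minn k n)) : i j / (i <= j)%N >-> i <= j}.
    by move=> i j ij; apply: sle; [by rewrite leq_min geq_minr geq_min ij|exact: geq_minr].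
  move=> /(_ tm); have mA' (i : 'I_n) : measurable ((fun x => x / c i) @^-1` A i).
    exact: measurable_scaled.
  move=> /(_ mA') h.
  have mE (i : 'I_n) : (minn i n = i) /\ (minn i.+1 n = i.+1).
    by split; apply/minn_idPl; [exact: ltnW|].
  transitivity (P (\bigcap_(i in [set: 'I_n])
     ((fun w => W (s (minn i.+1 n)) w - W (s (minn i n)) w) @^-1` ((fun x => x / c i) @^-1` A i)))).
    by congr (P _); apply/seteqP; split=> w /= hw i iT; have := hw i iT; have [-> ->] := mE i.
  by rewrite h; apply: eq_bigr => i _; have [-> ->] := mE i.
- move=> i A mA; have iN := ltn_ord i.
  have mA' : measurable ((fun x => x / c i) @^-1` A).
    exact: measurable_scaled.
  have := incr (s i) (s i.+1) (sge i (ltnW iN)) (smono i iN) _ mA'.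
  rewrite normal_prob_affine ?c0// => h.
  transitivity (P [set w | ((fun x => x / c i) @^-1` A) (W (s i.+1) w - W (s i) w)]) => //.
  rewrite h; transitivity (normal_prob 0 1 A); last by [].
  congr (normal_prob 0 1 _); apply/seteqP; split=> x /=;
    by rewrite add0r mulrC mulKf// gt_eqF// c0.
Qed.

Lemma increment_expectation f s t : 0 <= s -> s <= t -> (forall x, 0 <= f x) ->
  measurable_fun setT f ->
  (\int[P]_w (f (W t w - W s w))%:E = \int[N]_x (f (Num.sqrt (t - s) * x))%:E)%E.
Proof.
move=> s0; rewrite le_eqVlt => /predU1P[->|st] f0 mf.
  rewrite subrr sqrtr0; under eq_integral do rewrite subrr.
  under [RHS]eq_integral do rewrite mul0r.
  rewrite !integral_cst//; have := probability_setT P => /= ->.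
  by have := probability_setT N => /= ->.
pose u k := if k is 0%N then s else t.
pose G (l : seq R) := f (Num.sqrt (t - s) * nth 0 l 0).
have mG : measurable_seqfun G.
  move=> [|m]; first by apply: (eq_measurable_fun (cst (G [::]))) => // v _; rewrite tuple0.
  apply: (measurableT_comp mf); apply: measurable_funM; first exact: measurable_cst.
  apply: (eq_measurable_fun (fun v : m.+1.-tuple R => tnth v ord0)).
    by move=> v _; rewrite (tnth_nth 0).
  exact: measurable_tnth.
have G0 l : 0 <= G l by exact: f0.
transitivity (iid_int N 1 G); last first.
  rewrite iid_intS//; apply: eq_integral => x _; rewrite iid_int0//.
  exact: measurable_seqfun_cons.
rewrite -(@increments_iid u 1 G s0)//; last by case.
apply: eq_integral => w _; rewrite /G/= mulrCA divff ?mulr1// sqrtr_eq0.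
by rewrite -ltNge subr_gt0.
Qed.

End continuous_brownian_motion.

(** * Independence of Euler schemes over consecutive intervals *)

Section blocks.
Context d (T : measurableType d) (R : realType) (P : probability T R).
Variables (rho gamma : R).
Hypotheses (rho0 : 0 < rho) (gamma1 : 1 <= gamma).
Variable W : R -> T -> R.
Hypothesis cW : continuous_bm P W.
Local Notation N01 := (@std_normal R).
Local Notation euler := (euler rho0 gamma1).

Lemma measurable_euler d' (S : measurableType d') dt (h0 : S -> R) (X : nat -> S -> R) m :
  0 <= dt -> measurable_fun setT h0 -> (forall i, (i < m)%N -> measurable_fun setT (X i)) ->
  measurable_fun setT (fun w => euler dt (h0 w) (mkseq (X ^~ w) m)).
Proof.
move=> dt0 mh0; elim: m => [|m IH] mX; first exact: mh0.
rewrite (_ : (fun w => _) = fun w => resolvent rho0 gamma1 dt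
    (euler dt (h0 w) (mkseq (X ^~ w) m) + Num.sqrt dt * X m w)); last first.
  by apply/funext => w; rewrite mkseqS /euler -cats1 foldl_cat.
apply: measurableT_comp; first by apply: continuous_measurable_fun; exact: continuous_resolvent.
apply: measurable_funD; first by apply: IH => i im; apply: mX; exact: ltnW.
by apply: measurable_funM; [exact: measurable_cst|exact: mX].
Qed.

Lemma measurable_seqfun_euler dt x : 0 <= dt -> measurable_seqfun (euler dt x).
Proof.
move=> dt0 m; rewrite (_ : (fun u : m.-tuple R => _) =
    fun u : m.-tuple R => euler dt x (mkseq (fun i => nth 0 u i) m)); last first.
  by apply/funext => u; rewrite -{1}(mkseq_nth 0 u) size_tuple.
apply: measurable_euler => // i im.
apply: (eq_measurable_fun (fun u : m.-tuple R => tnth u (Ordinal im))); last exact: measurable_tnth.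
by move=> u _; rewrite (tnth_nth 0).
Qed.

Lemma cvg_prodR (U : Type) (F : set_system U) (I : finType) (f : I -> U -> R)
    (l : I -> R) : Filter F -> (forall i, f i x @[x --> F] --> l i) ->
  \prod_i f i x @[x --> F] --> \prod_i l i.
Proof.
move=> FF h; elim: (index_enum I) => [|i s IH].
  by rewrite big_nil; under eq_fun do rewrite big_nil; exact: cvg_cst.
by rewrite big_cons; under eq_fun do rewrite big_cons; exact: cvgM.
Qed.

Lemma take_drop_mkseq (X : nat -> R) j n N : (j < n)%N ->
  take N (drop (j * N) (mkseq X (n * N))) = mkseq (fun i => X (j * N + i)%N) N.
Proof.
move=> jn; have le : (N <= n * N - j * N)%N by rewrite -mulnBl leq_pmull// subn_gt0.
apply: (@eq_from_nth _ 0); first by rewrite size_takel ?size_drop !size_mkseq.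
move=> i; rewrite size_takel ?size_drop ?size_mkseq// => iN.
rewrite nth_take// nth_drop !nth_mkseq//.
by rewrite -ltn_subRL (leq_trans iN).
Qed.

Definition subinterval_increments (u : nat -> R) N (w : R -> R) j :=
  mkseq (fun i => (w (u j + i.+1%:R * ((u j.+1 - u j) / N.+1%:R))
      - w (u j + i%:R * ((u j.+1 - u j) / N.+1%:R))) / Num.sqrt ((u j.+1 - u j) / N.+1%:R)) N.+1.

(** The subdivisions of consecutive intervals form a single grid, whose
    increments are independent. *)
Lemma expectation_grid (u : nat -> R) N n (G : seq R -> R) : 0 <= u 0%N ->
  (forall j, (j < n)%N -> u j < u j.+1) -> (forall s, 0 <= G s) -> measurable_seqfun G ->
  (\int[P]_w (G (mkseq (fun k => nth 0%R (subinterval_increments u N (W ^~ w) (k %/ N.+1)%N)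
      (k %% N.+1)%N) (n * N.+1)%N))%:E = iid_int N01 (n * N.+1) G)%E.
Proof.
move=> u0 umono G0 mG.
pose dl j := (u j.+1 - u j) / N.+1%:R.
pose grid k := u (k %/ N.+1)%N + (k %% N.+1)%N%:R * dl (k %/ N.+1)%N.
have gridE j i : (i <= N.+1)%N -> grid (j * N.+1 + i)%N = u j + i%:R * dl j.
  rewrite leq_eqVlt => /predU1P[->|iN].
    rewrite -mulSnr /grid mulnK// modnMl mul0r addr0 /dl mulrC divfK ?pnatr_eq0//.
    by rewrite addrC subrK.
  by rewrite /grid divnMDl// divn_small// addn0 modnMDl modn_small.
have km k : (k %% N.+1 < N.+1)%N by rewrite ltn_mod.
have grid1 k : grid k.+1 = u (k %/ N.+1)%N + (k %% N.+1).+1%:R * dl (k %/ N.+1)%N.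
  by rewrite {1}(divn_eq k N.+1) -addnS gridE.
have gridS k : grid k.+1 - grid k = dl (k %/ N.+1)%N.
  rewrite grid1 /grid.
  by rewrite -natr1; set x := dl _; set y := u _; set z := (_ %:R); lra.
have dl0 j : (j < n)%N -> 0 < dl j by move=> jn; rewrite divr_gt0// subr_gt0 umono.
rewrite -(@increments_iid _ _ _ P W cW grid)//.
- apply: eq_integral => w _; congr (G _)%:E; apply/eq_in_map => k _.
  by rewrite gridS nth_mkseq// grid1.
- by rewrite /grid div0n mod0n mul0r addr0.
- by move=> k kn; rewrite -subr_gt0 gridS; apply: dl0; rewrite ltn_divLR.
Qed.

Lemma expectation_blocks (u : nat -> R) N n (G : nat -> seq R -> R) : 0 <= u 0%N ->
  (forall j, (j < n)%N -> u j < u j.+1) ->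
  (forall j s, 0 <= G j s) -> (forall j, measurable_seqfun (G j)) ->
  (\int[P]_w (\prod_(j < n) G j (subinterval_increments u N (W ^~ w) j))%:E =
   \prod_(j < n) iid_int N01 N.+1 (G j))%E.
Proof.
move=> u0 umono G0 mG; rewrite -iid_int_blocks// -(expectation_grid _ u0 umono).
- apply: eq_integral => w _; congr (_%:E); apply: eq_bigr => j _; congr (G j _).
  rewrite take_drop_mkseq//; apply: (@eq_from_nth _ 0); first by rewrite !size_mkseq.
  move=> i; rewrite size_mkseq => iN.
  by rewrite [RHS]nth_mkseq// divnMDl// divn_small// addn0 modnMDl modn_small.
- by move=> s; apply: prodr_ge0.
- move=> p; apply: measurable_prod => j _.
  by have := measurable_seqfun_drop (j * N.+1) (measurable_seqfun_take N.+1 (mG j)); exact.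
Qed.

(** An iterated normal integral, which depends on no probability space: this is
    what makes the laws of endpoints over different intervals comparable. *)
Definition euler_expectation L (g : R -> R) N :=
  fine (iid_int N01 N.+1 (fun s => g (euler (L / N.+1%:R) 0 s))).

Definition rescaled_path (s c : R) (w : R -> R) := fun x => w (s + c ^+ 2 * x) / c.

Lemma scaled_increments_rescaled (u : nat -> R) N j w L c : 0 < L -> 0 < c ->
  c ^+ 2 * L = u j.+1 - u j ->
  scaled_increments (rescaled_path (u j) c w) (L / N.+1%:R) N.+1 = subinterval_increments u N w j.
Proof.
move=> L0 c0 E; apply/eq_in_map => i _; rewrite -E /rescaled_path -mulrBl -mulrA -invfM.
congr (_ / _).
  by congr (w _ - w _); congr (_ + _); rewrite mulrCA; congr (_ * _); rewrite mulrA.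
by rewrite -mulrA [RHS]sqrtrM ?sqr_ge0// sqrtr_sqr gtr0_norm.
Qed.

(** The scheme converges along every path, and its endpoints over consecutive
    intervals are functions of disjoint blocks of independent increments. *)
Lemma cvg_euler_blocks (u c : nat -> R) n L (h : nat -> T -> R -> R) (g : nat -> R -> R) :
  0 < L -> 0 <= u 0%N -> (forall j, (j < n)%N -> 0 < c j) ->
  (forall j, (j < n)%N -> c j ^+ 2 * L = u j.+1 - u j) ->
  (forall j w, (j < n)%N -> [/\ continuous (h j w), h j w 0 = 0 &
     solves rho gamma (fun=> 1) (rescaled_path (u j) (c j) (W ^~ w)) (h j w) 0 L]) ->
  (forall j, continuous (g j)) -> (forall j x, 0 <= g j x <= 1) ->
  \prod_(j < n) euler_expectation L (g j) N @[N --> \oo] -->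
    \int[P]_w (\prod_(j < n) g j (h j w L)).
Proof.
move=> L0 u0 c0 cL hh cg g01.
have dt0 N : 0 <= L / N.+1%:R by rewrite divr_ge0// ltW.
have umono j : (j < n)%N -> u j < u j.+1.
  by move=> jn; rewrite -subr_gt0 -cL// mulr_gt0// exprn_gt0// c0.
pose X j N w := euler (L / N.+1%:R) 0 (subinterval_increments u N (W ^~ w) j).
have mg j : measurable_fun setT (g j) by apply: continuous_measurable_fun; exact: cg.
have mG N j : measurable_seqfun (fun s => g j (euler (L / N.+1%:R) 0 s)).
  by move=> m; apply: (measurableT_comp (mg j)); exact: (measurable_seqfun_euler 0 (dt0 N)).
have G0 N j s : 0 <= g j (euler (L / N.+1%:R) 0 s) by case/andP: (g01 j (euler (L / N.+1%:R) 0 s)).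
have p01 (x : nat -> R) : 0 <= \prod_(j < n) g j (x j) <= 1.
  apply/andP; split; first by apply: prodr_ge0 => j _; case/andP: (g01 j (x j)).
  by apply: Num.Theory.prodr_ile1 => j _.
have [mW _ _ _] := cW.
have mX j N : measurable_fun setT (X j N).
  apply: measurable_euler => // i _.
  by apply: measurable_funM; [exact: measurable_funB|exact: measurable_cst].
have E N : \prod_(j < n) euler_expectation L (g j) N = \int[P]_w (\prod_(j < n) g j (X j N w)).
  have := expectation_blocks N u0 umono (G0 N) (mG N).
  have fin j : (iid_int N01 N.+1 (fun s => g j (euler (L / N.+1%:R) 0 s)) =
      (euler_expectation L (g j) N)%:E)%E.
    rewrite fineK// ge0_fin_numE; last exact: iid_int_ge0.
    apply: (@le_lt_trans _ _ 1%:E); last exact: ltry.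
    rewrite -(iid_int1 N01 N.+1) ge0_le_integral//.
    - by move=> s _; rewrite lee_fin.
    - by apply/measurable_EFinP; exact: mG.
    - by move=> s _; rewrite lee_fin; case/andP: (g01 j (euler (L / N.+1%:R) 0 s)).
  rewrite (eq_bigr (fun j : 'I_n => (euler_expectation L (g j) N)%:E))//.
  by rewrite prodEFin /Rintegral => ->.
rewrite (_ : (fun N => _) = fun N => \int[P]_w (\prod_(j < n) g j (X j N w))); last first.
  by apply/funext.
apply: (bounded_cvg_expectation (C := 1)).
- by move=> N; apply: measurable_prod => j _; apply: (measurableT_comp (mg j)); exact: mX.
- by move=> N w; have /andP[p0 p1] := p01 (fun j => X j N w); rewrite ger0_norm.
move=> w; apply: cvg_prodR => j.
have [ch h0 sh] := hh j w (ltn_ord j).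
apply: (cvg_comp _ (g j)); last exact: (cg j).
have := cvg_euler rho0 gamma1 ch L0 sh; rewrite h0.
by under eq_fun do rewrite scaled_increments_rescaled ?c0 ?cL//.
Qed.

End blocks.

(** * Convergence to the invariant law *)

Section laws_and_expectations.
Context {R : realType}.

Section equal_laws.
Context d1 d2 d (T1 : measurableType d1) (T2 : measurableType d2)
  (S : measurableType d) (P1 : probability T1 R) (P2 : probability T2 R)
  (X1 : T1 -> S) (X2 : T2 -> S).
Hypotheses (m1 : measurable_fun setT X1) (m2 : measurable_fun setT X2)
  (e12 : forall A, measurable A -> P1 (X1 @^-1` A) = P2 (X2 @^-1` A)).

Lemma eq_law_ge0_integral (f : S -> \bar R) : measurable_fun setT f -> (forall x, 0 <= f x)%E ->
  (\int[P1]_w f (X1 w) = \int[P2]_w f (X2 w))%E.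
Proof.
move=> mf f0; have f0' : {in [set: S], forall x, (0 <= f x)%E} by move=> x _.
have := @ge0_integral_pushforward _ _ _ _ _ _ m1 P1 setT _ measurableT mf f0'.
have := @ge0_integral_pushforward _ _ _ _ _ _ m2 P2 setT _ measurableT mf f0'.
rewrite !preimage_setT => /= <- <-.
apply: (eq_measure_integral (measure_function_pushforward__canonical__measure_function_Measure P2 m2)).
by move=> A mA _; exact: e12.
Qed.

Lemma eq_law_integral (f : S -> \bar R) : measurable_fun setT f ->
  (\int[P1]_w f (X1 w) = \int[P2]_w f (X2 w))%E.
Proof.
move=> mf; change (\int[P1]_w (f \o X1) w = \int[P2]_w (f \o X2) w)%E.
rewrite integralE [RHS]integralE; congr (_ - _)%E.
  rewrite [in LHS]funepos_comp [in RHS]funepos_comp; apply: (eq_law_ge0_integral (f := f^\+%E)); [exact: measurable_funepos|exact: funepos_ge0].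
rewrite [in LHS]funeneg_comp [in RHS]funeneg_comp; apply: (eq_law_ge0_integral (f := f^\-%E)); [exact: measurable_funeneg|exact: funeneg_ge0].
Qed.

Lemma eq_law_expectation (g : S -> R) : measurable_fun setT g ->
  \int[P1]_w g (X1 w) = \int[P2]_w g (X2 w).
Proof.
move=> mg; rewrite /Rintegral; congr fine.
by apply: (eq_law_integral (f := fun x => (g x)%:E)); apply/measurable_EFinP.
Qed.

End equal_laws.

Context d (T : measurableType d) (P : probability T R).
Implicit Types (f g : T -> R).

Lemma dist_expectation_le f g (A : set T) e : measurable_fun setT f -> measurable_fun setT g ->
  measurable A -> 0 <= e -> (forall w, `|f w| <= 1) -> (forall w, `|g w| <= 1) ->
  (forall w, ~ A w -> `|f w - g w| <= e) ->
  `|\int[P]_w f w - \int[P]_w g w| <= e + 2 * fine (P A).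
Proof.
move=> mf mg mA e0 f1 g1 fg.
apply: (le_trans (Rint_distB P mf mg f1 g1)).
have mind : measurable_fun setT (\1_A : T -> R) by exact: measurable_indic.
have mi1 (i : 'I_1) : measurable_fun setT (\1_A : T -> R) by [].
have i1 (i : 'I_1) (w : T) : `|\1_A w : R| <= 1 by rewrite indicE; case: (_ \in _); rewrite ?normr1 ?normr0.
have := @Rint_affine _ _ _ P 'I_1 e (fun=> 2) (fun=> \1_A) 1 mi1 i1.
rewrite big_ord1 Rint_indic// => <-.
apply: (@Rint_le _ _ _ P _ _ (e + 2)).
- by apply: measurableT_comp => //; exact: measurable_funB.
- apply: measurable_funD; first exact: measurable_cst.
  apply: measurable_sum => i; apply: measurable_funM; [exact: measurable_cst|exact: mi1].
- move=> w; rewrite normr_id (le_trans (ler_normB _ _))//.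
  by rewrite (le_trans (lerD (f1 w) (g1 w)))// -[1 + 1]/(2%:R) lerDr.
- move=> w; rewrite big_ord1 ger0_norm; last by rewrite addr_ge0// mulr_ge0.
  by rewrite lerD2l -[leRHS]mulr1 ler_wpM2l// (le_trans (ler_norm _))// (i1 ord0).
- move=> w; rewrite big_ord1 indicE; have [Aw|nAw] := boolP (w \in A).
    rewrite mulr1 (le_trans (ler_normB _ _))// (le_trans (lerD (f1 w) (g1 w)))//.
    by rewrite -[1 + 1]/(2%:R) lerDr.
  by rewrite mulr0 addr0; apply: fg => Aw; move/negP: nAw; apply; exact: mem_set.
Qed.

End laws_and_expectations.

Section stationary.
Context {R : realType} (rho gamma : R).
Hypotheses (rho0 : 0 < rho) (gamma1 : 1 <= gamma).
Local Notation F := (drift rho gamma).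
Local Notation mu := (@lebesgue_measure R).
Local Notation I f a b := (\int[mu]_(x in `[a, b]) (f x)).

(** Chosen classically; [solves_unique] makes the choice immaterial. *)
Definition solution (w : R -> R) (cw : continuous w) (x : R) : R -> R :=
  projT1 (cid (exists_solution rho0 gamma1 x cw)).

Lemma solutionP w (cw : continuous w) x : [/\ continuous (solution cw x), solution cw x 0 = x &
  forall L, solves rho gamma (fun=> 1) w (solution cw x) 0 L].
Proof. by rewrite /solution; case: cid. Qed.

Lemma measurable_solution d (S : measurableType d) (W : R -> S -> R)
    (cW : forall w, continuous (W ^~ w)) (x : S -> R) t : 0 <= t ->
  (forall s, measurable_fun setT (W s)) -> measurable_fun setT x ->
  measurable_fun setT (fun w => solution (cW w) (x w) t).
Proof.
rewrite le_eqVlt => /predU1P[<-|t0] mW mx.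
  rewrite (_ : (fun w => _) = x)//; apply/funext => w.
  by have [_ -> _] := solutionP (cW w) (x w).
have dt0 N : 0 <= t / N.+1%:R by rewrite divr_ge0// ltW.
apply: (@measurable_fun_cvg _ _ _ setT (fun N w => euler rho0 gamma1 (t / N.+1%:R) (x w)
   (scaled_increments (W ^~ w) (t / N.+1%:R) N.+1))).
  move=> N; apply: measurable_euler => // i _.
  by apply: measurable_funM; [exact: measurable_funB|exact: measurable_cst].
move=> w _; have [ch h0 sh] := solutionP (cW w) (x w).
by rewrite -{1}h0; apply: cvg_euler.
Qed.

Lemma solution_contraction w (cw : continuous w) x eta L : 0 <= L -> 0 < eta ->
  `|solution cw x L - solution cw 0 L| <= eta + expR (- (decay_rate rho gamma eta * L)) * `|x|.
Proof.
move=> L0 eta0; have [cH H0 sH] := solutionP cw x; have [ch h0 sh] := solutionP cw 0.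
have := @solves_dist _ rho gamma rho0 gamma1 (fun=> 1) w _ _ L 1 0 eta (@cont_cst _ 1) cH ch L0 ler01 eta0.
rewrite H0 h0 subr0 mul0r addr0 mul1r; apply => //.
by move=> u _; rewrite subrr normr0.
Qed.

Section product_space.
Context d (T : measurableType d) (P : probability T R) (Pi : probability R R).
Variable W : R -> T -> R.
Hypothesis cW : continuous_bm P W.

Let Q : probability (T * R)%type R := [the probability _ _ of (P \x Pi)%E].

Let QX A B : measurable A -> measurable B -> Q (A `*` B) = (P A * Pi B)%E.
Proof. by move=> mA mB; rewrite /Q/= product_measure1E. Qed.

Let Qfst A : measurable A -> Q (fst @^-1` A) = P A.
Proof.
move=> mA; rewrite -setXT QX//; have := probability_setT Pi => /= ->; exact: mule1.
Qed.

Let Qsnd B : measurable B -> Q (snd @^-1` B) = Pi B.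
Proof.
move=> mB; rewrite -setTX QX//; have := probability_setT P => /= ->; exact: mul1e.
Qed.

Let W0 t (p : T * R) := W t p.1 - W 0 p.1.

Let mW0 t : measurable_fun setT (W0 t).
Proof.
have [mW _ _ _] := cW; apply: measurable_funB; apply: measurableT_comp => //; exact: measurable_fst.
Qed.

Let WR t : {RV Q >-> R} := mfun_Sub (mem_set (mW0 t)).

Let brownian_motion_W0 : brownian_motion WR.
Proof.
have [mW pW incr indep] := cW; split.
- by apply: aeW => p /=; rewrite /W0 subrr.
- apply: aeW => p; apply: continuous_subspaceT; apply: contB; [exact: pW|exact: cont_cst].
- move=> s t s0 st A mA; rewrite -(incr s t s0 st A mA).
  rewrite -Qfst; last first.
    rewrite -[X in measurable X]setTI.
    by have := measurable_funB (mW t) (mW s); apply.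
  congr (Q _); apply/seteqP; split=> p /=; rewrite /W0 opprB addrA subrK//.
- move=> n t t0 tm A mA.
  have E (i : 'I_n) : (fun w => WR (t i.+1) w - WR (t i) w) @^-1` A i =
      fst @^-1` ((fun w => W (t i.+1) w - W (t i) w) @^-1` A i).
    by apply/seteqP; split=> p /=; rewrite /W0 opprB addrA subrK.
  have mB (i : 'I_n) : measurable ((fun w => W (t i.+1) w - W (t i) w) @^-1` A i).
    rewrite -[X in measurable X]setTI.
    by have := measurable_funB (mW (t i.+1)) (mW (t i)); apply.
  transitivity (Q (fst @^-1` (\bigcap_(i in [set: 'I_n]) ((fun w => W (t i.+1) w - W (t i) w) @^-1` A i)))).
    congr (Q _); apply/seteqP; split=> p /= h i iT; have := h i iT;
      by rewrite /= /W0 opprB addrA subrK.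
  rewrite Qfst; last exact: fin_bigcap_measurable.
  by rewrite indep//; apply: eq_bigr => i _; rewrite E Qfst.
Qed.

Let pW : forall p : T * R, continuous (fun t => W t p.1).
Proof. by move=> p; have [_ + _ _] := cW; apply. Qed.

Let Ht t (p : T * R) := solution (@pW p) p.2 (maxr 0 t).

Let mHt t : measurable_fun setT (Ht t).
Proof.
have [mW _ _ _] := cW; apply: (@measurable_solution _ _ (fun t p => W t p.1)).
- by rewrite le_max lexx.
- by move=> s; apply: measurableT_comp => //; exact: measurable_fst.
- exact: measurable_snd.
Qed.

Let HR t : {RV Q >-> R} := mfun_Sub (mem_set (mHt t)).

Let HR0 p : HR 0 p = p.2.
Proof. by rewrite /= /Ht maxxx; have [_ -> _] := solutionP (@pW p) p.2. Qed.

Let independent_H0 : independent_of_process Q (HR 0) (fun t => WR t).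
Proof.
move=> A E mA sE.
have [E' mE' EE] : exists2 E', measurable E' & E = fst @^-1` E'.
  move: E sE; apply: smallest_sub => /=.
    split=> //.
    - by exists set0 => //; rewrite preimage_set0.
    - move=> B [B' mB' ->]; exists (~` B'); first exact: measurableC.
      by rewrite setTD preimage_setC.
    - move=> B hB; pose B' i := projT1 (cid2 (hB i)).
      exists (\bigcup_i B' i).
        by apply: bigcup_measurable => i _; rewrite /B'; case: (cid2 _).
      rewrite preimage_bigcup; apply: eq_bigcupr => i _.
      by rewrite /B'; case: (cid2 _).
  move=> B [t _ [C mC <-]]; exists ((fun w => W t w - W 0 w) @^-1` C).
    have [mW _ _ _] := cW; rewrite -[X in measurable X]setTI.
    by have := measurable_funB (mW t) (mW 0); apply.
  by rewrite setTI.
have -> : HR 0 @^-1` A = snd @^-1` A.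
  by apply/seteqP; split=> p; rewrite /preimage/mkset HR0.
rewrite EE setIC (_ : _ `&` _ = E' `*` A)//.
by rewrite QX// Qsnd// Qfst// muleC.
Qed.

Let sde_H : sde_solution WR HR (fun=> F) 0.
Proof.
apply: aeW => p; have [cH H0 sH] := solutionP (@pW p) p.2; split.
  apply: continuous_subspaceT; have := cont_comp (cont_max (@cont_cst _ 0) (@cont_id _)) cH.
  exact.
move=> t t0; have := sH t t; rewrite t0 lexx => /(_ isT); rewrite /= /Ht/= maxxx max_r// => ->.
rewrite /W0 subrr subr0; congr (_ - _); apply: eq_int => s /andP[s0 _].
by rewrite mul1r max_r.
Qed.

(** On the product space [Q] the solution with an independent starting point of
    law [Pi] has law [Pi] at all times by invariance, and the solution from 0
    driven by the same path merges with it. *)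
Lemma invariant_law_limit (g : R -> R) K e : invariant_law F Pi ->
  (forall x, 0 <= g x <= 1) -> 0 <= K -> (forall x y, `|g x - g y| <= K * `|x - y|) ->
  continuous g -> 0 < e ->
  exists2 L0, 0 < L0 & forall L, L0 <= L -> exists2 l,
    euler_expectation rho0 gamma1 L g N @[N --> \oo] --> l &
    0 <= l <= 1 /\ `|l - \int[Pi]_x g x| <= e.
Proof.
move=> inv g01 K0 gK cg e0.
have [mW pW' _ _] := cW.
have mg : measurable_fun setT g by exact: continuous_measurable_fun.
have [M M0 PM] := @tight_rv _ _ _ Pi id (e / 8) (@measurable_id _ _ _) (divr_gt0 e0 (ltr0n _ 8)).
pose eta := e / (4 * (K + 1)).
have K1 : 0 < 4 * (K + 1) by rewrite mulr_gt0// ltr_wpDl.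
have eta0 : 0 < eta by rewrite divr_gt0.
pose c := decay_rate rho gamma eta.
have c0 : 0 < c by exact: decay_rate_gt0.
(* From this time on two solutions that start at distance [M] are at distance
   at most [2 * eta]. *)
exists (M / (c * eta)); first by rewrite divr_gt0// mulr_gt0.
move=> L L0.
have Lpos : 0 < L by rewrite (lt_le_trans _ L0)// divr_gt0// mulr_gt0.
have decay : expR (- (c * L)) * M <= eta.
  rewrite expRN -ler_pdivlMl ?invr_gt0 ?expR_gt0// invrK.
  have cL : c * L <= expR (c * L) by rewrite (le_trans _ (expR_ge1Dx _))// lerDr.
  have ce : 0 < c * eta by exact: mulr_gt0.
  have LM : M <= L * (c * eta) by rewrite -(ler_pdivrMr _ _ ce).
  rewrite (le_trans LM)// mulrA; apply: ler_wpM2r; first exact: ltW.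
  by rewrite mulrC.
have g1 x : `|g x| <= 1 by case/andP: (g01 x) => h0 h1; rewrite ger0_norm.
have g0 x : 0 <= g x by case/andP: (g01 x).
have mh : measurable_fun setT (fun w => solution (pW' w) 0 L).
  by apply: (@measurable_solution _ _ W pW' (fun=> 0)) => //; exact: ltW.
exists (\int[P]_w g (solution (pW' w) 0 L)).
  have := @cvg_euler_blocks _ _ _ P _ _ rho0 gamma1 W cW (fun k => k%:R * L) (fun=> 1) 1 L
    (fun _ w => solution (pW' w) 0) (fun=> g) Lpos.
  have -> : (fun N => \prod_(j < 1) euler_expectation rho0 gamma1 L g N) =
      euler_expectation rho0 gamma1 L g by apply/funext => N; rewrite big_ord1.
  have -> : (fun w => \prod_(j < 1) g (solution (pW' w) 0 L)) =
      fun w => g (solution (pW' w) 0 L) by apply/funext => w; rewrite big_ord1.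
  rewrite mul0r.
  apply => //.
  - by case=> // _; rewrite expr1n !mul1r mul0r subr0.
  - case=> // w _; have [ch h0 sh] := solutionP (pW' w) 0; split=> //.
    rewrite (_ : rescaled_path _ _ _ = W ^~ w); first exact: sh.
    by apply/funext => x; rewrite /rescaled_path mul0r add0r expr1n mul1r divr1.
have mg1 : measurable_fun setT (fun w => g (solution (pW' w) 0 L)) by exact: measurableT_comp.
split.
  rewrite Rintegral_ge0//= -[leRHS](@Rint_cst _ _ _ P 1).
  by apply: (@Rint_le _ _ _ P _ _ 1) => // w; rewrite ?normr1//; case/andP: (g01 (solution (pW' w) 0 L)).
(* This is where the invariance of [Pi] enters. *)
have E1 : \int[Q]_p g (HR L p) = \int[Pi]_x g x.
  apply: (@eq_law_expectation _ _ _ _ _ _ _ Q Pi (HR L) id) => //.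
  move=> A mA; apply: (inv _ _ Q WR HR) => // [B mB|].
    by rewrite -(Qsnd mB); congr (Q _); apply/seteqP; split=> p; rewrite /preimage/mkset HR0.
  exact: ltW.
have E2 : \int[Q]_p g (solution (pW' p.1) 0 L) = \int[P]_w g (solution (pW' w) 0 L).
  apply: (@eq_law_expectation _ _ _ _ _ _ _ Q P fst id _ _ _ (fun w => g (solution (pW' w) 0 L))) => //.
rewrite -E1 -E2.
apply: (@le_trans _ _ (e / 2 + 2 * fine (Q (snd @^-1` [set x : R | M < `|x|])))).
  have mA : measurable [set x : R | M < `|x|] by exact: measurable_abs_gt.
  apply: dist_expectation_le => //.
  - apply: (measurableT_comp mg); apply: (measurableT_comp mh); exact: measurable_fst.
  - apply: (measurableT_comp mg); exact: measurable_funPT.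
  - by rewrite -[X in measurable X]setTI; apply: measurable_snd.
  - by rewrite divr_ge0// ltW.
  - move=> [w x] /= /negP; rewrite -leNgt => xM.
    rewrite distrC (le_trans (gK _ _))//.
    have -> : Ht L (w, x) = solution (pW' w) x L.
      by rewrite /Ht/= max_r ?ltW// (Prop_irrelevance (@pW (w, x)) (pW' w)).
    rewrite (@le_trans _ _ (K * (eta + eta)))//.
      apply: ler_wpM2l => //; rewrite (le_trans (solution_contraction _ _ (ltW Lpos) eta0))//.
      by rewrite lerD2l (le_trans _ decay)// ler_wpM2l// expR_ge0.
    have -> : K * (eta + eta) = (K / (K + 1)) * (e / 2).
      rewrite /eta; field; by rewrite gt_eqF// ltr_wpDl.
    have e2 : 0 <= e / 2 by rewrite divr_ge0// ltW.
    rewrite -[leRHS]mul1r; apply: ler_wpM2r => //.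
    by rewrite ler_pdivrMr ?ltr_wpDl// mul1r lerDl.
rewrite Qsnd; last exact: measurable_abs_gt.
have : fine (Pi [set x : R | M < `|x|]) <= e / 8.
  rewrite -lee_fin fineK//; apply: fin_num_measure; exact: measurable_abs_gt.
by set p := fine _; lra.
Qed.

End product_space.
End stationary.

(** * The a priori bound of the velocity *)

Section power_functions.
Context {R : realType}.
Implicit Types (x p e a : R).

Lemma powR_near1 p e : 0 < e -> exists2 dl, 0 < dl <= 1 / 2 &
  forall x, 1 - dl <= x <= 1 -> `|x `^ p - 1| <= e.
Proof.
move=> e0.
have : y `^ p @[y --> (1 : R)] --> (1 : R) `^ p.
  have E : \forall y \near (1 : R), expR (p * ln y) = y `^ p.
    near=> y; rewrite /powR gt_eqF//; near: y; exact: lt_nbhsr.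
  apply: (cvg_trans (near_eq_cvg E)); rewrite powR1.
  have h : expR (p * ln y) @[y --> (1 : R)] --> expR (p * ln (1 : R)).
    apply: (cvg_comp _ expR); last exact: continuous_expR.
    apply: cvgM; first exact: cvg_cst.
    exact: (@continuous_ln _ 1 ltr01).
  by rewrite ln1 mulr0 expR0 in h.
rewrite powR1 => /cvgrPdist_le/(_ e e0)[r /= r0 h].
exists (minr (r / 2) (1 / 2)).
  by rewrite lt_min !divr_gt0//= ge_min lexx orbT.
move=> x /andP[x1 x2]; rewrite distrC; apply: h => /=.
rewrite ger0_norm ?subr_ge0//.
have : minr (r / 2) (1 / 2) <= r / 2 by rewrite ge_min lexx.
by move: x1; set m := minr _ _; lra.
Unshelve. all: by end_near. Qed.

Lemma powR_neg_small p e : p < 0 -> 0 < e -> exists2 a, 0 < a & forall x, a <= x -> x `^ p <= e.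
Proof.
move=> p0 e0; exists (e `^ p^-1); first exact: powR_gt0.
move=> x ax; have x0 : 0 < x by rewrite (lt_le_trans _ ax)// powR_gt0.
rewrite -[p]opprK powRN -[leRHS]invrK lef_pV2 ?posrE ?invr_gt0 ?powR_gt0//.
have -> : e^-1 = (e `^ p^-1) `^ (- p).
  by rewrite -powRrM mulrN mulVf ?lt_eqF// powRN powRr1// ltW.
by apply: ge0_ler_powR; rewrite ?nnegrE ?oppr_ge0// ltW// powR_gt0.
Qed.

End power_functions.

Section expectations.
Context d (T : measurableType d) (R : realType) (P : probability T R).
Local Notation Ex f := (\int[P]_w (f w)%:E)%E.

(** Pathwise estimates below bound a distance by a linear combination of a
    noise, a starting value and a path integral; this transfers them to
    expectations. *)
Lemma expectation_linear_bound (f x y z : T -> R) (ex ey ez c k a : R) :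
  measurable_fun setT f -> measurable_fun setT x -> measurable_fun setT y -> measurable_fun setT z ->
  (forall w, 0 <= f w) -> (forall w, 0 <= x w) -> (forall w, 0 <= y w) -> (forall w, 0 <= z w) ->
  0 <= c -> 0 <= k -> 0 <= a ->
  (Ex x <= ex%:E)%E -> (Ex y <= ey%:E)%E -> (Ex z <= ez%:E)%E ->
  (forall w, f w <= x w + c + k * y w + a * z w) ->
  (Ex f <= (ex + c + k * ey + a * ez)%:E)%E.
Proof.
move=> mf mx my mz f0 x0 y0 z0 c0 k0 a0 Ex Ey Ez fle.
have mE (g : T -> R) : measurable_fun setT g -> measurable_fun setT (fun w => (g w)%:E).
  by move=> mg; apply/measurable_EFinP.
apply: (@le_trans _ _ (\int[P]_w ((x w)%:E + c%:E + k%:E * (y w)%:E + a%:E * (z w)%:E))%E).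
  apply: ge0_le_integral => //.
  - by move=> w _; rewrite lee_fin.
  - exact: mE.
  - apply: (mE (fun w => x w + c + k * y w + a * z w)).
    by repeat apply: measurable_funD => //; try apply: measurable_funM => //; exact: measurable_cst.
  - by move=> w _; rewrite -!EFinM -!EFinD lee_fin.
have pos (g : T -> R) : (forall w, 0 <= g w) -> forall w, [set: T] w -> (0 <= (g w)%:E)%E.
  by move=> g0 w _; rewrite lee_fin.
have mZ (r : R) (g : T -> R) : measurable_fun setT g -> measurable_fun setT (fun w => (r%:E * (g w)%:E)%E).
  move=> mg; under eq_fun do rewrite -EFinM; apply: mE; apply: measurable_funM => //; exact: measurable_cst.
rewrite !ge0_integralD//=; first last.
all: try by move=> w _; rewrite -?EFinM -?EFinD ?lee_fin ?addr_ge0 ?mulr_ge0.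
all: try by [exact: mE|exact: mZ].
all: try by (do ?apply: emeasurable_funD); first [exact: mE|exact: mZ|exact: measurable_cst].
rewrite !ge0_integralZl//=; [|exact: mE|exact: pos|exact: mE|exact: pos].
rewrite integral_cst//; have := probability_setT P => /= ->; rewrite mule1.
rewrite !EFinD !EFinM; apply: leeD; [apply: leeD; [exact: leeD|]|]; exact: lee_wpmul2l.
Qed.

End expectations.

Section moments.
Context d (T : measurableType d) (R : realType) (P : probability T R) (W : R -> T -> R).
Hypothesis cW : continuous_bm P W.
Variables (rho gamma : R).
Hypotheses (rho0 : 0 < rho) (gamma1 : 1 <= gamma).
Local Notation F := (drift rho gamma).
Local Notation Ex f := (\int[P]_w (f w)%:E)%E.

Definition normal_moment p : R := fine (\int[@std_normal R]_x (`|x| `^ p)%:E).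

Lemma normal_moment_ge0 p : 0 <= normal_moment p.
Proof. by apply: fine_ge0; apply: integral_ge0 => x _; rewrite lee_fin powR_ge0. Qed.

Let mpow p : measurable_fun [set: R] (fun x : R => `|x| `^ p).
Proof. exact: (measurableT_comp (measurable_powR p) (@normr_measurable _ _)). Qed.

Lemma expectation_increment_pow p s t : 0 <= p -> 0 <= s -> s <= t ->
  (Ex (fun w => (`|W t w - W s w| `^ p)%R) = (Num.sqrt (t - s) `^ p * normal_moment p)%:E)%E.
Proof.
move=> p0 s0 st.
rewrite (@increment_expectation _ _ _ _ _ cW (fun x => `|x| `^ p) s t s0 st); last 2 first.
- by move=> x; exact: powR_ge0.
- exact: mpow.
under eq_integral do rewrite normrM powRM// ger0_norm ?sqrtr_ge0// EFinM.
have mp : measurable_fun [set: R] (fun x => (`|x| `^ p)%:E) by apply/measurable_EFinP; exact: mpow.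
have p_ge0 (x : R) : [set: R] x -> (0 <= (`|x| `^ p)%:E)%E by move=> _; rewrite lee_fin powR_ge0.
rewrite ge0_integralZl// ?lee_fin ?powR_ge0//.
rewrite EFinM /normal_moment fineK// ge0_fin_numE; last first.
  by apply: integral_ge0 => x _; rewrite lee_fin powR_ge0.
rewrite ge0_integral_std_normal; [exact: normal_moment_finite| |].
- by apply/measurable_EFinP; exact: mpow.
- by move=> x; rewrite lee_fin powR_ge0.
Qed.

Lemma expectation_increment s t : 0 <= s -> s <= t ->
  (Ex (fun w => `|W t w - W s w|) = (Num.sqrt (t - s) * normal_moment 1)%:E)%E.
Proof.
move=> s0 st; have := expectation_increment_pow ler01 s0 st.
rewrite powRr1 ?sqrtr_ge0// => <-.
by apply: eq_integral => w _; rewrite powRr1.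
Qed.

Lemma expectation_drift_increment s t : 0 <= s -> s <= t ->
  (Ex (fun w => `|F (W t w - W s w)|) = (Num.sqrt (t - s) `^ gamma * (rho * normal_moment gamma))%:E)%E.
Proof.
move=> s0 st; have g0 : 0 <= gamma by rewrite (le_trans _ gamma1).
under eq_integral do rewrite norm_drift// drift_ge0E// EFinM.
have mf : measurable_fun setT (fun w => (`|W t w - W s w| `^ gamma)%:E).
  apply/measurable_EFinP; apply: (measurableT_comp (mpow gamma)).
  by have [mW _ _ _] := cW; exact: measurable_funB.
have f_ge0 w : [set: T] w -> (0 <= (`|W t w - W s w| `^ gamma)%:E)%E.
  by move=> _; rewrite lee_fin powR_ge0.
rewrite ge0_integralZl// ?lee_fin ?(ltW rho0)//.
by rewrite expectation_increment_pow// -EFinM mulrCA.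
Qed.

Lemma expectation_drift_integral s t : 0 <= s -> s <= t ->
  (Ex (fun w => \int[lebesgue_measure]_(u in `[s, t]) `|F (W u w - W s w)|) <=
   ((t - s) * (Num.sqrt (t - s) `^ gamma * (rho * normal_moment gamma)))%:E)%E.
Proof.
move=> s0 st; have [mW pW _ _] := cW.
have cF : continuous F by exact: continuous_drift.
have g0 : 0 <= gamma by rewrite (le_trans _ gamma1).
apply: (le_trans (@expectation_path_integral _ _ _ P (fun u w => `|F (W u w - W s w)|) s t
   (fun=> Num.sqrt (t - s) `^ gamma * (rho * normal_moment gamma)) st _ _ _ _ _)).
- move=> u; apply: measurableT_comp => //; apply: measurableT_comp.
    exact: continuous_measurable_fun.
  exact: measurable_funB.
- move=> w; have := continuous_norm (cont_comp (contB (pW w) (@cont_cst _ (W s w))) cF); exact.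
- by [].
- exact: cont_cst.
- move=> u /andP[su ut]; rewrite expectation_drift_increment// lee_fin ler_wpM2r//.
    by rewrite mulr_ge0 ?normal_moment_ge0// ltW.
  by apply: ge0_ler_powR; rewrite ?nnegrE ?sqrtr_ge0// ler_wsqrtr// lerB.
- by rewrite int_cst// mulrC.
Qed.

End moments.

Section a_priori.
Context d (T : measurableType d) (R : realType) (P : probability T R).
Variables (W U : R -> T -> R) (rho gamma beta q t0 v0 : R).
Hypotheses (rho0 : 0 < rho) (gamma1 : 1 <= gamma) (t00 : 0 < t0).
Hypotheses (qE : q = beta / (gamma + 1)) (q12 : q < 1 / 2).
Local Notation F := (drift rho gamma).
Local Notation Ex f := (\int[P]_w (f w)%:E)%E.

(** The time-dependent coefficient, extended continuously before [t0]. *)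
Definition coefficient (s : R) := (maxr t0 s) `^ (- beta).

Definition solution_paths := [/\ continuous_bm P W,
  forall t, measurable_fun setT (U t), forall w, continuous (U ^~ w),
  forall w, U t0 w = v0 &
  forall w t, t0 <= t -> solves rho gamma coefficient (W ^~ w) (U ^~ w) t0 t].

Hypothesis hU : solution_paths.

Lemma powR_addE x a b : 0 < x -> x `^ (a + b) = x `^ a * x `^ b :> R.
Proof. by move=> x0; rewrite powRD// (gt_eqF x0) implybT. Qed.

Lemma coefficient_scaled t u : 0 < t -> t0 <= u ->
  coefficient u = t `^ (- beta) * (u / t) `^ (- beta).
Proof.
move=> tpos u0; have upos : 0 < u by exact: lt_le_trans u0.
by rewrite /coefficient max_r// -powRM ?divr_ge0 ?(ltW tpos) ?(ltW upos)// mulrC divfK// gt_eqF.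
Qed.

Lemma decay_rateM k eta : 0 < k -> 0 < eta ->
  decay_rate rho gamma (k * eta) = k `^ (gamma - 1) * decay_rate rho gamma eta.
Proof.
move=> k0 eta0; have -> : decay_rate rho gamma (k * eta) = rho / 2 * (k * (eta / 2)) `^ (gamma - 1).
  by rewrite /decay_rate mulrA.
by rewrite powRM ?divr_ge0 ?(ltW k0) ?(ltW eta0)// mulrCA.
Qed.

Lemma continuous_max_pow p : continuous (fun s => (maxr t0 s) `^ p).
Proof.
move=> s; have m0 : 0 < maxr t0 s by rewrite lt_max t00.
have h : {for s, continuous (fun s => expR (p * ln (maxr t0 s)))}.
  apply: (@continuous_comp _ _ _ (fun s => p * ln (maxr t0 s)) expR); last exact: continuous_expR.
  apply: cvgM; first exact: cvg_cst.
  apply: (cvg_comp (maxr t0) (@ln R) (G := nbhs (maxr t0 s))); last exact: continuous_ln.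
  exact: (cont_max (@cont_cst _ t0) (@cont_id _)).
rewrite (_ : (fun s => _) = fun s => expR (p * ln (maxr t0 s)))//.
by apply/funext => x; rewrite /powR gt_eqF// lt_max t00.
Qed.

Lemma continuous_coefficient : continuous coefficient.
Proof. exact: continuous_max_pow. Qed.

(** The expectation of [window_bound] over a Brownian path. *)
Lemma window_expectation s t a0 a1 eta e : t0 <= s -> s <= t -> 0 <= a0 -> 0 < eta ->
  (forall u, s <= u <= t -> a0 <= coefficient u <= a1) -> 0 <= a1 ->
  (Ex (fun w => `|U s w|) <= e%:E)%E ->
  (Ex (fun w => `|U t w|) <= (Num.sqrt (t - s) * normal_moment 1 + eta +
     expR (- (a0 * decay_rate rho gamma eta * (t - s))) * e +
     a1 * ((t - s) * (Num.sqrt (t - s) `^ gamma * (rho * normal_moment gamma))))%:E)%E.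
Proof.
move=> ts st a00 eta0 ha a10 Ue; have [cW mU cU U0 eqU] := hU; have [mW pW _ _] := cW.
have s0 : 0 <= s by rewrite (le_trans (ltW t00)).
have cF : continuous F by exact: continuous_drift.
apply: (@expectation_linear_bound _ _ _ P _ (fun w => `|W t w - W s w|) (fun w => `|U s w|)
   (fun w => \int[lebesgue_measure]_(u in `[s, t]) `|F (W u w - W s w)|)) => //.
- exact: measurableT_comp.
- by apply: measurableT_comp => //; exact: measurable_funB.
- exact: measurableT_comp.
- apply: (measurable_path_integral (Y := fun u w => `|F (W u w - W s w)|)) => //.
    move=> u; apply: measurableT_comp => //; apply: measurableT_comp.
      exact: continuous_measurable_fun.
    exact: measurable_funB.
  by move=> w; have := continuous_norm (cont_comp (contB (pW w) (@cont_cst _ (W s w))) cF); exact.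
- by move=> w; apply: int_ge0.
- exact: ltW.
- by rewrite (expectation_increment cW).
- exact: expectation_drift_integral.
- move=> w; have := @window_bound _ rho gamma rho0 gamma1 coefficient (W ^~ w) (U ^~ w) s t a0 a1 eta.
  apply => //; first exact: continuous_coefficient.
  apply: solvesS (eqU w t (le_trans ts st)) => //; exact: continuous_coefficient.
Qed.

(** A single window starting at [t0] gives a bound that is only locally
    uniform. *)
Lemma crude_bound t1 : t0 <= t1 -> exists2 C, 0 <= C & forall t, t0 <= t <= t1 ->
  (Ex (fun w => `|U t w|) <= C%:E)%E.
Proof.
move=> t01; have [cW mU cU U0 eqU] := hU.
have [M M0 hM] := bounded_continuous t0 t1 continuous_coefficient.
have m0 (p : R) : 0 <= normal_moment p by exact: normal_moment_ge0.
have tpos : 0 <= t1 by rewrite (le_trans (ltW t00)).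
exists (Num.sqrt t1 * normal_moment 1 + 1 + `|v0| +
  M * (t1 * (Num.sqrt t1 `^ gamma * (rho * normal_moment gamma)))).
  by rewrite !addr_ge0 ?mulr_ge0 ?sqrtr_ge0 ?powR_ge0 ?(ltW rho0).
move=> t /andP[tt0 tt1].
have Ev : (Ex (fun w => `|U t0 w|) <= `|v0|%:E)%E.
  under eq_integral do rewrite U0.
  by rewrite integral_cst//; have := probability_setT P => /= ->; rewrite mule1.
have := @window_expectation t0 t 0 M 1 `|v0| (lexx _) tt0 (lexx _) ltr01 _ M0 Ev.
move=> /(_ _)/le_trans; apply.
  move=> u /andP[u0 ut]; rewrite powR_ge0/= (le_trans (ler_norm _))// hM//.
  by rewrite u0 (le_trans ut).
have dt : t - t0 <= t1 by rewrite lerBlDr (le_trans tt1)// lerDl ltW.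
have sq : Num.sqrt (t - t0) <= Num.sqrt t1 by exact: ler_wsqrtr.
rewrite lee_fin !mul0r oppr0 expR0 mul1r !lerD//; first by rewrite ler_wpM2r.
rewrite ler_wpM2l// ler_pM ?subr_ge0 ?mulr_ge0 ?powR_ge0 ?(ltW rho0)//.
rewrite ler_wpM2r ?mulr_ge0 ?(ltW rho0)//.
by apply: ge0_ler_powR; rewrite ?nnegrE ?sqrtr_ge0// (le_trans ler01)// ltW.
Qed.

(** The window of length [t ^ (2 q)] ending at [t] is the natural time scale:
    over it the noise has size [t ^ q], and the drift contracts differences of
    that size by a constant factor. *)
Lemma contraction_step : exists A k t1 : R, [/\ 0 <= A, 0 <= k < 1, t0 <= t1 &
  forall t, t1 <= t -> exists2 s, t0 <= s <= t & forall e, 0 <= e ->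
    (Ex (fun w => `|U s w|) <= (e * s `^ q)%:E)%E ->
    (Ex (fun w => `|U t w|) <= ((A + k * e) * t `^ q)%:E)%E].
Proof.
have g10 : 0 < gamma + 1 by rewrite ltr_wpDl// (le_trans ler01).
have bE : beta = q * (gamma + 1) by rewrite qE divfK// gt_eqF.
pose c := (1 / 2) * decay_rate rho gamma 1.
have c0 : 0 < c by rewrite mulr_gt0// decay_rate_gt0.
pose k := expR (- c).
have k1 : k < 1 by rewrite -expR0 ltr_expR oppr_lt0.
have k0 : 0 < k by exact: expR_gt0.
have e20 : 0 < (1 - k) / (2 * k) by rewrite divr_gt0 ?subr_gt0// mulr_gt0.
have half0 : 0 < 1 / 2 :> R by lra.
have [d1 /andP[d10 d12] h1] := powR_near1 (- beta) half0.
have [d2 /andP[d20 d22] h2] := powR_near1 q e20.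
have q20 : 2 * q - 1 < 0 by move: q12; lra.
have dm0 : 0 < minr d1 d2 by rewrite lt_min d10.
have [a a0 ha] := powR_neg_small q20 dm0.
have m0 p : 0 <= normal_moment p :> R by exact: normal_moment_ge0.
(* Half of the gap between [k] and 1 absorbs the ratio of [s ^ q] and [t ^ q]. *)
exists (normal_moment 1 + 1 + (3 / 2) * (rho * normal_moment gamma)), ((1 + k) / 2), (maxr (2 * t0) a).
split.
- by rewrite !addr_ge0 ?mulr_ge0 ?divr_ge0// ltW.
- by move: k0 k1; lra.
- by rewrite le_max ler_peMl ?ler1n// ltW.
move=> t; rewrite ge_max => /andP[tt0 ta].
have tpos : 0 < t by rewrite (lt_le_trans _ ta).
have tq0 : 0 < t `^ q by exact: powR_gt0.
have dl := ha t ta.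
have t2q : t `^ (2 * q) = t * t `^ (2 * q - 1).
  by rewrite -{2}[t](powRr1 (ltW tpos)) -powR_addE// addrC subrK.
have t2q2 : t `^ (2 * q) = t `^ q * t `^ q by rewrite mulrDl !mul1r powR_addE.
pose s := t - t `^ (2 * q).
have st : s <= t by rewrite gerBl powR_ge0.
have dl2 : t `^ (2 * q - 1) <= 1 / 2 by rewrite (le_trans dl)// ge_min d12.
have ts : t0 <= s.
  rewrite /s t2q; have : t * t `^ (2 * q - 1) <= t * (1 / 2) by rewrite ler_pM2l.
  by move: tt0; set z := t * (_ `^ _); lra.
have spos : 0 < s by rewrite (lt_le_trans t00).
have ratio u : s <= u <= t -> 1 - minr d1 d2 <= u / t <= 1.
  move=> /andP[su ut]; rewrite ler_pdivlMr// ler_pdivrMr// mul1r ut andbT (le_trans _ su)//.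
  by rewrite /s t2q mulrBl mul1r lerB// [minr _ _ * _]mulrC ler_pM2l.
have ratio1 u : s <= u <= t -> 1 - d1 <= u / t <= 1.
  by move=> /ratio/andP[r1 ->]; rewrite andbT (le_trans _ r1)// lerB// ge_min lexx.
have ratio2 : 1 - d2 <= s / t <= 1.
  have /ratio/andP[r1 ->] : s <= s <= t by rewrite lexx.
  by rewrite andbT (le_trans _ r1)// lerB// ge_min lexx orbT.
exists s; first by rewrite ts.
move=> e e0 Us.
have tb0 : 0 < t `^ (- beta) by exact: powR_gt0.
have coef u : s <= u <= t -> (1 / 2) * t `^ (- beta) <= coefficient u <= (3 / 2) * t `^ (- beta).
  move=> hu; have /andP[su ut] := hu.
  rewrite (coefficient_scaled tpos (le_trans ts su)) ![_ * t `^ _]mulrC !ler_pM2l//.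
  by have := h1 _ (ratio1 u hu); rewrite ler_norml; set z := _ `^ _; lra.
have a1 : 0 <= (3 / 2) * t `^ (- beta) by rewrite mulr_ge0 ?divr_ge0// ltW.
have a00 : 0 <= (1 / 2) * t `^ (- beta) by rewrite mulr_ge0 ?divr_ge0// ltW.
apply: (le_trans (window_expectation ts st a00 tq0 coef a1 Us)).
have -> : t - s = t `^ (2 * q) by rewrite /s opprB addrC subrK.
have -> : Num.sqrt (t `^ (2 * q)) = t `^ q by rewrite t2q2 -expr2 sqrtr_sqr ger0_norm// ltW.
have -> : (1 / 2) * t `^ (- beta) * decay_rate rho gamma (t `^ q) * t `^ (2 * q) = c.
  rewrite -[t `^ q]mulr1 decay_rateM// /c.
  have : t `^ (- beta) * ((t `^ q) `^ (gamma - 1) * t `^ (2 * q)) = 1.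
    by rewrite -powRrM -!powR_addE// bE (_ : _ + _ = 0) ?powRr0//; ring.
  set x := t `^ (- beta); set y := _ `^ (gamma - 1); set z := t `^ _; set D := decay_rate _ _ _ => E.
  by transitivity ((1 / 2) * D * (x * (y * z))); [ring|rewrite E mulr1].
have -> : (3 / 2) * t `^ (- beta) * (t `^ (2 * q) * ((t `^ q) `^ gamma * (rho * normal_moment gamma))) =
    t `^ q * ((3 / 2) * (rho * normal_moment gamma)).
  have : t `^ (- beta) * (t `^ (2 * q) * (t `^ q) `^ gamma) = t `^ q.
    by rewrite -powRrM -!powR_addE// bE; congr (_ `^ _); ring.
  set x := t `^ (- beta); set y := t `^ (2 * q); set z := (t `^ q) `^ _; set D := rho * _ => E.
  by rewrite -E; ring.
rewrite -/k lee_fin.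
have sq : s `^ q <= (1 + k) / (2 * k) * t `^ q.
  rewrite (_ : s `^ q = (s / t) `^ q * t `^ q); last first.
    by rewrite -powRM ?divr_ge0 ?ltW// divfK// gt_eqF.
  rewrite ler_pM2r//; have := h2 _ ratio2.
  rewrite ler_norml (_ : (1 + k) / (2 * k) = 1 + (1 - k) / (2 * k)); last by field; rewrite gt_eqF.
  by set z := _ `^ _; set y := (1 - k) / _; lra.
have : k * (e * s `^ q) <= (1 + k) / 2 * e * t `^ q.
  have -> : (1 + k) / 2 * e * t `^ q = k * (e * ((1 + k) / (2 * k) * t `^ q)).
    by field; rewrite gt_eqF.
  by rewrite ler_pM2l// ler_wpM2l.
set Z := t `^ q; set X := k * _; set Y := _ * _ * Z; set m1 := normal_moment 1.
set D := 3 / 2 * _ => XY.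
rewrite (_ : (_ + _ * e) * Z = Z * m1 + Z + Z * D + Y); last by rewrite /Y; ring.
by move: XY; lra.
Qed.

(** Going back window by window, the bound at [t] is a geometric series plus
    an initial contribution that the contraction factor makes negligible. *)
Lemma a_priori_bound : exists2 C, 0 <= C & forall t, t0 <= t ->
  (Ex (fun w => `|U t w|) <= (C * t `^ q)%:E)%E.
Proof.
have [A [k [t1 [A0 /andP[k0 k1] t01 step]]]] := contraction_step.
have lower t2 : t0 <= t2 -> exists2 C, 0 <= C & forall t, t0 <= t <= t2 ->
    (Ex (fun w => `|U t w|) <= (C * t `^ q)%:E)%E.
  move=> t02; have [C C0 hC] := crude_bound t02.
  have cp : continuous (fun t => (maxr t0 t) `^ (- q)).
    exact: continuous_max_pow.
  have [M M0 hM] := bounded_continuous t0 t2 cp.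
  exists (C * M); first exact: mulr_ge0.
  move=> t tt; have /andP[tt0 _] := tt; have tpos : 0 < t by exact: lt_le_trans tt0.
  apply: (le_trans (hC t tt)); rewrite lee_fin -[leLHS]mulr1 -mulrA ler_wpM2l//.
  have := hM t tt; rewrite max_r// ger0_norm ?powR_ge0// powRN => h.
  by rewrite -ler_pdivrMr ?powR_gt0// mul1r.
have [C0 C00 hC0] := lower t1 t01.
pose K := maxr C0 (A / (1 - k)).
have k10 : 0 < 1 - k by rewrite subr_gt0.
have K0 : 0 <= K by rewrite le_max C00.
have AK : A <= (1 - k) * K by rewrite mulrC -ler_pdivrMr// le_max lexx orbT.
exists K => // t tt0.
have [C1 C10 hC1] := lower t tt0.
(* [C1] depends on [t], but its contribution vanishes as [n] grows. *)
have iter n : forall r, t0 <= r <= t -> (Ex (fun w => `|U r w|) <= ((K + k ^+ n * C1) * r `^ q)%:E)%E.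
  elim: n => [|n IH] r /andP[r0 rt].
    apply: (le_trans (hC1 r _)); first by rewrite r0.
    by rewrite lee_fin ler_wpM2r ?powR_ge0// expr0 mul1r lerDr.
  have [r1|r1] := leP r t1.
    apply: (le_trans (hC0 r _)); first by rewrite r0.
    rewrite lee_fin ler_wpM2r ?powR_ge0//.
    by rewrite (@le_trans _ _ K) ?le_max ?lexx// lerDl mulr_ge0 ?exprn_ge0.
  have [s /andP[s0 sr] hs] := step r (ltW r1).
  apply: (le_trans (hs (K + k ^+ n * C1) _ _)).
  - by rewrite addr_ge0// mulr_ge0 ?exprn_ge0.
  - by apply: IH; rewrite s0 (le_trans sr).
  rewrite lee_fin ler_wpM2r ?powR_ge0// exprS.
  by move: AK; set x := k ^+ n; rewrite mulrBl mul1r mulrDr mulrA; lra.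
have cv : ((K + k ^+ n * C1) * t `^ q)%:E @[n --> \oo] --> (K * t `^ q)%:E.
  apply/fine_cvgP; split; first exact: nearW.
  rewrite -[K in X in _ --> X]addr0 -[0 in X in _ --> X](mul0r C1).
  apply: cvgM; last exact: cvg_cst.
  apply: cvgD; first exact: cvg_cst.
  apply: cvgM; last exact: cvg_cst.
  by apply: cvg_expr; rewrite ger0_norm.
rewrite -(cvg_lim _ cv)//; apply: lime_ge; first by apply/cvg_ex; eexists; exact: cv.
by apply: nearW => n; apply: iter; rewrite tt0 lexx.
Qed.

End a_priori.

(** * Long windows *)

Section finite_families.
Context {R : realType}.

Lemma prod_dist n (a b : nat -> R) : (forall j, 0 <= a j <= 1) -> (forall j, 0 <= b j <= 1) ->
  `|\prod_(j < n) a j - \prod_(j < n) b j| <= \sum_(j < n) `|a j - b j|.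
Proof.
move=> a01 b01; elim: n => [|n IH]; first by rewrite !big_ord0 subrr normr0.
rewrite !big_ord_recr/=; set A := \prod_(j < n) a j; set B := \prod_(j < n) b j.
have -> : A * a n - B * b n = (A - B) * a n + B * (a n - b n) by ring.
have B01 : 0 <= B <= 1.
  by rewrite prodr_ge0 ?Num.Theory.prodr_ile1// => j _; case/andP: (b01 j).
have /andP[an0 an1] := a01 n; have /andP[B0 B1] := B01.
rewrite (le_trans (ler_normD _ _))// !normrM (ger0_norm an0) (ger0_norm B0) lerD//.
  by rewrite (le_trans _ IH)// ler_piMr.
by rewrite ler_piMl.
Qed.

Lemma prod_double n (f : nat -> R) : \prod_(k < n.*2) f k = \prod_(j < n) (f j.*2 * f j.*2.+1).
Proof.
elim: n => [|n IH]; first by rewrite !big_ord0.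
by rewrite doubleS !big_ord_recr/= IH mulrA.
Qed.

Lemma eventually_forall_lt n (Q : nat -> R -> Prop) :
  (forall j, exists2 a, 0 < a & forall x, a <= x -> Q j x) ->
  exists2 a, 0 < a & forall x, a <= x -> forall j, (j < n)%N -> Q j x.
Proof.
move=> h; elim: n => [|n [a a0 IH]]; first by exists 1.
have [b b0 hb] := h n; exists (maxr a b); first by rewrite lt_max a0.
move=> x; rewrite ge_max => /andP[ax bx] j; rewrite ltnS leq_eqVlt => /predU1P[->|jn].
  exact: hb.
exact: IH.
Qed.

End finite_families.

Section windows.
Context d (T : measurableType d) (R : realType) (P : probability T R).
Variables (W U : R -> T -> R) (rho gamma beta q t0 v0 : R).
Hypotheses (rho0 : 0 < rho) (gamma1 : 1 <= gamma) (t00 : 0 < t0).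
Hypotheses (qE : q = beta / (gamma + 1)) (q12 : q < 1 / 2).
Local Notation F := (drift rho gamma).
Local Notation Ex f := (\int[P]_w (f w)%:E)%E.
Local Notation mu := (@lebesgue_measure R).
Local Notation I f a b := (\int[mu]_(x in `[a, b]) (f x)).
Local Notation coef := (coefficient beta t0).
Hypothesis hU : solution_paths P W U rho gamma beta t0 v0.

Let cW : continuous_bm P W. Proof. by case: hU. Qed.
Let mW t : measurable_fun setT (W t). Proof. by case: cW. Qed.
Let pW w : continuous (W ^~ w). Proof. by case: cW => _ + _ _; apply. Qed.
Let mU t : measurable_fun setT (U t). Proof. by case: hU. Qed.
Let cU w : continuous (U ^~ w). Proof. by case: hU => _ _ + _ _; apply. Qed.
Let cF : continuous F. Proof. exact: continuous_drift. Qed.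
Let ccoef : continuous coef. Proof. exact: continuous_coefficient. Qed.

Lemma continuous_rescaled s c (w : R -> R) : continuous w -> continuous (rescaled_path s c w).
Proof.
move=> cw; apply: contM; last exact: cont_cst.
by apply: (cont_comp _ cw); apply: contD; [exact: cont_cst|apply: contM; [exact: cont_cst|exact: cont_id]].
Qed.

(** Scale invariance: at the scale of the window the equation is a
    perturbation of the homogeneous one. *)
Lemma solves_rescaled t L w : 0 < t -> 0 <= L -> t0 <= t - L * t `^ (2 * q) ->
  solves rho gamma (fun x => t `^ beta * coef (t - L * t `^ (2 * q) + (t `^ q) ^+ 2 * x))
    (rescaled_path (t - L * t `^ (2 * q)) (t `^ q) (W ^~ w))
    (rescaled_path (t - L * t `^ (2 * q)) (t `^ q) (U ^~ w)) 0 L.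
Proof.
move=> tpos L0 ts x /andP[x0 xL].
have c0 : 0 < t `^ q by exact: powR_gt0.
set c := t `^ q in c0 *; set s := t - L * _ in ts *.
have c2 : t `^ (2 * q) = c ^+ 2 by rewrite mulrDl !mul1r powR_addE// expr2.
have sx : s <= s + c ^+ 2 * x by rewrite lerDl mulr_ge0// exprn_ge0// ltW.
have xt : s + c ^+ 2 * x <= t.
  have : c ^+ 2 * x <= c ^+ 2 * L by rewrite ler_pM2l// exprn_gt0.
  by rewrite /s c2 [L * _]mulrC; set a := _ * x; set b := _ * L; lra.
have [_ _ _ _ eqU] := hU.
have st : s <= t by rewrite (le_trans sx).
have := solvesS rho0 gamma1 ccoef (@cU w) ts (lexx t) (eqU w t (le_trans ts st)).
move=> /(_ (s + c ^+ 2 * x)); rewrite sx xt => /(_ isT) E.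
have cg : continuous (fun u => coef u * F (U u w)).
  by apply: contM => //; exact: (cont_comp (@cU w) cF).
have EI : I (fun u => coef u * F (U u w)) s (s + c ^+ 2 * x) =
    c ^+ 2 * I (fun u => coef (s + c ^+ 2 * u) * F (U (s + c ^+ 2 * u) w)) 0 x.
  by rewrite -(int_affine _ cg x0) ?exprn_ge0 ?(ltW c0)// mulr0 addr0.
have EF u : t `^ beta * coef (s + c ^+ 2 * u) * F (rescaled_path s c (U ^~ w) u) =
    c * (coef (s + c ^+ 2 * u) * F (U (s + c ^+ 2 * u) w)).
  have -> : U (s + c ^+ 2 * u) w = c * (rescaled_path s c (U ^~ w) u).
    by rewrite /rescaled_path [RHS]mulrC divfK// gt_eqF.
  rewrite driftM// (_ : t `^ beta = c * c `^ gamma); first by ring.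
  rewrite -{1}[c](powRr1 (ltW c0)) -powR_addE// -powRrM.
  by rewrite qE; congr (_ `^ _); field; rewrite gt_eqF// ltr_wpDl// (le_trans ler01).
have cg' : continuous (fun u => coef (s + c ^+ 2 * u) * F (U (s + c ^+ 2 * u) w)).
  have ca : continuous (fun u : R => s + c ^+ 2 * u).
    by apply: contD; [exact: cont_cst|apply: contM; [exact: cont_cst|exact: cont_id]].
  exact: (cont_comp ca cg).
rewrite (eq_int (fun u _ => EF u)) intZ// /rescaled_path mulr0 addr0 E EI.
by move: (gt_eqF c0); set J := (\int[_]_(_ in _) _) => cn0; field; rewrite cn0.
Qed.

Definition noise_drift (s c L : R) w := I (fun u => `|F ((W (s + c ^+ 2 * u) w - W s w) / c)|) 0 L.

Lemma noise_drift_bound s c L : 0 <= s -> 0 < c -> 0 <= L ->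
  measurable_fun setT (noise_drift s c L) /\
  (Ex (noise_drift s c L) <= (L * (Num.sqrt L `^ gamma * (rho * normal_moment gamma)))%:E)%E.
Proof.
move=> s0 c0 L0.
have g0 : 0 <= gamma by rewrite (le_trans _ gamma1).
pose Y u w := `|F ((W (s + c ^+ 2 * u) w - W s w) / c)|.
have mY u : measurable_fun setT (Y u).
  apply: measurableT_comp => //; apply: measurableT_comp; first exact: continuous_measurable_fun.
  by apply: measurable_funM; [exact: measurable_funB|exact: measurable_cst].
have cY w : continuous (Y ^~ w).
  have := continuous_norm (cont_comp (contM (contB (cont_comp (contD (@cont_cst _ s)
    (contM (@cont_cst _ (c ^+ 2)) (@cont_id _))) (@pW w)) (@cont_cst _ (W s w))) (@cont_cst _ c^-1)) cF).
  exact.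
split; first exact: measurable_path_integral.
apply: (le_trans (@expectation_path_integral _ _ _ P Y 0 L
   (fun=> Num.sqrt L `^ gamma * (rho * normal_moment gamma)) L0 mY cY _ _ _)).
- by move=> t w; exact: normr_ge0.
- exact: cont_cst.
- move=> u /andP[u0 uL].
  have su : s <= s + c ^+ 2 * u by rewrite lerDl mulr_ge0// exprn_ge0// ltW.
  have E w : Y u w = c^-1 `^ gamma * `|F (W (s + c ^+ 2 * u) w - W s w)|.
    rewrite /Y [_ / c]mulrC driftM ?invr_gt0// normrM ger0_norm ?powR_ge0//.
  under eq_integral do rewrite E EFinM.
  rewrite ge0_integralZl//; last 2 first.
  + apply/measurable_EFinP; apply: measurableT_comp => //; apply: measurableT_comp.
      exact: continuous_measurable_fun.
    exact: measurable_funB.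
  + by rewrite lee_fin powR_ge0.
  rewrite expectation_drift_increment// -EFinM lee_fin addrC addKr.
  rewrite sqrtrM ?exprn_ge0 ?(ltW c0)// sqrtr_sqr ger0_norm ?(ltW c0)//.
  rewrite powRM ?sqrtr_ge0 ?(ltW c0)// !mulrA -powRM ?invr_ge0 ?(ltW c0)//.
  rewrite mulVf ?gt_eqF// powR1 mul1r -!mulrA ler_wpM2r ?mulr_ge0 ?normal_moment_ge0 ?(ltW rho0)//.
  by apply: ge0_ler_powR; rewrite ?nnegrE ?sqrtr_ge0// ler_wsqrtr.
- by rewrite int_cst// subr0 mulrC.
Qed.

Lemma continuous_window_path t L w :
  continuous (rescaled_path (t - L * t `^ (2 * q)) (t `^ q) (W ^~ w)).
Proof. exact: continuous_rescaled. Qed.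

Definition window_solution t L w := solution rho0 gamma1 (@continuous_window_path t L w) 0.

Lemma measurable_window_solution t L : 0 <= L ->
  measurable_fun setT (fun w => window_solution t L w L).
Proof.
move=> L0; pose Wr x w := rescaled_path (t - L * t `^ (2 * q)) (t `^ q) (W ^~ w) x.
have mWr x : measurable_fun setT (Wr x).
  by apply: measurable_funM; [exact: mW|exact: measurable_cst].
exact: (@measurable_solution _ _ _ rho0 gamma1 _ _ Wr (@continuous_window_path t L) (fun=> 0) L L0
  mWr (@measurable_cst _ _ _ _ _ _)).
Qed.

(** The a priori bound makes the starting value of the rescaled solution bounded
    in mean, hence forgotten over a long window; and over a window of fixed
    rescaled length the coefficient tends to 1. *)
Lemma window_approximation e : 0 < e -> exists2 L1, 0 < L1 & forall L, L1 <= L ->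
  exists2 t1, 0 < t1 & forall t, t1 <= t ->
    t0 <= t - L * t `^ (2 * q) /\
    (Ex (fun w => `|U t w / t `^ q - window_solution t L w L|) <= e%:E)%E.
Proof.
move=> e0.
have E5 (e1 r x y z : R) : x <= y + z -> e1 + r + x <= 0 + (e1 + y) + r + z by lra.
have E6 (a b x y : R) : 0 < b -> x + y <= b / 4 -> a <= b / 4 -> b / 4 + x + a + y <= b by lra.
have [C C0 hC] := a_priori_bound rho0 gamma1 t00 qE q12 hU.
pose eta := e / 4.
have eta0 : 0 < eta by rewrite divr_gt0.
have c0 : 0 < decay_rate rho gamma eta by exact: decay_rate_gt0.
have half0 : 0 < 1 / 2 :> R by lra.
pose lam := (1 / 2) * decay_rate rho gamma eta.
have lam0 : 0 < lam by exact: mulr_gt0.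
have C1 : 0 < 2 * C + 1 by rewrite ltr_wpDl// mulr_ge0.
have L10 : 0 < (2 * C + 1) / (lam * eta) by apply: divr_gt0 => //; exact: mulr_gt0.
exists ((2 * C + 1) / (lam * eta)) => // L hL.
have L0 : 0 < L by rewrite (lt_le_trans _ hL).
have decay : expR (- (lam * L)) * (2 * C) <= eta.
  have le0 : 0 < lam * eta by exact: mulr_gt0.
  have LM : 2 * C + 1 <= L * (lam * eta) by rewrite -(ler_pdivrMr _ _ le0).
  have cL : lam * L <= expR (lam * L) by rewrite (le_trans _ (expR_ge1Dx _))// lerDr.
  have cLe : lam * L * eta <= expR (lam * L) * eta by rewrite ler_pM2r.
  rewrite expRN -ler_pdivlMl ?invr_gt0 ?expR_gt0// invrK; move: LM cLe.
  rewrite (_ : L * (lam * eta) = lam * L * eta); last by ring.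
  by set x := _ * eta; set y := _ * eta; lra.
pose A := 4 `^ gamma * (2 + F (1 / 2) * L).
pose B := 2 * 4 `^ gamma + 2 `^ gamma.
pose J := L * (Num.sqrt L `^ gamma * (rho * normal_moment gamma)).
have A0 : 0 <= A.
  by rewrite mulr_ge0 ?powR_ge0// addr_ge0// mulr_ge0 ?(ltW L0)// drift_ge0// ltW.
have B0 : 0 <= B by rewrite addr_ge0 ?mulr_ge0 ?powR_ge0.
have J0 : 0 <= J by rewrite !mulr_ge0 ?powR_ge0 ?normal_moment_ge0 ?(ltW L0) ?(ltW rho0).
pose om := minr (1 / 2) (eta / (A + B * J + 1)).
have om0 : 0 < om by rewrite lt_min half0 divr_gt0// ltr_wpDl// addr_ge0// mulr_ge0.
have [d1 /andP[d10 d12] h1] := powR_near1 (- beta) om0.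
have [d2 /andP[d20 d22] h2] := powR_near1 q (@ltr01 R).
have q20 : 2 * q - 1 < 0 by move: q12; lra.
have dm0 : 0 < minr d1 d2 / L by rewrite divr_gt0// lt_min d10.
have [a a0 ha] := powR_neg_small q20 dm0.
exists (maxr (2 * t0) a); first by rewrite lt_max a0 orbT.
move=> t; rewrite ge_max => /andP[tt0 ta].
have tpos : 0 < t by rewrite (lt_le_trans _ ta).
have tq0 : 0 < t `^ q by exact: powR_gt0.
have dl : L * t `^ (2 * q - 1) <= minr d1 d2 by rewrite mulrC -ler_pdivlMr// ha.
have t2q : L * t `^ (2 * q) = t * (L * t `^ (2 * q - 1)).
  by rewrite mulrCA -{2}[t](powRr1 (ltW tpos)) -powR_addE// addrC subrK.
have c2 : t `^ (2 * q) = (t `^ q) ^+ 2 by rewrite mulrDl !mul1r powR_addE// expr2.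
set s := t - L * t `^ (2 * q).
have dl2 : L * t `^ (2 * q - 1) <= 1 / 2 by rewrite (le_trans dl)// ge_min d12.
have ts : t0 <= s.
  rewrite /s t2q; have : t * (L * t `^ (2 * q - 1)) <= t * (1 / 2) by rewrite ler_pM2l.
  by move: tt0; set z := t * (_ * _); lra.
have spos : 0 < s by rewrite (lt_le_trans t00).
split=> //.
have ratio u : s <= u <= t -> 1 - minr d1 d2 <= u / t <= 1.
  move=> /andP[su ut]; rewrite ler_pdivlMr// ler_pdivrMr// mul1r ut andbT (le_trans _ su)//.
  by rewrite /s t2q mulrBl mul1r lerB// [minr _ _ * _]mulrC ler_pM2l.
have ratio1 u : s <= u <= t -> 1 - d1 <= u / t <= 1.
  by move=> /ratio/andP[r1 ->]; rewrite andbT (le_trans _ r1)// lerB// ge_min lexx.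
have st : s <= t by rewrite gerBl mulr_ge0 ?powR_ge0// ltW.
have ratio2 : 1 - d2 <= s / t <= 1.
  have /ratio/andP[r1 ->] : s <= s <= t by rewrite lexx.
  by rewrite andbT (le_trans _ r1)// lerB// ge_min lexx orbT.
have range x : 0 <= x <= L -> s <= s + (t `^ q) ^+ 2 * x <= t.
  move=> /andP[x0 xL]; rewrite lerDl mulr_ge0 ?exprn_ge0 ?(ltW tq0)//=.
  have : (t `^ q) ^+ 2 * x <= (t `^ q) ^+ 2 * L by rewrite ler_pM2l// exprn_gt0.
  by rewrite /s c2 [L * _]mulrC; set p := _ * x; set p' := _ * L; lra.
have coefE x : 0 <= x <= L ->
    t `^ beta * coef (s + (t `^ q) ^+ 2 * x) = ((s + (t `^ q) ^+ 2 * x) / t) `^ (- beta).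
  move=> /range/andP[sx xt]; rewrite (coefficient_scaled beta t00 tpos (le_trans ts sx)).
  by rewrite mulrA -powR_addE// subrr powRr0 mul1r.
have coef1 x : 0 <= x <= L -> `|1 - t `^ beta * coef (s + (t `^ q) ^+ 2 * x)| <= om.
  by move=> hx; rewrite coefE// distrC; apply: h1; apply: ratio1; exact: range.
have om2 : om <= 1 / 2 by rewrite ge_min lexx.
have coef2 x : 0 <= x <= L -> 1 / 2 <= t `^ beta * coef (s + (t `^ q) ^+ 2 * x).
  by move=> /coef1; rewrite ler_norml; move: om2; set z := _ * coef _; lra.
have EU : (Ex (fun w => `|U s w / t `^ q|) <= (2 * C)%:E)%E.
  have E w : (`|U s w / t `^ q|%:E = (t `^ q)^-1%:E * `|U s w|%:E)%E.
    by rewrite -EFinM normrM mulrC [`|_^-1|]ger0_norm// invr_ge0 ltW.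
  under eq_integral do rewrite E.
  rewrite ge0_integralZl//; last 2 first.
  - by apply/measurable_EFinP; exact: measurableT_comp.
  - by rewrite lee_fin invr_ge0 ltW.
  apply: (@le_trans _ _ ((t `^ q)^-1%:E * (C * s `^ q)%:E)%E).
    by apply: lee_wpmul2l; [rewrite lee_fin invr_ge0 ltW|exact: hC].
  rewrite -EFinM lee_fin mulrCA mulrC; apply: ler_wpM2r => //.
  have -> : (t `^ q)^-1 * s `^ q = (s / t) `^ q.
    have -> : s `^ q = (s / t) `^ q * t `^ q.
      by rewrite -powRM ?divr_ge0 ?(ltW tpos) ?(ltW spos)// divfK// gt_eqF.
    by rewrite [LHS]mulrC mulfK// gt_eqF.
  by have := h2 _ ratio2; rewrite ler_norml; set z := _ `^ _; lra.
have [mJ EJ] := noise_drift_bound (ltW spos) tq0 (ltW L0).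
pose ch w := @continuous_window_path t L w.
have mh : measurable_fun setT (fun w => window_solution t L w L).
  exact: (measurable_window_solution t (ltW L0)).
have Ux w : U t w / t `^ q = rescaled_path s (t `^ q) (U ^~ w) L.
  by rewrite /rescaled_path /s c2 mulrC [L * _]mulrC subrK mulrC.
apply: (le_trans (@expectation_linear_bound _ _ _ P _ (fun=> 0) (fun w => `|U s w / t `^ q|)
   (noise_drift s (t `^ q) L) 0 (2 * C) J (eta + om * A) (expR (- (lam * L))) (om * B)
   _ _ _ mJ _ _ _ _ _ _ _ _ EU EJ _)).
- apply: measurableT_comp => //; apply: measurable_funB => //.
  by apply: measurable_funM; [exact: mU|exact: measurable_cst].
- exact: measurable_cst.
- by apply: measurableT_comp => //; apply: measurable_funM; [exact: mU|exact: measurable_cst].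
- by [].
- by [].
- by [].
- by move=> w; apply: int_ge0.
- by apply: addr_ge0; [exact: ltW|exact: mulr_ge0 (ltW om0) A0].
- exact: expR_ge0.
- exact: mulr_ge0 (ltW om0) B0.
- by rewrite integral0.
- move=> w; have [csol sol0 hsol] := solutionP rho0 gamma1 (ch w) 0.
  have ccoef' : continuous (fun x => t `^ beta * coef (s + (t `^ q) ^+ 2 * x)).
    apply: contM; first exact: cont_cst.
    by apply: (cont_comp (contD (@cont_cst _ s) (contM (@cont_cst _ ((t `^ q) ^+ 2)) (@cont_id _))) ccoef).
  have cUr : continuous (rescaled_path s (t `^ q) (U ^~ w)) by exact: continuous_rescaled.
  rewrite Ux.
  have := @solves_dist _ rho gamma rho0 gamma1 _ _ _ _ L (1 / 2) om eta ccoef' cUr csol (ltW L0)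
    (ltW half0) eta0 coef2 coef1 (solves_rescaled w tpos (ltW L0) ts) (hsol L).
  rewrite -/lam sol0 subr0 => /le_trans; apply.
  have -> : rescaled_path s (t `^ q) (U ^~ w) 0 = U s w / t `^ q by rewrite /rescaled_path mulr0 addr0.
  have := solves_drift_integral rho0 gamma1 (ch w) csol (ltW L0) (hsol L).
  rewrite sol0 normr0 add0r.
  have -> : I (fun u => `|F (rescaled_path s (t `^ q) (W ^~ w) u - rescaled_path s (t `^ q) (W ^~ w) 0)|) 0 L
      = noise_drift s (t `^ q) L w.
    by apply: eq_int => u _; rewrite /rescaled_path mulr0 addr0 -mulrBl.
  set N := noise_drift _ _ _ _; set D := Rintegral _ _ _; set V := `|_ / _| => hD.
  have h4 : om * D <= om * A + om * B * N.
    rewrite -[om * B * N]mulrA -mulrDr ler_pM2l// (le_trans hD)// /A /B.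
    by set x := 4 `^ _; set y := 2 `^ _; set z := F _; rewrite le_eqVlt; apply/orP; left; apply/eqP; ring.
  exact: E5.
rewrite lee_fin add0r.
have h3 : om * (A + B * J) <= eta.
  have AB0 : 0 < A + B * J + 1 by rewrite ltr_wpDl// addr_ge0// mulr_ge0.
  have : om <= eta / (A + B * J + 1) by rewrite ge_min lexx orbT.
  rewrite ler_pdivlMr// => /(le_trans _); apply; rewrite ler_pM2l// lerDl//.
have h4 : om * A + om * B * J <= eta by rewrite -[om * B * J]mulrA -mulrDr.
exact: E6.
Qed.

End windows.

(** * Asymptotic independence over distant windows *)

Section product_limit.
Context d (T : measurableType d) (R : realType) (P : probability T R).
Variables (W U : R -> T -> R) (rho gamma beta q t0 v0 : R).
Hypotheses (rho0 : 0 < rho) (gamma1 : 1 <= gamma) (t00 : 0 < t0).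
Hypotheses (qE : q = beta / (gamma + 1)) (q12 : q < 1 / 2).
Local Notation F := (drift rho gamma).
Local Notation Ex f := (\int[P]_w (f w)%:E)%E.
Hypothesis hU : solution_paths P W U rho gamma beta t0 v0.

Let cW : continuous_bm P W. Proof. by case: hU. Qed.
Let mU t : measurable_fun setT (U t). Proof. by case: hU. Qed.
Let pW w : continuous (W ^~ w). Proof. by case: cW => _ + _ _; apply. Qed.

Lemma lipschitz_continuous (g : R -> R) K : (forall x y, `|g x - g y| <= K * `|x - y|) -> continuous g.
Proof.
move=> gK x; apply/cvgrPdist_le => e e0; near=> y.
have K1 : 0 < `|K| + 1 by rewrite ltr_wpDl.
rewrite (le_trans (gK x y))// (@le_trans _ _ ((`|K| + 1) * `|x - y|))//.
  by rewrite ler_wpM2r// (le_trans (ler_norm _))// lerDl.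
rewrite mulrC -ler_pdivlMr//; near: y.
by apply: (@cvgr_dist_le _ _ _ (nbhs x) _ id x); [exact: cvg_id|exact: divr_gt0].
Unshelve. all: by end_near. Qed.

Lemma eq_solution (w1 w2 : R -> R) (c1 : continuous w1) (c2 : continuous w2) x : w1 = w2 ->
  solution rho0 gamma1 c1 x = solution rho0 gamma1 c2 x.
Proof. by move=> E; move: c1; rewrite E => c1; rewrite (Prop_irrelevance c1 c2). Qed.

Lemma expectation_lipschitz_dist (g : R -> R) K e (X Y : T -> R) : 0 <= K ->
  (forall x, 0 <= g x <= 1) -> (forall x y, `|g x - g y| <= K * `|x - y|) ->
  measurable_fun setT X -> measurable_fun setT Y ->
  (Ex (fun w => `|X w - Y w|%R) <= e%:E)%E ->
  \int[P]_w `|g (X w) - g (Y w)| <= K * e.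
Proof.
move=> K0 g01 gK mX mY h.
have mg : measurable_fun setT g.
  by apply: continuous_measurable_fun; exact: lipschitz_continuous gK.
have mgd : measurable_fun setT (fun w => `|g (X w) - g (Y w)|).
  by apply: measurableT_comp => //; apply: measurable_funB; exact: measurableT_comp.
have g2 w : `| `|g (X w) - g (Y w)| | <= 1.
  rewrite normr_id ler_norml; have := g01 (X w); have := g01 (Y w).
  by set a := g _; set b := g _; lra.
rewrite -lee_fin -(Rint_EFin P mgd g2).
apply: (@le_trans _ _ (\int[P]_w (K%:E * `|X w - Y w|%:E))%E).
  apply: ge0_le_integral => //.
  - by apply/measurable_EFinP.
  - under eq_fun do rewrite -EFinM; apply/measurable_EFinP.
    apply: measurable_funM; first exact: measurable_cst.
    by apply: measurableT_comp => //; exact: measurable_funB.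
  - by move=> w _; rewrite -EFinM lee_fin.
rewrite ge0_integralZl//; last first.
  by apply/measurable_EFinP; apply: measurableT_comp => //; exact: measurable_funB.
by rewrite EFinM lee_wpmul2l.
Qed.

(** Replacing the factors one at a time reduces a product of test functions to
    the distances in mean of the variables. *)
Lemma product_expectation_dist n K e (g : nat -> R -> R) (X Y : nat -> T -> R) : 0 <= K ->
  (forall j x, 0 <= g j x <= 1) -> (forall j x y, `|g j x - g j y| <= K * `|x - y|) ->
  (forall j, measurable_fun setT (X j)) -> (forall j, measurable_fun setT (Y j)) ->
  (forall j, (Ex (fun w => `|X j w - Y j w|%R) <= e%:E)%E) ->
  `|\int[P]_w (\prod_(j < n) g j (X j w)) - \int[P]_w (\prod_(j < n) g j (Y j w))|
    <= n%:R * (K * e).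
Proof.
move=> K0 g01 gK mX mY h.
have mg j : measurable_fun setT (g j).
  by apply: continuous_measurable_fun; exact: lipschitz_continuous (gK j).
have mp (Z : nat -> T -> R) : (forall j, measurable_fun setT (Z j)) ->
    measurable_fun setT (fun w => \prod_(j < n) g j (Z j w)).
  by move=> mZ; apply: measurable_prod => j _; exact: measurableT_comp.
have p1 (Z : nat -> T -> R) w : `|\prod_(j < n) g j (Z j w)| <= 1.
  rewrite ger0_norm; last by apply: prodr_ge0 => j _; case/andP: (g01 j (Z j w)).
  by apply: Num.Theory.prodr_ile1 => j _.
have md (j : 'I_n) : measurable_fun setT (fun w => `|g j (X j w) - g j (Y j w)|).
  by apply: measurableT_comp => //; apply: measurable_funB; exact: measurableT_comp.
have d1 (j : 'I_n) w : `| `|g j (X j w) - g j (Y j w)| | <= 1.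
  rewrite normr_id ler_norml; have := g01 j (X j w); have := g01 j (Y j w).
  by set a := g _ _; set b := g _ _; lra.
apply: (le_trans (Rint_distB P (mp X mX) (mp Y mY) (p1 X) (p1 Y))).
apply: (@le_trans _ _ (\int[P]_w (\sum_(j < n) 1 * `|g j (X j w) - g j (Y j w)|))).
  apply: (@Rint_le _ _ _ P _ _ (n%:R + 2)).
  - by apply: measurableT_comp => //; apply: measurable_funB; exact: mp.
  - by apply: measurable_sum => j; apply: measurable_funM; [exact: measurable_cst|exact: md].
  - move=> w; rewrite normr_id (le_trans (ler_normB _ _))// (le_trans (lerD (p1 X w) (p1 Y w)))//.
    by rewrite -[1 + 1]/(2%:R) lerDr.
  - move=> w; rewrite (le_trans (ler_norm_sum _ _ _))// (@le_trans _ _ (\sum_(j < n) 1))//.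
      by apply: ler_sum => j _; rewrite mul1r.
    by rewrite sumr_const card_ord lerDl.
  - move=> w; under [leRHS]eq_bigr do rewrite mul1r.
    by apply: (prod_dist n (a := fun j => g j (X j w)) (b := fun j => g j (Y j w))).
rewrite (Rint_sum P (fun=> 1) md d1) mulr_natl -[X in _ *+ X](card_ord n) -sumr_const.
apply: ler_sum => j _; rewrite mul1r.
exact: expectation_lipschitz_dist.
Qed.

Variable Pi : probability R R.
Hypothesis inv : invariant_law F Pi.

(** For small [eps] the windows that end at the times [tt j / eps] are disjoint,
    so that the window solutions are independent with the same law as the
    homogeneous solution from 0, and this law is close to [Pi]. *)
Lemma window_product_limit n (tt : nat -> R) (g : nat -> R -> R) K : 0 < tt 0%N ->
  (forall j, tt j < tt j.+1) -> 0 <= K ->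
  (forall j x, 0 <= g j x <= 1) -> (forall j x y, `|g j x - g j y| <= K * `|x - y|) ->
  \int[P]_w (\prod_(j < n) g j (U (tt j / eps) w / (tt j / eps) `^ q)) @[eps --> 0^'+]
    --> \prod_(j < n) \int[Pi]_x g j x.
Proof.
move=> tt0 ttS K0 g01 gK.
have cg j : continuous (g j) by exact: lipschitz_continuous (gK j).
have mg j : measurable_fun setT (g j) by exact: continuous_measurable_fun.
have ttpos j : 0 < tt j by elim: j => // j IH; exact: lt_trans (ttS j).
have ttle j : tt 0%N <= tt j by elim: j => // j IH; rewrite (le_trans IH)// ltW.
have pi01 j : 0 <= \int[Pi]_x g j x <= 1.
  rewrite Rintegral_ge0/=; last by move=> x _; case/andP: (g01 j x).
  rewrite -[leRHS](@Rint_cst _ _ _ Pi 1); apply: (@Rint_le _ _ _ Pi _ _ 1) => //.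
  - by move=> x; case/andP: (g01 j x) => h0 h1; rewrite ger0_norm.
  - by move=> x; rewrite normr1.
  - by move=> x; case/andP: (g01 j x).
apply/cvgrPdist_le => e e0.
pose e1 := e / (2 * n.+1%:R); pose e2 := e1 / (K + 1).
have e10 : 0 < e1 by rewrite divr_gt0// mulr_gt0// ltr0n.
have e20 : 0 < e2 by rewrite divr_gt0// ltr_wpDl.
have [La La0 hLa] := eventually_forall_lt n (fun j => invariant_law_limit rho0 gamma1 cW inv (g01 j) K0
   (gK j) (cg j) e10).
have [Lb Lb0 hLb] := window_approximation rho0 gamma1 t00 qE q12 hU e20.
pose L := maxr La Lb.
have L0 : 0 < L by rewrite lt_max La0.
have [t1 t10 ht1] : exists2 t1, 0 < t1 & forall t, t1 <= t ->
    t0 <= t - L * t `^ (2 * q) /\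
    (Ex (fun w => `|U t w / t `^ q - window_solution q rho0 gamma1 hU t L w L|%R) <= e2%:E)%E.
  by apply: hLb; rewrite le_max lexx orbT.
have q20 : 2 * q - 1 < 0 by move: q12; lra.
have sep j : exists2 a, 0 < a & forall x, a <= x -> L * x `^ (2 * q - 1) < 1 - tt j / tt j.+1.
  have dj : 0 < (1 - tt j / tt j.+1) / (2 * L).
    by rewrite divr_gt0 ?mulr_gt0// subr_gt0 ltr_pdivrMr// mul1r.
  have [a a0 ha] := powR_neg_small q20 dj; exists a => // x ax.
  have := ha x ax; rewrite ler_pdivlMr ?mulr_gt0//; set y := _ `^ _.
  have : 0 < 1 - tt j / tt j.+1 by rewrite subr_gt0 ltr_pdivrMr// mul1r.
  by set z := 1 - _; rewrite mulrCA [y * L]mulrC; lra.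
have [t2 t20 ht2] := eventually_forall_lt n sep.
pose A := maxr t1 t2.
have A0 : 0 < A by rewrite lt_max t10.
near=> eps.
have eps0 : 0 < eps by near: eps; exact: nbhs_right_gt.
have epsA : eps <= tt 0%N / A by near: eps; apply: nbhs_right_le; exact: divr_gt0.
pose tm j := tt j / eps.
have tmpos j : 0 < tm j by exact: divr_gt0.
have tmA j : A <= tm j.
  rewrite /tm ler_pdivlMr// mulrC (le_trans _ (ttle j))//.
  by move: epsA; rewrite ler_pdivlMr.
have tm1 j : t1 <= tm j by rewrite (le_trans _ (tmA j))// le_max lexx.
have tm2 j : t2 <= tm j by rewrite (le_trans _ (tmA j))// le_max lexx orbT.
pose s j := tm j - L * tm j `^ (2 * q).
have s0 j : t0 <= s j by have [] := ht1 _ (tm1 j).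
have stm j : s j < tm j by rewrite /s ltrBlDr ltrDl mulr_gt0// powR_gt0.
have tms j : (j < n)%N -> tm j < s j.+1.
  move=> jn; have := ht2 _ (tm2 j.+1) j jn.
  have -> : s j.+1 = tm j.+1 * (1 - L * tm j.+1 `^ (2 * q - 1)).
    rewrite /s mulrBr mulr1 mulrCA -{4}[tm j.+1](powRr1 (ltW (tmpos _))) -powR_addE//.
    by rewrite [1 + _]addrC subrK.
  have -> : tm j = tm j.+1 * (tt j / tt j.+1).
    rewrite /tm mulrAC mulrCA divff ?mulr1// gt_eqF//.
  by rewrite ltr_pM2l//; set x := L * _; set y := _ / _; lra.
(* The odd blocks are the gaps between the windows. Their test function is 1,
   and their scale gives them the rescaled length [L] of the windows. *)
pose u k := if odd k then tm k./2 else s k./2.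
pose c k := if odd k then Num.sqrt ((u k.+1 - u k) / L) else tm k./2 `^ q.
pose h k w := solution rho0 gamma1 (@continuous_rescaled R (u k) (c k) (W ^~ w) (@pW w)) 0.
pose g' k := if odd k then fun=> 1 else g k./2.
have uS k : (k < n.*2)%N -> u k < u k.+1.
  move=> kn; rewrite /u /=; case: ifPn => ok /=.
    by rewrite uphalf_half ok add1n tms// ltn_half_double.
  by rewrite uphalf_half (negbTE ok) add0n stm.
have c0 k : (k < n.*2)%N -> 0 < c k.
  move=> kn; rewrite /c; case: ifPn => _; last exact: powR_gt0.
  by rewrite sqrtr_gt0 divr_gt0// subr_gt0 uS.
have cL k : (k < n.*2)%N -> c k ^+ 2 * L = u k.+1 - u k.
  move=> kn; rewrite /c; case: ifPn => ok.
    by rewrite sqr_sqrtr ?divfK ?gt_eqF// divr_ge0 ?(ltW L0)// subr_ge0 ltW// uS.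
  rewrite /u /= (negbTE ok)/= uphalf_half (negbTE ok) add0n /s.
  by rewrite mulrDl !mul1r powR_addE// expr2 opprB addrC subrK mulrC.
have blocks := @cvg_euler_blocks _ _ _ P _ _ rho0 gamma1 W cW u c n.*2 L h g' L0 _ c0 cL _ _ _.
have {}blocks : \prod_(k < n.*2) euler_expectation rho0 gamma1 L (g' k) N @[N --> \oo] -->
    \int[P]_w \prod_(k < n.*2) g' k (h k w L).
  apply: blocks.
  - by rewrite /u/= (le_trans (ltW t00)).
  - move=> k w kn; rewrite /h.
    by have [ch h0 sh] := solutionP rho0 gamma1 (@continuous_rescaled R (u k) (c k) (W ^~ w) (@pW w)) 0; split.
  - by move=> k; rewrite /g'; case: ifP => _; [exact: cst_continuous|exact: cg].
  - by move=> k x; rewrite /g'; case: ifP => _; rewrite ?ler01 ?lexx.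
have E1 N : \prod_(k < n.*2) euler_expectation rho0 gamma1 L (g' k) N =
    \prod_(j < n) euler_expectation rho0 gamma1 L (g j) N.
  rewrite (prod_double n (fun k => euler_expectation rho0 gamma1 L (g' k) N)); apply: eq_bigr => j _.
  rewrite /g' odd_double/= odd_double/= doubleK [X in _ * X](_ : _ = 1) ?mulr1//.
  by rewrite /euler_expectation iid_int1.
have E2 : (fun w => \prod_(k < n.*2) g' k (h k w L)) =
    fun w => \prod_(j < n) g j (window_solution q rho0 gamma1 hU (tm j) L w L).
  apply/funext => w; rewrite (prod_double n (fun k => g' k (h k w L))); apply: eq_bigr => j _.
  rewrite /g' odd_double/= odd_double/= doubleK mulr1; congr (g j _).
  have -> // : h j.*2 w = window_solution q rho0 gamma1 hU (tm j) L w.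
  by apply: eq_solution; rewrite /u /c odd_double doubleK.
move: blocks; rewrite (_ : (fun N => _) = fun N => \prod_(j < n) euler_expectation rho0 gamma1 L (g j) N);
  last by apply/funext.
rewrite E2 => blocks.
have /choice[l hl] : forall j : nat, exists l, (j < n)%N -> [/\
    euler_expectation rho0 gamma1 L (g j) N @[N --> \oo] --> l, 0 <= l <= 1 &
    `|l - \int[Pi]_x g j x| <= e1].
  move=> j; have [jn|jn] := ltnP j n; last by exists 0.
  have LaL : La <= L by rewrite le_max lexx.
  by have [l cl [l01 ld]] := hLa L LaL j jn; exists l.
have lim : \int[P]_w \prod_(j < n) g j (window_solution q rho0 gamma1 hU (tm j) L w L) =
    \prod_(j < n) l j.
  apply: (cvg_unique _ blocks) => //; apply: cvg_prodR => j.
  by have [] := hl j (ltn_ord j).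
have d1 : `|\prod_(j < n) \int[Pi]_x g j x - \prod_(j < n) l j| <= n%:R * e1.
  pose l' j := if (j < n)%N then l j else 0.
  have -> : \prod_(j < n) l j = \prod_(j < n) l' j by apply: eq_bigr => j _; rewrite /l' ltn_ord.
  rewrite (le_trans (prod_dist n pi01 _))//.
    move=> j; rewrite /l'; case: ifPn => [jn|_]; last by rewrite lexx ler01.
    by have [] := hl j jn.
  rewrite mulr_natl -[X in _ *+ X](card_ord n) -sumr_const; apply: ler_sum => j _.
  by rewrite /l' ltn_ord distrC; have [] := hl j (ltn_ord j).
have d2 : `|\prod_(j < n) l j - \int[P]_w (\prod_(j < n) g j (U (tm j) w / (tm j) `^ q))|
    <= n%:R * e1.
  rewrite -lim distrC.
  have mXj j : measurable_fun setT (fun w => U (tm j) w / tm j `^ q).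
    by apply: measurable_funM; [exact: mU|exact: measurable_cst].
  have mYj j : measurable_fun setT (fun w => window_solution q rho0 gamma1 hU (tm j) L w L).
    exact: (measurable_window_solution q rho0 gamma1 hU (tm j) (ltW L0)).
  have close j : (Ex (fun w => `|U (tm j) w / tm j `^ q -
      window_solution q rho0 gamma1 hU (tm j) L w L|%R) <= e2%:E)%E.
    by have [_] := ht1 _ (tm1 j).
  rewrite (le_trans (product_expectation_dist n K0 g01 gK mXj mYj close))//.
  rewrite ler_wpM2l// /e2 mulrCA -[leRHS]mulr1 ler_wpM2l ?(ltW e10)//.
  by rewrite ler_pdivrMr ?mul1r ?lerDl// ltr_wpDl.
rewrite (le_trans (ler_distD (\prod_(j < n) l j) _ _))// (le_trans (lerD d1 d2))//.
rewrite -mulrDl -natrD /e1 mulrCA -[leRHS]mulr1 ler_wpM2l ?(ltW e0)//.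
by rewrite ler_pdivrMr ?mulr_gt0 ?ltr0n// mul1r -natrM ler_nat addnn -muln2 mulnC leq_mul2l ltnW.
Unshelve. all: by end_near. Qed.

End product_limit.

(** * Convergence of the velocity *)

Section lipschitz_weights.
Context {R : realType}.
Implicit Types (f g : R -> R).

Definition bounded_lipschitz f := exists2 C, 0 <= C &
  (forall x, `|f x| <= C) /\ (forall x y, `|f x - f y| <= C * `|x - y|).

Lemma bounded_lipschitz_cst c : bounded_lipschitz (fun=> c).
Proof. by exists `|c| => //; split=> // x y; rewrite subrr normr0 mulr_ge0. Qed.

Lemma bounded_lipschitzM f g : bounded_lipschitz f -> bounded_lipschitz g ->
  bounded_lipschitz (fun x => f x * g x).
Proof.
move=> [C C0 [fC fL]] [D D0 [gD gL]]; exists (2 * (C * D)); first by rewrite !mulr_ge0.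
have CD0 : 0 <= C * D by rewrite mulr_ge0.
split=> [x|x y].
  by rewrite normrM (le_trans (ler_pM _ _ (fC x) (gD x)))// ler_peMl// ler1n.
have -> : f x * g x - f y * g y = (f x - f y) * g x + f y * (g x - g y) by ring.
rewrite (le_trans (ler_normD _ _))// !normrM.
have h1 : `|f x - f y| * `|g x| <= C * D * `|x - y|.
  by rewrite (le_trans (ler_pM _ _ (fL x y) (gD x)))// mulrAC.
have h2 : `|f y| * `|g x - g y| <= C * D * `|x - y|.
  by rewrite (le_trans (ler_pM _ _ (fC y) (gL x y)))// mulrA.
rewrite -[2 * _ * _]mulrA; move: h1 h2; set a := _ * `|x - y|.
by set b := _ * _; set c := _ * _; lra.
Qed.

Lemma bounded_lipschitzD f g : bounded_lipschitz f -> bounded_lipschitz g ->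
  bounded_lipschitz (fun x => f x + g x).
Proof.
move=> [C C0 [fC fL]] [D D0 [gD gL]]; exists (C + D); first exact: addr_ge0.
split=> [x|x y]; first by rewrite (le_trans (ler_normD _ _))// lerD.
by rewrite opprD addrACA (le_trans (ler_normD _ _))// mulrDl lerD.
Qed.

Lemma bounded_lipschitzX f n : bounded_lipschitz f -> bounded_lipschitz (fun x => f x ^+ n).
Proof.
move=> fL; elim: n => [|n IH]; first exact: bounded_lipschitz_cst.
rewrite (_ : (fun x => _) = fun x => f x * f x ^+ n); first exact: bounded_lipschitzM.
by apply/funext => x; rewrite exprS.
Qed.

Lemma sin_lipschitz (x y : R) : `|sin x - sin y| <= `|x - y|.
Proof.
wlog yx : x y / y <= x.
  move=> h; have [/h//|/ltW/h] := leP y x; by rewrite distrC [`|y - x|]distrC.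
have cc : continuous (@cos R) by exact: continuous_cos.
rewrite -(@FTC2 _ sin cos y x yx cc (fun z _ => is_derive_sin z)).
rewrite (le_trans (le_abs_int_cst yx cc (c := 1) _))//.
  by move=> z _; rewrite ler_norml cos_geN1 cos_le1.
by rewrite mul1r ler_norm.
Qed.

Lemma bounded_lipschitz_trig_weight m k M : 0 < M -> bounded_lipschitz (@trig_weight R m k M).
Proof.
move=> M0; have us : bounded_lipschitz (@to_unit R M).
  exists (1 + (4 * M)^-1); first by rewrite addr_ge0// invr_ge0 mulr_ge0// ltW.
  split=> [x|x y].
    rewrite (@le_trans _ _ 1)//; last by rewrite lerDl invr_ge0 mulr_ge0// ltW.
    rewrite /to_unit ler_norml; have := sin_geN1 (x / (2 * M)); have := sin_le1 (x / (2 * M)).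
    by set s := sin _; lra.
  rewrite /to_unit -mulrBl opprD addrACA subrr add0r normrM.
  rewrite (le_trans (ler_wpM2r _ (sin_lipschitz _ _)))// -mulrBl normrM -mulrA mulrC.
  rewrite ler_wpM2r// !ger0_norm ?invr_ge0 ?mulr_ge0 ?(ltW M0)//.
  have -> : (2 * M)^-1 * 2^-1 = (4 * M)^-1 by rewrite -invfM; congr (_^-1); ring.
  by rewrite lerDr.
rewrite /trig_weight /bernstein.
apply: bounded_lipschitzM; first apply: bounded_lipschitzM.
- exact: bounded_lipschitz_cst.
- exact: bounded_lipschitzX.
- apply: bounded_lipschitzX.
  have -> : (fun x => 1 - @to_unit R M x) = fun x => 1 + (-1) * to_unit M x.
    by apply/funext => x; rewrite mulN1r.
  apply: bounded_lipschitzD; first exact: bounded_lipschitz_cst.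
  by apply: bounded_lipschitzM => //; exact: bounded_lipschitz_cst.
Qed.

End lipschitz_weights.

Section sorted_times.
Context {R : realType} d (T : measurableType d) (P : probability T R)
  d' (T' : measurableType d') (P' : probability T' R).

(** A vector of values at distinct times is a continuous function of the vector
    of values at the sorted times. *)
Lemma fdd_cvg_sorted (Z : R -> R -> T -> R) (Y : R -> T' -> R) :
  (forall n (t : nat -> R), 0 < t 0%N -> (forall j, t j < t j.+1) ->
    cvg_in_law P P' (fun eps w => \row_(i < n) Z eps (t i) w) (fun w => \row_(i < n) Y (t i) w)) ->
  fdd_cvg P P' Z Y.
Proof.
move=> h n t tinj tpos f cf [C fC].
pose s := sort <=%O (codom t).
have ss : size s = n by rewrite size_sort size_codom card_ord.
have ms x : (x \in s) = (x \in codom t) by rewrite mem_sort.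
have us : uniq s by rewrite sort_uniq; apply/injectiveP.
have so : sorted <%O s by rewrite lt_sorted_uniq_le us sort_le_sorted.
pose M := \sum_i t i.
have tM i : t i <= M by rewrite /M (bigD1 i)//= lerDl sumr_ge0// => j _; exact: ltW.
have M0 : 0 <= M by rewrite sumr_ge0// => j _; exact: ltW.
(* The sorted times, continued to an increasing sequence. *)
pose tt j := if (j < n)%N then nth 0 s j else M + 1 + j%:R.
have nths j : (j < n)%N -> exists i, nth 0 s j = t i.
  by move=> jn; have : nth 0 s j \in s by [rewrite mem_nth ?ss]; rewrite ms => /codomP.
have tt0 : 0 < tt 0%N.
  rewrite /tt; case: ifPn => [/nths[i ->]//|_]; by rewrite addr0 ltr_wpDl.
have ttS j : tt j < tt j.+1.
  rewrite /tt; case: ifPn => jn.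
    case: ifPn => j1n; first by rewrite (lt_sorted_ltn_nth 0 so) ?inE ?ss.
    by have [i ->] := nths j jn; rewrite (le_lt_trans (tM i))// -addrA ltrDl addr_gt0// ltr0n.
  by rewrite ifN ?ltrD2l ?ltr_nat// -leqNgt leqW// leqNgt.
have iP i : (index (t i) s < n)%N by rewrite -ss index_mem ms codom_f.
pose p i := Ordinal (iP i).
have tp i : t i = tt (p i) by rewrite /tt /= iP nth_index// ms codom_f.
pose g (v : 'rV[R]_n) : 'rV[R]_n := \row_i v ord0 (p i).
have cg : continuous g.
  move=> v A /nbhs_ballP[e e0 sub]; apply/nbhs_ballP; exists e => // u [_ uv]; apply: sub.
  by split=> // i j; rewrite !mxE; exact: uv.
have := h n tt tt0 ttS (f \o g) (_ : continuous (f \o g)) _.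
have cfg : continuous (f \o g) by move=> v; apply: continuous_comp; [exact: cg|exact: cf].
move=> /(_ cfg) /(_ (ex_intro _ C (fun x => fC (g x)))).
have -> : (f \o g) \o (fun w => \row_(i < n) Y (tt i) w) = f \o (fun w => \row_(i < n) Y (t i) w).
  by apply/funext => w /=; congr f; apply/rowP => i; rewrite !mxE tp.
rewrite [X in X @ _](_ : _ = fun eps => ('E_P[f \o (fun w => \row_(i < n) Z eps (t i) w)])%E)//.
apply/funext => eps; congr (expectation P _).
by apply/funext => w /=; congr f; apply/rowP => i; rewrite !mxE tp.
Qed.

End sorted_times.

Lemma markov_bound (R : realType) d (T : measurableType d) (P : probability T R) (Z : T -> R) C M :
  measurable_fun setT Z -> 0 < M -> (\int[P]_w `|Z w|%:E <= C%:E)%E ->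
  (P [set w | (M < `|Z w|)%R] <= (C / M)%:E)%E.
Proof.
move=> mZ M0 EZ; set A := [set w | _].
have mA : measurable A by exact: measurable_abs_gt.
have mn : measurable_fun setT (fun w => `|Z w|%:E).
  by apply/measurable_EFinP; exact: measurableT_comp.
have : (M%:E * P A <= C%:E)%E.
  apply: le_trans EZ; rewrite -integral_cst//.
  apply: (@le_trans _ _ (\int[P]_(w in A) `|Z w|%:E)%E).
    apply: ge0_le_integral => //.
    - by move=> w _; rewrite lee_fin ltW.
    - exact: measurable_funTS.
    - by move=> w; rewrite /A/= lee_fin => /ltW.
  by apply: ge0_subset_integral.
have fA : P A \is a fin_num by exact: fin_num_measure.
by rewrite -(fineK fA) -EFinM !lee_fin ler_pdivlMr// mulrC.
Qed.

Lemma near_large_times (R : realType) (t0 : R) (t : nat -> R) : 0 < t0 -> 0 < t 0%N ->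
  (forall j, t j < t j.+1) ->
  \forall eps \near (0 : R)^'+, 0 < eps /\ forall j : nat, t0 < t j / eps.
Proof.
move=> t00 tpos0 tS; near=> eps; have eps0 : 0 < eps by near: eps; exact: nbhs_right_gt.
have le0 j : t 0%N <= t j by elim: j => // j IH; exact: le_trans (ltW (tS j)).
split=> // j; rewrite ltr_pdivlMr// (@lt_le_trans _ _ (t 0%N))//.
by rewrite mulrC -ltr_pdivlMr//; near: eps; apply: nbhs_right_lt; exact: divr_gt0.
Unshelve. all: by end_near. Qed.

Section velocity.
Context (R : realType) (gamma beta q rho t0 v0 x0 : R).
Hypotheses (gamma1 : 1 <= gamma) (qE : q = beta / (gamma + 1)) (q12 : q < 1 / 2).
Hypotheses (rho0 : 0 < rho) (t00 : 0 < t0).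
Context d (T : measurableType d) (P : probability T R) (B V X : R -> {RV P >-> R}).
Hypotheses (hB : brownian_motion B)
  (hV : sde_solution B V (fun t v => t `^ (- beta) * drift rho gamma v) t0)
  (hV0 : {ae P, forall w, V t0 w = v0})
  (hX : {ae P, forall w, forall t, t0 <= t ->
           X t w = x0 + \int[lebesgue_measure]_(s in `[t0, t]) V s w}).

(** Composition with a law-preserving map makes the almost sure hypotheses hold
    at every sample point, and no statement about laws changes. *)
Lemma regular_paths : exists phi : T -> T, [/\ measurable_fun setT phi,
  forall A, measurable A -> P (phi @^-1` A) = P A,
  solution_paths P (fun t w => B (maxr 0 t) (phi w)) (fun t w => V (maxr t0 t) (phi w))
    rho gamma beta t0 v0 &
  forall w t, t0 <= t ->
    X t (phi w) = x0 + \int[lebesgue_measure]_(s in `[t0, t]) V (maxr t0 s) (phi w)].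
Proof.
have [_ cB _ _] := hB.
pose Q w := [/\ {within `[0, +oo[, continuous (fun t => B t w)},
  {within `[t0, +oo[, continuous (fun t => V t w)},
  forall t, t0 <= t -> V t w = V t0 w + (B t w - B t0 w)
     - \int[lebesgue_measure]_(s in `[t0, t]) (s `^ (- beta) * drift rho gamma (V s w)),
  V t0 w = v0 &
  forall t, t0 <= t -> X t w = x0 + \int[lebesgue_measure]_(s in `[t0, t]) V s w].
have aeQ : {ae P, forall w, Q w}.
  near=> w; split.
  - by near: w; exact: cB.
  - by near: w; apply: filterS hV => w [].
  - by near: w; apply: filterS hV => w [].
  - by near: w; exact: hV0.
  - by near: w; exact: hX.
have [phi [mphi Qphi Pphi _]] := ae_retraction aeQ.
exists phi; split=> //; last first.
  move=> w t tt; have [_ _ _ _ ->//] := Qphi w; congr (_ + _).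
  by apply: eq_int => s /andP[ts _]; rewrite max_r.
split.
- by apply: brownian_motion_retraction => // w; have [] := Qphi w.
- by move=> t; apply: measurableT_comp => //; exact: measurable_funPT.
- by move=> w t; have [_ cV _ _ _] := Qphi w; exact: (continuous_max_within cV).
- by move=> w; rewrite maxxx; have [] := Qphi w.
- move=> w t tt s /andP[ts st]; have [_ _ eV V0 _] := Qphi w.
  have s0 : 0 <= s by rewrite (le_trans (ltW t00)).
  have E1 : maxr t0 s = s := max_r ts.
  have E2 : maxr 0 s = s := max_r s0.
  have E3 : maxr 0 t0 = t0 := max_r (ltW t00).
  rewrite maxxx E1 E2 E3; apply: (etrans (eV s ts)); apply: (congr1 (fun x => _ - x)).
  by apply: eq_int => u /andP[tu _]; rewrite /coefficient max_r.
Unshelve. all: by end_near. Qed.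

Context (Pi : probability R R) (inv : invariant_law (drift rho gamma) Pi).
Context d' (T' : measurableType d') (P' : probability T' R) (VV : R -> {RV P' >-> R}).
Hypothesis hVV : scaled_product_process VV Pi q.

Lemma scaled_product_expectation n (t : nat -> R) (g : nat -> R -> R) : 0 < t 0%N ->
  (forall j, t j < t j.+1) -> (forall j x, 0 <= g j x <= 1) -> (forall j, continuous (g j)) ->
  \int[P']_w (\prod_(i < n) g i (VV (t i) w)) = \prod_(i < n) \int[Pi]_x g i (t i `^ q * x).
Proof.
move=> tpos0 tS g01 cg.
have mg j : measurable_fun setT (g j) by exact: continuous_measurable_fun.
have tmono i j : (i < j)%N -> t i < t j.
  elim: j => // j IH; rewrite ltnS leq_eqVlt => /predU1P[->//|/IH h]; exact: lt_trans (tS j).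
have tpos j : 0 < t j by case: j => // j; rewrite (lt_trans tpos0)// tmono.
have tinj : injective (fun i : 'I_n => t i).
  move=> i j /= E; apply: val_inj; case: (ltngtP i j) => // /tmono; by rewrite E ltxx.
have mtup : measurable_fun setT (fun w => [tuple VV (t i) w | i < n]).
  by apply: measurable_tuple_of => i; exact: measurable_funPT.
pose sc (u : n.-tuple R) := [tuple t i `^ q * tnth u i | i < n].
have msc : measurable_fun setT sc.
  by apply: measurable_tuple_of => i; apply: measurable_funM; [exact: measurable_cst|exact: measurable_tnth].
pose G (u : n.-tuple R) := \prod_(i < n) g i (tnth u i).
have mG : measurable_fun setT G.
  by apply: measurable_prod => i _; apply: (measurableT_comp (mg i)); exact: measurable_tnth.
have G0 u : 0 <= G u by apply: prodr_ge0 => i _; case/andP: (g01 i (tnth u i)).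
transitivity (\int[P']_w G [tuple VV (t i) w | i < n]).
  by congr (Rintegral _ _ _); apply/funext => w; apply: eq_bigr => i _; rewrite tnth_mktuple.
rewrite (@eq_law_expectation _ _ _ _ _ _ _ P' (iid_law Pi n) _ sc mtup msc _ G mG); last first.
  move=> A mA; have := hVV tinj (fun i => tpos i) mA.
  by rewrite iid_lawE.
pose gs j x := g j (t j `^ q * x).
have mgs j : measurable_fun setT (gs j).
  by apply: (measurableT_comp (mg j)); apply: measurable_funM; [exact: measurable_cst|exact: measurable_id].
have gs01 j x : 0 <= gs j x <= 1 by exact: g01.
have gs0 j x : 0 <= gs j x by case/andP: (gs01 j x).
have E : iid_int Pi n (fun s => \prod_(j < n) gs j (nth 0 s j)) = (\prod_(j < n) \int[Pi]_x gs j x)%:E.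
  rewrite iid_int_prod// -prodEFin; apply: eq_bigr => j _.
  rewrite (@Rint_EFin _ _ _ Pi (gs j) 1)// => x.
  by case/andP: (gs01 j x) => h0 h1; rewrite ger0_norm.
rewrite -[RHS]/(fine (_%:E)) -E /Rintegral; congr fine; apply: eq_integral => u _.
congr (_%:E); rewrite /G; apply: eq_bigr => j _.
by rewrite tnth_mktuple /gs (tnth_nth 0).
Qed.

(** The factor [t ^ q] is absorbed into the test functions; tightness comes from
    the a priori bound. *)
Lemma velocity_fdd_cvg :
  fdd_cvg P P' (fun eps t w => eps `^ q * V (t / eps) w) (fun t => VV t).
Proof.
have [phi [mphi Pphi hU _]] := regular_paths.
apply: fdd_cvg_sorted => n t tpos0 tS.
have tmono i j : (i < j)%N -> t i < t j.
  elim: j => // j IH; rewrite ltnS leq_eqVlt => /predU1P[->//|/IH h]; exact: lt_trans (tS j).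
have tpos j : 0 < t j by case: j => // j; rewrite (lt_trans tpos0)// tmono.
pose U s w := V (maxr t0 s) (phi w).
have mU s : measurable_fun setT (U s) by apply: measurableT_comp => //; exact: measurable_funPT.
have near_time : \forall eps \near (0 : R)^'+, 0 < eps /\ forall j : nat, t0 <= t j / eps.
  apply: filterS (near_large_times t00 tpos0 tS) => eps [eps0 h].
  by split=> // j; exact: ltW.
have scale eps j w : 0 < eps -> t0 <= t j / eps ->
    eps `^ q * V (t j / eps) (phi w) = t j `^ q * (U (t j / eps) w / (t j / eps) `^ q).
  move=> eps0 te; rewrite /U max_r//.
  have -> : t j `^ q = (t j / eps) `^ q * eps `^ q.
    by rewrite -powRM ?divr_ge0 ?(ltW (tpos j)) ?(ltW eps0)// divfK// gt_eqF.
  have : (t j / eps) `^ q != 0 by rewrite gt_eqF// powR_gt0// divr_gt0.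
  by move: (_ `^ q) (eps `^ q) (V _ _) => a b c a0; field.
have mZ eps i : measurable_fun setT (fun w => eps `^ q * V (t i / eps) w).
  by apply: measurable_funM; [exact: measurable_cst|exact: measurable_funPT].
apply: (@cvg_in_law_criterion _ _ _ P _ _ P' n (fun eps i w => eps `^ q * V (t i / eps) w)
   (fun i => VV (t i))) => //.
- move=> e e0; have [C C0 hC] := a_priori_bound rho0 gamma1 t00 qE q12 hU.
  pose S := \sum_(i < n) t i `^ q.
  have S0 : 0 <= S by apply: sumr_ge0 => i _; exact: powR_ge0.
  exists ((S * C + 1) / e); first by rewrite divr_gt0// ltr_wpDl// mulr_ge0.
  set M := _ / e => i; have M0 : 0 < M by rewrite divr_gt0// ltr_wpDl// mulr_ge0.
  apply: filterS near_time => eps [eps0 te].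
  have mA : measurable [set w | M < `|eps `^ q * V (t i / eps) w|] by exact: measurable_abs_gt.
  rewrite -(Pphi _ mA).
  rewrite (_ : phi @^-1` _ = [set w | M < `|t i `^ q * (U (t i / eps) w / (t i / eps) `^ q)|]); last first.
    by apply/seteqP; split=> w /=; rewrite scale.
  have te0 : 0 < (t i / eps) `^ q by rewrite powR_gt0// divr_gt0.
  have mf : measurable_fun setT (fun w => t i `^ q * (U (t i / eps) w / (t i / eps) `^ q)).
    by apply: measurable_funM; [exact: measurable_cst|
      apply: measurable_funM; [exact: mU|exact: measurable_cst]].
  have E1 : (\int[P]_w `|t i `^ q * (U (t i / eps) w / (t i / eps) `^ q)|%:E <= (S * C)%:E)%E.
    apply: (le_trans (@expectation_linear_bound _ _ _ P _ (fun=> 0) (fun w => `|U (t i / eps) w|)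
      (fun=> 0) 0 (C * (t i / eps) `^ q) 0 0 (t i `^ q / (t i / eps) `^ q) 0 _ _ _ _ _ _ _ _ _ _ _ _ _ _ _))
      => //.
    - exact: measurableT_comp.
    - exact: measurableT_comp (mU _).
    - by rewrite divr_ge0// powR_ge0.
    - by rewrite integral0.
    - exact: hC.
    - by rewrite integral0.
    - move=> w; rewrite !add0r mul0r addr0 !normrM ger0_norm ?powR_ge0// mulrA mulrAC.
      by rewrite [`|_^-1|]ger0_norm// invr_ge0 powR_ge0.
    rewrite lee_fin !add0r mul0r addr0.
    have -> : t i `^ q / (t i / eps) `^ q * (C * (t i / eps) `^ q) = t i `^ q * C.
      by field; rewrite gt_eqF.
    rewrite ler_wpM2r// /S (bigD1 i)//= lerDl sumr_ge0// => j _; exact: powR_ge0.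
  apply: (le_trans (markov_bound mf M0 E1)); rewrite lee_fin /M invf_div mulrCA.
  by rewrite ger_pMr// ler_pdivrMr ?mul1r ?lerDl// ltr_wpDl// mulr_ge0.
- move=> m k M M0.
  pose g j x : R := if insub j is Some i then trig_weight m (k (i : 'I_n)) M x else 1.
  have gE (i : 'I_n) x : g i x = trig_weight m (k i) M x.
    by rewrite /g; case: insubP => [i' _ /val_inj ->//|]; rewrite ltn_ord.
  have gL j : bounded_lipschitz (g j).
    rewrite /g; case: insubP => [i _ _|_]; last exact: bounded_lipschitz_cst.
    exact: bounded_lipschitz_trig_weight.
  have g01 j x : 0 <= g j x <= 1.
    rewrite /g; case: insubP => [i _ _|_]; last by rewrite ler01 lexx.
    by rewrite trig_weight_ge0 trig_weight_le1.
  have cg j : continuous (g j) by have [D _ [_ h]] := gL j; exact: lipschitz_continuous h.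
  have /choice[D hD] : forall j, exists D, 0 <= D /\ forall x y, `|g j x - g j y| <= D * `|x - y|.
    by move=> j; have [D D0 [_ h]] := gL j; exists D.
  pose gs j x := if (j < n)%N then g j (t j `^ q * x) else 1.
  pose K := \sum_(j < n) D j * t j `^ q.
  have DT0 j : 0 <= D j * t j `^ q by rewrite mulr_ge0 ?powR_ge0//; have [] := hD j.
  have K0 : 0 <= K by apply: sumr_ge0.
  have gs01 j x : 0 <= gs j x <= 1 by rewrite /gs; case: ifP => _; rewrite ?g01// ler01 lexx.
  have gsK j x y : `|gs j x - gs j y| <= K * `|x - y|.
    rewrite /gs; case: ifPn => [jn|_]; last by rewrite subrr normr0 mulr_ge0.
    have [_ h] := hD j; rewrite (le_trans (h _ _))// -mulrBr normrM ger0_norm ?powR_ge0// mulrA.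
    rewrite ler_wpM2r// /K (bigD1 (Ordinal jn))//= lerDl; apply: sumr_ge0 => i _; exact: DT0.
  have := window_product_limit rho0 gamma1 t00 qE q12 hU inv (n := n) tpos0 tS K0 gs01 gsK.
  have -> : \prod_(j < n) \int[Pi]_x gs j x = \int[P']_w \prod_i trig_weight m (k i) M (VV (t i) w).
    transitivity (\int[P']_w (\prod_(i < n) g i (VV (t i) w))).
      rewrite scaled_product_expectation//; apply: eq_bigr => j _.
      by congr (Rintegral _ _ _); apply/funext => x; rewrite /gs ltn_ord.
    by congr (Rintegral _ _ _); apply/funext => w; apply: eq_bigr => i _; rewrite gE.
  apply: cvg_trans; apply: near_eq_cvg; apply: filterS near_time => eps [eps0 te].
  pose G w := \prod_(i < n) trig_weight m (k i) M (eps `^ q * V (t i / eps) w).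
  have mG : measurable_fun setT G by exact: (measurable_prod_weight (fun i : 'I_n => mZ eps i) k M).
  have G0 w : 0 <= G w by apply: prodr_ge0 => i _; exact: trig_weight_ge0.
  rewrite -(@eq_law_expectation _ _ _ _ _ _ _ P P phi id _ _ _ G) //.
  congr (Rintegral _ _ _); apply/funext => w; apply: eq_bigr => i _.
  by rewrite scale// -gE /gs ltn_ord.
Qed.

End velocity.

(** * Sums of independent normal variables *)

Section gaussian_sums.
Context {R : realType}.
Local Notation N := (@std_normal R).
Implicit Types (f : R -> R) (a b c x : R).

Lemma normal_reflect_scale (h : R -> \bar R) a : measurable_fun setT h ->
  (\int[N]_x h (a * x)%R = \int[N]_x h (`|a| * x)%R)%E.
Proof.
move=> mh; have [a0|a0] := leP 0 a; first by rewrite ger0_norm.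
have mo : measurable_fun [set: R] (fun x : R => - x) by exact: measurable_funN.
rewrite ltr0_norm//; transitivity (\int[N]_x h (- a * - x)%R)%E.
  by apply: eq_integral => x _; rewrite mulrNN.
apply: (@eq_law_integral _ _ _ _ _ _ _ N N (fun x => - x) id mo _ _ (fun x => h (- a * x))) => //.
  by move=> A mA; exact: normal_probN.
by apply: (measurableT_comp mh); apply: measurable_funM; [exact: measurable_cst|exact: measurable_id].
Qed.

Lemma measurable_nth m k : measurable_fun [set: m.-tuple R] (fun u => nth 0 u k).
Proof.
have [km|mk] := ltnP k m.
  apply: (eq_measurable_fun (fun u : m.-tuple R => tnth u (Ordinal km))); last exact: measurable_tnth.
  by move=> u _; rewrite (tnth_nth 0).
rewrite (_ : (fun u => _) = cst 0); first exact: measurable_cst.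
by apply/funext => u; rewrite nth_default// size_tuple.
Qed.

(** The two independent variables are realized as consecutive increments of a
    Brownian motion, whose sum is again an increment. *)
Lemma normal_convolution d (T : measurableType d) (P : probability T R) (W : R -> T -> R) f a b :
  continuous_bm P W -> measurable_fun setT f -> (forall x, 0 <= f x) -> 0 <= a -> 0 <= b ->
  (\int[N]_x \int[N]_y (f (a * x + b * y))%:E =
   \int[N]_z (f (Num.sqrt (a ^+ 2 + b ^+ 2) * z))%:E)%E.
Proof.
move=> cW mf f0; rewrite le_eqVlt => /predU1P[<- b0|a0].
  rewrite expr0n add0r sqrtr_sqr ger0_norm//.
  under eq_integral do under eq_integral do rewrite mul0r add0r.
  by rewrite integral_cst//; have := probability_setT N => /= ->; rewrite mule1.
rewrite le_eqVlt => /predU1P[<-|b0].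
  rewrite expr0n addr0 sqrtr_sqr ger0_norm ?(ltW a0)//; apply: eq_integral => x _.
  under eq_integral do rewrite mul0r addr0.
  by rewrite integral_cst//; have := probability_setT N => /= ->; rewrite mule1.
pose s k := match k with 0%N => 0 | 1%N => a ^+ 2 | _ => a ^+ 2 + b ^+ 2 end.
pose G (l : seq R) := f (a * nth 0 l 0 + b * nth 0 l 1).
have G0 l : 0 <= G l by exact: f0.
have mG : measurable_seqfun G.
  move=> m; apply: (measurableT_comp mf); apply: measurable_funD;
    (apply: measurable_funM; [exact: measurable_cst|exact: measurable_nth]).
have smono i : (i < 2)%N -> s i < s i.+1.
  by case: i => [|[|]]//= _; rewrite ?exprn_gt0// ltrDl exprn_gt0.
have := @increments_iid _ _ _ P W cW s 2 G (lexx _) smono G0 mG.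
rewrite iid_intS//.
have -> : (\int[N]_x iid_int N 1 (fun s => G (x :: s)) =
    \int[N]_x \int[N]_y (f (a * x + b * y))%:E)%E.
  apply: eq_integral => x _; rewrite iid_intS//; last exact: measurable_seqfun_cons.
  apply: eq_integral => y _; rewrite iid_int0//.
  exact: (measurable_seqfun_cons y (measurable_seqfun_cons x mG)).
move=> <-.
have s2 : 0 <= s 2 by rewrite addr_ge0 ?exprn_ge0 ?ltW.
have := @increment_expectation _ _ _ P W cW f 0 (s 2) (lexx _) s2 f0 mf.
rewrite subr0 => <-; apply: eq_integral => w _; congr (_%:E); rewrite /G /=; congr f.
rewrite subr0 (addrC (a ^+ 2)) addrK !sqrtr_sqr !ger0_norm ?(ltW a0) ?(ltW b0)//.
rewrite [a * _]mulrC [b * _]mulrC !divfK ?gt_eqF// [RHS]addrC.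
by set x := W 0 w; set y := W (a ^+ 2) w; set z := W (_ + _) w; ring.
Qed.

Lemma iid_normal_sum d (T : measurableType d) (P : probability T R) (W : R -> T -> R)
    f (phi : nat -> R) n : continuous_bm P W -> measurable_fun setT f -> (forall x, 0 <= f x) ->
  iid_int N n (fun s => f (\sum_(k < n) phi k * nth 0 s k)) =
  (\int[N]_x (f (Num.sqrt (\sum_(k < n) phi k ^+ 2) * x))%:E)%E.
Proof.
move=> cW; elim: n phi f => [|n IH] phi f mf f0.
  rewrite iid_int0//; last first.
    move=> m; apply: (eq_measurable_fun (cst (f 0))) => // u _; by rewrite big_ord0.
  rewrite !big_ord0 sqrtr0; under eq_integral do rewrite mul0r.
  by rewrite integral_cst//; have := probability_setT N => /= ->; rewrite mule1.
have mS m j (psi : nat -> R) : measurable_fun [set: m.-tuple R]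
    (fun u => f (\sum_(k < j) psi k * nth 0 u k)).
  apply: (measurableT_comp mf); apply: measurable_sum => k.
  by apply: measurable_funM; [exact: measurable_cst|exact: measurable_nth].
rewrite iid_intS//.
pose v := \sum_(k < n) phi k.+1 ^+ 2.
have v0 : 0 <= v by apply: sumr_ge0 => k _; exact: sqr_ge0.
have maff x : measurable_fun setT (fun y => f (phi 0%N * x + y)).
  by apply: (measurableT_comp mf); apply: measurable_funD; [exact: measurable_cst|exact: measurable_id].
transitivity (\int[N]_x \int[N]_y (f (phi 0%N * x + Num.sqrt v * y))%:E)%E.
  apply: eq_integral => x _.
  rewrite -(IH (fun k => phi k.+1) (fun y => f (phi 0%N * x + y)))//.
  by apply: eq_iid_int => s _; rewrite big_ord_recl.
pose h (z : R) := (\int[N]_y (f (z + Num.sqrt v * y))%:E)%E.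
have mh : measurable_fun setT h.
  pose g (s : seq R) := f (nth 0 s 0 + Num.sqrt v * nth 0 s 1).
  have mg : measurable_seqfun g.
    move=> m; apply: (measurableT_comp mf); apply: measurable_funD; first exact: measurable_nth.
    by apply: measurable_funM; [exact: measurable_cst|exact: measurable_nth].
  have g0 s : 0 <= g s by exact: f0.
  rewrite (_ : h = fun x => iid_int N 1 (fun s => g (x :: s))); first exact: measurable_iid_int_cons.
  apply/funext => x; rewrite iid_intS//; last exact: measurable_seqfun_cons.
  apply: eq_integral => y _; rewrite iid_int0//.
  exact: (measurable_seqfun_cons y (measurable_seqfun_cons x mg)).
rewrite (normal_reflect_scale (phi 0%N) mh) (normal_convolution cW mf f0)//.
by rewrite sqr_sqrtr// real_normK ?num_real// big_ord_recl.
Qed.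

End gaussian_sums.

(** * Trigonometric moments and Gaussian vectors *)

Section trigonometric_criterion.
Context {R : realType} d (T : measurableType d) (P : probability T R)
  d' (T' : measurableType d') (P' : probability T' R) (n : nat).
Variables (Z : R -> 'I_n -> T -> R) (Y : 'I_n -> T' -> R).
Hypotheses (mZ : forall eps i, measurable_fun setT (Z eps i))
  (mY : forall i, measurable_fun setT (Y i)).
Implicit Types (h m : ('I_n -> R) -> R) (a : 'I_n -> R) (b : R).

Let phase a b (x : 'I_n -> R) := \sum_i a i * x i + b.

Definition admissible h := [/\ exists C, forall x, `|h x| <= C,
  forall eps, measurable_fun setT (fun w => h (Z eps ^~ w)) &
  measurable_fun setT (fun w => h (Y ^~ w))].

Definition trig_cvg h := forall a b,
  \int[P]_w (h (Z eps ^~ w) * cos (phase a b (Z eps ^~ w))) @[eps --> 0^'+] -->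
  \int[P']_w (h (Y ^~ w) * cos (phase a b (Y ^~ w))).

(** Functions by which one may multiply a test function without losing the
    convergence of its trigonometric moments; the product formula for cosines
    makes them a ring containing the trigonometric functions. *)
Definition multiplier m := admissible m /\
  forall h, admissible h -> trig_cvg h -> trig_cvg (fun x => m x * h x).

Lemma admissibleM h m : admissible h -> admissible m -> admissible (fun x => h x * m x).
Proof.
move=> [[C hC] h1 h2] [[D mD] m1 m2]; split.
- exists (`|C| * `|D|) => x; rewrite normrM ler_pM//.
    by rewrite (le_trans (hC x))// ler_norm.
  by rewrite (le_trans (mD x))// ler_norm.
- by move=> eps; exact: measurable_funM.
- exact: measurable_funM.
Qed.

Lemma admissibleD h m : admissible h -> admissible m -> admissible (fun x => h x + m x).
Proof.
move=> [[C hC] h1 h2] [[D mD] m1 m2]; split.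
- by exists (C + D) => x; rewrite (le_trans (ler_normD _ _))// lerD.
- by move=> eps; exact: measurable_funD.
- exact: measurable_funD.
Qed.

Lemma admissible_cst b : admissible (fun=> b).
Proof. by split=> [|eps|]; [exists `|b| |exact: measurable_cst|exact: measurable_cst]. Qed.

Lemma admissible_cos a b : admissible (fun x => cos (phase a b x)).
Proof.
have mc d1 (T1 : measurableType d1) (X : 'I_n -> T1 -> R) : (forall i, measurable_fun setT (X i)) ->
    measurable_fun setT (fun w => cos (phase a b (X ^~ w))).
  move=> mX; apply: (@measurableT_comp _ _ _ _ _ _ (@cos R)).
    by apply: continuous_measurable_fun; exact: continuous_cos.
  apply: measurable_funD; last exact: measurable_cst.
  by apply: measurable_sum => i; apply: measurable_funM; [exact: measurable_cst|exact: mX].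
split.
- by exists 1 => x; rewrite ler_norml cos_geN1 cos_le1.
- by move=> eps; exact: mc.
- exact: mc.
Qed.

Let integrable_test h a b : admissible h ->
  (forall eps, P.-integrable setT (EFin \o (fun w => h (Z eps ^~ w) * cos (phase a b (Z eps ^~ w))))) /\
  P'.-integrable setT (EFin \o (fun w => h (Y ^~ w) * cos (phase a b (Y ^~ w)))).
Proof.
move=> ah; have [[C hC] h1 h2] := admissibleM ah (admissible_cos a b).
by split=> [eps|]; apply: (@integrable_bounded _ _ _ _ _ C).
Qed.

(** The product of two cosines is half the sum of the cosines of the sum and of
    the difference of the phases. *)
Lemma multiplier_cos a' b' : multiplier (fun x => cos (phase a' b' x)).
Proof.
split; first exact: admissible_cos.
move=> h ah ch a b.
have E x : cos (phase a' b' x) * h x * cos (phase a b x) =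
    1 / 2 * (h x * cos (phase (fun i => a i - a' i) (b - b') x)) +
    1 / 2 * (h x * cos (phase (fun i => a i + a' i) (b + b') x)).
  have -> : phase (fun i => a i - a' i) (b - b') x = phase a b x - phase a' b' x.
    rewrite /phase opprD addrACA -sumrB; congr (_ + _); apply: eq_bigr => i _; exact: mulrBl.
  have -> : phase (fun i => a i + a' i) (b + b') x = phase a b x + phase a' b' x.
    rewrite /phase addrACA -big_split/=; congr (_ + _); apply: eq_bigr => i _; exact: mulrDl.
  by move: (phase a b x) (phase a' b' x) (h x) => p p' y; rewrite cosB cosD; field.
have [iZ iY] := integrable_test (fun i => a i - a' i) (b - b') ah.
have [jZ jY] := integrable_test (fun i => a i + a' i) (b + b') ah.
have Zl d1 (T1 : measurableType d1) (P1 : probability T1 R) (f : T1 -> R) :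
    P1.-integrable setT (EFin \o f) -> P1.-integrable setT (EFin \o (fun w => 1 / 2 * f w)).
  by move=> intf; exact: (integrableZl measurableT (1 / 2) intf).
under eq_Rintegral do rewrite E.
rewrite RintegralD ?RintegralZl//; [|exact: Zl|exact: Zl].
have EZ : (fun eps => \int[P]_w (cos (phase a' b' (Z eps ^~ w)) * h (Z eps ^~ w) * cos (phase a b (Z eps ^~ w)))) =
    fun eps => 1 / 2 * \int[P]_w (h (Z eps ^~ w) * cos (phase (fun i => a i - a' i) (b - b') (Z eps ^~ w)))
      + 1 / 2 * \int[P]_w (h (Z eps ^~ w) * cos (phase (fun i => a i + a' i) (b + b') (Z eps ^~ w))).
  apply/funext => eps; under eq_Rintegral do rewrite E.
  by rewrite RintegralD ?RintegralZl//; exact: Zl.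
by rewrite EZ; apply: cvgD; apply: cvgMr; exact: ch.
Qed.

Lemma multiplierM m m' : multiplier m -> multiplier m' -> multiplier (fun x => m x * m' x).
Proof.
move=> [am hm] [am' hm']; split; first exact: admissibleM.
move=> h ah ch; rewrite (_ : (fun x => _) = fun x => m x * (m' x * h x)); last first.
  by apply/funext => x; rewrite mulrA.
by apply: hm; [exact: admissibleM|exact: hm'].
Qed.

Lemma multiplierD m m' : multiplier m -> multiplier m' -> multiplier (fun x => m x + m' x).
Proof.
move=> [am hm] [am' hm']; split; first exact: admissibleD.
move=> h ah ch a b.
have [iZ iY] := integrable_test a b (admissibleM am ah).
have [jZ jY] := integrable_test a b (admissibleM am' ah).
have E x : (m x + m' x) * h x * cos (phase a b x) =
    m x * h x * cos (phase a b x) + m' x * h x * cos (phase a b x) by rewrite !mulrDl.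
under eq_Rintegral do rewrite E.
rewrite RintegralD//.
have EZ : (fun eps => \int[P]_w ((m (Z eps ^~ w) + m' (Z eps ^~ w)) * h (Z eps ^~ w) * cos (phase a b (Z eps ^~ w)))) =
    fun eps => \int[P]_w (m (Z eps ^~ w) * h (Z eps ^~ w) * cos (phase a b (Z eps ^~ w)))
      + \int[P]_w (m' (Z eps ^~ w) * h (Z eps ^~ w) * cos (phase a b (Z eps ^~ w))).
  by apply/funext => eps; under eq_Rintegral do rewrite E; rewrite RintegralD.
by rewrite EZ; apply: cvgD; [exact: hm|exact: hm'].
Qed.

Lemma multiplier_cst c : multiplier (fun=> c).
Proof.
split; first exact: admissible_cst.
move=> h ah ch a b; have [iZ iY] := integrable_test a b ah.
under eq_Rintegral do rewrite -mulrA.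
rewrite RintegralZl//.
have EZ : (fun eps => \int[P]_w (c * h (Z eps ^~ w) * cos (phase a b (Z eps ^~ w)))) =
    fun eps => c * \int[P]_w (h (Z eps ^~ w) * cos (phase a b (Z eps ^~ w))).
  by apply/funext => eps; under eq_Rintegral do rewrite -mulrA; rewrite RintegralZl.
by rewrite EZ; apply: cvgMr; exact: ch.
Qed.

Lemma multiplierX m k : multiplier m -> multiplier (fun x => m x ^+ k).
Proof.
move=> hm; elim: k => [|k IH]; first exact: multiplier_cst.
rewrite (_ : (fun x => _) = fun x => m x * m x ^+ k); first exact: multiplierM.
by apply/funext => x; rewrite exprS.
Qed.

Lemma multiplier_prod (I : Type) (s : seq I) (m : I -> ('I_n -> R) -> R) :
  (forall i, multiplier (m i)) -> multiplier (fun x => \prod_(i <- s) m i x).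
Proof.
move=> hm; elim: s => [|i s IH].
  rewrite (_ : (fun x => _) = fun=> 1); first exact: multiplier_cst.
  by apply/funext => x; rewrite big_nil.
rewrite (_ : (fun x => _) = fun x => m i x * \prod_(j <- s) m j x); first exact: multiplierM.
by apply/funext => x; rewrite big_cons.
Qed.

(** A weight is a polynomial in [sin (x i / (2 * M))], itself a shifted cosine
    of a linear form. *)
Lemma multiplier_trig_weight (p k : nat) M i : multiplier (fun x => trig_weight p k M (x i)).
Proof.
have ms : multiplier (fun x => sin (x i / (2 * M))).
  rewrite (_ : (fun x => _) = fun x => cos (phase (fun j => (j == i)%:R / (2 * M)) (- (pi / 2)) x)).
    exact: multiplier_cos.
  apply/funext => x; rewrite /phase cosBpihalf; congr sin.
  rewrite (bigD1 i)//= eqxx big1 ?addr0; first by rewrite mulrAC mul1r.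
  by move=> j ji; rewrite (negbTE ji) !mul0r.
have mu : multiplier (fun x => to_unit M (x i)).
  rewrite (_ : (fun x => _) = fun x => (1 + sin (x i / (2 * M))) * 2^-1)//.
  by apply: multiplierM; [apply: multiplierD => //|]; exact: multiplier_cst.
rewrite /trig_weight /bernstein.
apply: multiplierM; last first.
  apply: multiplierX; rewrite (_ : (fun x => _) = fun x => 1 + (-1) * to_unit M (x i)); last first.
    by apply/funext => x; rewrite mulN1r.
  by apply: multiplierD; [exact: multiplier_cst|apply: multiplierM => //; exact: multiplier_cst].
by apply: multiplierM; [exact: multiplier_cst|exact: multiplierX].
Qed.

Lemma trig_weights_cvg (p : nat) (k : {ffun 'I_n -> 'I_p.+1}) M :
  (forall a b, \int[P]_w cos (\sum_i a i * Z eps i w + b) @[eps --> 0^'+] -->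
     \int[P']_w cos (\sum_i a i * Y i w + b)) ->
  \int[P]_w (\prod_i trig_weight p (k i) M (Z eps i w)) @[eps --> 0^'+] -->
  \int[P']_w (\prod_i trig_weight p (k i) M (Y i w)).
Proof.
move=> hcos.
have h1 : trig_cvg (fun=> 1).
  move=> a b; under eq_Rintegral do rewrite mul1r.
  rewrite (_ : (fun eps => _) = fun eps => \int[P]_w cos (phase a b (Z eps ^~ w))); first exact: hcos.
  by apply/funext => eps; under eq_Rintegral do rewrite mul1r.
have [_ hm] := multiplier_prod (index_enum 'I_n) (fun i => multiplier_trig_weight p (k i) M i).
have := hm _ (admissible_cst 1) h1 (fun=> 0) 0.
have ph x : phase (fun=> 0) 0 x = 0 by rewrite /phase big1 ?addr0// => i _; rewrite mul0r.
under eq_Rintegral do rewrite ph cos0 !mulr1.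
rewrite (_ : (fun eps => _) = fun eps => \int[P]_w (\prod_i trig_weight p (k i) M (Z eps i w)))//.
by apply/funext => eps; under eq_Rintegral do rewrite ph cos0 !mulr1.
Qed.

End trigonometric_criterion.

Section gaussian_vectors.
Context {R : realType} d (T : measurableType d) (P : probability T R).
Local Notation N := (@std_normal R).

Let mid : measurable_fun [set: R] (fun x : R => x). Proof. exact: measurable_id. Qed.

Lemma integral_std_normal_sqr : (\int[N]_x (x ^+ 2)%:E = 1)%E.
Proof.
rewrite ge0_integral_std_normal ?normal_second_moment//.
  by apply/measurable_EFinP; exact: measurable_funX.
by move=> x; rewrite lee_fin sqr_ge0.
Qed.

Lemma integrable_std_normal_id : N.-integrable setT (fun x => x%:E).
Proof.
apply/integrableP; split; first exact/measurable_EFinP.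
rewrite ge0_integral_std_normal//.
- have := @normal_moment_finite R 1 ler01; congr (_ < _)%E.
  by apply: eq_integral => x _; rewrite powRr1.
- by apply: measurableT_comp => //; exact/measurable_EFinP.
Qed.

(** Dirac masses and nondegenerate normal laws are all images of the standard
    one under affine maps, which removes the case distinction. *)
Lemma gaussian_rv_law (X : T -> R) : gaussian_rv P X -> exists m s : R, 0 <= s /\
  forall A, measurable A -> P (X @^-1` A) = N ((fun x => m + s * x) @^-1` A).
Proof.
move=> [m [s [s0 law]]]; exists m, s; split=> // A mA; rewrite law//.
case: eqP => [->|/eqP sn0].
  rewrite diracE; have [Am|Am] := pselect (A m).
    rewrite mem_set// (_ : _ @^-1` A = setT); first by have := probability_setT N => /= ->.
    by apply/seteqP; split=> // x _; rewrite /= mul0r addr0.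
  rewrite memNset// (_ : _ @^-1` A = set0) ?measure0//.
  by apply/seteqP; split=> // x; rewrite /= mul0r addr0.
by rewrite normal_prob_affine// lt_neqAle eq_sym sn0.
Qed.

Let maff m s : measurable_fun [set: R] (fun x : R => m + s * x).
Proof.
apply: measurable_funD; first exact: measurable_cst.
by apply: measurable_funM => //; exact: measurable_cst.
Qed.

Let intaff m s : N.-integrable setT (EFin \o (fun x : R => m + s * x)).
Proof.
have i1 : N.-integrable setT (EFin \o (fun=> m)).
  by apply: (@integrable_bounded _ _ _ N (fun=> m) `|m|) => //; exact: measurable_cst.
have i2 : N.-integrable setT (EFin \o (fun x => s * x)).
  exact: (integrableZl measurableT s integrable_std_normal_id).
exact: (integrableD measurableT i1 i2).
Qed.

Section one_variable.
Variables (X : T -> R) (m s : R).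
Hypotheses (mX : measurable_fun setT X)
  (law : forall A, measurable A -> P (X @^-1` A) = N ((fun x => m + s * x) @^-1` A)).

Lemma integrable_gaussian : P.-integrable setT (EFin \o X).
Proof.
apply/integrableP; split; first exact/measurable_EFinP.
have /integrableP[_] := intaff m s; congr (_ < _)%E.
apply/esym; apply: (eq_law_integral mX (maff m s) law (f := fun x => `|x%:E|%E)).
by apply: measurableT_comp => //; exact/measurable_EFinP.
Qed.

Lemma gaussian_mean : \int[P]_w X w = m.
Proof.
rewrite (eq_law_expectation mX (maff m s) law mid).
rewrite RintegralD//; last 2 first.
- by apply: (@integrable_bounded _ _ _ N (fun=> m) `|m|) => //; exact: measurable_cst.
- exact: (integrableZl measurableT s integrable_std_normal_id).
rewrite Rint_cst RintegralZl//; last exact: integrable_std_normal_id.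
by rewrite /Rintegral integral_std_normal_id mulr0 addr0.
Qed.

Lemma gaussian_second_moment : m = 0 -> (\int[P]_w (X w ^+ 2)%:E = (s ^+ 2)%:E)%E.
Proof.
move=> m0; rewrite (eq_law_integral mX (maff m s) law (f := fun x => (x ^+ 2)%:E)); last first.
  by apply/measurable_EFinP; exact: measurable_funX.
transitivity (\int[N]_x ((s ^+ 2)%:E * (x ^+ 2)%:E))%E.
  by apply: eq_integral => x _; rewrite m0 add0r exprMn.
rewrite ge0_integralZl//; last 3 first.
- by apply/measurable_EFinP; exact: measurable_funX.
- by move=> x _; rewrite lee_fin sqr_ge0.
- by rewrite lee_fin sqr_ge0.
by rewrite integral_std_normal_sqr mule1.
Qed.

End one_variable.

(** A normal law is determined by its mean and its variance, and the latter is
    the quadratic form of the covariances. *)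
Lemma centered_gaussian_expectation (Y : R -> {RV P >-> R}) (K : R -> R -> R) n
    (t a : 'I_n -> R) (f : R -> R) :
  centered_gaussian_process Y K -> (forall i, 0 <= t i) -> measurable_fun setT f ->
  \int[P]_w f (\sum_i a i * Y (t i) w) =
  \int[N]_x f (Num.sqrt (\sum_i \sum_j a i * a j * K (t i) (t j)) * x).
Proof.
move=> [gY mean cov] t0 mf.
have mY s : measurable_fun setT (Y s) by exact: measurable_funPT.
pose S w := \sum_i a i * Y (t i) w.
have mS : measurable_fun setT S.
  by apply: measurable_sum => i; apply: measurable_funM; [exact: measurable_cst|exact: mY].
have [m [s [s0 lawS]]] := gaussian_rv_law (gY n t a t0).
have lawY i : exists m s : R, 0 <= s /\
    forall A, measurable A -> P (Y (t i) @^-1` A) = N ((fun x => m + s * x) @^-1` A).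
  have := gY 1%N (fun=> t i) (fun=> 1) (fun=> t0 i).
  rewrite (_ : (fun w => _) = Y (t i)); first exact: gaussian_rv_law.
  by apply/funext => w; rewrite big_ord1 mul1r.
have intY i : P.-integrable setT (EFin \o Y (t i)).
  by have [m' [s' [_ h]]] := lawY i; exact: (integrable_gaussian (mY _) h).
have meanY i : \int[P]_w Y (t i) w = 0.
  by rewrite /Rintegral; have := mean (t i) (t0 i); rewrite unlock => /= ->.
have intYY i : P.-integrable setT (EFin \o (fun w => Y (t i) w ^+ 2)).
  have [m' [s' [_ h]]] := lawY i.
  have m0 : m' = 0 by rewrite -(gaussian_mean (mY _) h) meanY.
  apply/integrableP; split; first by apply/measurable_EFinP; exact: measurable_funX.
  under eq_integral => w _ do rewrite /= ger0_norm ?sqr_ge0//.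
  by rewrite (gaussian_second_moment (mY _) h m0) ltry.
have intYZ i j : P.-integrable setT (EFin \o (fun w => Y (t i) w * Y (t j) w)).
  apply: (le_integrable measurableT _ _ (integrableD measurableT (intYY i) (intYY j))).
    by apply/measurable_EFinP; exact: measurable_funM.
  move=> w _; rewrite /= lee_fin [leRHS]ger0_norm ?addr_ge0 ?sqr_ge0//.
  rewrite normrM -(real_normK (num_real (Y (t i) w))) -(real_normK (num_real (Y (t j) w))).
  by set x := `|_|; set y := `|_|; have := sqr_ge0 (x - y); have := sqr_ge0 (x + y); nra.
have covY i j : \int[P]_w (Y (t i) w * Y (t j) w) = K (t i) (t j).
  have := cov _ _ (t0 i) (t0 j); rewrite covariance.unlock mean// mean//.
  rewrite unlock => /(congr1 fine)/= <-; congr fine; apply: eq_integral => w _.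
  by rewrite -[RHS]/(((Y (t i) w - 0) * (Y (t j) w - 0))%:E) !subr0.
have m0 : m = 0.
  rewrite -(gaussian_mean mS lawS) /S Rint_lin// big1// => i _; by rewrite meanY mulr0.
have s2 : s ^+ 2 = \sum_i \sum_j a i * a j * K (t i) (t j).
  have := gaussian_second_moment mS lawS m0 => /(congr1 fine)/= <-.
  rewrite pair_big /=.
  transitivity (\int[P]_w \sum_(p : 'I_n * 'I_n) a p.1 * a p.2 * (Y (t p.1) w * Y (t p.2) w)).
    congr Rintegral; apply/funext => w; rewrite /S expr2 big_distrlr/= pair_big/=.
    by apply: eq_bigr => p _; rewrite mulrACA.
  by rewrite Rint_lin//; apply: eq_bigr => p _; rewrite covY.
rewrite (eq_law_expectation mS (maff m s) lawS mf) m0 -s2 sqrtr_sqr ger0_norm//.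
by congr Rintegral; apply/funext => x; rewrite add0r.
Qed.

End gaussian_vectors.

(** * Integrals of powers of time against Brownian motion *)

Section finite_sums.
Context {R : realType}.

Lemma sum_blocks (F : nat -> nat -> R) n N : (0 < N)%N ->
  \sum_(k < n * N) F (k %/ N)%N (k %% N)%N = \sum_(j < n) \sum_(i < N) F j i.
Proof.
move=> N0; elim: n => [|n IH]; first by rewrite !big_ord0.
rewrite big_ord_recr/= -IH -(big_mkord xpredT (fun k => F (k %/ N)%N (k %% N)%N)).
rewrite -(big_mkord xpredT (fun k => F (k %/ N)%N (k %% N)%N)).
rewrite (@big_cat_nat _ _ _ (n * N))//= ?leq_mul//; congr (_ + _).
rewrite mulSn addnC -{1}[(n * N)%N]add0n big_addn addnC addnK big_mkord.
apply: eq_bigr => i _; rewrite addnC divnMDl// modnMDl divn_small ?modn_small ?addn0//.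
Qed.

Lemma sum_ord_le n (J : nat -> R) i : (i < n)%N ->
  \sum_(k < i.+1) J k = \sum_(k < n) (k <= i)%:R * J k.
Proof.
move=> iN; rewrite (big_ord_widen _ _ iN) big_mkcond/=; apply: eq_bigr => k _.
by rewrite ltnS; case: (k <= i)%N; rewrite ?mul1r ?mul0r.
Qed.

(** Summation by parts: a combination of values at the end points becomes a
    combination of increments. *)
Lemma sum_abel n (a J : nat -> R) :
  \sum_(i < n) a i * (\sum_(k < i.+1) J k) =
  \sum_(k < n) (\sum_(i < n) a i * (k <= i)%:R) * J k.
Proof.
under eq_bigr do rewrite (sum_ord_le J (ltn_ord _)) mulr_sumr.
rewrite exchange_big/=; apply: eq_bigr => k _; rewrite mulr_suml; apply: eq_bigr => i _.
by rewrite mulrA.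
Qed.

Lemma telescope_ord n (H : nat -> R) : \sum_(k < n) (H k.+1 - H k) = H n - H 0%N.
Proof. by rewrite -(big_mkord xpredT (fun k => H k.+1 - H k)) telescope_sumr. Qed.

(** The variance of a combination of values at increasing times of a process
    with uncorrelated increments. *)
Lemma quadratic_telescope n (a H : nat -> R) :
  \sum_(k < n) (\sum_(i < n) a i * (k <= i)%:R) ^+ 2 * (H k.+1 - H k) =
  \sum_(i < n) \sum_(j < n) a i * a j * (H (minn i j).+1 - H 0%N).
Proof.
under eq_bigr do rewrite expr2 big_distrlr/= mulr_suml.
rewrite exchange_big/=; apply: eq_bigr => i _.
under eq_bigr do rewrite mulr_suml.
rewrite exchange_big/=; apply: eq_bigr => j _.
rewrite -telescope_ord (sum_ord_le (fun k => H k.+1 - H k) (n := n)); last first.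
  by rewrite (leq_ltn_trans (geq_minl _ _)).
rewrite mulr_sumr; apply: eq_bigr => k _; rewrite leq_min.
by case: (k <= i)%N; case: (k <= j)%N; rewrite /=; ring.
Qed.

End finite_sums.

Section stieltjes.
Context {R : realType} (beta t0 : R).
Hypothesis t00 : 0 < t0.
Local Notation mu := (@lebesgue_measure R).
Local Notation I f a b := (\int[mu]_(x in `[a, b]) (f x)).

(** The power [s ^ p], extended continuously before [t0]. *)
Definition cpow (p s : R) := (maxr t0 s) `^ p.

Lemma continuous_cpow p : continuous (cpow p).
Proof. exact: continuous_max_pow. Qed.

Lemma integral_cpow p a b : t0 <= a -> a <= b ->
  I (fun s => p * cpow (p - 1) s) a b = b `^ p - a `^ p.
Proof.
move=> ta ab; apply: (@FTC2 _ (fun s => s `^ p)) => //.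
  by apply: contM; [exact: cont_cst|exact: continuous_cpow].
move=> x /andP[ax xb]; rewrite /cpow max_r ?(le_trans ta)//.
by apply: is_derive1_powR; rewrite (lt_le_trans t00)// (le_trans ta).
Qed.

(** The integral of [s ^ beta] against a continuous path, by parts. *)
Definition stieltjes (w : R -> R) a b :=
  b `^ beta * w b - a `^ beta * w a - I (fun s => beta * cpow (beta - 1) s * w s) a b.

Definition stieltjes_sum (w : R -> R) a b N := \sum_(k < N.+1)
  (a + k%:R * ((b - a) / N.+1%:R)) `^ beta *
  (w (a + k.+1%:R * ((b - a) / N.+1%:R)) - w (a + k%:R * ((b - a) / N.+1%:R))).

Let cg : continuous (fun s => beta * cpow (beta - 1) s).
Proof. by apply: contM; [exact: cont_cst|exact: continuous_cpow]. Qed.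

Lemma stieltjes_cat w a b c : continuous w -> a <= b -> b <= c ->
  stieltjes w a c = stieltjes w a b + stieltjes w b c.
Proof.
move=> cw ab bc; rewrite /stieltjes (int_cat _ ab bc); last exact: contM.
have E (x y z i j : R) : z - x - (i + j) = y - x - i + (z - y - j) by ring.
exact: E.
Qed.

(** On each subinterval the integration by parts leaves the oscillation of the
    path against the derivative of [s ^ beta]. *)
Lemma cvg_stieltjes_sum w a b : continuous w -> t0 <= a -> a <= b ->
  stieltjes_sum w a b N @[N --> \oo] --> stieltjes w a b.
Proof.
move=> cw ta ab; have [C C0 hC] := bounded_continuous a b cg.
apply: cvg_nat_eps => e e0.
pose e1 := e / ((C + 1) * (b - a + 1)).
have C1 : 0 < C + 1 by rewrite ltr_wpDl.
have b1 : 0 < b - a + 1 by rewrite ltr_wpDl// subr_ge0.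
have e10 : 0 < e1 by rewrite divr_gt0// mulr_gt0.
have [dl dl0 hdl] := heine a b cw e10.
have [M hM] := mesh_small (b - a) dl0; exists M => N MN.
pose h := (b - a) / N.+1%:R; pose s k := a + k%:R * h.
have h0 : 0 <= h by rewrite divr_ge0// subr_ge0.
have hd : h <= dl by exact: hM.
have sN : s N.+1 = b by rewrite /s /h mulrC divfK ?pnatr_eq0// addrC subrK.
have s0 : s 0%N = a by rewrite /s mul0r addr0.
have sS k : s k <= s k.+1 by rewrite lerD2l ler_wpM2r// ler_nat.
have sab k : (k <= N.+1)%N -> a <= s k <= b by move=> kN; exact: subdivision_itv.
have sk k : s k.+1 - s k = h by rewrite /s -natr1; ring.
have cgw : continuous (fun u => beta * cpow (beta - 1) u * w u) by exact: contM.
have EI : I (fun u => beta * cpow (beta - 1) u * w u) a b =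
    \sum_(k < N.+1) I (fun u => beta * cpow (beta - 1) u * w u) (s k) (s k.+1).
  by rewrite -(int_grid _ N.+1 cgw h0) -/(s N.+1) sN.
have EW : b `^ beta * w b - a `^ beta * w a =
    \sum_(k < N.+1) (s k.+1 `^ beta * w (s k.+1) - s k `^ beta * w (s k)).
  by rewrite (telescope_ord _ (fun k => s k `^ beta * w (s k))) sN s0.
have cd k : continuous (fun u => beta * cpow (beta - 1) u * (w (s k.+1) - w u)).
  by apply: contM => //; apply: contB => //; exact: cont_cst.
have -> : stieltjes w a b - stieltjes_sum w a b N =
    \sum_(k < N.+1) I (fun u => beta * cpow (beta - 1) u * (w (s k.+1) - w u)) (s k) (s k.+1).
  rewrite /stieltjes EI EW /stieltjes_sum -/h -!sumrB; apply: eq_bigr => k _.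
  have ak : t0 <= s k by have /andP[ask _] := sab k (ltnW (ltn_ord k)); exact: le_trans ask.
  rewrite (eq_int (fun u _ => mulrBr _ (w (s k.+1)) (w u))) intB//; last first.
    by apply: contM => //; exact: cont_cst.
  rewrite (eq_int (fun u _ => mulrC (beta * cpow (beta - 1) u) (w (s k.+1)))) intZ//.
  rewrite (integral_cpow beta ak (sS k)) -/(s k.+1) -/(s k).
  have E (x y z z' i : R) : x * z - y * z' - i - y * (z - z') = z * (x - y) - i by ring.
  exact: E.
apply: (@le_trans _ _ (\sum_(k < N.+1) C * e1 * h)).
  rewrite (le_trans (ler_norm_sum _ _ _))//; apply: ler_sum => k _.
  rewrite -(sk k); apply: (le_abs_int_cst (sS k) (cd k)) => u /andP[us1 us2].
  have /andP[as1 _] := sab k (ltnW (ltn_ord k)).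
  have /andP[as2 bs2] := sab k.+1 (ltn_ord k).
  have uab : a <= u <= b by rewrite (le_trans as1 us1) (le_trans us2 bs2).
  rewrite normrM ler_pM//; first exact: hC.
  apply: hdl => //; first by rewrite as2.
  by rewrite ger0_norm ?subr_ge0// (le_trans _ hd)// -(sk k) lerB.
rewrite sumr_const card_ord -mulr_natr -mulrA.
have -> : h * N.+1%:R = b - a by rewrite /h divfK ?pnatr_eq0.
have ba : 0 <= b - a by rewrite subr_ge0.
have Cb : C * (b - a) <= (C + 1) * (b - a + 1) by rewrite ler_pM ?lerDl.
rewrite mulrAC (le_trans (ler_wpM2r (ltW e10) Cb))//.
by rewrite /e1 mulrC divfK// gt_eqF// mulr_gt0.
Qed.

End stieltjes.

Section stieltjes_law.
Context {R : realType} (beta t0 : R) d (T : measurableType d) (P : probability T R).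
Hypothesis t00 : 0 < t0.
Variable W : R -> T -> R.
Hypothesis cW : continuous_bm P W.
Local Notation mu := (@lebesgue_measure R).
Local Notation I f a b := (\int[mu]_(x in `[a, b]) (f x)).
Local Notation N01 := (@std_normal R).
Local Notation J w a b := (stieltjes beta t0 w a b).

(** The approximating sums are combinations of independent normal increments.
    In the limit the integrals over consecutive intervals are independent and
    normal, with the variance given by Wiener's isometry. *)
Lemma stieltjes_expectation (u b : nat -> R) n (f : R -> R) : t0 <= u 0%N ->
  (forall j, (j < n)%N -> u j < u j.+1) -> continuous f -> (forall x, 0 <= f x <= 1) ->
  \int[P]_w f (\sum_(j < n) b j * J (W ^~ w) (u j) (u j.+1)) =
  \int[N01]_x f (Num.sqrt (\sum_(j < n) b j ^+ 2 * I (cpow t0 (2 * beta)) (u j) (u j.+1)) * x).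
Proof.
move=> u0 uS cf f01; have [mW pW _ _] := cW.
have mf : measurable_fun setT f by exact: continuous_measurable_fun.
have f0 x : 0 <= f x by case/andP: (f01 x).
have f1 x : `|f x| <= 1 by case/andP: (f01 x) => h0 h1; rewrite ger0_norm.
have tu j : (j <= n)%N -> t0 <= u j.
  by elim: j => // j IH jn; rewrite (le_trans (IH (ltnW jn)))// ltW// uS.
pose dl N j := (u j.+1 - u j) / N.+1%:R.
have dl0 N j : (j < n)%N -> 0 < dl N j by move=> jn; rewrite divr_gt0// subr_gt0 uS.
pose A N w := \sum_(j < n) b j * stieltjes_sum beta (W ^~ w) (u j) (u j.+1) N.
pose V N := \sum_(j < n) b j ^+ 2 * riemann_sum (cpow t0 (2 * beta)) (u j) (u j.+1) N.
have EN N : \int[P]_w f (A N w) = \int[N01]_x f (Num.sqrt (V N) * x).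
  pose phi k := b (k %/ N.+1)%N * ((u (k %/ N.+1)%N + (k %% N.+1)%N%:R * dl N (k %/ N.+1)%N) `^ beta
     * Num.sqrt (dl N (k %/ N.+1)%N)).
  have mG : measurable_seqfun (fun s => f (\sum_(k < n * N.+1) phi k * nth 0 s k)).
    move=> m; apply: (measurableT_comp mf); apply: measurable_sum => k.
    by apply: measurable_funM; [exact: measurable_cst|exact: measurable_nth].
  rewrite /Rintegral; congr fine.
  have -> : V N = \sum_(k < n * N.+1) phi k ^+ 2.
    rewrite (sum_blocks (fun j i => (b j * ((u j + i%:R * dl N j) `^ beta * Num.sqrt (dl N j))) ^+ 2))//.
    apply: eq_bigr => j _; rewrite /riemann_sum mulr_sumr; apply: eq_bigr => i _.
    rewrite -/(dl N j) !exprMn sqr_sqrtr ?ltW ?dl0//; congr (_ * (_ * _)).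
    have up : t0 <= u j + i%:R * dl N j.
      rewrite (le_trans (tu j (ltnW (ltn_ord j))))// lerDl mulr_ge0// ltW// dl0//.
    by rewrite /cpow max_r// mulrDl !mul1r powR_addE ?expr2// (lt_le_trans t00).
  rewrite -(iid_normal_sum _ _ cW)// -(expectation_grid cW _ (le_trans (ltW t00) u0) uS)//.
  apply: eq_integral => w _; congr (f _)%:E; rewrite /A.
  under [RHS]eq_bigr => k _ do rewrite nth_mkseq//.
  rewrite (sum_blocks (fun j i => b j * ((u j + i%:R * dl N j) `^ beta * Num.sqrt (dl N j)) *
     nth 0 (subinterval_increments u N (W ^~ w) j) i))//.
  apply: eq_bigr => j _; rewrite /stieltjes_sum mulr_sumr; apply: eq_bigr => i _.
  rewrite nth_mkseq// -/(dl N j) -!mulrA; congr (_ * (_ * _)).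
  by rewrite [RHS]mulrC divfK// gt_eqF// sqrtr_gt0 dl0.
have cA : \int[P]_w f (A N w) @[N --> \oo] -->
    \int[P]_w f (\sum_(j < n) b j * J (W ^~ w) (u j) (u j.+1)).
  apply: (@bounded_cvg_expectation _ _ _ P _ _ 1) => //.
    move=> N; apply: (measurableT_comp mf); apply: measurable_sum => j.
    apply: measurable_funM; first exact: measurable_cst.
    apply: measurable_sum => k; apply: measurable_funM; first exact: measurable_cst.
    exact: measurable_funB.
  move=> w; apply: (cvg_comp _ f); last exact: cf.
  apply: cvg_sumR => j; apply: cvgMr; apply: cvg_stieltjes_sum => //.
    exact: tu (ltnW (ltn_ord j)).
  exact: ltW (uS j (ltn_ord j)).
have cV : \int[N01]_x f (Num.sqrt (V N) * x) @[N --> \oo] -->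
    \int[N01]_x f (Num.sqrt (\sum_(j < n) b j ^+ 2 * I (cpow t0 (2 * beta)) (u j) (u j.+1)) * x).
  apply: (@bounded_cvg_expectation _ _ _ N01 _ _ 1) => //.
    move=> N; apply: (measurableT_comp mf).
    by apply: measurable_funM; [exact: measurable_cst|exact: measurable_id].
  move=> x; apply: (cvg_comp _ f); last exact: cf.
  apply: cvgMl; apply: (cvg_comp _ Num.sqrt); last exact: sqrt_continuous.
  apply: cvg_sumR => j; apply: cvgMr; apply: cvg_riemann_sum; first exact: continuous_cpow.
  exact: ltW (uS j (ltn_ord j)).
apply: (cvg_unique _ cA) => //.
by rewrite (_ : (fun N => _) = fun N => \int[N01]_x f (Num.sqrt (V N) * x))//; apply/funext.
Qed.

(** Decomposing the integrals from [t0] over consecutive intervals makes them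
    combinations of independent ones; the intervals common to two times carry
    their covariance. *)
Lemma stieltjes_combination (u a : nat -> R) n (f : R -> R) : u 0%N = t0 ->
  (forall j, u j < u j.+1) -> continuous f -> (forall x, 0 <= f x <= 1) -> 0 < 1 + 2 * beta ->
  \int[P]_w f (\sum_(i < n) a i * J (W ^~ w) t0 (u i.+1)) =
  \int[N01]_x f (Num.sqrt (\sum_(i < n) \sum_(j < n) a i * a j *
    ((u (minn i j).+1 `^ (1 + 2 * beta) - t0 `^ (1 + 2 * beta)) / (1 + 2 * beta))) * x).
Proof.
move=> u0 uS cf f01 b0; have [mW pW _ _] := cW.
have tu j : t0 <= u j by elim: j => [|j IH]; [rewrite u0|rewrite (le_trans IH)// ltW].
pose H k := u k `^ (1 + 2 * beta) / (1 + 2 * beta).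
have JE w i : J (W ^~ w) t0 (u i.+1) = \sum_(k < i.+1) J (W ^~ w) (u k) (u k.+1).
  elim: i => [|i IH]; first by rewrite big_ord1 u0.
  by rewrite big_ord_recr/= -IH; apply: stieltjes_cat => //; exact: ltW.
have -> : (fun w => f (\sum_(i < n) a i * J (W ^~ w) t0 (u i.+1))) =
    fun w => f (\sum_(k < n) (\sum_(i < n) a i * (k <= i)%:R) * J (W ^~ w) (u k) (u k.+1)).
  apply/funext => w; congr f; rewrite -(sum_abel _ a (fun k => J (W ^~ w) (u k) (u k.+1))).
  by apply: eq_bigr => i _; rewrite JE.
have u0' : t0 <= u 0%N by rewrite u0.
rewrite (stieltjes_expectation (fun k => \sum_(i < n) a i * (k <= i)%:R) u0' (fun j _ => uS j) cf f01).
congr Rintegral; apply/funext => x; congr (f (Num.sqrt _ * _)).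
transitivity (\sum_(k < n) (\sum_(i < n) a i * (k <= i)%:R) ^+ 2 * (H k.+1 - H k)).
  apply: eq_bigr => k _; congr (_ * _); rewrite /H -mulrBl.
  have := integral_cpow t00 (1 + 2 * beta) (tu k) (ltW (uS k)).
  rewrite intZ; last exact: continuous_cpow.
  by rewrite addrAC subrr add0r => <-; rewrite [RHS]mulrC mulKf// gt_eqF.
rewrite quadratic_telescope; apply: eq_bigr => i _; apply: eq_bigr => j _.
by rewrite /H u0 -mulrBl.
Qed.

End stieltjes_law.

(** * The position in the linear case *)

Lemma powR_nonincreasing (R : realType) (x y r : R) : 0 < x -> x <= y -> r <= 0 ->
  y `^ r <= x `^ r.
Proof.
move=> x0 xy r0; have y0 : 0 < y by exact: lt_le_trans xy.
pose k := - r; have -> : r = - k by rewrite opprK.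
rewrite [y `^ _]powRN [x `^ _]powRN lef_pV2 ?posrE ?powR_gt0//.
by apply: ge0_ler_powR; rewrite ?nnegrE ?(ltW x0) ?(ltW y0)// /k oppr_ge0.
Qed.

(** An exponent between the growth rate of the remainder of the position and that
    of its noise integral. *)
Lemma intermediate_exponent (R : realType) (beta : R) : beta < 1 -> - (1 / 2) < beta ->
  exists2 p, 0 < p & beta + beta / 2 <= p < beta + 1 / 2.
Proof.
move=> beta1 betaN.
exists ((maxr (beta + beta / 2) 0 + (beta + 1 / 2)) / 2); last first.
  have : beta + beta / 2 <= maxr (beta + beta / 2) 0 by rewrite le_max lexx.
  have : maxr (beta + beta / 2) 0 < beta + 1 / 2 by rewrite gt_max; apply/andP; split; lra.
  by set m := maxr _ _ => h1 h2; apply/andP; split; lra.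
have : 0 <= maxr (beta + beta / 2) 0 by rewrite le_max lexx orbT.
by set m := maxr _ _ => h1; lra.
Qed.

Section linear_drift.
Context {R : realType} (rho beta t0 v0 : R) d (T : measurableType d) (P : probability T R).
Hypotheses (rho0 : 0 < rho) (t00 : 0 < t0).
Variables W U : R -> T -> R.
Hypothesis hU : solution_paths P W U rho 1 beta t0 v0.
Local Notation mu := (@lebesgue_measure R).
Local Notation I f a b := (\int[mu]_(x in `[a, b]) (f x)).
Local Notation J w a b := (stieltjes beta t0 w a b).
Local Notation cp := (cpow t0).
Local Notation Ex f := (\int[P]_w (f w)%:E)%E.

Let cW : continuous_bm P W. Proof. by case: hU. Qed.
Let mU t : measurable_fun setT (U t). Proof. by case: hU. Qed.
Let cU w : continuous (U ^~ w). Proof. by case: hU. Qed.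
Let mW t : measurable_fun setT (W t). Proof. by case: cW. Qed.
Let pW w : continuous (W ^~ w). Proof. by case: cW => _ + _ _; apply. Qed.

Let ccp p : continuous (cp p). Proof. exact: continuous_cpow. Qed.

Let cwt (f : R -> R) : continuous f -> continuous (fun s => beta * cp (beta - 1) s * f s).
Proof. by move=> cf; apply: contM => //; apply: contM => //; exact: cont_cst. Qed.

(** The product rule for [s ^ beta * (W s - U s)], which is differentiable
    because the noise cancels, expresses the position through the integral of
    [s ^ beta] against the noise. *)
Lemma position_decomposition w tau : t0 <= tau ->
  rho * I (U ^~ w) t0 tau = J (W ^~ w) t0 tau +
    (t0 `^ beta * v0 - tau `^ beta * U tau w +
     I (fun s => beta * cp (beta - 1) s * U s w) t0 tau).
Proof.
move=> tt; have [_ _ _ U0 sol] := hU.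
pose g s := coefficient beta t0 s * drift rho 1 (U s w).
have gE s : g s = cp (- beta) s * (rho * U s w).
  by rewrite /g /drift powRr1// mulr_sg_norm.
have cg : continuous g.
  apply: contM; first exact: continuous_coefficient.
  have -> : (fun s => drift rho 1 (U s w)) = fun s => rho * U s w.
    by apply/funext => s; rewrite /drift powRr1// mulr_sg_norm.
  by apply: contM => //; exact: cont_cst.
have [G [GI dG]] := primitive t0 cg.
pose c := W t0 w - v0.
have yE s : t0 <= s -> W s w - U s w = c + G s.
  move=> ts; have := sol w s ts s; rewrite ts lexx => /(_ erefl) ->.
  rewrite U0 (GI _ ts) /c -[I g t0 s]/(I (fun u => coefficient beta t0 u * drift rho 1 (U u w)) t0 s).
  by set i := I _ _ _; ring.
pose f s := beta * cp (beta - 1) s * (W s w - U s w) + rho * U s w.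
have cf : continuous f.
  apply: contD; first by apply: cwt; exact: contB.
  by apply: contM => //; exact: cont_cst.
have dF s : t0 <= s <= tau -> is_derive s 1 (fun s => s `^ beta * (c + G s)) (f s).
  move=> /andP[ts _]; have s0 : 0 < s by exact: lt_le_trans ts.
  have d1 : is_derive s 1 (fun s => c + G s) (g s).
    by rewrite -[g s]add0r; apply: is_deriveD; exact: dG.
  have := is_deriveM (is_derive1_powR beta s0) d1.
  congr (is_derive _ _ _ _); rewrite /f yE// gE /cpow max_r// /GRing.scale/=.
  have : s `^ beta * s `^ (- beta) = 1 by rewrite -powR_addE// subrr powRr0.
  move: (s `^ beta) (s `^ (- beta)) (s `^ (beta - 1)) => x y z xy.
  rewrite [x * _]mulrA xy mul1r [LHS]addrC; congr (_ + _); ring.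
have := FTC2 tt cf dF; rewrite -!yE// /f intD//; last 2 first.
- by apply: cwt; exact: contB.
- by apply: contM => //; exact: cont_cst.
rewrite intZ// (eq_int (fun s _ => mulrBr (beta * cp (beta - 1) s) (W s w) (U s w))) intB; [|exact: cwt|exact: cwt].
rewrite /stieltjes U0; move: (\int[mu]_(x in _) (beta * cp (beta - 1) x * W x w)) (\int[mu]_(x in _) (beta * cp (beta - 1) x * U x w)).
move: (\int[mu]_(x in _) U x w) => i j k h; have {h} : rho * i = tau `^ beta * (W tau w - U tau w) -
  t0 `^ beta * (W t0 w - v0) - (j - k) by rewrite -h; ring.
by move=> ->; ring.
Qed.

(** The integrand grows at most like [s ^ (p - 1)] in mean, which integrates to
    [tau ^ p] because [p] is positive. *)
Lemma weighted_integral_bound (Y : R -> T -> R) C r p : 0 <= C -> 0 < p -> beta + r <= p ->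
  (forall t, measurable_fun setT (Y t)) -> (forall w, continuous (Y ^~ w)) ->
  (forall s, t0 <= s -> (Ex (fun w => `|Y s w|) <= (C * s `^ r)%:E)%E) ->
  exists2 C', 0 <= C' & forall tau, t0 <= tau ->
    (Ex (fun w => `|I (fun s => beta * cp (beta - 1) s * Y s w)%R t0 tau|) <= (C' * tau `^ p)%:E)%E.
Proof.
move=> C0 p0 brp mY cY hC.
pose M := `|beta| * C * t0 `^ (beta + r - p) / p.
have M0 : 0 <= M by rewrite divr_ge0 ?mulr_ge0 ?powR_ge0// ltW.
exists M => // tau tt.
pose Z s w := `|beta * cp (beta - 1) s * Y s w|.
have mZ s : measurable_fun setT (Z s).
  by apply: measurableT_comp => //; apply: measurable_funM; [exact: measurable_cst|exact: mY].
have cZ w : continuous (Z ^~ w) by apply: continuous_norm; exact: cwt.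
pose m s := M * (p * cp (p - 1) s).
have cm : continuous m by do 2!(apply: contM; first exact: cont_cst).
have Zm s : t0 <= s <= tau -> (\int[P]_w (Z s w)%:E <= (m s)%:E)%E.
  move=> /andP[ts _]; have s0 : 0 < s by exact: lt_le_trans ts.
  rewrite /Z; under eq_integral do rewrite normrM EFinM.
  rewrite ge0_integralZl//; last first.
    by apply/measurable_EFinP; apply: measurableT_comp => //; exact: mY.
  apply: (@le_trans _ _ (`|beta * cp (beta - 1) s|%:E * (C * s `^ r)%:E)%E).
    by apply: lee_wpmul2l; [rewrite lee_fin|exact: hC].
  rewrite -EFinM lee_fin normrM /m /M /cpow max_r// [`|_ `^ _|]ger0_norm ?powR_ge0//.
  have -> : `|beta| * C * t0 `^ (beta + r - p) / p * (p * s `^ (p - 1)) =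
      `|beta| * C * (t0 `^ (beta + r - p) * s `^ (p - 1)).
    by rewrite mulrA divfK ?gt_eqF// mulrA.
  have -> : `|beta| * s `^ (beta - 1) * (C * s `^ r) = `|beta| * C * (s `^ (beta - 1) * s `^ r) by ring.
  rewrite ler_wpM2l ?mulr_ge0// -powR_addE//.
  have -> : beta - 1 + r = (beta + r - p) + (p - 1) by ring.
  by rewrite powR_addE// ler_wpM2r ?powR_ge0// powR_nonincreasing// subr_le0.
have h := expectation_path_integral tt mZ cZ (fun _ _ => normr_ge0 _) cm Zm.
apply: (@le_trans _ _ (\int[P]_w (I (Z ^~ w) t0 tau)%:E)%E).
  apply: ge0_le_integral => //.
  - apply/measurable_EFinP; apply: measurableT_comp => //; apply: measurable_path_integral => //.
    + by move=> s; apply: measurable_funM; [exact: measurable_cst|exact: mY].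
    + by move=> w; exact: cwt.
  - by apply/measurable_EFinP; apply: measurable_path_integral.
  - by move=> w _; rewrite lee_fin; apply: le_abs_int; exact: cwt.
apply: (le_trans h); rewrite lee_fin intZ; last by apply: contM => //; exact: cont_cst.
by rewrite (integral_cpow t00 p (lexx t0) tt) ler_wpM2l// gerBl powR_ge0.
Qed.

Let pow_absorb c r p tau : 0 <= c -> r <= p -> t0 <= tau ->
  c * tau `^ r <= c * t0 `^ (r - p) * tau `^ p.
Proof.
move=> c0 rp tt; have tau0 : 0 < tau by exact: lt_le_trans tt.
rewrite -mulrA ler_wpM2l//.
have -> : tau `^ r = tau `^ (r - p) * tau `^ p by rewrite -powR_addE// subrK.
by rewrite ler_wpM2r ?powR_ge0// powR_nonincreasing// subr_le0.
Qed.

Lemma measurable_stieltjes a b : a <= b -> measurable_fun setT (fun w => J (W ^~ w) a b).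
Proof.
move=> ab; apply: measurable_funB; first apply: measurable_funB.
- by apply: measurable_funM; [exact: measurable_cst|exact: mW].
- by apply: measurable_funM; [exact: measurable_cst|exact: mW].
apply: measurable_path_integral => //.
- by move=> s; apply: measurable_funM; [exact: measurable_cst|exact: mW].
- by move=> w; exact: cwt.
Qed.

Lemma measurable_position tau : t0 <= tau -> measurable_fun setT (fun w => I (U ^~ w) t0 tau).
Proof. by move=> tt; exact: measurable_path_integral. Qed.

Hypotheses (beta1 : beta < 1) (betaN : - (1 / 2) < beta).

(** By [position_decomposition] the remainder involves the velocity only
    through terms of order [tau ^ (3 * beta / 2)], up to a constant. Its
    exponent is below [beta + 1/2] exactly because [beta < 1]. *)
Lemma position_remainder x0 : exists C p : R, [/\ 0 <= C, 0 < p, p < beta + 1 / 2 &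
  forall tau, t0 <= tau ->
    (Ex (fun w => `|x0 + I (U ^~ w)%R t0 tau - rho^-1 * J (W ^~ w) t0 tau|%R) <= (C * tau `^ p)%:E)%E].
Proof.
pose r := beta / 2.
have rE : r = beta / (1 + 1) by [].
have r12 : r < 1 / 2 by rewrite /r ltr_pM2r// invr_gt0.
have [C C0 hC] := a_priori_bound rho0 (lexx 1) t00 rE r12 hU.
have [p p0 /andP[brp pb]] := intermediate_exponent beta1 betaN.
have [C1 C10 hC1] := weighted_integral_bound C0 p0 brp mU cU hC.
pose c := `|x0| + rho^-1 * `|t0 `^ beta * v0|.
have ri0 : 0 <= rho^-1 by rewrite invr_ge0 ltW.
have c0 : 0 <= c by rewrite addr_ge0// mulr_ge0.
have c10 : 0 <= rho^-1 * C by rewrite mulr_ge0.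
exists (c * t0 `^ (0 - p) + rho^-1 * C * t0 `^ (beta + r - p) + rho^-1 * C1), p.
split=> //; first by rewrite !addr_ge0// mulr_ge0// powR_ge0.
move=> tau tt; have tau0 : 0 < tau by exact: lt_le_trans tt.
pose K w := I (fun s => beta * cp (beta - 1) s * U s w) t0 tau.
have mK : measurable_fun setT K.
  apply: measurable_path_integral => //; last by move=> w; exact: cwt.
  by move=> s; apply: measurable_funM; [exact: measurable_cst|exact: mU].
apply: (le_trans (@expectation_linear_bound _ _ _ P _ (fun=> 0) (fun w => `|U tau w|)
   (fun w => `|K w|) 0 (C * tau `^ r) (C1 * tau `^ p) c (rho^-1 * tau `^ beta) rho^-1
   _ _ _ _ _ _ _ _ _ _ _ _ _ _ _)) => //.
- apply: measurableT_comp => //; apply: measurable_funB.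
    by apply: measurable_funD; [exact: measurable_cst|exact: measurable_position].
  by apply: measurable_funM; [exact: measurable_cst|exact: measurable_stieltjes].
- exact: measurableT_comp (mU _).
- exact: measurableT_comp.
- by rewrite mulr_ge0// powR_ge0.
- by rewrite integral0.
- exact: hC.
- exact: hC1.
- move=> w; have -> : I (U ^~ w) t0 tau = rho^-1 * (rho * I (U ^~ w) t0 tau).
    by rewrite mulKf// gt_eqF.
  rewrite position_decomposition// -/(K w) add0r /c.
  have -> : x0 + rho^-1 * (J (W ^~ w) t0 tau + (t0 `^ beta * v0 - tau `^ beta * U tau w + K w)) -
     rho^-1 * J (W ^~ w) t0 tau =
     x0 + rho^-1 * (t0 `^ beta * v0) + - (rho^-1 * (tau `^ beta) * U tau w) + rho^-1 * K w.
    by move: (J _ _ _) (K w) => j k; ring.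
  rewrite (le_trans (ler_normD _ _))// lerD ?normrM ?[`|rho^-1|]ger0_norm//.
  rewrite (le_trans (ler_normD _ _))// lerD ?normrN ?normrM ?[`|rho^-1|]ger0_norm//; last first.
    by rewrite [`|_ `^ _|]ger0_norm// powR_ge0.
  by rewrite (le_trans (ler_normD _ _))// normrM [`|rho^-1|]ger0_norm// normrM.
rewrite lee_fin add0r.
have h1 := pow_absorb c0 (ltW p0) tt; rewrite powRr0 mulr1 in h1.
have h2 := pow_absorb c10 brp tt.
have -> : rho^-1 * tau `^ beta * (C * tau `^ r) = rho^-1 * C * tau `^ (beta + r).
  by rewrite powR_addE//; ring.
by clearbody c; rewrite !mulrDl -[rho^-1 * C1 * _]mulrA lerD2r lerD.
Qed.

(** The noise integral has the order of its integrand [s ^ beta] times a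
    Brownian path, and dominates the remainder. *)
Lemma position_bound x0 : exists2 C, 0 <= C & forall tau, t0 <= tau ->
  (Ex (fun w => `|x0 + I (U ^~ w)%R t0 tau|%R) <= (C * tau `^ (beta + 1 / 2))%:E)%E.
Proof.
have [C [p [C0 p0 pb hC]]] := position_remainder x0.
pose Y s w := W s w - W t0 w.
have mY s : measurable_fun setT (Y s) by exact: measurable_funB.
have cY w : continuous (Y ^~ w) by apply: contB => //; exact: cont_cst.
pose m := @normal_moment R 1.
have m0 : 0 <= m by exact: normal_moment_ge0.
have hY s : t0 <= s -> (Ex (fun w => `|Y s w|) <= (m * s `^ (1 / 2))%:E)%E.
  move=> ts; rewrite (expectation_increment cW (ltW t00) ts) lee_fin mulrC ler_wpM2l//.
  have -> : 1 / 2 = 2^-1 :> R by rewrite div1r.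
  by rewrite powR12_sqrt ?(le_trans (ltW t00))// ler_sqrt ?(le_trans (ltW t00) ts)// gerBl ltW.
have b0 : 0 < beta + 1 / 2 by lra.
have [C1 C10 hC1] := weighted_integral_bound m0 b0 (lexx _) mY cY hY.
have ri0 : 0 <= rho^-1 by rewrite invr_ge0 ltW.
exists (C * t0 `^ (p - (beta + 1 / 2)) + rho^-1 * m + rho^-1 * C1).
  by rewrite !addr_ge0 ?mulr_ge0 ?powR_ge0.
move=> tau tt; have tau0 : 0 < tau by exact: lt_le_trans tt.
pose K w := I (fun s => beta * cp (beta - 1) s * Y s w) t0 tau.
have mK : measurable_fun setT K.
  apply: measurable_path_integral => //; last by move=> w; exact: cwt.
  by move=> s; apply: measurable_funM; [exact: measurable_cst|exact: mY].
(* Subtracting the initial value of the noise does not change the integral. *)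
have JE w : J (W ^~ w) t0 tau = tau `^ beta * Y tau w - K w.
  rewrite /K (eq_int (fun s _ => mulrBr (beta * cp (beta - 1) s) (W s w) (W t0 w))) intB.
  - rewrite (eq_int (fun s _ => mulrC (beta * cp (beta - 1) s) (W t0 w))) intZ; last first.
      by apply: contM => //; exact: cont_cst.
    rewrite (integral_cpow t00 beta (lexx t0) tt) /stieltjes /Y.
    by move: (\int[mu]_(x in _) _) => i; ring.
  - exact: cwt.
  - by apply: cwt; exact: cont_cst.
pose D w := x0 + I (U ^~ w) t0 tau - rho^-1 * J (W ^~ w) t0 tau.
have mD : measurable_fun setT D.
  apply: measurable_funB.
    by apply: measurable_funD; [exact: measurable_cst|exact: measurable_position].
  by apply: measurable_funM; [exact: measurable_cst|exact: measurable_stieltjes].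
apply: (le_trans (@expectation_linear_bound _ _ _ P _ (fun w => `|D w|) (fun w => `|Y tau w|)
   (fun w => `|K w|) (C * tau `^ p) (m * tau `^ (1 / 2)) (C1 * tau `^ (beta + 1 / 2)) 0
   (rho^-1 * tau `^ beta) rho^-1 _ _ _ _ _ _ _ _ _ _ _ _ _ _ _)) => //.
- apply: measurableT_comp => //.
  by apply: measurable_funD; [exact: measurable_cst|exact: measurable_position].
- exact: measurableT_comp.
- exact: measurableT_comp (mY _).
- exact: measurableT_comp.
- by rewrite mulr_ge0// powR_ge0.
- exact: hC.
- exact: hY.
- exact: hC1.
- move=> w; have -> : x0 + I (U ^~ w) t0 tau = D w + rho^-1 * tau `^ beta * Y tau w + - (rho^-1 * K w).
    by rewrite /D JE; move: (\int[mu]_(x in _) _) (K w) => i k; ring.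
  rewrite addr0 (le_trans (ler_normD _ _))// lerD ?normrN ?normrM ?[`|rho^-1|]ger0_norm//.
  rewrite (le_trans (ler_normD _ _))// lerD// ?normrM ?[`|rho^-1|]ger0_norm//.
  by rewrite [`|_ `^ _|]ger0_norm// powR_ge0.
rewrite lee_fin addr0.
have h1 := pow_absorb C0 (ltW pb) tt.
have -> : rho^-1 * tau `^ beta * (m * tau `^ (1 / 2)) = rho^-1 * m * tau `^ (beta + 1 / 2).
  by rewrite powR_addE//; ring.
by rewrite !mulrDl -[rho^-1 * C1 * _]mulrA lerD2r lerD.
Qed.

End linear_drift.

(** * Convergence of the position *)

Lemma cvg_dist (R : realType) (U : Type) (F : set_system U) (A B D : U -> R) (l : R) :
  Filter F -> (\forall x \near F, `|A x - B x| <= D x) -> D x @[x --> F] --> 0 ->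
  B x @[x --> F] --> l -> A x @[x --> F] --> l.
Proof.
move=> FF AB D0 Bl.
have h : (A x - B x) @[x --> F] --> (0 : R).
  apply: (@squeeze_cvgr _ _ _ _ (fun x => - D x) D) => //.
    by apply: filterS AB => x; rewrite ler_norml.
  by rewrite -oppr0; exact: cvgN.
rewrite (_ : A = fun x => (A x - B x) + B x); last by apply/funext => x; rewrite subrK.
by rewrite -[l]add0r; exact: cvgD.
Qed.

Section expectation_bounds.
Context d (T : measurableType d) (R : realType) (P : probability T R).
Local Notation Ex f := (\int[P]_w (f w)%:E)%E.

Lemma expectation_scale (Y : T -> R) c e : measurable_fun setT Y -> 0 <= c ->
  (Ex (fun w => `|Y w|) <= e%:E)%E -> (Ex (fun w => `|c * Y w|%R) <= (c * e)%:E)%E.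
Proof.
move=> mY c0 h; under eq_integral do rewrite normrM EFinM.
rewrite ge0_integralZl//; last by apply/measurable_EFinP; exact: measurableT_comp.
by rewrite EFinM ger0_norm//; apply: lee_wpmul2l; rewrite ?lee_fin.
Qed.

Lemma expectation_sum_bound n (a e : 'I_n -> R) (Y : 'I_n -> T -> R) :
  (forall i, measurable_fun setT (Y i)) -> (forall i, Ex (fun w => `|Y i w|) <= (e i)%:E)%E ->
  (Ex (fun w => `|\sum_i a i * Y i w|%R) <= (\sum_i `|a i| * e i)%:E)%E.
Proof.
move=> mY hY.
have mZ i : measurable_fun setT (fun w => (`|a i * Y i w|)%:E).
  apply/measurable_EFinP; apply: measurableT_comp => //.
  by apply: measurable_funM; [exact: measurable_cst|exact: mY].
apply: (@le_trans _ _ (\int[P]_w (\sum_i (`|a i * Y i w|)%:E))%E).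
  apply: ge0_le_integral => //.
  - apply/measurable_EFinP; apply: measurableT_comp => //; apply: measurable_sum => i.
    by apply: measurable_funM; [exact: measurable_cst|exact: mY].
  - exact: emeasurable_sum.
  - by move=> w _; rewrite sumEFin lee_fin ler_norm_sum.
rewrite ge0_integral_sum//.
rewrite -sumEFin; apply: lee_sum => i _.
have := expectation_scale (mY i) (normr_ge0 (a i)) (hY i).
by congr (_ <= _)%E; apply: eq_integral => w _; rewrite !normrM normr_id.
Qed.

End expectation_bounds.

Section shifted_cosine.
Context {R : realType}.
Local Notation N01 := (@std_normal R).

(** The normalization to [[0, 1]] fits the estimates for Lipschitz test
    functions. *)
Definition unit_cos (b x : R) := (1 + cos (x + b)) / 2.

Lemma unit_cos01 b x : 0 <= unit_cos b x <= 1.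
Proof.
rewrite /unit_cos; have := cos_geN1 (x + b); have := cos_le1 (x + b).
by set c := cos _ => h1 h2; apply/andP; split; lra.
Qed.

Lemma unit_cos_lipschitz b x y : `|unit_cos b x - unit_cos b y| <= 1 * `|x - y|.
Proof.
have cs z : cos z = sin (z + pi / 2) by rewrite sinDpihalf.
have := sin_lipschitz (x + b + pi / 2) (y + b + pi / 2); rewrite -!cs.
have -> : x + b + pi / 2 - (y + b + pi / 2) = x - y by ring.
rewrite /unit_cos -mulrBl opprD addrACA subrr add0r normrM [`|2^-1|]ger0_norm//.
by have := normr_ge0 (cos (x + b) - cos (y + b)); set c := `|_|; set e := `|_|; lra.
Qed.

Lemma continuous_unit_cos b : continuous (unit_cos b).
Proof. exact: lipschitz_continuous (unit_cos_lipschitz b). Qed.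

Lemma measurable_unit_cos b : measurable_fun setT (unit_cos b).
Proof. by apply: continuous_measurable_fun; exact: continuous_unit_cos. Qed.

Lemma expectation_cos d (T : measurableType d) (P : probability T R) (X : T -> R) b :
  measurable_fun setT X ->
  \int[P]_w cos (X w + b) = -1 + 2 * \int[P]_w unit_cos b (X w).
Proof.
move=> mX.
have -> : (fun w => cos (X w + b)) = fun w => -1 + \sum_(i < 1) 2 * unit_cos b (X w).
  by apply/funext => w; rewrite big_ord1 /unit_cos; field.
rewrite (@Rint_affine _ _ _ P _ (-1) (fun _ : 'I_1 => 2) (fun _ w => unit_cos b (X w)) 1) ?big_ord1//.
  by move=> _; apply: measurableT_comp => //; exact: measurable_unit_cos.
by move=> _ w; case/andP: (unit_cos01 b (X w)) => h0 h1; rewrite ger0_norm.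
Qed.

Lemma continuous_normal_expectation (g : R -> R) :
  (forall x, 0 <= g x <= 1) -> (forall x y, `|g x - g y| <= 1 * `|x - y|) ->
  continuous (fun s : R => \int[N01]_x g (s * x)).
Proof.
move=> g01 gL.
have ms s : measurable_fun [set: R] (fun x : R => s * x).
  by apply: measurable_funM; [exact: measurable_cst|exact: measurable_id].
have mg : measurable_fun setT g.
  by apply: continuous_measurable_fun; exact: lipschitz_continuous gL.
have mgs s : measurable_fun [set: R] (fun x : R => g (s * x)) by exact: measurableT_comp.
have g1 s (x : R) : `|g (s * x)| <= 1.
  by case/andP: (g01 (s * x)) => h0 h1; rewrite ger0_norm.
pose M := fine (\int[N01]_x `|x|%:E)%E.
have ME : (\int[N01]_x `|x|%:E = M%:E)%E.
  rewrite /M fineK// ge0_fin_numE; last by apply: integral_ge0.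
  by have /integrableP[_ /=] := @integrable_std_normal_id R.
apply: (@lipschitz_continuous _ _ M) => s r.
apply: (le_trans (Rint_distB N01 (mgs s) (mgs r) (g1 s) (g1 r))).
have := expectation_lipschitz_dist (P := N01) (e := `|s - r| * M) ler01 g01 gL (ms s) (ms r).
rewrite mul1r [M * _]mulrC; apply.
under eq_integral => x _ do rewrite -mulrBl normrM EFinM.
by rewrite ge0_integralZl//; rewrite ?ME//; apply/measurable_EFinP; exact: normr_measurable.
Qed.

End shifted_cosine.

Section position.
Context (R : realType) (beta rho t0 v0 x0 : R).
Hypotheses (beta1 : beta < 1) (betaN : - (1 / 2) < beta).
Hypotheses (rho0 : 0 < rho) (t00 : 0 < t0).
Context d (T : measurableType d) (P : probability T R) (B V X : R -> {RV P >-> R}).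
Hypotheses (hB : brownian_motion B)
  (hV : sde_solution B V (fun t v => t `^ (- beta) * drift rho 1 v) t0)
  (hV0 : {ae P, forall w, V t0 w = v0})
  (hX : {ae P, forall w, forall t, t0 <= t ->
           X t w = x0 + \int[lebesgue_measure]_(s in `[t0, t]) V s w}).
Context d' (T' : measurableType d') (P' : probability T' R) (XX : R -> {RV P' >-> R}).
Hypothesis hXX : centered_gaussian_process XX
  (fun s t => (minr s t) `^ (1 + 2 * beta) / (rho ^+ 2 * (1 + 2 * beta))).
Local Notation sc := (beta + 1 / 2).
Local Notation Ex f := (\int[P]_w (f w)%:E)%E.

(** After replacing the positions by noise integrals, the linear combination is
    exactly normal for each [eps], and its variance converges. *)
Lemma position_cos_cvg n (t : nat -> R) (a : 'I_n -> R) b : 0 < t 0%N -> (forall j, t j < t j.+1) ->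
  \int[P]_w unit_cos b (\sum_i a i * (eps `^ sc * X (t i / eps) w)) @[eps --> 0^'+] -->
  \int[P']_w unit_cos b (\sum_i a i * XX (t i) w).
Proof.
move=> tpos0 tS; have [phi [mphi Pphi hU XE]] := regular_paths t00 hB hV hV0 hX.
set Ws := (fun t w => B _ _) in hU; set Us := (fun t w => V _ _) in hU.
have [cW mU cU _ _] := hU; have [mW pW _ _] := cW.
have tmono i j : (i <= j)%N -> t i <= t j.
  elim: j => [|j IH]; first by rewrite leqn0 => /eqP->.
  by rewrite leq_eqVlt => /predU1P[->//|/IH h]; exact: le_trans (ltW (tS j)).
have tpos j : 0 < t j by exact: lt_le_trans (tmono 0%N j (leq0n j)).
have [C [p [C0 p0 pb hC]]] := position_remainder rho0 t00 hU beta1 betaN x0.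
have f01 := @unit_cos01 R b; have fL := @unit_cos_lipschitz R b.
have cf := @continuous_unit_cos R b; have mf := @measurable_unit_cos R b.
pose k := 1 + 2 * beta; have k0 : 0 < k by rewrite /k; lra.
pose Xs s w := x0 + \int[lebesgue_measure]_(r in `[t0, s]) Us r w.
pose J s w := stieltjes beta t0 (Ws ^~ w) t0 s.
have mXs s : t0 <= s -> measurable_fun setT (Xs s).
  by move=> ts; apply: measurable_funD; [exact: measurable_cst|exact: (measurable_position hU)].
have mJ s : t0 <= s -> measurable_fun setT (J s) by move=> ts; exact: (measurable_stieltjes t00 hU).
pose var eps := \sum_(i < n) \sum_(j < n) a i * a j *
  ((minr (t i) (t j) `^ k - eps `^ k * t0 `^ k) / (rho ^+ 2 * k)).
have cvar : var eps @[eps --> 0^'+] --> \sum_(i < n) \sum_(j < n) a i * a j *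
    (minr (t i) (t j) `^ k / (rho ^+ 2 * k)).
  apply: cvg_sumR => i; apply: cvg_sumR => j; apply: cvgMr; apply: cvgMl.
  rewrite -[X in _ --> X]subr0; apply: cvgB; first exact: cvg_cst.
  by rewrite -[X in _ --> X](mul0r (t0 `^ k)); apply: cvgMl; exact: powR_cvg0.
pose S := \sum_(i < n) `|a i| * (C * t i `^ p).
apply: (@cvg_dist _ _ _ _ (fun eps => \int[@std_normal R]_x unit_cos b (Num.sqrt (var eps) * x))
   (fun eps => S * eps `^ (sc - p))).
- apply: filterS (near_large_times t00 tpos0 tS) => eps [eps0 te].
  pose c := eps `^ sc; have c0 : 0 <= c by exact: powR_ge0.
  have -> : \int[P]_w unit_cos b (\sum_i a i * (eps `^ sc * X (t i / eps) w)) =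
      \int[P]_w unit_cos b (\sum_i a i * (c * Xs (t i / eps) w)).
    have mG : measurable_fun setT (fun w => unit_cos b (\sum_i a i * (eps `^ sc * X (t i / eps) w))).
      apply: measurableT_comp => //; apply: measurable_sum => i.
      apply: measurable_funM; first exact: measurable_cst.
      by apply: measurable_funM; [exact: measurable_cst|exact: measurable_funPT].
    rewrite -(@eq_law_expectation _ _ _ _ _ _ _ P P phi id _ _ _ _ mG)//.
    congr (Rintegral _ _ _); apply/funext => w; congr unit_cos; apply: eq_bigr => i _.
    by rewrite XE// ltW.
  (* The grid starts at [t0], where the noise integrals start. *)
  pose u j := if j is j'.+1 then t j' / eps else t0.
  have uS j : u j < u j.+1 by case: j => [|j] //=; rewrite ltr_pM2r// invr_gt0.
  have -> : \int[@std_normal R]_x unit_cos b (Num.sqrt (var eps) * x) =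
      \int[P]_w unit_cos b (\sum_i a i * (c * (rho^-1 * J (t i / eps) w))).
    pose aa i := if insub i is Some i' then a i' * (c / rho) else 0.
    have aE (i : 'I_n) : aa i = a i * (c / rho).
      by rewrite /aa; case: insubP => [i' _ /val_inj ->//|]; rewrite ltn_ord.
    have := stieltjes_combination t00 cW aa n (erefl : u 0%N = t0) uS cf f01 k0.
    have -> : (fun w => unit_cos b (\sum_(i < n) aa i * stieltjes beta t0 (Ws ^~ w) t0 (u i.+1))) =
        fun w => unit_cos b (\sum_i a i * (c * (rho^-1 * J (t i / eps) w))).
      by apply/funext => w; congr unit_cos; apply: eq_bigr => i _; rewrite aE /J /= !mulrA.
    move=> ->; congr (Rintegral _ _ _); apply/funext => x; congr (unit_cos _ (Num.sqrt _ * _)).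
    apply: eq_bigr => i _; apply: eq_bigr => j _; rewrite !aE.
    have mE : minr (t i) (t j) = t (minn i j).
      case: (leqP i j) => ij; first by rewrite min_l// tmono.
      by rewrite min_r// tmono// ltnW.
    have cE : c * c = eps `^ k by rewrite /c -powR_addE// /k; congr (_ `^ _); field.
    have tE : (t (minn i j) / eps) `^ k * eps `^ k = t (minn i j) `^ k.
      rewrite -powRM ?divr_ge0 ?(ltW (tpos _)) ?(ltW eps0)//.
      by rewrite divfK// gt_eqF.
    rewrite -/k mE -tE -cE /=; move: (_ `^ k) (t0 `^ k) => y z; field.
    by rewrite !gt_eqF.
  pose Y i w := c * (Xs (t i / eps) w - rho^-1 * J (t i / eps) w).
  have te' i : t0 <= t i / eps by exact: ltW.
  have mD i : measurable_fun setT (fun w => Xs (t i / eps) w - rho^-1 * J (t i / eps) w).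
    apply: measurable_funB; first exact: mXs.
    by apply: measurable_funM; [exact: measurable_cst|exact: mJ].
  have mY i : measurable_fun setT (Y i) by apply: measurable_funM; [exact: measurable_cst|exact: mD].
  have hY i : (Ex (fun w => `|Y i w|) <= (c * (C * (t i / eps) `^ p))%:E)%E.
    by apply: expectation_scale => //; exact: hC.
  have m1 : measurable_fun setT (fun w => \sum_i a i * (c * Xs (t i / eps) w)).
    apply: measurable_sum => i; apply: measurable_funM; first exact: measurable_cst.
    by apply: measurable_funM; [exact: measurable_cst|exact: mXs].
  have m2 : measurable_fun setT (fun w => \sum_i a i * (c * (rho^-1 * J (t i / eps) w))).
    apply: measurable_sum => i; apply: measurable_funM; first exact: measurable_cst.
    apply: measurable_funM; first exact: measurable_cst.
    by apply: measurable_funM; [exact: measurable_cst|exact: mJ].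
  have f1 x : `|unit_cos b x| <= 1 by case/andP: (f01 x) => h0 h1; rewrite ger0_norm.
  apply: (le_trans (Rint_distB P (measurableT_comp mf m1) (measurableT_comp mf m2)
    (fun w => f1 _) (fun w => f1 _))).
  have SE : \sum_(i < n) `|a i| * (c * (C * (t i / eps) `^ p)) = S * eps `^ (sc - p).
    rewrite /S mulr_suml; apply: eq_bigr => i _.
    have tE : t i `^ p = (t i / eps) `^ p * eps `^ p.
      by rewrite -powRM ?divr_ge0 ?(ltW (tpos _)) ?(ltW eps0)// divfK// gt_eqF.
    have cE : c = eps `^ p * eps `^ (sc - p) by rewrite -powR_addE// addrC subrK.
    by rewrite tE cE; ring.
  have := expectation_lipschitz_dist (P := P) (e := S * eps `^ (sc - p)) ler01 f01 fL m1 m2.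
  rewrite [1 * (S * _)]mul1r; apply; rewrite -SE.
  apply: (le_trans _ (expectation_sum_bound a (fun i => mY i) (fun i => hY i))).
  rewrite le_eqVlt; apply/orP; left; apply/eqP; apply: eq_integral => w _; congr ((`|_|)%:E); rewrite -sumrB; apply: eq_bigr => i _.
  by rewrite /Y; ring.
- rewrite -[X in _ --> X](mulr0 S); apply: cvgMr; apply: powR_cvg0; rewrite subr_gt0//.
rewrite (centered_gaussian_expectation a hXX (fun i => ltW (tpos i)) mf).
apply: (cvg_comp _ (fun s => \int[@std_normal R]_x unit_cos b (s * x))); last first.
  exact: (continuous_normal_expectation f01 fL).
by apply: (cvg_comp _ Num.sqrt); [exact: cvar|exact: sqrt_continuous].
Qed.

(** Tightness comes from [position_bound]; the trigonometric moments determine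
    the limits of all weights. *)
Lemma position_fdd_cvg :
  fdd_cvg P P' (fun eps t w => eps `^ sc * X (t / eps) w) (fun t => XX t).
Proof.
have [phi [mphi Pphi hU XE]] := regular_paths t00 hB hV hV0 hX.
apply: fdd_cvg_sorted => n t tpos0 tS.
have tpos j : 0 < t j by elim: j => // j IH; exact: lt_trans (tS j).
have mZ eps i : measurable_fun setT (fun w => eps `^ sc * X (t i / eps) w).
  by apply: measurable_funM; [exact: measurable_cst|exact: measurable_funPT].
apply: (@cvg_in_law_criterion _ _ _ P _ _ P' n (fun eps i w => eps `^ sc * X (t i / eps) w)
   (fun i => XX (t i))) => //.
- move=> e e0; have [C C0 hC] := position_bound rho0 t00 hU beta1 betaN x0.
  pose S := \sum_(i < n) C * t i `^ sc.
  have S0 : 0 <= S by apply: sumr_ge0 => i _; rewrite mulr_ge0// powR_ge0.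
  exists ((S + 1) / e); first by rewrite divr_gt0// ltr_wpDl.
  set M := _ / e => i; have M0 : 0 < M by rewrite divr_gt0// ltr_wpDl.
  apply: filterS (near_large_times t00 tpos0 tS) => eps [eps0 te].
  have mX : measurable_fun setT (X (t i / eps)) by exact: measurable_funPT.
  have EX : (Ex (fun w => `|X (t i / eps) w|) <= (C * (t i / eps) `^ sc)%:E)%E.
    have mn : measurable_fun setT (fun w => `|X (t i / eps) w|%:E).
      by apply/measurable_EFinP; exact: measurableT_comp.
    rewrite -(@eq_law_ge0_integral _ _ _ _ _ _ _ P P phi id _ _ _ _ mn)//.
    apply: le_trans (hC _ (ltW (te i))); rewrite le_eqVlt; apply/orP; left; apply/eqP.
    by apply: eq_integral => w _; rewrite XE// ltW.
  have E1 : (Ex (fun w => `|eps `^ sc * X (t i / eps) w|%R) <= S%:E)%E.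
    apply: (le_trans (expectation_scale mX (powR_ge0 _ _) EX)); rewrite lee_fin.
    have -> : eps `^ sc * (C * (t i / eps) `^ sc) = C * t i `^ sc.
      rewrite mulrCA -powRM ?divr_ge0 ?(ltW (tpos _)) ?(ltW eps0)//.
      by rewrite mulrC [eps * _]mulrC divfK ?gt_eqF// mulrC.
    by rewrite /S (bigD1 i)//= lerDl sumr_ge0// => j _; rewrite mulr_ge0// powR_ge0.
  apply: (le_trans (markov_bound (mZ eps i) M0 E1)); rewrite lee_fin /M invf_div mulrCA.
  by rewrite ger_pMr// ler_pdivrMr ?mul1r ?lerDl// ltr_wpDl.
move=> m k M M0.
apply: (@trig_weights_cvg _ _ _ P _ _ P' n (fun eps i w => eps `^ sc * X (t i / eps) w)
   (fun i => XX (t i))) => // a b.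
have mS (Z : 'I_n -> T -> R) : (forall i, measurable_fun setT (Z i)) ->
    measurable_fun setT (fun w => \sum_i a i * Z i w).
  by move=> h; apply: measurable_sum => i; apply: measurable_funM; [exact: measurable_cst|exact: h].
rewrite expectation_cos; last first.
  by apply: measurable_sum => i; apply: measurable_funM; [exact: measurable_cst|exact: measurable_funPT].
have -> : (fun eps => \int[P]_w cos (\sum_i a i * (eps `^ sc * X (t i / eps) w) + b)) =
    fun eps => -1 + 2 * \int[P]_w unit_cos b (\sum_i a i * (eps `^ sc * X (t i / eps) w)).
  by apply/funext => eps; rewrite expectation_cos//; exact: mS.
by apply: cvgD; [exact: cvg_cst|apply: cvgMr; exact: position_cos_cvg].
Qed.

End position.

(** * Both limits *)

Theorem theorem2p5 (R : realType)
    (gamma beta q rho t0 v0 x0 : R)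
    (hgamma : 1 <= gamma)
    (hq : q = beta / (gamma + 1)) (hq2 : q < 1 / 2)
    (hrho : 0 < rho) (ht0 : 0 < t0) (hv0 : 0 < v0)
    (d : measure_display) (T : measurableType d) (P : probability T R)
    (B V X : R -> {RV P >-> R})
    (hB : brownian_motion B)
    (hV : sde_solution B V (fun t v => t `^ (- beta) * drift rho gamma v) t0)
    (hV0 : {ae P, forall w, V t0 w = v0})
    (hX : {ae P, forall w, forall t, t0 <= t ->
             X t w = x0 + \int[lebesgue_measure]_(s in `[t0, t]) V s w}) :
  (forall (Pi : probability R R), invariant_law (drift rho gamma) Pi ->
    forall (d' : measure_display) (T' : measurableType d')
      (P' : probability T' R) (VV : R -> {RV P' >-> R}),
      scaled_product_process VV Pi q ->
      fdd_cvg P P' (fun eps t w => eps `^ q * V (t / eps) w)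
                   (fun t => VV t)) /\
  (gamma = 1 -> - (1 / 2) < beta ->
    forall (d' : measure_display) (T' : measurableType d')
      (P' : probability T' R) (XX : R -> {RV P' >-> R}),
      centered_gaussian_process XX
        (fun s t => (minr s t) `^ (1 + 2 * beta)
                    / (rho ^+ 2 * (1 + 2 * beta))) ->
      fdd_cvg P P' (fun eps t w => eps `^ (beta + 1 / 2) * X (t / eps) w)
                   (fun t => XX t)).

Proof.
split=> [Pi inv d' T' P' VV hVV|g1 betaN d' T' P' XX hXX].
  exact: (velocity_fdd_cvg hgamma hq hq2 hrho ht0 hB hV hV0 hX inv hVV).
move: hq2 hV; rewrite {}hq {}g1 => hb hV1.
have beta1 : beta < 1 by move: hb; rewrite -[1 + 1]/(2 : R) ltr_pM2r// invr_gt0.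
exact: (position_fdd_cvg beta1 betaN hrho ht0 hB hV1 hV0 hX hXX).
Qed.
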